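(* Let $k$ be an algebraically closed field of characteristic $p\ge 7$ and let $H$ be a hyperelliptic curve of genus $4$ over $k$. Then the reduced automorphism group $\overline{\mathrm{Aut}}(H)$ is isomorphic to one of the ten groups $\{0\},\mathbb{Z}_2,\mathbb{Z}_3,V_4,D_4,D_5,A_4,D_8,\mathbb{Z}_9,D_{10}$. In each case, $H$ is isomorphic to $y^2=f(x)$ with $f$ as follows, and $\mathrm{Aut}(H)$ is isomorphic to the group indicated (with $a,b,c,d\in k$ and $i\in k$ an element satisfying $i^2=-1$): (1) $\overline{\mathrm{Aut}}(H)\cong\{0\}$: $f$ is a square-free polynomial of degree $9$ or $10$; $\mathrm{Aut}(H)\cong\mathbb{Z}_2$. (2) $\overline{\mathrm{Aut}}(H)\cong\mathbb{Z}_2$: either (2-1) $f=x^{10}+ax^8+bx^6+cx^4+dx^2+1$ and $\mathrm{Aut}(H)\cong V_4$, or (2-2) $f=x^9+ax^7+bx^5+cx^3+x$ and $\mathrm{Aut}(H)\cong\mathbb{Z}_4$. (3) $\overline{\mathrm{Aut}}(H)\cong\mathbb{Z}_3$: $f=x^{10}+ax^7+bx^4+x$; $\mathrm{Aut}(H)\cong\mathbb{Z}_6$. (4) $\overline{\mathrm{Aut}}(H)\cong V_4$: either (4-1) $f=x^{10}+ax^8+bx^6+bx^4+ax^2+1$ or $f=x^9+ax^7+bx^5+ax^3+x$, and $\mathrm{Aut}(H)\cong D_4$, or (4-2) $f=x(x^4-1)(x^4+ax^2+1)$ and $\mathrm{Aut}(H)\cong Q_8$. (5) $\overline{\mathrm{Aut}}(H)\cong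 D_4$: $f=x^9+ax^5+x$; $\mathrm{Aut}(H)\cong D_8$. (6) $\overline{\mathrm{Aut}}(H)\cong D_5$: $f=x^{10}+ax^5+1$; $\mathrm{Aut}(H)\cong D_{10}$. (7) $\overline{\mathrm{Aut}}(H)\cong A_4$: $f=x(x^4-1)(x^4+2i\sqrt{3}\,x^2+1)$; $\mathrm{Aut}(H)\cong\mathrm{SL}_2(\mathbb{F}_3)$. (8) $\overline{\mathrm{Aut}}(H)\cong D_8$: $f=x^9+x$; $\mathrm{Aut}(H)\cong\mathbb{Z}_{16}\rtimes\mathbb{Z}_2$ (a semidirect product, of order $32$). (9) $\overline{\mathrm{Aut}}(H)\cong\mathbb{Z}_9$: $f=x^{10}+x$; $\mathrm{Aut}(H)\cong\mathbb{Z}_{18}$. (10) $\overline{\mathrm{Aut}}(H)\cong D_{10}$: $f=x^{10}+1$; $\mathrm{Aut}(H)\cong\mathbb{Z}_5\rtimes D_4$ (a semidirect product, of order $40$).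
   Context: A hyperelliptic curve given by $y^2=f(x)$, with $f$ separable of degree $2g+1$ or $2g+2$, means the desingularization of the projective closure of the affine curve (genus $g$). $\mathrm{Aut}(H)$ is the automorphism group of $H$ over $k$, $\iota$ is the hyperelliptic involution, and $\overline{\mathrm{Aut}}(H)=\mathrm{Aut}(H)/\langle\iota\rangle$. $\mathbb{Z}_n$ is the cyclic group of order $n$, $D_n$ the dihedral group of order $2n$, $A_4$ the alternating group of order $12$, $V_4=\mathbb{Z}_2\times\mathbb{Z}_2$, $Q_8$ the quaternion group of order $8$; $\{0\}$ is the trivial group. $\sqrt{3}$ denotes a square root of $3$ in $k$. *)

(* Defs.v *)
From HB Require Import structures.
From mathcomp Require Import all_boot all_order all_fingroup all_algebra.
From mathcomp Require Import all_solvable all_field.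
From mathcomp Require Import boolp classical_sets.

Set Implicit Arguments.
Unset Strict Implicit.
Unset Printing Implicit Defensive.

Import GRing.Theory.

(** * Smooth model of y^2 = f(x)

    Varieties are taken in the classical sense over an algebraically closed
    field: a set of closed points with its Zariski topology and its k-valued
    regular functions.  For f separable of degree 2g+1 or 2g+2 over a field of
    characteristic different from 2, the desingularization of the projective
    closure of y^2 = f(x) is the gluing of the two nonsingular affine curves
      y^2 = f(x)   and   v^2 = u^(2g+2) f(1/u)
    along u = 1/x, v = y/x^(g+1). *)

Section Curve.
Local Open Scope ring_scope.

Variable k : fieldType.

Definition hyperelliptic_poly (g : nat) (f : {poly k}) : Prop :=
  separable_poly f /\ (size f = (g.*2.+1).+1 \/ size f = (g.*2.+2).+1).

(** The points outside the first chart are the points (0, w) of the second one;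
    there is one of them if deg f = 2g+1 and two if deg f = 2g+2. *)
Inductive curve (g : nat) (f : {poly k}) : Type :=
| Aff (x y : k) of y ^+ 2 == f.[x]
| Inf (w : k) of w ^+ 2 == f`_(g.*2.+2).

Definition chart g f (second : bool) (P : curve g f) : option (k * k) :=
  match P, second with
  | Aff x y _, false => Some (x, y)
  | Aff x y _, true => if x == 0 then None else Some (x^-1, y / x ^+ g.+1)
  | Inf w _, false => None
  | Inf w _, true => Some (0, w)
  end.

Definition eval2 (A : {poly {poly k}}) (c : k * k) : k := A.[c.1%:P].[c.2].

Lemma chart_aff_image g f (x y : k) :
  (exists P : curve g f, chart false P = Some (x, y)) <-> y ^+ 2 = f.[x].
Proof.
split=> [[[x' y' e|w e]] //= [<- <-]|/eqP e]; first exact/eqP.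
by exists (Aff g e).
Qed.

Definition rev_poly (g : nat) (f : {poly k}) : {poly k} :=
  \poly_(i < g.*2.+3) f`_(g.*2.+2 - i).

Lemma rev_polyE g (f : {poly k}) (x : k) : (size f <= g.*2.+3)%N -> x != 0 ->
  (rev_poly g f).[x^-1] = f.[x] / x ^+ g.*2.+2.
Proof.
move=> sf x0; rewrite horner_poly (horner_coef_wide _ sf) mulr_suml.
rewrite (reindex_inj rev_ord_inj) /=; apply: eq_bigr => i _.
have le_i : (i <= g.*2.+2)%N by rewrite -ltnS.
rewrite subSS subKn // -mulrA; congr (_ * _).
apply: (canRL (mulfK (expf_neq0 _ x0))).
have -> : x ^+ g.*2.+2 = x ^+ (g.*2.+2 - i) * x ^+ i by rewrite -exprD subnK.
by rewrite mulrA exprVn mulVf ?mul1r // expf_neq0.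
Qed.

Lemma chart_inf_image g (f : {poly k}) (u v : k) : (size f <= g.*2.+3)%N ->
  (exists P : curve g f, chart true P = Some (u, v)) <->
  v ^+ 2 = (rev_poly g f).[u].
Proof.
move=> sf; split.
  case=> -[x y e|w e] /=.
    case: eqVneq => // x0 [<- <-]; rewrite rev_polyE // -(eqP e) expr_div_n.
    by rewrite -exprM muln2 doubleS.
  by case=> <- <-; rewrite horner_coef0 coef_poly /= subn0 (eqP e).
have [-> e|u0 e] := eqVneq u 0.
  have {}e : v ^+ 2 == f`_(g.*2.+2).
    by rewrite e horner_coef0 coef_poly /= subn0.
  by exists (Inf e).
have x0 : u^-1 != 0 by rewrite invr_eq0.
have h : (v * u^-1 ^+ g.+1) ^+ 2 == f.[u^-1].
  rewrite exprMn -exprM muln2 doubleS e -{1}[u]invrK rev_polyE //.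
  by rewrite mulfVK // expf_neq0.
exists (Aff g h) => /=.
by rewrite (negbTE x0) invrK mulfK // expf_neq0.
Qed.

(** Jacobian criterion (in characteristic different from 2) at the points of the
    first chart and at the points at infinity. *)
Lemma nonsingular_aff (f : {poly k}) (x : k) :
  separable_poly f -> f.[x] = 0 -> f^`().[x] != 0.
Proof.
by rewrite separable_poly.unlock => sf /rootP; apply: coprimep_root sf.
Qed.

Lemma nonsingular_inf g (f : {poly k}) : hyperelliptic_poly g f ->
  (rev_poly g f).[0] = 0 -> (rev_poly g f)^`().[0] != 0.
Proof.
case=> _ sf; rewrite !horner_coef0 coef_deriv !coef_poly /= subn0 subn1 mulr1n.
have f0 : f != 0 by rewrite -size_poly_gt0; case: sf => ->.
case: sf => sf; last by move/eqP; rewrite -[_.+2]/(_.+3.-1) -sf -lead_coefE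
  lead_coef_eq0 (negbTE f0).
by move=> _; rewrite -[_.+1]/(_.+2.-1) -sf -lead_coefE lead_coef_eq0.
Qed.

(** Zariski topology: open sets are unions of principal opens of the charts. *)
Definition zopen g f (U : set (curve g f)) : Prop :=
  forall P, U P -> exists (i : bool) (A : {poly {poly k}}),
    (exists2 c, chart i P = Some c & eval2 A c != 0) /\
    (forall Q c, chart i Q = Some c -> eval2 A c != 0 -> U Q).

(** [s] is regular on the open set [U]; its values outside [U] are junk. *)
Definition regular_on g f (U : set (curve g f)) (s : curve g f -> k) : Prop :=
  forall P, U P -> exists V : set (curve g f), [/\ zopen V, V P, subset V U &
    exists (i : bool) (A B : {poly {poly k}}), forall Q, V Q ->
      exists c, [/\ chart i Q = Some c, eval2 B c != 0 &
                    s Q = eval2 A c / eval2 B c]].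

Definition curve_morphism g f g' f' (phi : curve g f -> curve g' f') : Prop :=
  (forall V, zopen V -> zopen (preimage phi V)) /\
  (forall V s, zopen V -> regular_on V s ->
     regular_on (preimage phi V) (s \o phi)).

Definition curve_iso g f g' f' : Prop :=
  exists (phi : curve g f -> curve g' f') (psi : curve g' f' -> curve g f),
    [/\ curve_morphism phi, curve_morphism psi, cancel phi psi & cancel psi phi].

Lemma curve_morphism_id g f : curve_morphism (@id (curve g f)).
Proof. by split. Qed.

Lemma curve_morphism_comp g1 f1 g2 f2 g3 f3
    (phi : curve g2 f2 -> curve g3 f3) (psi : curve g1 f1 -> curve g2 f2) :
  curve_morphism phi -> curve_morphism psi -> curve_morphism (phi \o psi).
Proof.
move=> [c1 r1] [c2 r2]; split=> [V oV|V s oV rs]; first exact: c2 _ (c1 _ oV).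
exact: r2 _ _ (c1 _ oV) (r1 _ _ oV rs).
Qed.

End Curve.

(** * The automorphism group *)

Section Aut.
Variables (k : fieldType) (g : nat) (f : {poly k}).

Record curve_aut : Type := MkAut {
  aut_fun :> curve g f -> curve g f;
  aut_inv : curve g f -> curve g f;
  aut_funP : curve_morphism aut_fun;
  aut_invP : curve_morphism aut_inv;
  aut_funK : cancel aut_fun aut_inv;
  aut_invK : cancel aut_inv aut_fun }.

Lemma aut_eq (a b : curve_aut) : aut_fun a =1 aut_fun b -> a = b.
Proof.
case: a b => [a a' ma ma' aK a'K] [b b' mb mb' bK b'K] /= ab.
have E : a = b by apply: funext.
subst b; have E' : a' = b' by apply: funext => P; rewrite -{1}(b'K P) aK.
by subst b'; congr MkAut; apply: Prop_irrelevance.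
Qed.

HB.instance Definition _ := gen_eqMixin curve_aut.
HB.instance Definition _ := gen_choiceMixin curve_aut.

Definition aut_one : curve_aut :=
  MkAut (@curve_morphism_id _ g f) (@curve_morphism_id _ g f) (frefl id) (frefl id).

Definition aut_mul (a b : curve_aut) : curve_aut :=
  MkAut (curve_morphism_comp (aut_funP a) (aut_funP b))
        (curve_morphism_comp (aut_invP b) (aut_invP a))
        (can_comp (aut_funK a) (aut_funK b))
        (can_comp (aut_invK b) (aut_invK a)).

Definition aut_invg (a : curve_aut) : curve_aut :=
  MkAut (aut_invP a) (aut_funP a) (aut_invK a) (aut_funK a).

Lemma aut_mulA : associative aut_mul.
Proof. by move=> a b c; apply: aut_eq. Qed.
Lemma aut_mul1g : left_id aut_one aut_mul.
Proof. by move=> a; apply: aut_eq. Qed.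
Lemma aut_mulg1 : right_id aut_one aut_mul.
Proof. by move=> a; apply: aut_eq. Qed.
Lemma aut_mulVg : left_inverse aut_one aut_invg aut_mul.
Proof. by move=> a; apply: aut_eq => P; apply: aut_funK. Qed.
Lemma aut_mulgV : right_inverse aut_one aut_invg aut_mul.
Proof. by move=> a; apply: aut_eq => P; apply: aut_invK. Qed.

HB.instance Definition _ :=
  isGroup.Build curve_aut aut_mulA aut_mul1g aut_mulg1 aut_mulVg aut_mulgV.

End Aut.

Section Involution.
Local Open Scope ring_scope.
Variables (k : fieldType) (g : nat) (f : {poly k}).

Fact sqr_opp_eq (y c : k) : y ^+ 2 == c -> (- y) ^+ 2 == c.
Proof. by rewrite sqrrN. Qed.

Definition hinv_fun (P : curve g f) : curve g f :=
  match P with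
  | Aff x y e => Aff g (sqr_opp_eq e)
  | Inf w e => Inf (sqr_opp_eq e)
  end.

Lemma hinv_funK : involutive hinv_fun.
Proof.
case=> [x y e|w e] /=; set e' := sqr_opp_eq _; move: e'; rewrite opprK => e'.
  by congr Aff; apply: bool_irrelevance.
by congr Inf; apply: bool_irrelevance.
Qed.

Lemma chart_hinv i (P : curve g f) :
  chart i (hinv_fun P) = omap (fun c => (c.1, - c.2)) (chart i P).
Proof.
by case: P i => [x y e|w e] [] //=; case: (x == 0) => //=; rewrite mulNr.
Qed.

Definition opp2 (A : {poly {poly k}}) : {poly {poly k}} :=
  map_poly (comp_poly (- 'X)) A.

Lemma eval2_opp2 A (c : k * k) : eval2 (opp2 A) c = eval2 A (c.1, - c.2).
Proof.
rewrite /eval2 /= -{1}(comp_polyC c.1 (- 'X)) horner_map /=.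
by rewrite horner_comp hornerN hornerX.
Qed.

Lemma zopen_hinv V : zopen V -> zopen (preimage hinv_fun V).
Proof.
move=> oV P /oV[i [A [[c cP Ac] AV]]]; exists i, (opp2 A); split.
  move: cP; rewrite chart_hinv; case cP: (chart i P) => [d|] //= [dc].
  by exists d => //; rewrite eval2_opp2 dc.
move=> Q d dQ; rewrite eval2_opp2 => Ad; apply: (AV _ (d.1, - d.2)) => //.
by rewrite chart_hinv dQ.
Qed.

Lemma curve_morphism_hinv : curve_morphism hinv_fun.
Proof.
split=> [|V s oV rs P VP]; first exact: zopen_hinv.
have [W [oW WP WV [i [A [B AB]]]]] := rs _ VP.
exists (preimage hinv_fun W); split=> //; first exact: zopen_hinv.
  by move=> Q /WV.
exists i, (opp2 A), (opp2 B) => Q /AB[c []].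
rewrite chart_hinv; case: (chart i Q) => [d|] //= [<-] Bd sQ.
by exists d; rewrite !eval2_opp2.
Qed.

(** The hyperelliptic involution (x, y) |-> (x, -y). *)
Definition hinv : curve_aut g f :=
  MkAut curve_morphism_hinv curve_morphism_hinv hinv_funK hinv_funK.

End Involution.

(** * Comparison with finite groups *)

Section Isog.
Local Open Scope group_scope.

Definition isog_to (A : groupType) (gT : finGroupType) (G : {set gT}) : Prop :=
  exists h : A -> gT, [/\ {morph h : a b / a * b}, injective h &
    forall x, x \in G <-> exists a, h a = x].

Definition cycle_coset (A : groupType) (z a : A) : set A :=
  fun b => exists n : nat, b = a * z ^+ n.

(** The quotient of [A] by the subgroup generated by [z], with product
    [(a <z>) (b <z>) = (a * b) <z>], is isomorphic to [G].  In particular this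
    product is well defined, i.e. the subgroup is normal. *)
Definition quotient_isog_to (A : groupType) (z : A)
    (gT : finGroupType) (G : {set gT}) : Prop :=
  exists h : set A -> gT,
  [/\ forall a b, h (cycle_coset z (a * b)) =
                  h (cycle_coset z a) * h (cycle_coset z b),
      forall a b, h (cycle_coset z a) = h (cycle_coset z b) ->
                  cycle_coset z a = cycle_coset z b &
      forall x, x \in G <-> exists a, h (cycle_coset z a) = x].

Definition semidirect_isog_to (A : groupType) (nT cT : finGroupType)
    (N : {set nT}) (C : {set cT}) : Prop :=
  exists (gT : finGroupType) (G N' C' : {group gT}),
    [/\ N' ><| C' = G, N' \isog N, C' \isog C & isog_to A G].

Definition SL2_F (p : nat) : {set {'GL_2(p)}} :=
  [set M : {'GL_2(p)} | (\det (GLval M) == 1)%R].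

End Isog.

Definition aut_isog (k : fieldType) (g : nat) (f : {poly k})
    (gT : finGroupType) (G : {set gT}) : Prop :=
  isog_to (curve_aut g f) G.

Definition reduced_aut_isog (k : fieldType) (g : nat) (f : {poly k})
    (gT : finGroupType) (G : {set gT}) : Prop :=
  quotient_isog_to (hinv g f) G.

(* Main.v *)
From HB Require Import structures.
From mathcomp Require Import boolp classical_sets.
From mathcomp Require Import all_boot all_order all_fingroup all_algebra.
From mathcomp Require Import all_solvable all_field.
From mathcomp Require Import ring zify.
Require Import Defs.

Set Implicit Arguments.
Unset Strict Implicit.
Unset Printing Implicit Defensive.

(** Every isomorphism of hyperelliptic curves of genus at least 2 is induced by a
    Moebius map of the coordinate x: for general t, the function
    1 / (x o phi - t) has at most two poles, both simple, and the expression of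
    such a function in the two charts shows that it depends on x only.  Hence the
    reduced automorphism group is a finite group of Moebius maps permuting the
    ten branch points, and each nontrivial element has exactly two fixed points
    because a translation by c would change the sum of the finite branch points
    by 9c or 10c.  The class equation leaves two possibilities: the group
    preserves a pair of points, or it is tetrahedral (octahedral and icosahedral
    groups have no invariant set of ten points).

    With an invariant pair at 0 and infinity all automorphisms are monomial, and
    the exponents occurring in f determine the group and the normal form.  In the
    tetrahedral case the six fixed points of the involutions can be put at
    0, infinity, 1, -1, i, -i; then f = x (x^4 - 1) (x^4 + a x^2 + 1), and
    invariance under x |-> (i - x) / (i + x) forces a^2 = -12.

    The ten reduced groups have distinct orders, so the reduced group determines
    the case. *)

(** * The class equation *)

(** An automorphism is given only as a bicontinuous bijection respecting regular functions, with no
    equation attached, and the proof must first recover equations. Two facts do this: a function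
    regular on a whole chart has the form a0(x) + a1(x) y, and such expressions that agree over all
    but finitely many x coincide. The genus enters when poles are counted: a function with poles
    over m values of x depends on x alone if m <= g, and m = 2 occurs. The characteristic enters
    through the invertibility of 2, 3 and 5: 2 separates y from -y, 9 and 10 exclude translations,
    and the roots of unity that appear have orders of the form 2^a 3^b 5^c. The class equation is
    applied to the full automorphism group, in which the hyperelliptic involution acts trivially;
    hence the doubled orders. For an invariant pair at 0 and infinity, a diagonal substitution (a x,
    b y) preserves y^2 = F(x) exactly when F_i a^i = b^2 F_i for all i. So the set of exponents that
    occur and the symmetry i |-> 10 - i decide everything. *)

Section Arithmetic.

(** Divided by N, the last equation is 1/e1 + 1/e2 + 1/e3 = 1 + 2/N, whose solutions here are
    (2,3,3), (2,3,4) and (2,3,5). The bound [3 <= s3] discards the dihedral solutions (2,2,n), where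
    an orbit has two points. *)
Lemma tri_sorted s1 s2 s3 e1 e2 e3 N : s1 * e1 = N -> s2 * e2 = N -> s3 * e3 = N ->
  3 <= s3 -> s3 <= s2 -> s2 <= s1 -> 1 < e1 -> 1 < e2 -> 1 < e3 ->
  s1 + s2 + s3 = N + 2 ->
  [\/ [/\ N = 12, s1 = 6, s2 = 4 & s3 = 4], [/\ N = 24, s1 = 12, s2 = 8 & s3 = 6] |
      [/\ N = 60, s1 = 30, s2 = 20 & s3 = 12]].
Proof.
move=> h1 h2 h3 s3g s32 s21 e12 e22 e32 hs.
have E1 : e1 = 2.
  case: e1 h1 e12 => [|[|[|e1]]] // h1 _; exfalso; nia.
subst e1.
have E2 : e2 = 3.
  case: e2 h2 e22 => [|[|[|[|e2]]]] // h2 _; exfalso; nia.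
subst e2.
have [?|[?|?]] : e3 = 3 \/ e3 = 4 \/ e3 = 5.
  case: e3 h3 e32 => [|[|[|[|[|[|e3]]]]]] // h3 _; try lia; exfalso; nia.
- by subst e3; constructor 1; split; lia.
- by subst e3; constructor 2; split; lia.
by subst e3; constructor 3; split; lia.
Qed.

(** The booleans record which special orbits lie in the invariant set of ten points; an orbit with
    trivial reduced stabilizer has N points and does not fit when 10 < N. The sizes 12, 8, 6 and 30,
    20, 12 have no partial sum 10, and with 6, 4, 4 the only way is 6 + 4, which puts the orbit of
    length 6 inside the set. *)
Lemma tri s1 s2 s3 e1 e2 e3 N (b1 b2 b3 : bool) :
  s1 * e1 = N -> s2 * e2 = N -> s3 * e3 = N ->
  2 < s1 -> 2 < s2 -> 2 < s3 -> 1 < e1 -> 1 < e2 -> 1 < e3 ->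
  s1 + s2 + s3 = N + 2 -> (10 < N -> b1 * s1 + b2 * s2 + b3 * s3 = 10) ->
  N = 12 /\ [\/ [/\ b1, s1 = 6, s2 = 4 & s3 = 4], [/\ b2, s1 = 4, s2 = 6 & s3 = 4] |
      [/\ b3, s1 = 4, s2 = 4 & s3 = 6]].
Proof.
move=> h1 h2 h3 g1 g2 g3 e12 e22 e32 hs hb.
wlog le12 : s1 s2 e1 e2 b1 b2 h1 h2 g1 g2 e12 e22 hs hb / s2 <= s1.
  move=> W; have [le|/ltnW le] := leqP s2 s1; first exact: (W s1 s2 e1 e2).
  have hs' : s2 + s1 + s3 = N + 2 by lia.
  have hb' : 10 < N -> b2 * s2 + b1 * s1 + b3 * s3 = 10 by move=> /hb; lia.
  have := W s2 s1 e2 e1 b2 b1 h2 h1 g2 g1 e22 e12 hs' hb' le.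
  by move=> [-> []] [? ? ? ?]; split=> //; [constructor 2|constructor 1|constructor 3].
wlog le23 : s2 s3 e2 e3 b2 b3 h2 h3 g2 g3 e22 e32 hs hb le12 / s3 <= s2.
  move=> W; have [le|/ltnW le] := leqP s3 s2; first exact: (W s2 s3 e2 e3).
  have [le13|/ltnW le13] := leqP s3 s1.
    have hs' : s1 + s3 + s2 = N + 2 by lia.
    have hb' : 10 < N -> b1 * s1 + b3 * s3 + b2 * s2 = 10 by move=> /hb; lia.
    have := W s3 s2 e3 e2 b3 b2 h3 h2 g3 g2 e32 e22 hs' hb' le13 le.
    by move=> [-> []] [? ? ? ?]; split=> //; [constructor 1|constructor 3|constructor 2].
  have hs' : s3 + s1 + s2 = N + 2 by lia.
  have := tri_sorted h3 h1 h2 g2 le12 le13 e32 e12 e22 hs'.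
  case=> -[eN e1' e2' e3']; have := hb; rewrite eN e1' e2' e3' => /(_ isT).
  + by case: (b1); case: (b2); case: (b3) => //= _; split=> //; constructor 3.
  + by case: (b1); case: (b2); case: (b3).
  + by case: (b1); case: (b2); case: (b3).
have := tri_sorted h1 h2 h3 g3 le23 le12 e12 e22 e32 hs.
case=> -[eN e1' e2' e3']; have := hb; rewrite eN e1' e2' e3' => /(_ isT).
+ by case: (b1); case: (b2); case: (b3) => //= _; split=> //; constructor 1.
+ by case: (b1); case: (b2); case: (b3).
+ by case: (b1); case: (b2); case: (b3).
Qed.

End Arithmetic.

Section ClassEquation.
Local Open Scope group_scope.
Variables (gT : finGroupType) (T : finType) (to : {action gT &-> T}).
Variables (z : gT) (N : nat).
Local Notation G := [set: gT].
Hypotheses (z1 : z != 1) (zz : z * z = 1) (toz : forall x, to x z = x).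
Hypotheses (cardG : #|G| = N.*2) (N2 : 1 < N).
Hypothesis fix2 : forall a, a != 1 -> a != z -> #|'Fix_to[a]| = 2.

(** Since [z] fixes every point, a stabilizer of order 2 is trivial in the reduced group; these are
    the points with a nontrivial reduced stabilizer. *)
Definition special : {set T} := [set x | 2 < #|'C_G[x | to]|].

Lemma stab_even x : exists2 e, #|'C_G[x | to]| = e.*2 & 0 < e.
Proof.
have zC : z \in 'C_G[x | to] by rewrite in_setI in_setT; apply/astab1P/toz.
have oz : #[z] = 2.
  by apply/eqP; rewrite eqn_leq order_gt1 z1 andbT dvdn_leq // order_dvdn expgS expg1 zz.
have := order_dvdG zC; rewrite oz => /dvdnP[e he]; exists e; first by rewrite he muln2.
by have := cardG_gt0 'C_G[x | to]; rewrite he muln_gt0 => /andP[].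
Qed.

Lemma special_stab x : x \in special ->
  exists2 e, #|'C_G[x | to]| = e.*2 & 1 < e.
Proof.
by rewrite inE => h; have [e e1 e2] := stab_even x; exists e; rewrite // e1 in h; lia.
Qed.

Lemma orbit_size x e : #|'C_G[x | to]| = e.*2 -> (#|orbit to G x| * e)%N = N.
Proof. by move=> h; have := card_orbit_stab to [group of G] x;
  rewrite h cardG -mul2n mulnCA mul2n => /double_inj. Qed.

Lemma fix_special a x : a != 1 -> a != z -> to x a = x -> x \in special.
Proof.
move=> a1 az ax; rewrite inE.
have sub : [set 1; z; a] \subset 'C_G[x | to].
  apply/subsetP => b hb; rewrite in_setI in_setT; apply/astab1P; move: hb.
  by rewrite !inE -orbA => /or3P[] /eqP->; rewrite ?act1 ?toz ?ax.
apply: leq_trans (subset_leq_card sub).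
by rewrite setUC !cardsU1 !inE cards1 (negbTE az) (negbTE a1) eq_sym (negbTE z1).
Qed.

Lemma acts_special : [acts G, on special | to].
Proof.
apply/actsP => a _ x; rewrite !inE; congr (2 < _)%N.
have E y : (#|orbit to G y| * #|'C_G[y | to]|)%N = #|G| := card_orbit_stab to [group of G] y.
have eo : orbit to G (to x a) = orbit to G x.
  by apply/(@orbit_eqP _ _ to [group of G]); apply: mem_orbit; rewrite in_setT.
have o0 : 0 < #|orbit to G x|.
  by apply/card_gt0P; exists x; apply: (@orbit_refl _ _ _ to [group of G]).
by apply/eqP; rewrite -(eqn_pmul2l o0) -{1}eo !E.
Qed.

Local Notation orbs := [set orbit to G x | x in special].

(** Burnside's count on the special points, halved: 1 and [z] fix all of them, each of the other 2N
    - 2 elements fixes two, and the total is 2N per orbit. *)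
Lemma special_count : (#|special| + N.*2 = #|orbs| * N + 2)%N.
Proof.
have := Frobenius_Cauchy acts_special.
have fixE a : a != 1 -> a != z -> #|'Fix_(special | to)[a]| = 2.
  move=> a1 az; rewrite -(fix2 a1 az); congr #|pred_of_set _|.
  apply/setP => x; rewrite inE andbC; case: afix1P => //= /fix_special; exact.
have fixT a : (a == 1) || (a == z) -> #|'Fix_(special | to)[a]| = #|special|.
  move=> ha; congr #|pred_of_set _|; apply/setIidPl/subsetP => x _; apply/afix1P.
  by case/orP: ha => /eqP ->; rewrite ?act1 ?toz.
rewrite (bigD1 1) ?inE //= (bigD1 z) ?inE //= !fixT ?eqxx ?orbT //.
rewrite (eq_bigr (fun=> 2)); last by move=> a /andP[/andP[_ a1] az]; apply: fixE.
rewrite sum_nat_const cardG.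
have -> : #|[pred a | (a \in G) && (a != 1) && (a != z)]| = (N.*2 - 2)%N.
  rewrite (eq_card (B := mem (~: [set 1; z]))); last first.
    by move=> a; rewrite !inE negb_or.
  by rewrite cardsCs setCK cards2 eq_sym z1 -cardsT cardG.
by rewrite -muln2 mulnA; move: (_ * N)%N => u; lia.
Qed.

Lemma orbs_size O : O \in orbs -> exists2 e, (#|O| * e)%N = N & 1 < e.
Proof.
by case/imsetP => x /special_stab[e he e2] ->; exists e => //; apply: orbit_size.
Qed.

Lemma orbs_sum : \sum_(O <- enum orbs) #|O| = #|special|.
Proof. by rewrite big_enum; apply: acts_sum_card_orbit acts_special. Qed.

(** An orbit outside the special points has N elements, too many for [B]. *)
Lemma invariant_sum (B : {set T}) : [acts G, on B | to] -> #|B| < N ->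
  #|B| = \sum_(O <- enum orbs | O \subset B) #|O|.
Proof.
move=> actB sB; rewrite -(acts_sum_card_orbit actB) big_enum_cond /=.
apply: eq_bigl => O; apply/imsetP/andP => [[x xB ->]|[/imsetP[x xS ->] sO]].
  have sO : orbit to G x \subset B by rewrite (acts_sub_orbit _ actB).
  split=> //; apply/imsetP; exists x => //; rewrite inE.
  have [e he e0] := stab_even x; have := orbit_size he; rewrite he.
  by have := subset_leq_card sO; case: e e0 {he} => [|[|e]] // _; lia.
by exists x => //; apply: (subsetP sO); apply: (@orbit_refl _ _ _ to [group of G]).
Qed.

(** The class equation 2 - 2/N = sum (1 - 1/e) of a finite group of Moebius maps,
    together with an invariant set of 10 points, leaves only two possibilities. *)
Lemma pair_or_tetrahedral (B : {set T}) : [acts G, on B | to] -> #|B| = 10 ->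
  (exists x y, x != y /\ forall a, to x a \in [set x; y] /\ to y a \in [set x; y]) \/
  N = 12 /\ exists O : {set T}, [/\ #|O| = 6, O \subset B,
    forall x, x \in O -> orbit to G x = O,
    forall x, x \in O -> #|'C_G[x | to]| = 4 &
    forall x, x \in special -> x \notin O -> #|'C_G[x | to]| = 6].
Proof.
move=> actB cB.
have pair O : [acts G, on O | to] -> #|O| = 2 -> exists x y, x != y /\
    forall a, to x a \in [set x; y] /\ to y a \in [set x; y].
  move=> actO cO; have /cards2P[x [y [xy eO]]] : #|O| == 2 by rewrite cO.
  exists x, y; split=> // a.
  by rewrite -eO !(acts_act actO) ?in_setT // eO !inE !eqxx orbT.
have actO O : O \in orbs -> [acts G, on O | to].
  by case/imsetP => x _ ->; apply: acts_orbit; apply: subsetT.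
have := special_count; have := orbs_sum; rewrite [#|orbs|]cardE.
have memE O : O \in enum orbs -> O \in orbs by rewrite mem_enum.
have uE : uniq (enum orbs) := enum_uniq _.
have inE' O : O \in orbs -> O \in enum orbs by rewrite mem_enum.
move: (invariant_sum actB); rewrite cB.
(* With r special orbits the count reads |special| = (r - 2) N + 2. This is impossible for r <= 1;
   for r = 2 the special points themselves are an invariant pair; r >= 4 is impossible because every
   special orbit has at most N/2 points. *)
move: memE inE' uE; case: (enum orbs) => [|O1 [|O2 [|O3 rest]]] memE inE' uE sB.
- by rewrite big_nil /=; lia.
- have [|e he _] := @orbs_size O1; first by apply: memE; rewrite inE.
  have : 0 < #|O1| by rewrite lt0n; apply: contraTneq N2 => h; rewrite -he h mul0n.
  by rewrite big_cons big_nil /=; lia.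
- move=> _ /= h; left; apply: (pair special); first exact: acts_special.
  by move: h; lia.
have m1 : O1 \in orbs by apply: memE; rewrite !inE eqxx.
have m2 : O2 \in orbs by apply: memE; rewrite !inE eqxx ?orbT.
have m3 : O3 \in orbs by apply: memE; rewrite !inE eqxx ?orbT.
have [e1 h1 e12] := orbs_size m1; have [e2 h2 e22] := orbs_size m2.
have [e3 h3 e32] := orbs_size m3.
have rest_le : ((\sum_(O <- rest) #|O|) * 2 <= size rest * N)%N.
  have : forall O, O \in rest -> (#|O| * 2 <= N)%N.
    move=> O Or; have [|e <- e2'] := @orbs_size O.
      by apply: memE; rewrite !inE Or !orbT.
    by rewrite leq_mul2l e2' orbT.
  elim: (rest) => [|O r IH] hr; first by rewrite big_nil.
  rewrite big_cons mulnDl /= mulSn leq_add ?hr ?mem_head // IH // => O' O'r.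
  by rewrite hr // inE O'r orbT.
rewrite !big_cons /= => hs hc.
have s1 : (#|O1| * 2 <= N)%N by rewrite -h1 leq_mul2l e12 orbT.
have s2 : (#|O2| * 2 <= N)%N by rewrite -h2 leq_mul2l e22 orbT.
have s3 : (#|O3| * 2 <= N)%N by rewrite -h3 leq_mul2l e32 orbT.
have rest0 : rest = [::].
  case: (rest) rest_le hs hc => // O r; move: (\sum_(_ <- _) _) => u /= h hs hc.
  exfalso; move: (size r) (#|special|) h hs hc => v w h hs hc; nia.
subst rest; rewrite /= big_nil addn0 in hs hc.
have {hc}hs' : (#|O1| + #|O2| + #|O3| = N + 2)%N by lia.
have [c1|n1] := eqVneq #|O1| 2; first by left; apply: (pair O1) => //; apply: actO.
have [c2|n2] := eqVneq #|O2| 2; first by left; apply: (pair O2) => //; apply: actO.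
have [c3|n3] := eqVneq #|O3| 2; first by left; apply: (pair O3) => //; apply: actO.
have hB : 10 < N -> ((O1 \subset B) * #|O1| + (O2 \subset B) * #|O2| + (O3 \subset B) * #|O3| = 10)%N.
  move=> /sB; rewrite !big_cons big_nil.
  by do 3![case: ifP => _]; rewrite ?mul1n ?mul0n ?addn0 ?add0n ?addnA => ->.
have g1 : 2 < #|O1| by lia.
have g2 : 2 < #|O2| by lia.
have g3 : 2 < #|O3| by lia.
right; have [eN hO] := tri h1 h2 h3 g1 g2 g3 e12 e22 e32 hs' hB.
split=> //.
have stabE O x c : O \in orbs -> x \in O -> #|O| = c -> orbit to G x = O /\ (c * #|'C_G[x | to]| = 24)%N.
  move=> /imsetP[y _ ->] xO <-; have eo : orbit to G x = orbit to G y.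
    exact/(@orbit_eqP _ _ to [group of G]).
  by split=> //; rewrite -{1}eo (card_orbit_stab to [group of G]) cardG eN.
have inO x : x \in special -> [\/ x \in O1, x \in O2 | x \in O3].
  move=> xS; have xo : x \in orbit to G x by apply: (@orbit_refl _ _ _ to [group of G]).
  have : orbit to G x \in orbs by apply/imsetP; exists x.
  move/inE'; rewrite !inE => /or3P[] /eqP eo; rewrite eo in xo;
  [constructor 1|constructor 2|constructor 3]; exact: xo.
have fin (O : {set T}) : O \in orbs -> #|O| = 6 -> O \subset B ->
    (forall x, x \in special -> x \notin O -> exists2 O', O' \in orbs & x \in O' /\ #|O'| = 4) ->
    exists O : {set T}, [/\ #|O| = 6, O \subset B,
    forall x, x \in O -> orbit to G x = O,
    forall x, x \in O -> #|'C_G[x | to]| = 4 &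
    forall x, x \in special -> x \notin O -> #|'C_G[x | to]| = 6].
  move=> mO cO OB hO'; exists O; split=> // [x xO|x xO|x xS xO].
  - by have [] := stabE _ _ _ mO xO cO.
  - by have [_ h] := stabE _ _ _ mO xO cO; apply/eqP; rewrite -(eqn_pmul2l (isT : 0 < 6)) h.
  by have [O' mO' [xO' cO']] := hO' _ xS xO; have [_ h] := stabE _ _ _ mO' xO' cO';
  apply/eqP; rewrite -(eqn_pmul2l (isT : 0 < 4)) h.
case: hO => [[b c1 c2 c3]|[b c1 c2 c3]|[b c1 c2 c3]].
- by apply: (fin O1) => // x /inO[] xO nO; [rewrite xO in nO|exists O2|exists O3].
- by apply: (fin O2) => // x /inO[] xO nO; [exists O1|rewrite xO in nO|exists O3].
by apply: (fin O3) => // x /inO[] xO nO; [exists O1|exists O2|rewrite xO in nO].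
Qed.

End ClassEquation.

(** * Recognition of finite groups *)

Section Recognition.
Local Open Scope group_scope.
Variable gT : finGroupType.
Implicit Types (G : {group gT}) (x y a b t : gT).

(** The relations make [G] a homomorphic image of the presented group, and the lower bound on its
    order makes that map an isomorphism. *)
Lemma isog_dihedral G x y q : 1 < q -> G :=: <<[set x; y]>> -> x ^+ q = 1 -> y ^+ 2 = 1 ->
  x ^ y = x^-1 -> q.*2 <= #|G| -> G \isog 'D_(q.*2).
Proof.
move=> q1 defG xq y2 xy cG; rewrite isogEcard card_dihedral // cG andbT.
rewrite Grp_dihedral //; apply/existsP; exists (x, y) => /=.
by rewrite !xpair_eqE xq y2 xy !eqxx !andbT joing_idl joing_idr -[_ <*> _]/(<<[set x] :|: [set y]>>) -defG.
Qed.

Lemma isog_quaternion G x y : G :=: <<[set x; y]>> -> x ^+ 4 = 1 -> y ^+ 2 = x ^+ 2 ->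
  x ^ y = x^-1 -> 8 <= #|G| -> G \isog 'Q_8.
Proof.
move=> defG x4 y2 xy cG; rewrite -[8]/(2 ^ 3)%N isogEcard card_quaternion // cG andbT.
rewrite Grp_quaternion //; apply/existsP; exists (x, y) => /=.
by rewrite !xpair_eqE x4 y2 xy !eqxx !andbT joing_idl joing_idr -[_ <*> _]/(<<[set x] :|: [set y]>>) -defG.
Qed.

Lemma isog_Zp G n : cyclic G -> #|G| = n -> G \isog Zp n.
Proof. by move=> /cyclicP[x ->] <-; rewrite isog_sym -orderE Zp_isog. Qed.

Lemma gen2E x y : <<[set x; y]>> = <[x]> <*> <[y]>.
Proof. by rewrite joing_idl joing_idr. Qed.

(** The element [y] normalizes [<[x]>], and the quotient is generated by its image, of order 2. *)
Lemma card_gen2 x y : x ^ y \in <[x]> -> y ^+ 2 \in <[x]> -> y \notin <[x]> ->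
  #|<<[set x; y]>>| = #[x].*2.
Proof.
move=> xy y2 yx; have nyx : <[y]> \subset 'N(<[x]>) by rewrite norms_cycle.
have yN : y \in 'N(<[x]>) by rewrite -cycle_subG.
rewrite gen2E; have sub : <[x]> \subset <[x]> <*> <[y]> by apply: joing_subl.
rewrite -(Lagrange sub) -orderE -muln2; congr (_ * _)%N.
rewrite -card_quotient; last by rewrite join_subG normG.
rewrite /= norm_joinEr // quotientMidl quotient_cycle // -orderE.
apply: nt_prime_order => //; first by rewrite -morphX //=; apply: coset_id.
by apply: contra yx => /eqP; apply: coset_idr.
Qed.

Lemma isog_Klein G : #|G| = 4 -> (forall x, x \in G -> x ^+ 2 = 1) ->
  G \isog [set: 'Z_2 * 'Z_2].
Proof.
move=> oG sq; have ab (hT : finGroupType) (H : {group hT}) : #|H| = 4 ->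
    (forall w : hT, w \in H -> w ^+ 2 = 1) -> 2.-abelem H.
  move=> oH sqH; rewrite abelemE //; apply/andP; split; last by apply/exponentP.
  by apply: (@card_p2group_abelian _ 2); rewrite ?oH.
rewrite (isog_abelem_card _ (ab _ _ oG sq)) oG; apply/andP; split.
  apply: ab => [|[u v] _]; first by rewrite cardsT card_prod !card_ord.
  have sq2 (w : 'Z_2) : w ^+ 2 = 1 by apply: val_inj; case: w => [[|[|w]] i].
  by rewrite expgS expg1 -[LHS]/(u ^+ 2, v ^+ 2) !sq2.
by rewrite cardsT card_prod !card_ord.
Qed.

(** With n = 4 these are the relations of SL_2(F_3), the quaternion group of
    order 8 extended by an element of order 3; with n = 2 those of A_4. *)
Definition tetra_rel a b t := [/\ b ^+ 2 = a ^+ 2, a ^ b = a^-1, t ^+ 3 = 1,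
  a ^ t = b & b ^ t = a * b].

(** The subgroup generated by [a] and [b] has order 2n, that is 4 or 8, and is normalized by [t], of
    order 3; coprimality multiplies the orders. *)
Lemma card_tetra a b t n : (n == 2) || (n == 4) -> tetra_rel a b t -> #[a] = n ->
  b \notin <[a]> -> t != 1 -> #|<<[set a; b; t]>>| = (6 * n)%N.
Proof.
move=> n24 [ba ab t3 at_ bt] oa bna t1.
have oQ : #|<<[set a; b]>>| = n.*2.
  by rewrite card_gen2 ?oa // ?ab ?ba ?groupV ?groupX ?cycle_id.
have nQ : <[t]> \subset 'N(<<[set a; b]>>).
  rewrite cycle_subG; apply/normP; rewrite -genJ; apply/eqP.
  rewrite eqEcard genJ cardJg leqnn andbT -genJ gen_subG.
  apply/subsetP => _ /imsetP[u /set2P[]-> ->]; rewrite ?at_ ?bt ?groupM //;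
  by rewrite mem_gen // !inE eqxx ?orbT.
have ot : #[t] = 3 by apply: nt_prime_order.
have -> : <<[set a; b; t]>> = <<[set a; b]>> <*> <[t]>.
  by rewrite joing_idl joing_idr.
rewrite norm_joinEr // coprime_cardMg.
  by rewrite -orderE ot oQ; case/orP: n24 => /eqP->.
by rewrite -orderE ot oQ; case/orP: n24 => /eqP->.
Qed.

End Recognition.

(** Both groups are projections of the subgroup of the product generated by the pairs of generators.
    The pairs satisfy the same relations, so [card_tetra] gives this subgroup the same order 6n, and
    both projections are isomorphisms. *)
Lemma isog_tetra (gT hT : finGroupType) (a b t : gT) (c d u : hT) n :
  (n == 2) || (n == 4) -> tetra_rel a b t -> tetra_rel c d u ->
  #[a]%g = n -> #[c]%g = n -> b \notin <[a]>%g -> d \notin <[c]>%g ->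
  t != 1%g -> u != 1%g -> (<<[set a; b; t]>> \isog <<[set c; d; u]>>)%g.
Proof.
move=> n24 r1 r2 oa oc ba dc t1 u1.
pose x := (a, c); pose y := (b, d); pose z := (t, u).
pose D := (<<[set x; y; z]>>)%G.
have r : tetra_rel x y z.
  have xX (w : gT * hT) m : (w ^+ m = (w.1 ^+ m, w.2 ^+ m))%g.
    by elim: m => // m IH; rewrite !expgS IH.
  case: r1 r2 => [e1 e2 e3 e4 e5] [f1 f2 f3 f4 f5]; split.
  - by rewrite !xX /= e1 f1.
  - by rewrite -[LHS]/((a ^ b)%g, (c ^ d)%g) e2 f2.
  - by rewrite xX /= e3 f3.
  - by rewrite -[LHS]/((a ^ t)%g, (c ^ u)%g) e4 f4.
  by rewrite -[LHS]/((b ^ t)%g, (d ^ u)%g) e5 f5.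
have fM : {in [set: gT * hT] &, {morph fst : v w / (v * w)%g}} by move=> v w _ _.
have sM : {in [set: gT * hT] &, {morph snd : v w / (v * w)%g}} by move=> v w _ _.
pose f := Morphism fM; pose s := Morphism sM.
have fD : (f @* D = <<[set a; b; t]>>)%g.
  by rewrite morphim_gen ?subsetT // morphimEsub ?subsetT // !imsetU !imset_set1.
have sD : (s @* D = <<[set c; d; u]>>)%g.
  by rewrite morphim_gen ?subsetT // morphimEsub ?subsetT // !imsetU !imset_set1.
have ox : #[x]%g = n.
  apply/eqP; rewrite eqn_dvd -{2}oa; apply/andP; split.
    rewrite order_dvdn; apply/eqP; rewrite -[RHS]/(1%g, 1%g).
    have -> : (x ^+ n = (a ^+ n, c ^+ n))%g by elim: n {n24 oa oc r} => // m IH; rewrite !expgS IH.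
    by rewrite -{1}oa -oc !expg_order.
  have -> : a = f x by []. by apply: morph_order; rewrite inE.
have yx : y \notin <[x]>%g.
  apply: contra ba => yx; have -> : <[a]>%g = (f @* <[x]>)%g by rewrite morphim_cycle ?inE.
  have -> : b = f y by []. by apply: mem_morphim; rewrite ?inE.
have z1 : z != 1%g by apply: contra t1 => /eqP[-> _].
have cD := card_tetra n24 r ox yx z1.
have cG := card_tetra n24 r1 oa ba t1; have cH := card_tetra n24 r2 oc dc u1.
apply: (@isog_trans _ _ _ _ D).
  by rewrite isogEcard /= cD cG leqnn andbT -fD morphim_homg ?subsetT.
by rewrite isog_sym isogEcard /= cD cH leqnn andbT -sD morphim_homg ?subsetT.
Qed.

Section Alt4.
Local Open Scope group_scope.

Lemma isog_Alt4 (gT : finGroupType) (a b t : gT) : tetra_rel a b t -> #[a] = 2 ->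
  b \notin <[a]> -> t != 1 -> <<[set a; b; t]>> \isog 'Alt_('I_4).
Proof.
move=> r oa ba t1.
pose p0 := @Ordinal 4 0 isT; pose p1 := @Ordinal 4 1 isT.
pose p2 := @Ordinal 4 2 isT; pose p3 := @Ordinal 4 3 isT.
have allp (x : 'I_4) : [\/ x = p0, x = p1, x = p2 | x = p3].
  case: x => [[|[|[|[|]]]]] // i; [constructor 1|constructor 2|constructor 3|constructor 4];
  exact: val_inj.
pose c := tperm p0 p1 * tperm p2 p3; pose d := tperm p0 p2 * tperm p1 p3.
pose u := tperm p1 p2 * tperm p1 p3.
have tE (x y z : 'I_4) : tperm x y z = if z == x then y else if z == y then x else z.
  by case: tpermP => [->|->|/eqP/negbTE-> /eqP/negbTE->]; rewrite ?eqxx //; case: eqP.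
have cc : c * c = 1 by apply/permP => x; case: (allp x) => ->; rewrite !permM perm1 !tE.
have dd : d * d = 1 by apply/permP => x; case: (allp x) => ->; rewrite !permM perm1 !tE.
have inv (x : {perm 'I_4}) : x * x = 1 -> x^-1 = x by move=> e; apply: (mulgI x); rewrite mulgV.
have cj (x y z : {perm 'I_4}) : x * y = y * z -> x ^ y = z by rewrite conjgC => /mulgI.
have rc : tetra_rel c d u.
  split; rewrite ?expgS ?expg0 ?mulg1 ?cc ?dd ?inv //; try apply: cj.
  - by apply/permP => x; case: (allp x) => ->; rewrite !permM !tE.
  - by apply/permP => x; case: (allp x) => ->; rewrite !permM perm1 !tE.
  - by apply/permP => x; case: (allp x) => ->; rewrite !permM !tE.
  by apply/permP => x; case: (allp x) => ->; rewrite !permM !tE.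
have ne (x y : {perm 'I_4}) i : x i != y i -> x != y by apply: contraNneq => ->.
have c1 : c != 1 by apply: (ne _ _ p0); rewrite permM perm1 !tE.
have oc : #[c] = 2 by apply: nt_prime_order; rewrite // expgS expg1.
have dc : d \notin <[c]>.
  rewrite cycle2g // !inE negb_or; apply/andP; split; apply: (ne _ _ p0);
  by rewrite !permM ?perm1 !tE.
have u1 : u != 1 by apply: (ne _ _ p1); rewrite permM perm1 !tE.
suff <- : <<[set c; d; u]>> = 'Alt_('I_4) by apply: isog_tetra r rc oa oc ba dc t1 u1.
have cA : #|'Alt_('I_4)| = 12.
  by have := @card_Alt 'I_4; rewrite card_ord => /(_ isT); rewrite !factS fact0; lia.
apply/eqP; rewrite eqEcard cA (card_tetra _ rc oc dc u1) // andbT gen_subG.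
apply/subsetP => x hx; rewrite Alt_even; move: hx.
by rewrite !inE -orbA => /or3P[] /eqP ->; rewrite !odd_permM !odd_tperm.
Qed.
End Alt4.

Section SL23.
Local Open Scope ring_scope.
Import GRing.Theory.

Definition mx22 (R : nzRingType) (p q r s : R) : 'M[R]_2 :=
  \matrix_(i, j) if i == 0 then (if j == 0 then p else q) else (if j == 0 then r else s).

Lemma mx22M (R : nzRingType) (p q r s p' q' r' s' : R) :
  mx22 p q r s *m mx22 p' q' r' s' =
  mx22 (p * p' + q * r') (p * q' + q * s') (r * p' + s * r') (r * q' + s * s').
Proof.
by apply/matrixP => i j; rewrite !mxE !big_ord_recl big_ord0 !mxE /= addr0;
  case: ifP => _; case: ifP.
Qed.

Lemma det_mx22 (R : comNzRingType) (p q r s : R) : \det (mx22 p q r s) = p * s - q * r.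
Proof.
rewrite (expand_det_row _ 0) !big_ord_recl big_ord0 /cofactor !det_mx11 !mxE /= addr0.
by rewrite expr0 expr1 mul1r mulN1r mulrN.
Qed.

Lemma isog_SL2_3 (gT : finGroupType) (a b t : gT) : tetra_rel a b t -> #[a]%g = 4%N ->
  b \notin <[a]>%g -> t != 1%g ->
  exists2 H : {group {'GL_2(3)}}, [set M : {'GL_2(3)} | \det (GLval M) == 1] = H &
    <<[set a; b; t]>>%g \isog H.
Proof.
move=> rel oa ba t1.
have un (p q r s : 'F_3) : p * s - q * r != 0 -> mx22 p q r s \is a GRing.unit.
  by rewrite -det_mx22 -unitfE.
(* The matrices [c] and [d] generate a quaternion group and [u] is a transvection of order 3. The
   matrix [v], of determinant -1, shows that the determinant-one subgroup is proper in ['GL_2(3)],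
   of order 48, so that it has at most 24 elements. *)
have hc : (0 * 0 - 2 * 1 != 0 :> 'F_3) by []. have hd : (1 * 2 - 1 * 1 != 0 :> 'F_3) by [].
have hu : (1 * 1 - 2 * 0 != 0 :> 'F_3) by []. have hv : (1 * 2 - 0 * 0 != 0 :> 'F_3) by [].
pose c : {'GL_2(3)} := FinRing.unit _ (un _ _ _ _ hc).
pose d : {'GL_2(3)} := FinRing.unit _ (un _ _ _ _ hd).
pose u : {'GL_2(3)} := FinRing.unit _ (un _ _ _ _ hu).
pose v : {'GL_2(3)} := FinRing.unit _ (un _ _ _ _ hv).
have cj (x y z : {'GL_2(3)}) : (x * y = y * z -> x ^ y = z)%g by rewrite conjgC => /mulgI.
have ext (p q r s p' q' r' s' : 'F_3) : [&& p == p', q == q', r == r' & s == s'] ->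
    mx22 p q r s = mx22 p' q' r' s' by case/and4P=> /eqP-> /eqP-> /eqP-> /eqP->.
have one : 1%:M = mx22 1 0 0 1 :> 'M['F_3]_2.
  by apply/matrixP => i j; rewrite !mxE; case: i => [[|[|]]] //; case: j => [[|[|]]].
have ne (x y : {'GL_2(3)}) i j : GLval x i j != GLval y i j -> x != y.
  by apply: contraNneq => ->.
have c4 : (c * c * (c * c) = 1)%g.
  by apply: val_inj; apply: etrans (esym one); rewrite /= -!mulmxE !mx22M; apply: ext.
have u3 : (u * u * u = 1)%g.
  by apply: val_inj; apply: etrans (esym one); rewrite /= -!mulmxE !mx22M; apply: ext.
have cV : (c^-1 = c * c * c)%g by apply: (mulgI c); rewrite mulgV -c4 !mulgA.
have rc : tetra_rel c d u.
  split; rewrite ?expgS ?expg0 ?mulg1 ?cV ?mulgA ?u3 //; try apply: cj;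
  apply: val_inj; by rewrite /= -!mulmxE !mx22M; apply: ext.
have oc : #[c]%g = 4%N.
  rewrite (@orderXprime _ 2 2) //; apply: nt_prime_order => //.
  by rewrite expgS expg1; apply: (ne _ _ 0 0); rewrite /= -!mulmxE mx22M !mxE.
have u1 : u != 1%g by apply: (ne _ _ 0 1); rewrite /= !mxE.
have dc : d \notin <[c]>%g.
  apply/cycleP => -[m dm]; have : (d * c = c * d)%g by rewrite dm -expgSr -expgS.
  move/eqP; apply/negP; apply: (ne _ _ 0 0).
  by rewrite /= -!mulmxE !mx22M !mxE.
pose S := [set M : {'GL_2(3)} | \det (GLval M) == 1].
have gS : group_set S.
  apply/group_setP; split=> [|x y]; rewrite !inE ?GL_1E ?det1 //.
  by rewrite GL_MxE det_mulmx => /eqP-> /eqP->; rewrite mulr1.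
exists (Group gS) => //.
suff <- : <<[set c; d; u]>>%g = Group gS by apply: isog_tetra rel rc oa oc ba dc t1 u1.
apply/eqP; rewrite eqEcard (card_tetra _ rc oc dc u1) // gen_subG; apply/andP; split.
  apply/subsetP => x hx; rewrite inE; move: hx.
  by rewrite !inE -orbA => /or3P[] /eqP ->; rewrite /= det_mx22.
have sub : Group gS \subset 'GL_2(3)%g by apply: subsetT.
have := Lagrange sub; rewrite card_GL_2 card_Fp //=.
have : (1 < #|'GL_2(3)%g : Group gS|%g)%N.
  rewrite indexg_gt1; apply/negP => /subsetP/(_ v); rewrite !inE /= det_mx22 => /(_ isT).
  by [].
by move: #|_ : _|%g #|Group gS| => m n; lia.
Qed.
End SL23.

Import GRing.Theory.
Local Open Scope ring_scope.

(** * Isomorphisms induced by Moebius maps *)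

Section Homogeneous.
Variables (k : fieldType) (g : nat).
Implicit Types (f : {poly k}) (X Z Y : k).

(** The binary form of degree 2g + 2 attached to [f]. It treats infinity like any other point:
    infinity is a zero exactly when the degree of [f] falls below 2g + 2. *)
Definition hform f X Z : k :=
  \sum_(i < g.*2.+3) f`_i * X ^+ i * Z ^+ (g.*2.+2 - i).

Lemma hform1 f x : (size f <= g.*2.+3)%N -> hform f x 1 = f.[x].
Proof.
move=> sf; rewrite (horner_coef_wide _ sf).
by apply: eq_bigr => i _; rewrite expr1n mulr1.
Qed.

Lemma hform0 f : hform f 1 0 = f`_(g.*2.+2).
Proof.
rewrite /hform (bigD1 ord_max) //= subnn !expr1n !mulr1 big1 ?addr0 // => i ni.
have lt : (i < g.*2.+2)%N.
  by have := ltn_ord i; rewrite ltnS leq_eqVlt -val_eqE /= in ni *; rewrite (negbTE ni).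
by rewrite expr0n subn_eq0 leqNgt lt mulr0.
Qed.

Lemma hformM f l X Z : hform f (l * X) (l * Z) = l ^+ g.*2.+2 * hform f X Z.
Proof.
rewrite /hform mulr_sumr; apply: eq_bigr => i _.
have le_i : (i <= g.*2.+2)%N by rewrite -ltnS.
rewrite !exprMn; have -> : l ^+ g.*2.+2 = l ^+ i * l ^+ (g.*2.+2 - i).
  by rewrite -exprD subnKC.
ring.
Qed.

Lemma hform_aff f x Z : (size f <= g.*2.+3)%N ->
  hform f (x * Z) Z = f.[x] * Z ^+ g.*2.+2.
Proof. by move=> sf; rewrite -hform1 // [RHS]mulrC -hformM mulr1 mulrC. Qed.

Lemma hform_inf f X : hform f X 0 = f`_(g.*2.+2) * X ^+ g.*2.+2.
Proof. by rewrite -hform0 [RHS]mulrC -hformM mulr1 mulr0. Qed.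

Lemma sqr_exp_half (l : k) : (l ^+ g.+1) ^+ 2 = l ^+ g.*2.+2.
Proof. by rewrite -exprM muln2 doubleS. Qed.

(** (X : Z : Y) are coordinates of [P] in the weighted projective plane with weights 1, 1, g + 1.
    This covers both charts at once and turns Moebius maps into linear substitutions. *)
Definition rep f (P : curve g f) X Z Y : Prop :=
  match P with
  | Aff x y _ => [/\ Z != 0, X = x * Z & Y = y * Z ^+ g.+1]
  | Inf w _ => [/\ Z = 0, X != 0 & Y = w * X ^+ g.+1]
  end.

Section Rep.
Variable f : {poly k}.
Hypothesis sf : (size f <= g.*2.+3)%N.
Implicit Type P : curve g f.

Lemma rep_hform P X Z Y : rep P X Z Y -> Y ^+ 2 = hform f X Z.
Proof.
case: P => [x y /eqP e|w /eqP e] /= [h1 h2 ->].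
  by rewrite h2 hform_aff // -e exprMn sqr_exp_half.
by rewrite h1 hform_inf -e exprMn sqr_exp_half.
Qed.

Lemma rep_neq0 P X Z Y : rep P X Z Y -> (X != 0) || (Z != 0).
Proof. by case: P => [x y e|w e] /= [h1 h2 _]; rewrite ?h1 ?h2 ?orbT. Qed.

Lemma rep_ex X Z Y : (X != 0) || (Z != 0) -> Y ^+ 2 = hform f X Z ->
  exists P, rep P X Z Y.
Proof.
move=> nz e; have [Z0|Z0] := eqVneq Z 0.
  rewrite Z0 eqxx orbF in nz e.
  have h : (Y / X ^+ g.+1) ^+ 2 == f`_(g.*2.+2).
    by rewrite expr_div_n sqr_exp_half e hform_inf mulfK // expf_neq0.
  by exists (Inf h); split; rewrite ?divfK ?expf_neq0.
have h : (Y / Z ^+ g.+1) ^+ 2 == f.[X / Z].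
  rewrite expr_div_n sqr_exp_half e -[X in hform f X _](divfK Z0).
  by rewrite hform_aff // mulfK // expf_neq0.
by exists (Aff g h); split; rewrite ?divfK ?expf_neq0.
Qed.

Lemma rep_inj P Q X Z Y : rep P X Z Y -> rep Q X Z Y -> P = Q.
Proof.
case: P => [x y e|w e]; case: Q => [x' y' e'|w' e'] /= [h1 h2 h3] [h1' h2' h3'].
- have ex : x = x' by apply: (mulIf h1); rewrite -h2.
  have ey : y = y' by apply: (mulIf (expf_neq0 g.+1 h1)); rewrite -h3.
  by subst; congr Aff; apply: bool_irrelevance.
- by rewrite h1' eqxx in h1.
- by rewrite h1 eqxx in h1'.
have ew : w = w' by apply: (mulIf (expf_neq0 g.+1 h2)); rewrite -h3.
by subst; congr Inf; apply: bool_irrelevance.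
Qed.

Lemma repM l P X Z Y : l != 0 -> rep P X Z Y ->
  rep P (l * X) (l * Z) (l ^+ g.+1 * Y).
Proof.
move=> l0; case: P => [x y e|w e] /= [h1 h2 h3]; split.
- by rewrite mulf_neq0.
- by rewrite h2 mulrCA.
- by rewrite h3 exprMn mulrCA.
- by rewrite h1 mulr0.
- by rewrite mulf_neq0.
by rewrite h3 exprMn mulrCA.
Qed.

Lemma rep_prop P X Z Y X' Z' Y' : rep P X Z Y -> rep P X' Z' Y' ->
  exists2 l, l != 0 & [/\ X' = l * X, Z' = l * Z & Y' = l ^+ g.+1 * Y].
Proof.
case: P => [x y e|w e] /= [h1 h2 h3] [h1' h2' h3'].
  exists (Z' / Z); first by rewrite mulf_neq0 ?invr_eq0.
  split; first by rewrite h2 h2' mulrCA divfK.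
    by rewrite divfK.
  by rewrite h3 h3' mulrCA -exprMn divfK.
exists (X' / X); first by rewrite mulf_neq0 ?invr_eq0.
split; first by rewrite divfK.
  by rewrite h1 h1' mulr0.
by rewrite h3 h3' mulrCA -exprMn divfK.
Qed.

Lemma repE P : exists X Z Y, rep P X Z Y.
Proof.
case: P => [x y e|w e].
  by exists x, 1, y; split; rewrite ?oner_neq0 ?expr1n ?mulr1.
by exists 1, 0, w; split; rewrite ?oner_neq0 ?expr1n ?mulr1.
Qed.

Lemma rep_chart (i : bool) P X Z Y : rep P X Z Y ->
  let D := if i then X else Z in let N := if i then Z else X in
  chart i P = if D == 0 then None else Some (N / D, Y / D ^+ g.+1).
Proof.
case: P i => [x y e|w e] [] /= [h1 h2 h3].
- rewrite h2 mulf_eq0 (negbTE h1) orbF; case: eqP => // /eqP x0.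
  congr (Some (_, _)); first by rewrite invfM mulrCA divff ?mulr1.
  by rewrite h3 exprMn invfM mulrACA divff ?mulr1 // expf_neq0.
- by rewrite (negbTE h1) h2 h3 !mulfK ?expf_neq0.
- by rewrite (negbTE h2) h1 mul0r h3 mulfK ?expf_neq0.
by rewrite h1 eqxx.
Qed.

Lemma chart_rep (i : bool) P c : chart i P = Some c ->
  rep P (if i then 1 else c.1) (if i then c.1 else 1) c.2.
Proof.
case: P i => [x y e|w e] [] //=.
- case: eqP => // /eqP x0 [<-] /=; split; rewrite ?invr_eq0 ?mulfV //.
  by rewrite exprVn.
- by case=> <- /=; split; rewrite ?oner_neq0 ?expr1n ?mulr1.
by case=> <- /=; split; rewrite ?oner_neq0 ?expr1n ?mulr1.
Qed.

Lemma chart_negb (i : bool) P x y : chart i P = Some (x, y) ->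
  chart (~~ i) P = if x == 0 then None else Some (x^-1, y / x ^+ g.+1).
Proof. by move/chart_rep/(rep_chart (~~ i)) => -> /=; case: i; rewrite mul1r. Qed.

Lemma chart_ex P : exists i c, chart i P = Some c.
Proof.
by case: P => [x y e|w e]; [exists false, (x, y)|exists true, (0, w)].
Qed.

End Rep.
End Homogeneous.

Arguments rep {k g f}.

Section Mobius.
Variables (k : fieldType) (g : nat).
Implicit Types f : {poly k}.

(** The substitution (X, Z, Y) |-> (a X + b Z, c X + d Z, e Y) on weighted
    homogeneous coordinates, where x = X / Z and y = Y / Z^(g+1). *)
Record mob := Mob { ma : k; mb : k; mc : k; md : k; me : k }.

Definition mdet m := ma m * md m - mb m * mc m.

Definition mmul m n := Mob (ma m * ma n + mb m * mc n) (ma m * mb n + mb m * md n)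
  (mc m * ma n + md m * mc n) (mc m * mb n + md m * md n) (me m * me n).

(** The adjugate matrix: its product with [m] is the scalar [mdet m] rather than 1. The last entry
    makes that scalar act with weight g + 1 on Y, so the composite is [msim] to the identity. *)
Definition minv m := Mob (md m) (- mb m) (- mc m) (ma m) (mdet m ^+ g.+1 / me m).

Definition mX m X Z := ma m * X + mb m * Z.
Definition mZ m X Z := mc m * X + md m * Z.

Definition compat m f f' := [/\ mdet m != 0, me m != 0 &
  forall X Z, hform g f' (mX m X Z) (mZ m X Z) = me m ^+ 2 * hform g f X Z].

Definition induces f f' m (phi : curve g f -> curve g f') :=
  forall P X Z Y, rep P X Z Y -> rep (phi P) (mX m X Z) (mZ m X Z) (me m * Y).

Lemma mmul_XZ m n X Z : mX (mmul m n) X Z = mX m (mX n X Z) (mZ n X Z) /\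
  mZ (mmul m n) X Z = mZ m (mX n X Z) (mZ n X Z).
Proof. by rewrite /mX /mZ /=; split; ring. Qed.

Lemma mdetM m n : mdet (mmul m n) = mdet m * mdet n.
Proof. by rewrite /mdet /=; ring. Qed.

Lemma mX_eq0 m X Z : mdet m != 0 -> (X != 0) || (Z != 0) ->
  (mX m X Z != 0) || (mZ m X Z != 0).
Proof.
move=> d0; apply: contraTT; rewrite !negb_or !negbK => /andP[/eqP hX /eqP hZ].
have eX : mdet m * X = md m * mX m X Z - mb m * mZ m X Z.
  by rewrite /mdet /mX /mZ; ring.
have eZ : mdet m * Z = ma m * mZ m X Z - mc m * mX m X Z.
  by rewrite /mdet /mX /mZ; ring.
rewrite hX hZ !mulr0 subr0 in eX eZ.
by move/eqP: eX; move/eqP: eZ; rewrite !mulf_eq0 (negbTE d0) /= => -> ->.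
Qed.

Lemma compatV m f f' : compat m f f' -> compat (minv m) f' f.
Proof.
move=> [h1 h2 h3]; have dV : mdet (minv m) = mdet m.
  by rewrite /mdet /=; ring.
split; first by rewrite dV.
  by rewrite /= mulf_neq0 ?invr_eq0 ?expf_neq0.
move=> X Z; apply: (mulfI (expf_neq0 2 h2)); rewrite -h3.
have -> : mX m (mX (minv m) X Z) (mZ (minv m) X Z) = mdet m * X.
  by rewrite /mX /mZ /mdet /=; ring.
have -> : mZ m (mX (minv m) X Z) (mZ (minv m) X Z) = mdet m * Z.
  by rewrite /mX /mZ /mdet /=; ring.
by rewrite hformM mulrA -exprMn /= mulrCA divff // mulr1 sqr_exp_half.
Qed.

Lemma induces_comp f f' f'' m n (phi : curve g f' -> curve g f'')
    (psi : curve g f -> curve g f') :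
  induces m phi -> induces n psi -> induces (mmul m n) (phi \o psi).
Proof.
move=> hm hn P X Z Y r; have [-> ->] := mmul_XZ m n X Z.
by rewrite /= -mulrA; apply/hm/hn.
Qed.

(** Proportional data, for the weights (1, 1, g + 1), induce the same map. *)
Definition msim m n := exists2 l, l != 0 &
  [/\ ma n = l * ma m, mb n = l * mb m, mc n = l * mc m, md n = l * md m &
      me n = l ^+ g.+1 * me m].

Lemma induces_sim f f' m n (phi psi : curve g f -> curve g f') :
  msim m n -> induces m phi -> induces n psi -> phi =1 psi.
Proof.
move=> [l l0 [ea eb ec ed ee]] hm hn P; have [X [Z [Y r]]] := repE P.
apply: rep_inj (repM l0 (hm _ _ _ _ r)) _.
have := hn _ _ _ _ r; rewrite /mX /mZ ea eb ec ed ee.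
by rewrite !mulrDr !mulrA.
Qed.

Lemma induces_id f : induces (Mob 1 0 0 1 1) (@id (curve g f)).
Proof. by move=> P X Z Y; rewrite /mX /mZ /= !mul1r !mul0r addr0 add0r. Qed.

Lemma induces_hinv f : induces (Mob 1 0 0 1 (-1)) (@hinv_fun _ g f).
Proof.
move=> P X Z Y; rewrite /mX /mZ /= !mul1r !mul0r addr0 add0r.
by case: P => [x y e|w e] /= [h1 h2 h3]; split; rewrite // h3 mulN1r mulNr.
Qed.

Lemma mob_ex f f' m : (size f <= g.*2.+3)%N -> (size f' <= g.*2.+3)%N ->
  compat m f f' -> exists phi : curve g f -> curve g f', induces m phi.
Proof.
move=> sf sf' [d0 e0 h].
have /choice[phi hphi] : forall P : curve g f, exists Q : curve g f',
    forall X Z Y, rep P X Z Y -> rep Q (mX m X Z) (mZ m X Z) (me m * Y).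
  move=> P; have [X [Z [Y r]]] := repE P.
  have [|Q rQ] := rep_ex sf' (mX_eq0 d0 (rep_neq0 r)) (Y := me m * Y).
    by rewrite h exprMn (rep_hform sf r).
  exists Q => X' Z' Y' r'; have [l l0 [-> -> ->]] := rep_prop r r'.
  by have := repM l0 rQ; rewrite /mX /mZ !mulrDr ![l * (_ * _)]mulrCA
     ![_ ^+ _ * (_ * _)]mulrCA.
by exists phi; exact: hphi.
Qed.

Lemma mob_cancel f f' m (phi : curve g f -> curve g f') psi : mdet m != 0 ->
  me m != 0 -> induces m phi -> induces (minv m) psi -> cancel phi psi.
Proof.
move=> d0 e0 h1 h2; have h := induces_comp h2 h1.
apply: (fun s => induces_sim s h (@induces_id f)).
exists (mdet m)^-1; first by rewrite invr_eq0.
rewrite /mdet /= in d0 *; split; try by field.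
by rewrite divfK // exprVn mulVf // expf_neq0.
Qed.

Lemma minvK m : mdet m != 0 -> me m != 0 -> minv (minv m) = m.
Proof.
case: m => a b c d e; rewrite /minv /mdet /= => d0 e0; congr Mob; rewrite ?opprK //.
have -> : d * a - - b * - c = a * d - b * c by ring.
by rewrite invf_div mulrCA divff ?mulr1 // expf_neq0.
Qed.

End Mobius.

(** * Moebius substitutions are morphisms of curves *)

Section Pullback.
Variables (k : fieldType) (g : nat).
Implicit Types f : {poly k}.
Implicit Types A B : {poly {poly k}}.

Lemma eval2D A B (c : k * k) : eval2 (A + B) c = eval2 A c + eval2 B c.
Proof. by rewrite /eval2 !hornerD. Qed.

Lemma eval2M A B (c : k * k) : eval2 (A * B) c = eval2 A c * eval2 B c.
Proof. by rewrite /eval2 !hornerM. Qed.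

Definition xpoly (p : {poly k}) : {poly {poly k}} := map_poly polyC p.

Lemma eval2_xpoly p (c : k * k) : eval2 (xpoly p) c = p.[c.1].
Proof. by rewrite /eval2 horner_map hornerC. Qed.

Lemma eval2_ypoly p (c : k * k) : eval2 p%:P c = p.[c.2].
Proof. by rewrite /eval2 hornerC. Qed.

(** Clearing denominators, by induction on [A]: exponents add under products, and sums are brought
    to a common power of [D]. *)
Lemma eval2_subst A (N D : {poly k}) e : exists n B, forall x y, D.[x] != 0 ->
  eval2 B (x, y) = D.[x] ^+ n * eval2 A (N.[x] / D.[x], e * y / D.[x] ^+ g.+1).
Proof.
pose S A := exists n B, forall x y, D.[x] != 0 ->
  eval2 B (x, y) = D.[x] ^+ n * eval2 A (N.[x] / D.[x], e * y / D.[x] ^+ g.+1).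
have SD A1 A2 : S A1 -> S A2 -> S (A1 + A2).
  move=> [n1 [B1 h1]] [n2 [B2 h2]]; exists (n1 + n2)%N.
  exists (B1 * xpoly (D ^+ n2) + B2 * xpoly (D ^+ n1)) => x y Dx.
  rewrite !eval2D !eval2M !eval2_xpoly /= h1 // h2 // !horner_exp exprD; ring.
have SM A1 A2 : S A1 -> S A2 -> S (A1 * A2).
  move=> [n1 [B1 h1]] [n2 [B2 h2]]; exists (n1 + n2)%N, (B1 * B2) => x y Dx.
  by rewrite !eval2M h1 // h2 // exprD; ring.
have SC a : S a%:P%:P.
  by exists 0%N, a%:P%:P => x y _; rewrite mul1r !eval2_ypoly !hornerC.
have SX : S 'X.
  exists 1%N, (xpoly N) => x y Dx.
  by rewrite eval2_xpoly {1}/eval2 hornerX hornerC /= expr1 mulrC divfK.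
have SY : S ('X)%:P.
  exists g.+1, (e *: 'X)%:P => x y Dx.
  by rewrite !eval2_ypoly hornerZ !hornerX /= [RHS]mulrC divfK // expf_neq0.
have SP (p : {poly k}) : S p%:P.
  elim/poly_ind: p => [|p c Sp]; first exact: (SC 0).
  by rewrite polyCD polyCM; apply: SD (SC c); apply: SM.
elim/poly_ind: A => [|A p SA]; first exact: (SP 0).
by apply: SD (SP p); apply: SM.
Qed.

Variables (f f' : {poly k}) (m : mob k) (phi : curve g f -> curve g f').
Hypothesis hm : induces m phi.

Definition mobX (j : bool) : {poly k} :=
  if j then (ma m)%:P + mb m *: 'X else ma m *: 'X + (mb m)%:P.
Definition mobZ (j : bool) : {poly k} :=
  if j then (mc m)%:P + md m *: 'X else mc m *: 'X + (md m)%:P.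
Definition mobD (i j : bool) := if i then mobX j else mobZ j.

Lemma chart_mob (i j : bool) P x y : chart j P = Some (x, y) ->
  chart i (phi P) = if (mobD i j).[x] == 0 then None else
    Some ((mobD (~~ i) j).[x] / (mobD i j).[x], me m * y / (mobD i j).[x] ^+ g.+1).
Proof.
move/chart_rep/hm/(rep_chart i) => ->; rewrite /mobD /mobX /mobZ /mX /mZ /=.
by case: i j => [] [] /=; rewrite !(hornerD, hornerZ, hornerX, hornerC) ?mulr1.
Qed.

(** Read in chart [j], the pullback of a polynomial on chart [i] has a power of [mobD i j] as its
    denominator, and [mobD i j] vanishes exactly where the image leaves chart [i]. For the identity
    this is the change of charts. *)
Lemma mob_pull (i j : bool) A : exists n B, forall P d, chart j P = Some d ->
  if (mobD i j).[d.1] == 0 then chart i (phi P) = None else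
  exists2 c, chart i (phi P) = Some c &
             eval2 B d = (mobD i j).[d.1] ^+ n * eval2 A c.
Proof.
have [n [B h]] := eval2_subst A (mobD (~~ i) j) (mobD i j) (me m).
exists n, B => P [x y] /(chart_mob i) /= ->; case: eqP => // /eqP D0.
by rewrite h //; eexists.
Qed.

Lemma zopen_mob (V : set (curve g f')) : zopen V -> zopen (preimage phi V).
Proof.
move=> oV P /oV[i [A [[c cP Ac] AV]]]; have [j [d dP]] := chart_ex P.
have [n [B h]] := mob_pull i j A.
exists j, (xpoly (mobD i j) * B); split.
  exists d => //; have := h _ _ dP; case: ifPn => [_|D0 [c']]; rewrite cP //.
  by case=> <- e; rewrite eval2M eval2_xpoly e !mulf_neq0 ?expf_neq0.
move=> Q d' dQ; rewrite eval2M eval2_xpoly mulf_eq0 negb_or => /andP[D0].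
have := h _ _ dQ; rewrite (negbTE D0) => -[c' cQ ->].
by rewrite mulf_eq0 negb_or => /andP[_ /AV]; apply.
Qed.

End Pullback.

Section Open.
Variables (k : fieldType) (g : nat) (f : {poly k}).
Implicit Types U V : set (curve g f).

Definition chart_dom (i : bool) : set (curve g f) := fun P => exists c, chart i P = Some c.

Lemma zopen_chart i : zopen (chart_dom i).
Proof.
move=> P [c cP]; exists i, 1; split; last by move=> Q d dQ _; exists d.
by exists c => //; rewrite /eval2 !hornerC oner_neq0.
Qed.

(** Principal opens of different charts are brought into the same chart by [mob_pull] for the
    identity; the factor [D] removes the points outside the other chart. *)
Lemma zopenI U V : zopen U -> zopen V -> zopen (fun P => U P /\ V P).
Proof.
move=> oU oV P [/oU[i [A [[c cP Ac] AU]]] /oV[j [B [[d dP Bd] BV]]]].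
have [n [B' h]] := mob_pull (@induces_id _ g f) j i B.
set D := mobD _ j i in h.
exists i, (A * (xpoly D * B')); split.
  exists c => //; have := h _ _ cP; case: ifPn => [_|D0 [c']]; rewrite dP //.
  by case=> <- e; rewrite !eval2M eval2_xpoly e !mulf_neq0 ?expf_neq0.
move=> Q d' dQ; rewrite !eval2M eval2_xpoly !mulf_eq0 !negb_or.
move=> /and3P[/(AU _ _ dQ) UQ D0]; have := h _ _ dQ; rewrite (negbTE D0).
by move=> [c' cQ ->]; rewrite mulf_eq0 negb_or => /andP[_ /BV-/(_ _ cQ)].
Qed.

End Open.

Lemma mob_morphism (k : fieldType) g (f f' : {poly k}) m
  (phi : curve g f -> curve g f') : induces m phi -> curve_morphism phi.
Proof.
move=> hm; split=> [|V s oV rs P VP]; first exact: zopen_mob hm.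
have [W [oW WP WV [i [A [B AB]]]]] := rs _ VP.
have [j jP] := chart_ex P.
exists (fun Q => preimage phi W Q /\ chart_dom j Q); split=> //.
  by apply: zopenI (@zopen_chart _ _ _ j); apply: (zopen_mob hm oW).
  by move=> Q [/WV].
have [n [A' hA]] := mob_pull hm i j A; have [l [B' hB]] := mob_pull hm i j B.
set D := mobD m i j in hA hB.
exists j, (A' * xpoly (D ^+ l)), (B' * xpoly (D ^+ n)) => Q [WQ [d dQ]].
have [c [cQ Bc sQ]] := AB _ WQ; exists d; split=> //=.
  have := hB _ _ dQ; case: ifPn => [_|D0 [c']]; rewrite cQ //.
  by case=> <- e; rewrite !eval2M eval2_xpoly horner_exp e !mulf_neq0 ?expf_neq0.
have := hA _ _ dQ; have := hB _ _ dQ; case: ifPn => [_|D0]; rewrite cQ //.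
move=> [_ [<-] eB] [_ [<-] eA]; rewrite sQ !eval2M !eval2_xpoly !horner_exp eA eB.
have := expf_neq0 n D0; have := expf_neq0 l D0.
by move: (D.[_] ^+ l) (D.[_] ^+ n) => u v u0 v0; field; apply/and3P; split.
Qed.

Lemma compat_iso (k : fieldType) g (f f' : {poly k}) m :
  (size f <= g.*2.+3)%N -> (size f' <= g.*2.+3)%N -> compat g m f f' ->
  exists (phi : curve g f -> curve g f') (psi : curve g f' -> curve g f),
  [/\ curve_morphism phi, curve_morphism psi, cancel phi psi, cancel psi phi &
      induces m phi /\ induces (minv g m) psi].
Proof.
move=> sf sf' cm; have cm' := compatV cm.
have [phi hphi] := mob_ex sf sf' cm; have [psi hpsi] := mob_ex sf' sf cm'.
have [d0 e0 _] := cm; have [d0' e0' _] := cm'.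
exists phi, psi; split=> //.
- exact: mob_morphism hphi.
- exact: mob_morphism hpsi.
- exact: mob_cancel d0 e0 hphi hpsi.
by apply: mob_cancel d0' e0' hpsi _; rewrite minvK.
Qed.

(** * Every isomorphism is induced by a Moebius map *)

Section ClosedField.
Variable k : closedFieldType.
Implicit Types (p : {poly k}) (L : seq k).

Lemma sqrt_ex (c : k) : exists y, y ^+ 2 = c.
Proof.
have /closed_rootP[y /rootP] : size ('X^2 - c%:P : {poly k}) != 1.
  by rewrite size_XnsubC.
by rewrite !hornerE => /eqP; rewrite subr_eq0 => /eqP; exists y.
Qed.

Lemma notin_ex L : exists x : k, x \notin L.
Proof.
have /closed_nonrootP[x] : \prod_(a <- L) ('X - a%:P) != 0 :> {poly k}.
  by rewrite prodf_seq_neq0; apply/allP => a _; rewrite polyXsubC_eq0.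
by rewrite root_prod_XsubC; exists x.
Qed.

Lemma poly_cofin_eq0 p L : (forall x, x \notin L -> p.[x] = 0) -> p = 0.
Proof.
move=> h; apply/eqP; apply/negPn/negP => p0.
have /closed_nonrootP[x] : p * \prod_(a <- L) ('X - a%:P) != 0.
  rewrite mulf_neq0 // prodf_seq_neq0; apply/allP => a _.
  by rewrite polyXsubC_eq0.
rewrite rootM root_prod_XsubC negb_or => /andP[px xL].
by rewrite /root (h _ xL) eqxx in px.
Qed.

Lemma poly_cofin_inj p q L : (forall x, x \notin L -> p.[x] = q.[x]) -> p = q.
Proof.
move=> h; apply/eqP; rewrite -subr_eq0; apply/eqP/(@poly_cofin_eq0 _ L) => x xL.
by rewrite hornerD hornerN h // subrr.
Qed.

Lemma roots_ex p : p != 0 -> exists L : seq k, forall x, root p x = (x \in L).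
Proof.
have [r ->] := closed_field_poly_normal p; rewrite scaler_eq0 negb_or => /andP[c0 _].
by exists r => x; rewrite rootZ // root_prod_XsubC.
Qed.

Lemma poly_flip p n : (size p <= n.+1)%N -> exists q : {poly k},
  (size q <= n.+1)%N /\ forall u : k, u != 0 -> q.[u] = u ^+ n * p.[u^-1].
Proof.
move=> sp; exists (\poly_(i < n.+1) p`_(n - i)); split; first exact: size_poly.
move=> u u0; rewrite horner_poly (horner_coef_wide _ sp) mulr_sumr.
rewrite (reindex_inj rev_ord_inj) /=; apply: eq_bigr => i _.
have le_i : (i <= n)%N by rewrite -ltnS.
rewrite subSS subKn //; have -> : u ^+ n = u ^+ (n - i) * u ^+ i.
  by rewrite -exprD subnK.
by rewrite exprVn [RHS]mulrCA mulfK // expf_neq0.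
Qed.

End ClosedField.

(** * Regular functions as expressions a(x) + b(x) y *)

Section Regular.
Variables (k : closedFieldType) (g : nat) (f : {poly k}).
Hypothesis sf : (size f <= g.*2.+3)%N.
Local Notation curve := (curve g f).
Implicit Types (a b : {poly k} * {poly k}) (c d e : k * k) (P Q : curve).

Definition cpoly (i : bool) := if i then rev_poly g f else f.

Lemma chart_eq i P c : chart i P = Some c -> c.2 ^+ 2 = (cpoly i).[c.1].
Proof.
case: c => x y cP; case: i cP => cP.
  by apply/(chart_inf_image x y sf); exists P.
by apply/(chart_aff_image g f x y); exists P.
Qed.

Lemma chart_point i x y : y ^+ 2 = (cpoly i).[x] -> exists P, chart i P = Some (x, y).
Proof. by case: i => [/(chart_inf_image x y sf)|/(chart_aff_image g f x y)]. Qed.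

Lemma chart_inj i P Q c : chart i P = Some c -> chart i Q = Some c -> P = Q.
Proof. by move=> /chart_rep h1 /chart_rep h2; apply: rep_inj h1 h2. Qed.

(** The pair (a0, a1) stands for the function a0(x) + a1(x) y. *)
Definition nf a c := a.1.[c.1] + a.2.[c.1] * c.2.

Definition nfM (h : {poly k}) a b := (a.1 * b.1 + a.2 * b.2 * h, a.1 * b.2 + a.2 * b.1).

Lemma nfME h a b c : c.2 ^+ 2 = h.[c.1] -> nf (nfM h a b) c = nf a c * nf b c.
Proof. by move=> e; rewrite /nf /= !hornerE -e; ring. Qed.

Lemma nfZE h (p : {poly k}) a c : c.2 ^+ 2 = h.[c.1] ->
  nf (nfM h (p, 0) a) c = p.[c.1] * nf a c.
Proof. by move=> /nfME ->; rewrite {1}/nf /= horner0 mul0r addr0. Qed.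

Lemma nf_conj a c : nf a (c.1, - c.2) = a.1.[c.1] - a.2.[c.1] * c.2.
Proof. by rewrite /nf /= mulrN. Qed.

(** Reduction of polynomials in x and y modulo y^2 = h. *)
Lemma nf_ex h (A : {poly {poly k}}) : exists a,
  forall c, c.2 ^+ 2 = h.[c.1] -> eval2 A c = nf a c.
Proof.
pose S (A : {poly {poly k}}) := exists a, forall c, c.2 ^+ 2 = h.[c.1] -> eval2 A c = nf a c.
have SD A1 A2 : S A1 -> S A2 -> S (A1 + A2).
  move=> [a1 h1] [a2 h2]; exists (a1.1 + a2.1, a1.2 + a2.2) => c e.
  by rewrite eval2D h1 // h2 // /nf /= !hornerD mulrDl addrACA.
have SM A1 A2 : S A1 -> S A2 -> S (A1 * A2).
  by move=> [a1 h1] [a2 h2]; exists (nfM h a1 a2) => c e; rewrite eval2M h1 // h2 // nfME.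
have SC x : S x%:P%:P.
  by exists (x%:P, 0) => c _; rewrite eval2_ypoly /nf /= !hornerE.
have SX : S 'X by exists ('X, 0) => c _; rewrite /eval2 /nf /= !hornerE.
have SY : S ('X)%:P by exists (0, 1) => c _; rewrite eval2_ypoly /nf /= !hornerE.
have SP (p : {poly k}) : S p%:P.
  elim/poly_ind: p => [|p x Sp]; first exact: (SC 0).
  by rewrite polyCD polyCM; apply: SD (SC x); apply: SM.
elim/poly_ind: A => [|A p SA]; first exact: (SP 0).
by apply: SD (SP p); apply: SM.
Qed.

(** A local quotient represents [s] only on a neighbourhood [V]. Numerator and denominator are
    multiplied by [C], which does not vanish at [P] but vanishes at the points of the chart outside
    a smaller neighbourhood contained in [V]; the equation b s = a then holds on the entire
    chart. *)
Lemma regular_loc (U : set curve) s i P c : regular_on U s -> U P ->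
  chart i P = Some c -> exists a b, nf b c != 0 /\
  forall Q d, chart i Q = Some d -> nf b d * s Q = nf a d.
Proof.
move=> rs /rs [V [oV VP _ [l [A [B AB]]]]] cP.
have [j [H [[c' c'P Hc'] HV]]] := oV _ VP.
have [n1 [H1 h1]] := mob_pull (@induces_id _ g f) j i H.
have [nA [A1 hA]] := mob_pull (@induces_id _ g f) l i A.
have [nB [B1 hB]] := mob_pull (@induces_id _ g f) l i B.
set Dj := mobD _ j i in h1; set Dl := mobD _ l i in hA hB.
pose C := xpoly Dj * H1.
have [b hb] := nf_ex (cpoly i) (C * (B1 * xpoly (Dl ^+ nA))).
have [a ha] := nf_ex (cpoly i) (C * (A1 * xpoly (Dl ^+ nB))).
exists a, b; split.
  rewrite -hb ?(chart_eq cP) // !eval2M !eval2_xpoly horner_exp.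
  have := h1 _ _ cP; case: ifPn => [_|D0 [c1]]; rewrite c'P // => -[<-] ->.
  have [c2 [c2P Bc2 _]] := AB _ VP.
  have := hB _ _ cP; case: ifPn => [_|E0 [c3]]; rewrite c2P // => -[<-] ->.
  by rewrite !mulf_neq0 ?expf_neq0.
move=> Q d dQ; rewrite -hb ?(chart_eq dQ) // -ha ?(chart_eq dQ) //.
rewrite ![eval2 (C * _) _]eval2M; have [->|C0] := eqVneq (eval2 C d) 0; first by rewrite !mul0r.
move: C0; rewrite /C eval2M eval2_xpoly mulf_eq0 negb_or => /andP[D0].
have := h1 _ _ dQ; rewrite (negbTE D0) => -[c1 c1Q ->].
rewrite mulf_eq0 negb_or => /andP[_ Hc1]; have VQ := HV _ _ c1Q Hc1.
have [c2 [c2Q Bc2 ->]] := AB _ VQ.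
rewrite ![eval2 (_ * xpoly _) _]eval2M !eval2_xpoly !horner_exp.
have := hB _ _ dQ; have := hA _ _ dQ; case: ifPn => [_|E0]; rewrite c2Q //.
by move=> [_ [<-] ->] [_ [<-] ->]; field.
Qed.

(** Over all but finitely many x there are two points (x, y) and (x, -y) with y nonzero. Adding and
    subtracting the two equations kills both components, as 2 is invertible. *)
Lemma nf_eq0 (h : {poly k}) a (L : seq k) : 2 != 0 :> k -> h != 0 ->
  (forall c, c.1 \notin L -> c.2 ^+ 2 = h.[c.1] -> nf a c = 0) -> a = (0, 0).
Proof.
move=> two0 h0 ha; have [R hR] := roots_ex h0.
have aux x : x \notin L ++ R -> a.1.[x] = 0 /\ a.2.[x] = 0.
  rewrite mem_cat negb_or -hR /root => /andP[xL hx].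
  have [y ey] := sqrt_ex h.[x].
  have y0 : y != 0 by apply: contraNneq hx => y0; rewrite -ey y0 expr0n.
  have e1 := ha (x, y) xL ey.
  have e2 : nf a (x, - y) = 0 by apply: ha; rewrite // sqrrN.
  rewrite (nf_conj a (x, y)) in e2; rewrite /nf /= in e1 e2.
  have f1 : 2 * a.1.[x] = 0.
    by rewrite -[RHS](addr0 0) -{1}e1 -e2; ring.
  have f2 : 2 * y * a.2.[x] = 0.
    by rewrite -[RHS](subr0 0) -{1}e1 -e2; ring.
  move/eqP: f1; move/eqP: f2; rewrite !mulf_eq0 (negbTE two0) (negbTE y0) /=.
  by move=> /eqP-> /eqP->.
rewrite [a]surjective_pairing; congr (_, _).
  by apply: (@poly_cofin_eq0 _ _ (L ++ R)) => x /aux[].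
by apply: (@poly_cofin_eq0 _ _ (L ++ R)) => x /aux[].
Qed.

(** The denominators of [s] form an ideal whose norms have no common zero on the
    line; a norm of minimal degree is then a nonzero constant. *)
Lemma loc_global i (G : curve -> Prop) s :
  (forall P c, chart i P = Some c -> exists a b, nf b c != 0 /\
     forall Q d, G Q -> chart i Q = Some d -> nf b d * s Q = nf a d) ->
  exists a, forall Q d, G Q -> chart i Q = Some d -> s Q = nf a d.
Proof.
move=> loc; pose h := cpoly i.
pose J (p : {poly k}) := exists a, forall Q d, G Q -> chart i Q = Some d ->
  p.[d.1] * s Q = nf a d.
have J0 x : exists p, p.[x] != 0 /\ J p.
  have [y ey] := sqrt_ex h.[x].
  have ey' : (- y) ^+ 2 = h.[x] by rewrite sqrrN.
  have [P1 cP1] := chart_point ey; have [P2 cP2] := chart_point ey'.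
  have [a1 [b1 [n1 h1]]] := loc _ _ cP1; have [a2 [b2 [n2 h2]]] := loc _ _ cP2.
  (* A denominator nonzero at both points over x has a norm nonzero at x. If each of the two local
     denominators vanishes at the other point, their sum is nonzero at both. *)
  suff [a [b [m1 m2 hb]]] : exists a b, [/\ nf b (x, y) != 0, nf b (x, - y) != 0 &
      forall Q d, G Q -> chart i Q = Some d -> nf b d * s Q = nf a d].
    exists (b.1 ^+ 2 - b.2 ^+ 2 * h); split.
      have := mulf_neq0 m1 m2; rewrite (nf_conj b (x, y)) /nf /= !hornerE -ey.
      by congr (_ != 0); ring.
    exists (nfM h (b.1, - b.2) a) => Q d GQ dQ; have eQ := chart_eq dQ.
    rewrite nfME // -(hb Q) // /nf /= !hornerE -[h]/(cpoly i) -eQ.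
    by rewrite /=; ring.
  have [b1y|b1y] := eqVneq (nf b1 (x, - y)) 0; last by exists a1, b1.
  have [b2y|b2y] := eqVneq (nf b2 (x, y)) 0; last by exists a2, b2.
  exists (a1.1 + a2.1, a1.2 + a2.2), (b1.1 + b2.1, b1.2 + b2.2).
  have nfD u v c : nf (u.1 + v.1, u.2 + v.2) c = nf u c + nf v c.
    by rewrite /nf /= !hornerE /=; ring.
  rewrite !nfD b1y b2y addr0 add0r; split=> // Q d GQ dQ.
  by rewrite !nfD mulrDl h1 // h2.
have JM p q : J p -> J (q * p).
  move=> [a ha]; exists (nfM h (q, 0) a) => Q d GQ dQ.
  by rewrite nfZE ?(chart_eq dQ) // -(ha Q) // hornerM mulrA.
have JB p q : J p -> J q -> J (p - q).
  move=> [a ha] [b hb]; exists (a.1 - b.1, a.2 - b.2) => Q d GQ dQ.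
  rewrite hornerD hornerN mulrBl (ha Q) // (hb Q) //.
  by rewrite /nf /= !hornerE /=; ring.
suff : forall n (p : {poly k}), (size p <= n)%N -> p != 0 -> J p -> J 1.
  have [p [p0 Jp]] := J0 0; have pn0 : p != 0.
    by apply: contraNneq p0 => ->; rewrite horner0.
  move=> /(_ _ _ (leqnn _) pn0 Jp)[a ha]; exists a => Q d GQ dQ.
  by rewrite -(ha Q) // hornerC mul1r.
elim=> [|n IH] p sp p0 Jp; first by rewrite leqn0 size_poly_eq0 (negbTE p0) in sp.
have [/eqP/size_poly1P[c c0 ep]|/closed_rootP[x /rootP px]] := eqVneq (size p) 1%N.
  have := JM _ (c^-1)%:P Jp; rewrite ep -polyCM mulVf //; exact.
have [q [qx Jq]] := J0 x; apply: (IH (q %% p)).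
- by rewrite -ltnS; apply: leq_trans sp; rewrite ltn_modp.
- apply: contraNneq qx => /eqP; rewrite -/(dvdp p q) => /dvdpP[r ->].
  by rewrite hornerM px mulr0.
have -> : q %% p = q - (q %/ p) * p.
  by rewrite {2}(divp_eq q p) addrAC subrr add0r.
by apply: JB => //; apply: JM.
Qed.

Definition xc P := if P is Aff x _ _ then x else 0.
Definition generic (L : seq k) P := if P is Aff x _ _ then x \notin L else false.

Lemma generic_chart L Q : generic L Q -> exists y, chart false Q = Some (xc Q, y).
Proof. by case: Q => [x y e|w e] //= _; exists y. Qed.

Lemma nf_flip a : exists n a', forall u v : k, u != 0 ->
  nf a' (u, v) = u ^+ n * nf a (u^-1, v / u ^+ g.+1).
Proof.
pose N := (size a.1 + size a.2)%N.
have s1 : (size a.1 <= N.+1)%N by rewrite leqW // leq_addr.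
have s2 : (size a.2 <= N.+1)%N by rewrite leqW // leq_addl.
have [q1 [_ h1]] := poly_flip s1; have [q2 [_ h2]] := poly_flip s2.
exists (N + g.+1)%N, ('X^(g.+1) * q1, q2) => u v u0.
rewrite /nf /= !hornerE h1 // h2 // exprD /=.
by have := expf_neq0 g.+1 u0; move: (u ^+ g.+1) => w w0; field.
Qed.

(** A function whose poles are bounded by [m] fibres of [x], [m <= g], is a
    function of [x]: compare its expressions a(x) + b(x) y in the two charts. *)
Lemma few_poles (L : seq k) t (d : {poly k}) m : 2 != 0 :> k -> f != 0 -> 0 \in L ->
  (size d <= m.+1)%N -> (m <= g)%N ->
  (forall P c, chart false P = Some c -> exists a b, nf b c != 0 /\
     forall Q e, generic L Q -> chart false Q = Some e ->
     nf b e * (d.[xc Q] * t Q) = nf a e) ->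
  (forall P c, chart true P = Some c -> c.1 = 0 -> exists a b, nf b c != 0 /\
     forall Q e, generic L Q -> chart true Q = Some e -> nf b e * t Q = nf a e) ->
  exists A : {poly k}, (size A <= m.+1)%N /\
    forall Q, generic L Q -> d.[xc Q] * t Q = A.[xc Q].
Proof.
move=> two0 f0 L0 sd mg h1 h2; have [dr [_ hdr]] := poly_flip sd.
have gen_u Q e : generic L Q -> chart true Q = Some e ->
    [/\ e.1 != 0, xc Q = e.1^-1 & chart false Q = Some (e.1^-1, e.2 / e.1 ^+ g.+1)].
  case: e => u v gQ eQ; have := chart_negb eQ => /=; case: Q gQ eQ => //= x y q xL.
  case: eqP => // x0 _; case: eqP => // u0 [ex ey].
  by split; [apply/eqP|rewrite ex|rewrite -ex -ey].
have [A hA] := loc_global h1.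
(* The hypotheses at infinity and over the first chart are merged into one about the second chart:
   multiplied by [dr], the polynomial [d] reversed in degree m, the function has no poles there. *)
have {h1 h2}h2 P c : chart true P = Some c -> exists a b, nf b c != 0 /\
     forall Q e, generic L Q -> chart true Q = Some e ->
     nf b e * (dr.[e.1] * t Q) = nf a e.
  move=> cP; have [c0|c0] := eqVneq c.1 0.
    have [a [b [b0 hb]]] := h2 _ _ cP c0.
    exists (nfM (cpoly true) (dr, 0) a), b; split=> // Q e gQ eQ.
    by rewrite nfZE ?(chart_eq eQ) // -(hb Q) //; ring.
  case: c cP c0 => u v cP u0.
  have := chart_negb cP; rewrite (negbTE u0) => /h1[a [b [b0 hb]]].
  have [na [a' ha']] := nf_flip a; have [nb [b' hb']] := nf_flip b.
  exists (nfM (cpoly true) ('X^(nb + m), 0) a'), (nfM (cpoly true) ('X^na, 0) b').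
  split=> [|Q e gQ eQ].
    rewrite nfZE ?(chart_eq cP) // hb' // !mulf_neq0 ?expf_neq0 //.
    by rewrite hornerXn expf_neq0.
  have [e0 ex eQ'] := gen_u _ _ gQ eQ; have := hb _ _ gQ eQ'.
  rewrite !nfZE ?(chart_eq eQ) // hdr // [e]surjective_pairing hb' // ha' //= => <-.
  by rewrite ex !hornerXn exprD; ring.
have {}h2 P c : chart true P = Some c -> exists a b, nf b c != 0 /\
     forall Q e, generic L Q -> chart true Q = Some e ->
     nf b e * (dr.[(xc Q)^-1] * t Q) = nf a e.
  move=> /h2[a [b [b0 hb]]]; exists a, b; split=> // Q e gQ eQ.
  by have [e0 -> _] := gen_u _ _ gQ eQ; rewrite invrK hb.
have [B hB] := loc_global h2.
pose N := (size B.1 + size B.2)%N.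
have s1 : (size B.1 <= N.+1)%N by rewrite leqW // leq_addr.
have s2 : (size B.2 <= N.+1)%N by rewrite leqW // leq_addl.
have [q1 [sq1 e1]] := poly_flip s1; have [q2 [sq2 e2]] := poly_flip s2.
clearbody N.
(* The charts give d t = A(x, y) and d t = x^m B(1/x, y/x^(g+1)). [D] is the difference of these,
   multiplied by x^(N+g+1) and split into its part free of y and its coefficient of y. *)
pose D := ('X^(N + g.+1) * A.1 - 'X^(m + g.+1) * q1, 'X^(N + g.+1) * A.2 - 'X^m * q2).
have : D = (0, 0).
  apply: (@nf_eq0 f D L) => // -[x y] xL exy.
  have [P cP] := @chart_point false _ _ exy.
  have gP : generic L P by case: P cP => //= ? ? ? [-> _].
  have x0 : x != 0 by apply: contraNneq xL => ->.
  have := chart_negb cP; rewrite (negbTE x0) => cP'.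
  have xP : xc P = x by case: P cP {gP cP'} => //= ? ? ? [].
  have /= := hB _ _ gP cP'; rewrite xP hdr ?invr_eq0 // invrK => hB'.
  have := hA _ _ gP cP; rewrite xP => hA'.
  have xm0 := expf_neq0 m x0; have xN0 := expf_neq0 N x0; have xg0 := expf_neq0 g.+1 x0.
  rewrite exprVn -mulrA hA' in hB'.
  have hB2 : nf A (x, y) = x ^+ m * nf B (x^-1, y / x ^+ g.+1).
    by rewrite -hB' mulrA divff // mul1r.
  rewrite /nf /= in hB2 *; rewrite !hornerE e1 // e2 // !(exprD x N) !(exprD x m) /=.
  transitivity (x ^+ N * x ^+ g.+1 * ((A.1.[x] + A.2.[x] * y)
      - x ^+ m * (B.1.[x^-1] + B.2.[x^-1] * (y / x ^+ g.+1)))).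
    by move: (x ^+ g.+1) xg0 => w w0; field.
  by rewrite hB2 subrr mulr0.
case=> /eqP; rewrite subr_eq0 => /eqP E1 /eqP; rewrite subr_eq0 => /eqP E2.
(* The y-component reads x^(N+g+1) A.2 = x^m q2 with q2 of degree at most N, which is impossible for
   nonzero A.2 because m <= g. The other component bounds the degree of A.1 by m in the same way. *)
have A20 : A.2 = 0.
  apply/eqP; apply/negPn/negP => n0.
  have := congr1 (size \o polyseq) E2 => /=.
  have [q20|q20] := eqVneq q2 0.
    by move/eqP: E2; rewrite q20 mulr0 mulf_eq0 (negbTE n0) orbF expf_eq0 polyX_eq0 andbF.
  rewrite !['X^_ * _]mulrC !size_mulXn //; move: sq2 mg n0; rewrite -size_poly_gt0.
  by move: (size q2) (size A.2) => u v; lia.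
exists A.1; split.
  have [->|n0] := eqVneq A.1 0; first by rewrite size_poly0.
  have [q10|q10] := eqVneq q1 0.
    by move/eqP: E1; rewrite q10 mulr0 mulf_eq0 (negbTE n0) orbF expf_eq0 polyX_eq0 andbF.
  have := congr1 (size \o polyseq) E1 => /=.
  rewrite !['X^_ * _]mulrC !size_mulXn //; move: sq1.
  by move: (size q1) (size A.1) => u v; lia.
move=> Q gQ; have [y cQ] := generic_chart gQ; rewrite (hA _ _ gQ cQ).
by rewrite /nf A20 horner0 mul0r addr0.
Qed.

End Regular.

Section Functions.
Variables (k : closedFieldType) (g : nat) (f : {poly k}).
Local Notation curve := (curve g f).
Implicit Types (P Q : curve) (a b : {poly k} * {poly k}) (c d : k * k).

Definition yc P := if P is Aff _ y _ then y else 0.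
Definition vc P := match P with Aff x y _ => y / x ^+ g.+1 | Inf w _ => w end.
Definition x_neq (t : k) P := if P is Aff x _ _ then x != t else true.
Definition inv_x (t : k) P := if P is Aff x _ _ then (x - t)^-1 else 0.

Lemma regular_frac (U : set curve) s :
  (forall P, U P -> exists i a b c, [/\ chart i P = Some c, nf b c != 0 &
     forall Q d, chart i Q = Some d -> nf b d != 0 -> U Q /\ s Q = nf a d / nf b d]) ->
  zopen U /\ regular_on U s.
Proof.
pose T a := xpoly a.1 + xpoly a.2 * ('X)%:P.
have ET a c : eval2 (T a) c = nf a c.
  by rewrite eval2D eval2M !eval2_xpoly eval2_ypoly hornerX.
move=> h; have oU : zopen U.
  move=> P /h[i [a [b [c [cP bc hb]]]]]; exists i, (T b); rewrite -ET in bc.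
  by split=> [|Q d dQ]; [exists c|rewrite ET => /(hb _ _ dQ)[]].
split=> // P UP; have [i [a [b [c [cP bc hb]]]]] := h _ UP.
exists (fun Q => exists2 d, chart i Q = Some d & nf b d != 0); split.
- move=> Q [d dQ bd]; exists i, (T b); split; first by exists d; rewrite ?ET.
  by move=> R e eR; rewrite ET => be; exists e.
- by exists c.
- by move=> Q [d dQ /(hb _ _ dQ)[]].
exists i, (T a), (T b) => Q [d dQ bd]; exists d; rewrite !ET; split=> //.
by have [] := hb _ _ dQ bd.
Qed.

Lemma nf1 c : @nf k (1, 0) c = 1.
Proof. by rewrite /nf /= hornerC horner0 mul0r addr0. Qed.

Lemma nfX c : @nf k ('X, 0) c = c.1.
Proof. by rewrite /nf /= hornerX horner0 mul0r addr0. Qed.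

Lemma nfY c : @nf k (0, 1) c = c.2.
Proof. by rewrite /nf /= horner0 hornerC mul1r add0r. Qed.

Lemma regular_nf i s a : (forall P c, chart i P = Some c -> s P = nf a c) ->
  regular_on (@chart_dom k g f i) s.
Proof.
move=> hs; apply: (@regular_frac _ s _).2 => P [c cP].
exists i, a, (1, 0), c; rewrite nf1 oner_neq0; split=> // Q d dQ _.
by rewrite nf1 divr1; split; [exists d|apply: hs].
Qed.

Lemma regular_xc : regular_on (@chart_dom k g f false) (@xc k g f).
Proof. by apply: (@regular_nf _ _ ('X, 0)) => -[x y e|w e] c //= [<-]; rewrite nfX. Qed.

Lemma regular_yc : regular_on (@chart_dom k g f false) yc.
Proof. by apply: (@regular_nf _ _ (0, 1)) => -[x y e|w e] c //= [<-]; rewrite nfY. Qed.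

Lemma regular_vc : regular_on (@chart_dom k g f true) vc.
Proof.
apply: (@regular_nf _ _ (0, 1)) => -[x y e|w e] c /=; last by case=> <-; rewrite nfY.
by case: eqP => // _ [<-]; rewrite nfY.
Qed.

Lemma regular_inv_x t : zopen (x_neq t) /\ regular_on (x_neq t) (inv_x t).
Proof.
have nfp (p : {poly k}) c : nf (p, 0) c = p.[c.1].
  by rewrite /nf /= horner0 mul0r addr0.
apply: regular_frac => -[x y e|w e] /= h.
  exists false, (1, 0), ('X - t%:P, 0), (x, y).
  rewrite nfp hornerXsubC subr_eq0; split=> // -[x' y' e'|w' e'] [u v] //= [<- <-].
  by rewrite !nfp hornerXsubC hornerC subr_eq0 mul1r.
exists true, ('X, 0), (1 - t *: 'X, 0), (0, w).
rewrite nfp !(hornerD, hornerN, hornerZ, hornerX, hornerC) mulr0 subr0 oner_neq0.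
split=> // -[x' y' e'|w' e'] [u v] /=.
  case: eqP => // /eqP x0 [<- _].
  rewrite !nfp !(hornerD, hornerN, hornerZ, hornerX, hornerC) /= => h'.
  have xt : x' != t by apply: contraNneq h' => <-; rewrite divff // subrr.
  by split=> //; field; rewrite x0 subr_eq0 xt.
by case=> <- _; rewrite !nfp !hornerX mul0r.
Qed.

Lemma inv_x_eq t P Q : x_neq t P -> x_neq t Q -> inv_x t P = inv_x t Q ->
  Q = P \/ Q = hinv_fun P.
Proof.
case: P Q => [x y e|w e] [x' y' e'|w' e'] /= h h'.
- move/invr_inj/addIr => ex; subst x'.
  have : y' ^+ 2 == y ^+ 2 by rewrite (eqP e) (eqP e').
  rewrite eqf_sqr => /orP[] /eqP ey; [left|right]; subst y'; congr Aff;
  exact: bool_irrelevance.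
- by move/eqP; rewrite invr_eq0 subr_eq0 (negbTE h).
- by move/esym/eqP; rewrite invr_eq0 subr_eq0 (negbTE h').
move=> _; have : w' ^+ 2 == w ^+ 2 by rewrite (eqP e) (eqP e').
rewrite eqf_sqr => /orP[] /eqP ew; [left|right]; subst w'; congr Inf;
exact: bool_irrelevance.
Qed.

(** Only finitely many points have y = 0 or lie at infinity. A value [t] outside the list is taken
    at affine points with y nonzero, and there x minus its value is a uniformizer. *)
Lemma special_values (h : curve -> k) : f != 0 -> exists L : seq k, forall P,
  (if P is Aff _ y _ then y = 0 else True) -> h P \in L.
Proof.
move=> f0; have [R hR] := roots_ex f0.
have val i c : exists z, forall P, chart i P = Some c -> h P = z.
  have [[P cP]|no] := pselect (exists P, chart i P = Some c).
    by exists (h P) => Q cQ; rewrite (chart_inj cQ cP).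
  by exists 0 => P cP; case: no; exists P.
have /choice[z hz] : forall x, exists z, forall P, chart false P = Some (x, 0) -> h P = z.
  by move=> x; apply: val.
have [w0 ew0] := sqrt_ex f`_(g.*2.+2).
have [z1 h1] := val true (0, w0); have [z2 h2] := val true (0, - w0).
exists (z1 :: z2 :: map z R) => -[x y e|w e] /= hP; rewrite !inE.
  apply/orP; right; apply/orP; right; subst y.
  rewrite (hz x) // map_f // -hR /root -(eqP e) expr0n //.
have : w ^+ 2 == w0 ^+ 2 by rewrite (eqP e) ew0.
rewrite eqf_sqr => /orP[] /eqP ew; subst w; first by rewrite (h1 (Inf e)) ?eqxx.
by rewrite (h2 (Inf e)) ?eqxx ?orbT.
Qed.

Lemma generic_ex (L : seq k) : exists P, generic L P.
Proof.
have [x xL] := notin_ex L; have [y ey] := sqrt_ex f.[x].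
by exists (@Aff k g f x y (introT eqP ey)).
Qed.

End Functions.

(** The product of [a] with its conjugate is a polynomial in x vanishing at t, so the conjugate
    serves as [b] if it is nonzero at the point. If it vanishes too, both components of [a] are
    divisible by x - t. *)
Lemma nf_uniformizer (k : closedFieldType) (h : {poly k}) a (t r : k) : 2 != 0 :> k ->
  r != 0 -> r ^+ 2 = h.[t] -> nf a (t, r) = 0 ->
  exists b a', nf b (t, r) != 0 /\ forall c, c.2 ^+ 2 = h.[c.1] ->
    nf b c * nf a c = (c.1 - t) * nf a' c.
Proof.
move=> two0 r0 er a0; have [c0|c0] := eqVneq (nf a (t, - r)) 0.
  rewrite /nf /= in a0 c0.
  have e1 : 2 * a.1.[t] = 0 by rewrite -[RHS](addr0 0) -{1}a0 -c0; ring.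
  have e2 : 2 * r * a.2.[t] = 0 by rewrite -[RHS](subr0 0) -{1}a0 -c0; ring.
  move/eqP: e1; move/eqP: e2; rewrite !mulf_eq0 (negbTE two0) (negbTE r0) /=.
  rewrite -!/(root _ _) => /factor_theorem[q2 e2] /factor_theorem[q1 e1].
  exists (1, 0), (q1, q2); rewrite /nf /= e1 e2 !hornerE oner_neq0; split=> // c _.
  by rewrite !hornerE /=; ring.
have : root (a.1 ^+ 2 - a.2 ^+ 2 * h) t.
  rewrite /root !hornerE -er; rewrite /nf /= in a0.
  apply/eqP; rewrite -[RHS](mul0r (a.1.[t] - a.2.[t] * r)) -a0 /=; ring.
move=> /factor_theorem[q eq]; exists (a.1, - a.2), (q, 0).
rewrite {1 2}/nf /= hornerN mulNr -mulrN; split=> // c ec.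
rewrite /nf /= !hornerE; transitivity (a.1 ^+ 2 - a.2 ^+ 2 * h).[c.1].
  by rewrite !hornerE -ec /=; ring.
by rewrite eq !hornerE mulrC.
Qed.

(** * The coordinate x pulls back to a fractional linear function of x *)

Section Isomorphism.
Variables (k : closedFieldType) (g : nat) (f f' : {poly k}).
Hypotheses (two0 : 2 != 0 :> k) (g2 : (2 <= g)%N).
Hypotheses (hf : hyperelliptic_poly g f) (hf' : hyperelliptic_poly g f').
Variables (phi : curve g f -> curve g f') (psi : curve g f' -> curve g f).
Hypotheses (hphi : curve_morphism phi) (hpsi : curve_morphism psi).
Hypotheses (phiK : cancel phi psi) (psiK : cancel psi phi).
Implicit Types (P Q : curve g f) (c d e : k * k).

Lemma hyper_size (F : {poly k}) : hyperelliptic_poly g F ->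
  (g.*2.+2 <= size F <= g.*2.+3)%N.
Proof. by case=> _ [] ->; rewrite !leqnn !leqnSn. Qed.

Lemma hyper_neq0 (F : {poly k}) : hyperelliptic_poly g F -> F != 0.
Proof.
by move=> /hyper_size /andP[h _]; rewrite -size_poly_gt0; apply: leq_trans h.
Qed.

Let sf : (size f <= g.*2.+3)%N. Proof. by case/andP: (hyper_size hf). Qed.
Let sf' : (size f' <= g.*2.+3)%N. Proof. by case/andP: (hyper_size hf'). Qed.
Let f0 := hyper_neq0 hf.
Let f'0 := hyper_neq0 hf'.

Lemma nf_affE (F : {poly k}) (P : curve g F) c : chart false P = Some c -> c.1 = xc P.
Proof. by case: P => [x y e|//] /= [<-]. Qed.

(** At a point where x - t is a uniformizer, an isomorphism pulls x - t back to a
    unit times x - q, so 1 / (x o phi - t) has a simple pole. *)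
Lemma simple_pole Q1 q y1 t r : chart false Q1 = Some (q, y1) ->
  chart false (phi Q1) = Some (t, r) -> r != 0 ->
  exists a b, nf b (q, y1) != 0 /\ forall Q e, chart false Q = Some e ->
    x_neq t (phi Q) -> nf b e * ((xc Q - q) * inv_x t (phi Q)) = nf a e.
Proof.
move=> cQ1 cR1 r0.
(* Near the image of [Q1] the function x o psi is a/b with value q, so a - q b vanishes there and is
   a multiple of x - t up to a unit. Composition with [phi] carries this relation back to the first
   curve. *)
have [a [b [b0 hb]]] := regular_loc sf' (hpsi.2 _ _ (@zopen_chart _ _ _ false)
  (@regular_xc k g f)) (ex_intro _ _ (etrans (congr1 (chart false) (phiK Q1)) cQ1)) cR1.
pose a0 := (a.1 - q%:P * b.1, a.2 - q%:P * b.2).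
have a0E c : nf a0 c = nf a c - q * nf b c by rewrite /nf /= !hornerE /=; ring.
have er : r ^+ 2 = f'.[t] := chart_eq sf' cR1.
have a00 : nf a0 (t, r) = 0.
  by rewrite a0E -(hb _ _ cR1) /= phiK -(nf_affE cQ1) /= mulrC subrr.
have [b1 [a1 [b10 h1]]] := nf_uniformizer two0 r0 er a00.
pose C := nfM f' b1 b.
pose cf (u : {poly k} * {poly k}) (R : curve g f') :=
  if chart false R is Some c then nf u c else 0.
have cfP u : regular_on (@chart_dom k g f' false) (cf u).
  by apply: (@regular_nf _ _ _ false _ u) => R c; rewrite /cf => ->.
have dom1 : chart_dom false (phi Q1) by exists (t, r).
have loc u := regular_loc sf (hphi.2 _ _ (@zopen_chart _ _ _ false) (cfP u)) dom1 cQ1.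
have [d [c [c0 hc]]] := loc C; have [d' [c' [c0' hc']]] := loc a1.
have C0 : nf C (t, r) != 0 by rewrite nfME // mulf_neq0.
have eq1 : y1 ^+ 2 = f.[q] := chart_eq sf cQ1.
exists (nfM f c d'), (nfM f c' d); split=> [|Q e eQ].
  rewrite nfME // mulf_neq0 // -(hc _ _ cQ1) /= /cf cR1; exact: mulf_neq0.
have ee : e.2 ^+ 2 = f.[e.1] := chart_eq sf eQ.
rewrite !nfME // -(hc _ _ eQ) -(hc' _ _ eQ) /= /cf.
case eR : (chart false (phi Q)) => [z|]; last by rewrite !mulr0 mul0r.
have ez : z.2 ^+ 2 = f'.[z.1] := chart_eq sf' eR.
have key : nf C z * (xc Q - q) = (z.1 - t) * nf a1 z.
  rewrite nfME // -h1 // a0E -(hb _ _ eR) /= phiK; ring.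
case: (phi Q) eR key => //= x y q' [<-] /= key xt.
have {}key : nf C (x, y) * (xc Q - q) / (x - t) = nf a1 (x, y).
  by rewrite key mulrAC divff ?mul1r // subr_eq0.
by rewrite -key; ring.
Qed.

(** A value of 1/(x - t) is attained at most at two conjugate points, while three points with
    distinct x have three distinct images. *)
Lemma inv_x_not_constant (L : seq k) t s :
  (forall Q, generic L Q -> x_neq t (phi Q)) ->
  ~ (forall Q, generic L Q -> inv_x t (phi Q) = s).
Proof.
move=> ht hs; have [P1 g1] := generic_ex g f L.
have [P2 g2'] := generic_ex g f (xc P1 :: L).
have [P3 g3] := generic_ex g f (xc P1 :: xc P2 :: L).
have {g2'}[g2' n12] : generic L P2 /\ xc P1 != xc P2.
  by case: (P2) g2' => //= x _ _; rewrite inE negb_or eq_sym => /andP[-> ->].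
have {g3}[g3 n13 n23] : [/\ generic L P3, xc P1 != xc P3 & xc P2 != xc P3].
  case: (P3) g3 => //= x _ _; rewrite !inE !negb_or => /and3P[h1 h2 ->].
  by rewrite ![_ == x]eq_sym.
have nphi P Q : xc P != xc Q -> phi Q <> phi P.
  by move=> n /(can_inj phiK) e; rewrite e eqxx in n.
have h2 := inv_x_eq (ht _ g1) (ht _ g2') (etrans (hs _ g1) (esym (hs _ g2'))).
have h3 := inv_x_eq (ht _ g1) (ht _ g3) (etrans (hs _ g1) (esym (hs _ g3))).
case: h2 => h2; first exact: nphi n12 h2.
case: h3 => h3; first exact: nphi n13 h3.
by apply: nphi n23 _; rewrite h2 h3.
Qed.

(** Let u = 1/(x o phi - t), with possible poles at the preimages, over q1 and q2, of the two points
    over t. By [few_poles] with m = 2 <= g, (x - q1)(x - q2) u is a polynomial A(x) if q1 and q2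
    differ; A then vanishes at both, which makes u constant, a contradiction. So q1 = q2, and m = 1
    gives (x - q1) u = al x + be, which is solved for x o phi. *)
Lemma x_mobius : exists (a b c d : k) (L : seq k), a * d - b * c != 0 /\
  forall Q, generic L Q -> exists x y, [/\ chart false (phi Q) = Some (x, y),
    c * xc Q + d != 0 & x = (a * xc Q + b) / (c * xc Q + d)].
Proof.
have [L0 hL0] := special_values (fun P => xc (phi P)) f0.
have [R' hR'] := roots_ex f'0.
have [t] := notin_ex (L0 ++ R'); rewrite mem_cat negb_or -hR' => /andP[tL0 tf'].
have [r er] := sqrt_ex f'.[t].
have r0 : r != 0 by apply: contraNneq tf' => r0; rewrite /root -er r0 expr0n.
have er' : (- r) ^+ 2 = f'.[t] by rewrite sqrrN.
pose R1 : curve g f' := Aff g (introT eqP er).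
pose R2 : curve g f' := Aff g (introT eqP er').
have fib R : xc R = t -> x_neq t (phi (psi R)) = false -> R = R1 \/ R = R2.
  rewrite psiK; case: R => [x y e|w e] //= ex _; subst x.
  have : y ^+ 2 == r ^+ 2 by rewrite er (eqP e).
  rewrite eqf_sqr => /orP[] /eqP ey; [left|right]; subst y; congr Aff;
  exact: bool_irrelevance.
have pre R : xc R = t -> exists q y, chart false (psi R) = Some (q, y) /\ y != 0.
  move=> xR; have := hL0 (psi R); rewrite psiK xR (negbTE tL0).
  case: (psi R) => [q y e|w e] h; last by case: notF; apply: h.
  by exists q, y; split=> //; apply/eqP => /h.
have [q1 [y1 [cQ1 y10]]] := pre R1 erefl; have [q2 [y2 [cQ2 y20]]] := pre R2 erefl.
have cR1 : chart false (phi (psi R1)) = Some (t, r) by rewrite psiK.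
have cR2 : chart false (phi (psi R2)) = Some (t, - r) by rewrite psiK.
have r0' : - r != 0 by rewrite oppr_eq0.
have [a1 [b1 [b10 h1]]] := simple_pole cQ1 cR1 r0.
have [a2 [b2 [b20 h2]]] := simple_pole cQ2 cR2 r0'.
have xneqP P : ~~ x_neq t (phi P) -> P = psi R1 \/ P = psi R2.
  move=> /negbTE h; have xP : xc (phi P) = t.
    by case: (phi P) h => [x y e|//] /= /negbFE/eqP.
  have := fib _ xP; rewrite psiK => /(_ h) [] <-; rewrite phiK; by [left|right].
pose L := [:: 0; q1; q2].
have Lneq Q : generic L Q -> [/\ xc Q != 0, xc Q != q1 & xc Q != q2].
  by case: Q => //= x y e; rewrite !inE !negb_or => /and3P[].
have Lt Q : generic L Q -> x_neq t (phi Q).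
  move=> gQ; apply/negPn/negP => /xneqP; have [_ n1 n2] := Lneq _ gQ.
  by case=> e; move: n1 n2; rewrite e -?(nf_affE cQ1) -?(nf_affE cQ2) eqxx.
have [oV rV] := @regular_inv_x k g f' t.
have rt := hphi.2 _ _ oV rV.
have poles (d : {poly k}) m : (size d <= m.+1)%N -> (m <= g)%N ->
    (exists d1 : {poly k}, d = d1 * ('X - q1%:P)) -> (exists d2 : {poly k}, d = d2 * ('X - q2%:P)) ->
    exists A : {poly k}, (size A <= m.+1)%N /\
      forall Q, generic L Q -> d.[xc Q] * inv_x t (phi Q) = A.[xc Q].
  move=> sd mg [d1 e1] [d2 e2]; apply: few_poles => //; first by rewrite inE eqxx.
  - have pole Q1 q y1' a b (d' : {poly k}) : d = d' * ('X - q%:P) ->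
        chart false Q1 = Some (q, y1') -> nf b (q, y1') != 0 ->
        (forall Q e, chart false Q = Some e -> x_neq t (phi Q) ->
           nf b e * ((xc Q - q) * inv_x t (phi Q)) = nf a e) ->
        exists a b, nf b (q, y1') != 0 /\
        forall Q e, generic L Q -> chart false Q = Some e ->
          nf b e * (d.[xc Q] * inv_x t (phi Q)) = nf a e.
      move=> ed cQ b0 h; exists (nfM f (d', 0) a), b; split=> // Q e gQ eQ.
      rewrite nfZE; last exact: chart_eq eQ.
      by rewrite -(h _ _ eQ (Lt _ gQ)) (nf_affE eQ) ed hornerM hornerXsubC; ring.
    move=> P c cP; have [xP|/xneqP[] eP] := boolP (x_neq t (phi P)).
    + have [a [b [b0 hb]]] := regular_loc sf rt xP cP.
      exists (nfM f (d, 0) a), b; split=> // Q e gQ eQ.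
      rewrite nfZE; last exact: chart_eq eQ.
      by rewrite -(hb _ _ eQ) (nf_affE eQ) /=; ring.
    + by move: cP; rewrite eP cQ1 => -[<-]; apply: pole e1 cQ1 b10 h1.
    by move: cP; rewrite eP cQ2 => -[<-]; apply: pole e2 cQ2 b20 h2.
  move=> P c cP c0; have xP : x_neq t (phi P).
    apply/negPn/negP => /xneqP hP.
    suff [z cz] : exists z, chart false P = Some z.
      by move: c0; case: P cP cz {hP} => //= x y _; case: eqP => // x0 [<-] _ /eqP;
        rewrite /= invr_eq0 => /eqP.
    by case: hP => ->; [exists (q1, y1)|exists (q2, y2)].
  have [a [b [b0 hb]]] := regular_loc sf rt xP cP.
  by exists a, b; split=> // Q e gQ eQ; rewrite -(hb _ _ eQ).
have q12 : q1 = q2.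
  apply/eqP; apply/negPn/negP => nq.
  have [|||A [sA hA]] := poles (('X - q1%:P) * ('X - q2%:P)) 2%N _ g2.
  - by apply: leq_trans (size_polyMleq _ _) _; rewrite !size_XsubC.
  - by exists ('X - q2%:P); rewrite mulrC.
  - by exists ('X - q1%:P).
  (* The conjugate point (q, -y) is not a pole, so [d] times the function vanishes there together
     with [d]; this product is A(q). *)
  have root_A (q y : k) : y != 0 -> y ^+ 2 = f.[q] -> q = q1 /\ y = y1 \/ q = q2 /\ y = y2 ->
      root A q.
    move=> n ey hq; have n2 : y != - y.
      by rewrite -subr_eq0 opprK -mulr2n -mulr_natl mulf_neq0.
    rewrite -sqrrN in ey; have [P cP] := @chart_point k g f sf false _ _ ey.
    have xP : x_neq t (phi P).
      apply/negPn/negP => /xneqP[] eP; move: cP; rewrite eP ?cQ1 ?cQ2 => -[eq eyy];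
      case: hq => -[qq yy]; first [by case/eqP: n2; rewrite {1}yy | by case/eqP: nq; rewrite eq qq].
    have [a [b [b0 hb]]] := regular_loc sf rt xP cP.
    pose d := ('X - q1%:P) * ('X - q2%:P).
    have : (b.1 * A - d * a.1, b.2 * A - d * a.2) = (0, 0).
      apply: (nf_eq0 (L := L) two0 f0) => -[x z] xL exz.
      have [Q cQ] := @chart_point k g f sf false _ _ exz.
      have xQ := nf_affE cQ; rewrite /= in xQ.
      have gQ : generic L Q by case: (Q) cQ => //= ? ? ? [-> _].
      have := hb _ _ cQ; have := hA _ gQ; rewrite -xQ /= -/d => h1' h2'.
      transitivity (nf b (x, z) * A.[x] - d.[x] * nf a (x, z)).
        by rewrite /nf /= !(hornerD, hornerN, hornerM d, hornerM _ A) /=; ring.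
      by rewrite -h1' -h2'; ring.
    have dq : d.[q] = 0.
      by rewrite hornerM !hornerXsubC; case: hq => -[-> _]; rewrite subrr ?mul0r ?mulr0.
    clearbody d; case=> /(congr1 (fun p => p.[q])) E1 /(congr1 (fun p => p.[q])) E2.
    move: E1 E2; rewrite !(hornerD, hornerN, hornerM) dq !mul0r !subr0 horner0 => /eqP;
      rewrite mulf_eq0 => /orP[/eqP b1q|//].
    move/eqP; rewrite mulf_eq0 => /orP[/eqP b2q|//].
    by move: b0; rewrite /nf /= b1q b2q mul0r addr0 eqxx.
  have /factor_theorem[A1 eA1] : root A q1.
    by apply: root_A y10 (chart_eq sf cQ1) _; left.
  have : root A q2 by apply: root_A y20 (chart_eq sf cQ2) _; right.
  rewrite eA1 rootM root_XsubC eq_sym (negbTE nq) orbF => /factor_theorem[A2 eA2].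
  have eA : A = A2 * (('X - q1%:P) * ('X - q2%:P)).
    by rewrite eA1 eA2; ring.
  have [s es] : exists s, A2 = s%:P.
    exists A2`_0; apply: size1_polyC; move: sA; rewrite eA.
    have [->|n] := eqVneq A2 0; first by rewrite size_poly0.
    rewrite mulrA !size_Mmonic ?monicXsubC ?size_XsubC ?addn2 //=.
    by rewrite mulf_neq0 // polyXsubC_eq0.
  apply: (@inv_x_not_constant L t s) Lt _ => Q gQ; have [_ n1 n2] := Lneq _ gQ.
  have := hA _ gQ; rewrite eA es !hornerE /=.
  have m0 : (xc Q - q1) * (xc Q - q2) != 0 by rewrite mulf_neq0 ?subr_eq0.
  by rewrite -mulrA [s * _]mulrC; apply: mulfI.
have [|||A [sA hA]] := poles ('X - q1%:P) 1%N _ (ltnW g2).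
- by rewrite size_XsubC.
- by exists 1; rewrite mul1r.
- by exists 1; rewrite mul1r q12.
pose al := A`_1; pose be := A`_0.
have AE x : A.[x] = al * x + be.
  by rewrite (horner_coef_wide _ sA) !big_ord_recl big_ord0 /= addr0 expr0 mulr1 addrC.
(* A zero of A at q1 would cancel the pole and leave the constant [al]. *)
have Aq : A.[q1] != 0.
  apply/eqP => Aq; apply: (@inv_x_not_constant L t al) Lt _ => Q gQ.
  have [_ n1 _] := Lneq _ gQ; have := hA _ gQ; rewrite hornerXsubC AE.
  have -> : al * xc Q + be = (xc Q - q1) * al.
    by rewrite -[RHS]addr0 -Aq AE; ring.
  by apply: mulfI; rewrite subr_eq0.
have A0 : A != 0 by apply: contraNneq Aq => ->; rewrite horner0.
have [RA hRA] := roots_ex A0.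
(* These are the coefficients of t + (x - q1)/(al x + be). *)
exists (t * al + 1), (t * be - q1), al, be, (RA ++ L); split.
  by move: Aq; rewrite AE; congr (_ != 0); ring.
move=> Q gQ; have [gQ' AQ] : generic L Q /\ A.[xc Q] != 0.
  by case: Q gQ => //= x y e; rewrite mem_cat negb_or -hRA => /andP[].
have := Lt _ gQ'; have := hA _ gQ'; have [_ n1 _] := Lneq _ gQ'.
case: (phi Q) => [x y e|w e] /=; last by rewrite mulr0 => e0; rewrite -e0 eqxx in AQ.
rewrite hornerXsubC => hx xt; exists x, y; rewrite -AE; split=> //.
have xt0 : x - t != 0 by rewrite subr_eq0.
rewrite (_ : _ + _ = t * A.[xc Q] + (xc Q - q1)); last by rewrite AE; ring.
by rewrite -hx; field; rewrite !subr_eq0 ?n1 ?xt.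
Qed.

End Isomorphism.

(** * Morphisms are determined by their generic values *)

Section Separation.
Variables (k : closedFieldType) (g : nat).

Lemma separating (f : {poly k}) (R S : curve g f) : R <> S ->
  exists (U : set (curve g f)) s, [/\ zopen U, regular_on U s, U R, U S & s R <> s S].
Proof.
have oc i := @zopen_chart k g f i.
(* An affine point and a point at infinity are separated by 1/(X - (x + 1)), equal to -1 at the
   first and 0 at the second. *)
have aff_inf (x y w : k) (e : y ^+ 2 == f.[x]) (e' : w ^+ 2 == f`_(g.*2.+2)) :
    [/\ x_neq (x + 1) (@Aff _ g _ _ _ e), x_neq (x + 1) (Inf e') &
        inv_x (x + 1) (@Aff _ g _ _ _ e) <> inv_x (x + 1) (Inf e')].
  rewrite /= -subr_eq0 opprD addNKr oppr_eq0 oner_eq0; split=> //.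
  by apply/eqP; rewrite invr_eq0 oppr_eq0 oner_eq0.
case: R S => [x y e|w e] [x' y' e'|w' e'] n.
- have [ex|nx] := eqVneq x x'; last first.
    exists (@chart_dom _ _ _ false), (@xc _ g f); split=> //; try exact: regular_xc.
    + by exists (x, y).
    + by exists (x', y').
    exact/eqP.
  exists (@chart_dom _ _ _ false), (@yc _ g f); split=> //; try exact: regular_yc.
  + by exists (x, y).
  + by exists (x', y').
  by move=> /= ey; subst x' y'; apply: n; congr Aff; apply: bool_irrelevance.
- have [o r] := @regular_inv_x k g f (x + 1); have [h1 h2 h3] := aff_inf _ _ _ e e'.
  by exists (fun P => x_neq (x + 1) P), (@inv_x _ g f (x + 1)).
- have [o r] := @regular_inv_x k g f (x' + 1); have [h1 h2 h3] := aff_inf _ _ _ e' e.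
  exists (fun P => x_neq (x' + 1) P), (@inv_x _ g f (x' + 1)); split=> //.
  by move=> eq; apply: h3.
exists (@chart_dom _ _ _ true), (@vc _ g f); split=> //; try exact: regular_vc.
+ by exists (0, w).
+ by exists (0, w').
by move=> /= ew; subst w'; apply: n; congr Inf; apply: bool_irrelevance.
Qed.

Lemma rev_poly_neq0 (f : {poly k}) : (size f <= g.*2.+3)%N -> f != 0 -> rev_poly g f != 0.
Proof.
move=> sf; apply: contraNneq => r0; apply/eqP/polyP => i.
have [h|h] := leqP i g.*2.+2; last by rewrite coef0 nth_default // (leq_trans sf).
have := congr1 (fun p : {poly k} => p`_(g.*2.+2 - i)) r0.
by rewrite /rev_poly coef_poly ltnS leq_subr subKn // !coef0.
Qed.

(** If the images at [P] differed, a separating function would have two pullbacks a/b and a'/b'.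
    Generic agreement gives the polynomial identity b' a = b a', hence equal values at [P] as
    well. *)
Lemma morphism_eq (f f' : {poly k}) (phi chi : curve g f -> curve g f') (L : seq k) :
  2 != 0 :> k -> (size f <= g.*2.+3)%N -> f != 0 ->
  curve_morphism phi -> curve_morphism chi ->
  (forall Q, generic L Q -> phi Q = chi Q) -> phi =1 chi.
Proof.
move=> two0 sf f0 [_ r1] [_ r2] h P; have [//|n] := pselect (phi P = chi P).
have [U [s [oU rU U1 U2]]] := separating n; case.
have [i [c cP]] := chart_ex P.
have [a [b [b0 hb]]] := regular_loc sf (r1 _ _ oU rU) U1 cP.
have [a' [b' [b0' hb']]] := regular_loc sf (r2 _ _ oU rU) U2 cP.
have F0 : cpoly g f i != 0 by case: (i) => //; apply: rev_poly_neq0.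
pose u := nfM (cpoly g f i) b' a; pose v := nfM (cpoly g f i) b a'.
have : (u.1 - v.1, u.2 - v.2) = (0, 0).
  apply: (nf_eq0 (L := (0 :: L) ++ map GRing.inv L) two0 F0) => -[x y] xL e.
  have [Q cQ] := @chart_point k g f sf i _ _ e.
  have gQ : generic L Q.
    move: xL; rewrite /= inE mem_cat !negb_or => /and3P[x0 xL xL'].
    case: (i) Q cQ => -[x' y' e'|w e'] //=; last 2 first.
    - by case=> ex _; rewrite ex eqxx in x0.
    - by case=> -> _.
    case: eqP => // _ [ex _]; apply: contra xL' => hx; rewrite -ex.
    exact: map_f.
  transitivity (nf u (x, y) - nf v (x, y)).
    by rewrite /nf /= !(hornerD, hornerN) /=; ring.
  by rewrite !nfME // -(hb _ _ cQ) -(hb' _ _ cQ) /= (h _ gQ); ring.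
case=> /eqP; rewrite subr_eq0 => /eqP E1 /eqP; rewrite subr_eq0 => /eqP E2.
have ec := chart_eq sf cP.
have : nf u c = nf v c by rewrite /u /v /nf /= E1 E2.
rewrite !nfME // -(hb _ _ cP) -(hb' _ _ cP) /= mulrCA.
by move=> /(mulfI b0) /(mulfI b0').
Qed.

End Separation.

(** For Z nonzero homogeneity reduces the identity to the affine one. For fixed X both sides are
    polynomials in Z, so it persists at Z = 0. *)
Lemma hform_lift (k : closedFieldType) g (f f' : {poly k}) (a b c d e : k) :
  (size f <= g.*2.+3)%N ->
  (forall x, hform g f' (a * x + b) (c * x + d) = e * f.[x]) ->
  forall X Z, hform g f' (a * X + b * Z) (c * X + d * Z) = e * hform g f X Z.
Proof.
move=> sf h X Z; pose n := g.*2.+2.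
pose p1 : {poly k} := \sum_(i < n.+1) f'`_i *:
  ((b *: 'X + (a * X)%:P) ^+ i * (d *: 'X + (c * X)%:P) ^+ (n - i)).
pose p2 : {poly k} := e *: \sum_(i < n.+1) (f`_i * X ^+ i) *: 'X^(n - i).
have E1 W : p1.[W] = hform g f' (a * X + b * W) (c * X + d * W).
  rewrite horner_sum; apply: eq_bigr => i _.
  by rewrite hornerZ hornerM !horner_exp !(hornerD, hornerZ, hornerX, hornerC) mulrA ![_ + _ * X]addrC.
have E2 W : p2.[W] = e * hform g f X W.
  rewrite hornerZ horner_sum; congr (_ * _); apply: eq_bigr => i _.
  by rewrite hornerZ hornerXn.
suff : p1 = p2 by move=> /(congr1 (fun p => p.[Z])); rewrite E1 E2.
apply: (@poly_cofin_inj _ _ _ [:: 0]) => W; rewrite inE => W0; rewrite E1 E2.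
have -> : a * X + b * W = W * (a * (X / W) + b) by field.
have -> : c * X + d * W = W * (c * (X / W) + d) by field.
by rewrite hformM h -{2}[X](divfK W0) hform_aff // mulrCA [_ * f.[_]]mulrC.
Qed.

Lemma linear_subst (k : closedFieldType) g (f : {poly k}) (a b c d : k) :
  exists2 T : {poly k}, (size T <= g.*2.+3)%N &
    forall X Z, hform g T X Z = hform g f (a * X + b * Z) (c * X + d * Z).
Proof.
pose n := g.*2.+2; pose N : {poly k} := a *: 'X + b%:P; pose D : {poly k} := c *: 'X + d%:P.
have NE x : N.[x] = a * x + b by rewrite !(hornerD, hornerZ, hornerX, hornerC).
have DE x : D.[x] = c * x + d by rewrite !(hornerD, hornerZ, hornerX, hornerC).
pose T : {poly k} := \sum_(i < n.+1) f`_i *: (N ^+ i * D ^+ (n - i)).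
have TE x : T.[x] = hform g f (a * x + b) (c * x + d).
  rewrite horner_sum -NE -DE; apply: eq_bigr => i _.
  by rewrite hornerZ hornerM !horner_exp mulrA.
have sT : (size T <= n.+1)%N.
  apply: leq_trans (size_sum _ _ _) _; apply/bigmax_leqP => i _.
  apply: leq_trans (size_scale_leq _ _) _; apply: leq_trans (size_polyMleq _ _) _.
  have s1 (u v : k) j : (size ((u *: 'X + v%:P) ^+ j) <= j.+1)%N.
    apply: leq_trans (size_poly_exp_leq _ _) _.
    have : (size (u *: 'X + v%:P : {poly k})%R <= 2)%N.
      apply: leq_trans (size_polyD _ _) _; rewrite geq_max (leq_trans (size_polyC_leq1 _)) // andbT.
      by apply: leq_trans (size_scale_leq _ _) _; rewrite size_polyX.
    by case: (size _) => [|[|[|]]] //= _; rewrite ?mul0n ?mul1n.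
  have := s1 a b i; have := s1 c d (n - i)%N; have := ltn_ord i; rewrite -/N -/D.
  by move: (size (N ^+ i)) (size (D ^+ (n - i))) => p q; move: (nat_of_ord i) => r; lia.
exists T => // X Z.
by rewrite (hform_lift (f := T) (e := 1)) ?mul1r // => x; rewrite mul1r TE.
Qed.

Section Isomorphism.
Variables (k : closedFieldType) (g : nat) (f f' : {poly k}).
Hypotheses (two0 : 2 != 0 :> k) (g2 : (2 <= g)%N).
Hypotheses (hf : hyperelliptic_poly g f) (hf' : hyperelliptic_poly g f').
Variables (phi : curve g f -> curve g f') (psi : curve g f' -> curve g f).
Hypotheses (hphi : curve_morphism phi) (hpsi : curve_morphism psi).
Hypotheses (phiK : cancel phi psi) (psiK : cancel psi phi).

(** With x o phi = N/D, the function D^(g+1) (y o phi) is regular on the affine curve, hence equal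
    to A.1 + A.2 y. Its square is the polynomial T(x), so A.1 A.2 = 0. If A.2 = 0, conjugate points
    would have equal images; so A.1 = 0 and A.2^2 f = T, where the degrees force A.2 to be
    constant. *)
Theorem iso_induced : exists2 m, compat g m f f' & induces m phi.
Proof.
have sf : (size f <= g.*2.+3)%N by case/andP: (hyper_size hf).
have sf' : (size f' <= g.*2.+3)%N by case/andP: (hyper_size hf').
have f0 := hyper_neq0 hf; have f'0 := hyper_neq0 hf'.
have [a [b [c [d [L0 [det0 hx]]]]]] := x_mobius two0 g2 hf hf' hphi hpsi phiK psiK.
pose N : {poly k} := a *: 'X + b%:P; pose D : {poly k} := c *: 'X + d%:P.
have NE x : N.[x] = a * x + b by rewrite !(hornerD, hornerZ, hornerX, hornerC).
have DE x : D.[x] = c * x + d by rewrite !(hornerD, hornerZ, hornerX, hornerC).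
have N0 : N != 0.
  apply: contraNneq det0 => N0; have := NE 0; have := NE 1.
  rewrite N0 !horner0 mulr1 mulr0 add0r => ea eb; rewrite -eb addr0 in ea.
  by rewrite -ea -eb !mul0r subrr.
have [RN hRN] := roots_ex N0; have [Rf hRf] := roots_ex f0.
pose L := RN ++ (Rf ++ L0).
have {}hx Q : generic L Q -> exists x y, [/\ chart false (phi Q) = Some (x, y),
    D.[xc Q] != 0, N.[xc Q] != 0, x = N.[xc Q] / D.[xc Q] & f.[xc Q] != 0].
  move=> gQ; have [g0 gN gf] : [/\ generic L0 Q, N.[xc Q] != 0 & f.[xc Q] != 0].
    by case: Q gQ => //= x y e; rewrite !mem_cat !negb_or -hRN -hRf => /and3P[].
  by have [x [y]] := hx Q g0; rewrite -DE -NE => -[h1 h2 h3]; exists x, y.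
pose s Q := D.[xc Q] ^+ g.+1 * yc (phi Q).
have xE (F : {poly k}) (P : curve g F) e : chart false P = Some e -> xc P = e.1 /\ yc P = e.2.
  by case: P => [x y q|//] /= [<-].
have [A hA] : exists A, forall Q e, generic L Q -> chart false Q = Some e -> s Q = nf A e.
  apply: (@loc_global _ _ _ sf false (fun Q => generic L Q)) => P e0 cP.
  (* At a point sent outside the first chart, y = v x^(g+1) shows that N^(g+1) (v o phi) is the same
     function and is regular there. *)
  have [[z cz]|no] := pselect (chart_dom false (phi P)).
    have [u [v [v0 hv]]] := regular_loc sf (hphi.2 _ _ (@zopen_chart _ _ _ false)
      (@regular_yc k g f')) (ex_intro _ _ cz) cP.
    exists (nfM f (D ^+ g.+1, 0) u), v; split=> // Q e gQ eQ.
    rewrite nfZE; last exact: chart_eq eQ.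
    have [ex _] := xE _ _ _ eQ.
    by rewrite -(hv _ _ eQ) /s ex horner_exp /=; ring.
  have Ut : chart_dom true (phi P).
    by have [[] [z cz]] := chart_ex (phi P); [exists z|case: no; exists z].
  have [u [v [v0 hv]]] := regular_loc sf (hphi.2 _ _ (@zopen_chart _ _ _ true)
      (@regular_vc k g f')) Ut cP.
  exists (nfM f (N ^+ g.+1, 0) u), v; split=> // Q e gQ eQ.
  rewrite nfZE; last exact: chart_eq eQ.
  have [ex _] := xE _ _ _ eQ.
  rewrite -(hv _ _ eQ) /s ex horner_exp /=.
  have [x [y [cQ D0 n0 eX _]]] := hx _ gQ; rewrite ex in D0 n0 eX.
  have [ex' ey'] := xE _ _ _ cQ.
  case: (phi Q) cQ ex' ey' => //= x1 y1 q _ -> _; rewrite eX expr_div_n.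
  by have := expf_neq0 g.+1 D0; have := expf_neq0 g.+1 n0;
    move: (N.[_] ^+ _) (D.[_] ^+ _) => w1 w2 w10 w20; field; rewrite w10 w20.
have [T sT hT] := linear_subst g f' a b c d.
have TE x : T.[x] = hform g f' (a * x + b) (c * x + d).
  by rewrite -(hform1 _ sT) hT !mulr1.
have : (A.1 ^+ 2 + A.2 ^+ 2 * f - T, (2 : k)%:P * A.1 * A.2) = (0, 0).
  apply: (nf_eq0 (L := L) two0 f0) => -[x y] xL e.
  have [Q cQ] := @chart_point k g f sf false _ _ e.
  have [ex _] := xE _ _ _ cQ; rewrite /= in ex.
  have gQ : generic L Q by case: (Q) cQ => //= ? ? ? [-> _].
  have [X [Y [cQ' D0 n0 eX _]]] := hx _ gQ; have [_ eY] := xE _ _ _ cQ'.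
  have hY := chart_eq sf' cQ'; rewrite /= in hY.
  transitivity (nf A (x, y) ^+ 2 - T.[x]).
    rewrite /nf /=; rewrite !(hornerD, hornerN, hornerM, horner_exp) -e hornerC /=; ring.
  rewrite -(hA _ _ gQ cQ) /s eY /= exprMn hY TE -NE -DE -ex.
  rewrite -[N.[_]](divfK D0) -eX hform_aff // sqr_exp_half; ring.
case=> /eqP; rewrite subr_eq0 => /eqP ET /eqP.

rewrite !mulf_eq0 polyC_eq0 (negbTE two0) /= => /orP[/eqP A10|/eqP A20]; last first.
  have [P gP] := generic_ex g f L.
  have [X [Y [cP D0 n0 eX fP]]] := hx _ gP.
  have gP' : generic L (hinv_fun P) by case: (P) gP.
  have [X' [Y' [cP' D0' _ eX' _]]] := hx _ gP'.
  have xP : xc (hinv_fun P) = xc P by case: (P).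
  have [y hy] := generic_chart gP; have [y' hy'] := generic_chart gP'.
  have e1 := hA _ _ gP hy; have e2 := hA _ _ gP' hy'.
  have : phi P = phi (hinv_fun P).
    apply: (chart_inj (i := false) cP); rewrite cP' eX eX' xP; congr (Some (_, _)).
    have [_ /= <-] := xE _ _ _ cP; have [_ /= <-] := xE _ _ _ cP'.
    apply: (mulfI (expf_neq0 g.+1 D0)); rewrite -[RHS]/(s P) e1.
    have -> : D.[xc P] ^+ g.+1 * yc (phi (hinv_fun P)) = s (hinv_fun P) by rewrite /s xP.
    by rewrite e2 /nf /= A20 !horner0 !mul0r xP.
  move=> /(can_inj phiK) eP; move: gP fP eP hy;
    case: P {cP gP' cP' xP hy' e1 e2 n0 D0 D0' eX eX'} => // x z q _ /= fx [] ez.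
  have : 2 * z = 0 by rewrite mulr_natl mulr2n {1}ez addNr.
  move/eqP; rewrite mulf_eq0 (negbTE two0) /= => /eqP z0.
  by rewrite -(eqP q) z0 expr0n eqxx in fx.
rewrite A10 expr0n add0r in ET.
have T0 : T != 0.
  have /closed_nonrootP[y1 fy] := f'0; apply/negP => /eqP T0.
  move: fy; rewrite /root -(@hform1 _ g) //.
  have hz X1 Z1 : hform g f' (a * X1 + b * Z1) (c * X1 + d * Z1) = 0.
    rewrite (@hform_lift _ g f f' a b c d 0) ?mul0r // => x.
    by rewrite mul0r -TE T0 horner0.
  have := hz ((d * y1 - b) / (a * d - b * c)) ((a - c * y1) / (a * d - b * c)).
  rewrite (_ : a * _ + _ = y1); last by field.
  rewrite (_ : c * _ + _ = 1); last by field.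
  by move=> ->; rewrite eqxx.
have A20 : A.2 != 0 by apply: contraNneq T0 => A20; rewrite -ET A20 expr0n mul0r.
have [e ee] : exists e, A.2 = e%:P.
  exists A.2`_0; apply: size1_polyC; move: sT; rewrite -ET expr2.
  have := hyper_size hf => /andP[h _]; rewrite !size_mul ?mulf_neq0 //.
  move: A20 f0 h; rewrite -!size_poly_gt0.
  by move: (size A.2) (size f) => u v; lia.
have e0 : e != 0 by apply: contraNneq A20; rewrite ee => ->.
pose m := Mob a b c d e.
have cm : compat g m f f'.
  split=> // X Z; apply: hform_lift => // x.
  by rewrite -TE -ET ee hornerM horner_exp hornerC.
exists m => //; have [chi [chi' [mchi _ _ _ [hchi _]]]] := compat_iso sf sf' cm.
suff eq : phi =1 chi by move=> P X Z Y r; rewrite eq; apply: hchi.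
apply: (morphism_eq two0 sf f0 hphi mchi (L := L)) => Q gQ.
have [y cQ] := generic_chart gQ; have [X [Y [cQ' D0 _ eX _]]] := hx _ gQ.
have /= r1 := hchi _ _ _ _ (chart_rep cQ); have /= r2 := repM D0 (chart_rep cQ').
apply: rep_inj r2 _; have [_ eY] := xE _ _ _ cQ'; rewrite /= in eY.
have := hA _ _ gQ cQ; rewrite /s eY /nf /= A10 ee horner0 add0r hornerC => ->.
by move: r1; rewrite /mX /mZ /= eX !mulr1 [D.[_] * _]mulrC divfK // NE DE.
Qed.

End Isomorphism.

(** * The action on the projective line *)

Section ProjectiveLine.
Variable k : closedFieldType.
Implicit Types (t : option k) (m n : mob k) (X Z l : k).

(** The projective line is [option k], with [None] the point at infinity. *)
Definition pX t : k := odflt 1 t.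
Definition pZ t : k := if t is Some _ then 1 else 0.
Definition pnorm X Z : option k := if Z == 0 then None else Some (X / Z).
Definition mob_act m t := pnorm (mX m (pX t) (pZ t)) (mZ m (pX t) (pZ t)).

Lemma pXZ_neq0 t : (pX t != 0) || (pZ t != 0).
Proof. by case: t => [x|] /=; rewrite oner_neq0 ?orbT. Qed.

Lemma pnormK t : pnorm (pX t) (pZ t) = t.
Proof. by case: t => [x|]; rewrite /pnorm /= ?oner_eq0 ?eqxx ?divr1. Qed.

Lemma pnormE X Z : (X != 0) || (Z != 0) ->
  exists2 l, l != 0 & X = l * pX (pnorm X Z) /\ Z = l * pZ (pnorm X Z).
Proof.
rewrite /pnorm; have [-> |Z0] := eqVneq Z 0.
  by rewrite orbF => X0; exists X; rewrite //= mulr1 mulr0.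
by move=> _; exists Z; rewrite //= mulr1 mulrC divfK.
Qed.

Lemma pnormZ l X Z : l != 0 -> pnorm (l * X) (l * Z) = pnorm X Z.
Proof.
move=> l0; rewrite /pnorm mulf_eq0 (negbTE l0) /=; case: eqP => // /eqP Z0.
by congr Some; field; rewrite ?l0 ?Z0.
Qed.

Lemma mXZ_scale m l X Z : mX m (l * X) (l * Z) = l * mX m X Z /\
  mZ m (l * X) (l * Z) = l * mZ m X Z.
Proof. by rewrite /mX /mZ; split; ring. Qed.

Lemma mob_act_pnorm m X Z : (X != 0) || (Z != 0) ->
  mob_act m (pnorm X Z) = pnorm (mX m X Z) (mZ m X Z).
Proof.
move=> /pnormE[l l0]; move: (pnorm X Z) => t [-> ->].
by have [-> ->] := mXZ_scale m l (pX t) (pZ t); rewrite pnormZ.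
Qed.

Lemma mob_actM m n t : mdet n != 0 -> mob_act (mmul m n) t = mob_act m (mob_act n t).
Proof.
move=> d0; rewrite [mob_act n t]/mob_act mob_act_pnorm ?mX_eq0 ?pXZ_neq0 //.
by rewrite /mob_act; have [-> ->] := mmul_XZ m n (pX t) (pZ t).
Qed.

Lemma mob_act_sim g m n t : msim g m n -> mob_act m t = mob_act n t.
Proof.
move=> [l l0 [ea eb ec ed _]]; rewrite /mob_act /mX /mZ ea eb ec ed.
by rewrite -!mulrA -!mulrDr pnormZ.
Qed.

Lemma mob_act_id e t : mob_act (Mob 1 0 0 1 e) t = t.
Proof. by rewrite /mob_act /mX /mZ /= !mul1r !mul0r addr0 add0r pnormK. Qed.

Lemma mob_actK g m : mdet m != 0 -> cancel (mob_act m) (mob_act (minv g m)).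
Proof.
move=> d0 t; rewrite -mob_actM // -[RHS](mob_act_id 1) /mob_act /mX /mZ /=.
rewrite -[RHS](pnormZ _ _ d0); congr pnorm; rewrite /mdet; ring.
Qed.

Lemma mob_actVK g m : mdet m != 0 -> cancel (mob_act (minv g m)) (mob_act m).
Proof.
move=> d0 t; have dV : mdet (minv g m) = mdet m by rewrite /mdet /=; ring.
rewrite -mob_actM ?dV // -[RHS](mob_act_id 1) /mob_act /mX /mZ /=.
rewrite -[RHS](pnormZ _ _ d0); congr pnorm; rewrite /mdet; ring.
Qed.

Lemma mob_act_move t1 t2 : t1 != t2 ->
  exists2 m, mdet m != 0 & mob_act m t1 = Some 0 /\ mob_act m t2 = None.
Proof.
move=> n12; exists (Mob (pZ t1) (- pX t1) (pZ t2) (- pX t2) 1).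
  rewrite /mdet /=; move: n12; case: t1 t2 => [x|] [y|] //= n; rewrite ?mul1r ?mul0r ?mulr1.
  - by rewrite opprK addrC subr_eq0; apply: contraNneq n => ->.
  - by rewrite mulr0 subr0 oppr_eq0 oner_eq0.
  by rewrite sub0r opprK oner_eq0.
rewrite /mob_act /mX /mZ /=; split; last first.
  have -> : pZ t2 * pX t2 + - pX t2 * pZ t2 = 0 by ring.
  by rewrite /pnorm eqxx.
have -> : pZ t1 * pX t1 + - pX t1 * pZ t1 = 0 by ring.
rewrite /pnorm mul0r; case: eqP => // h.
move: n12 h; case: t1 t2 => [x|] [y|] //=;
  rewrite ?mul1r ?mul0r ?mulr1 ?mulr0 ?addr0 ?add0r ?eqxx //.
- by move=> n /eqP; rewrite subr_eq0 => /eqP e; rewrite e eqxx in n.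
- by move=> _ /eqP; rewrite oppr_eq0 oner_eq0.
by move=> _ /eqP; rewrite oner_eq0.
Qed.

Variable g : nat.

Definition form_zero (f : {poly k}) t := hform g f (pX t) (pZ t) == 0.

Lemma compat_zero m (f F : {poly k}) t : compat g m f F ->
  form_zero F (mob_act m t) = form_zero f t.
Proof.
move=> [d0 e0 h]; rewrite /form_zero.
have := h (pX t) (pZ t).
have [l l0] := pnormE (mX_eq0 d0 (pXZ_neq0 t)); rewrite -/(mob_act m t) => -[-> ->].
rewrite hformM => E.
apply/eqP/eqP => H; rewrite H mulr0 in E.
  by move/esym/eqP: E; rewrite mulf_eq0 expf_eq0 (negbTE e0) andbF => /eqP.
by move/eqP: E; rewrite mulf_eq0 expf_eq0 (negbTE l0) andbF => /eqP.
Qed.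

Lemma form_zero_aff (f : {poly k}) x : (size f <= g.*2.+3)%N ->
  form_zero f (Some x) = root f x.
Proof. by move=> sf; rewrite /form_zero hform1. Qed.

Lemma form_zero_inf (f : {poly k}) : form_zero f None = (f`_(g.*2.+2) == 0).
Proof. by rewrite /form_zero hform0. Qed.

(** In odd degree, infinity supplies the branch point that the roots of [f] lack. *)
Lemma hyper_zeros (f : {poly k}) : hyperelliptic_poly g f ->
  exists2 s : seq (option k), uniq s & size s = g.*2.+2 /\
    forall t, (t \in s) = form_zero f t.
Proof.
move=> hf; have /andP[_ sf] := hyper_size hf; have f0 := hyper_neq0 hf.
have [r er] := closed_field_poly_normal f.
have l0 : lead_coef f != 0 by rewrite lead_coef_eq0.
have rE x : (x \in r) = root f x by rewrite er rootZ // root_prod_XsubC.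
have sr : size f = (size r).+1 by rewrite er size_scale // size_prod_XsubC.
have ur : uniq r.
  by case: hf => sep _; move: sep; rewrite er (eqp_separable (eqp_scale _ l0)) separable_prod_XsubC.
have us : uniq (map Some r) by rewrite map_inj_uniq // => x y [].
have sE x : (Some x \in map Some r) = form_zero f (Some x).
  by rewrite (mem_map (f := Some)) ?rE ?form_zero_aff // => u v [].
have nN : None \notin map Some r by apply/mapP => -[].
case: hf => _ [] h; rewrite h in sr.
  exists (None :: map Some r); first by rewrite /= nN.
  split; first by rewrite /= size_map; case: sr => ->.
  move=> [x|]; rewrite inE ?sE //= form_zero_inf nth_default ?eqxx // h //.
exists (map Some r) => //; split; first by rewrite size_map; case: sr => ->.
move=> [x|]; first exact: sE; rewrite (negbTE nN) form_zero_inf.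
by rewrite -[_.+2]/(_.+3.-1) -h -lead_coefE (negbTE l0).
Qed.

(** The converse of [hyper_zeros]: having 2g + 2 distinct zeros fixes the degree and gives
    separability. It lets coordinate changes trade degree 2g + 1 for 2g + 2. *)
Lemma zeros_hyper (f : {poly k}) (s : seq (option k)) : (size f <= g.*2.+3)%N ->
  f != 0 -> uniq s -> size s = g.*2.+2 -> (forall t, t \in s -> form_zero f t) ->
  hyperelliptic_poly g f.
Proof.
move=> sf f0 us ss hs; pose r := pmap id s.
have rE x : (x \in r) = (Some x \in s).
  by rewrite mem_pmap map_id.
have ur : uniq r by apply: (@pmap_uniq _ _ id Some) us; case.
have rr : all (root f) r.
  by apply/allP => x; rewrite rE => /hs; rewrite form_zero_aff.
have mr := max_poly_roots f0 rr ur.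
have sr : size r = (g.*2.+2 - (None \in s))%N.
  have cr : size r = count isSome s by rewrite size_pmap; apply: eq_count.
  have cN : count (predC isSome) s = (None \in s).
    by rewrite -count_uniq_mem //; apply: eq_count; case.
  by rewrite cr -ss -(count_predC isSome s) cN addnK.
have sep : size f = (size r).+1 -> separable_poly f.
  move=> e; have := all_roots_prod_XsubC e rr; rewrite uniq_rootsE => /(_ ur) ->.
  by rewrite (eqp_separable (eqp_scale _ _)) ?lead_coef_eq0 // separable_prod_XsubC.
case: (boolP (None \in s)) sr => nN sr; rewrite ?subn1 ?subn0 /= in sr.
  have fn : f`_(g.*2.+2) = 0 by apply/eqP; rewrite -form_zero_inf hs.
  have sf' : (size f <= g.*2.+2)%N.
    rewrite leqNgt; apply/negP => h; have e : size f = g.*2.+3 by apply/eqP; rewrite eqn_leq sf.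
    by move/eqP: fn; rewrite -[_.+2]/(_.+3.-1) -e -lead_coefE lead_coef_eq0 (negbTE f0).
  have e : size f = g.*2.+2 by apply/eqP; rewrite eqn_leq sf' -sr.
  by split; [apply: sep; rewrite sr|left].
have e : size f = g.*2.+3 by apply/eqP; rewrite eqn_leq sf -sr.
by split; [apply: sep; rewrite sr|right].
Qed.

Lemma mob_act_inj m : mdet m != 0 -> injective (mob_act m).
Proof. by move=> d0; apply: can_inj (mob_actK 0 d0). Qed.

Lemma compat_hyper m (f F : {poly k}) : hyperelliptic_poly g f ->
  (size F <= g.*2.+3)%N -> compat g m f F -> hyperelliptic_poly g F.
Proof.
move=> hf sF cm; have [d0 e0 h] := cm; have [s us [ss hs]] := hyper_zeros hf.
apply: (@zeros_hyper _ (map (mob_act m) s)) => //.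
- have f0 := hyper_neq0 hf; apply: contraNneq f0 => F0; apply/eqP.
  apply: (@poly_cofin_eq0 _ _ [::]) => x _; rewrite -(@hform1 _ g);
    last by case/andP: (hyper_size hf).
  have := h x 1; rewrite F0 /hform big1; last by move=> i _; rewrite coef0 !mul0r.
  by move/esym/eqP; rewrite mulf_eq0 expf_eq0 (negbTE e0) andbF => /eqP.
- by rewrite (map_inj_uniq (mob_act_inj d0)).
- by rewrite size_map.
by move=> t /mapP[u us' ->]; rewrite (compat_zero _ cm) -hs.
Qed.

Lemma change_coord m (f : {poly k}) : hyperelliptic_poly g f -> mdet m != 0 ->
  exists F n, [/\ hyperelliptic_poly g F, compat g n f F &
    forall t, mob_act n t = mob_act m t].
Proof.
move=> hf d0; pose n0 := Mob (md m) (- mb m) (- mc m) (ma m) 1.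
have d0' : mdet n0 != 0 by move: d0; rewrite /mdet /=; congr (_ != 0); ring.
have [F sF hF] := linear_subst g f (md m) (- mb m) (- mc m) (ma m).
have c0 : compat g n0 F f.
  by split=> //=; [exact: oner_neq0|move=> X Z; rewrite expr1n mul1r -hF].
have cm := compatV c0; exists F, (minv g n0); split=> //; first exact: compat_hyper cm.
by move=> t; rewrite /mob_act /mX /mZ /= !opprK.
Qed.

End ProjectiveLine.

(** * The automorphism group acting on the line *)

Section AutGroup.
Variables (k : closedFieldType) (g : nat) (f : {poly k}).
Hypotheses (two0 : 2 != 0 :> k) (g2 : (2 <= g)%N) (hf : hyperelliptic_poly g f).
Local Notation A := (curve_aut g f).
Implicit Types (a b : A) (m n : mob k) (t : option k).

Let sf : (size f <= g.*2.+3)%N. Proof. by case/andP: (hyper_size hf). Qed.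

Lemma aut_mob a : exists2 m, compat g m f f & induces m a.
Proof.
exact: (iso_induced two0 g2 hf hf (aut_funP a) (aut_invP a) (aut_funK a) (aut_invK a)).
Qed.

Definition mob_of a : mob k := projT1 (cid2 (aut_mob a)).

Lemma mob_ofP a : compat g (mob_of a) f f /\ induces (mob_of a) a.
Proof. by rewrite /mob_of; case: cid2. Qed.

Lemma aut_ex m : compat g m f f -> exists a, induces m a.
Proof.
by move=> /(compat_iso sf sf)[phi [psi [h1 h2 h3 h4 [h5 _]]]]; exists (MkAut h1 h2 h3 h4).
Qed.

Lemma aut_sim m n a b : msim g m n -> induces m a -> induces n b -> a = b.
Proof. by move=> h1 h2 h3; apply: aut_eq; apply: induces_sim h1 h2 h3. Qed.

Lemma induces_autM m n a b : induces m a -> induces n b -> induces (mmul m n) (a * b)%g.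
Proof. exact: induces_comp. Qed.

Lemma induces_aut1 : induces (Mob 1 0 0 1 1) (1%g : A).
Proof. exact: induces_id. Qed.

Lemma induces_iota : induces (Mob 1 0 0 1 (-1)) (hinv g f).
Proof. exact: induces_hinv. Qed.

Lemma sqr_hform X Z : (X != 0) || (Z != 0) -> exists (P : curve g f) Y,
  rep P X Z Y /\ Y ^+ 2 = hform g f X Z.
Proof.
move=> h; have [Y eY] := sqrt_ex (hform g f X Z); have [P rP] := rep_ex sf h eY.
by exists P, Y.
Qed.

(** A priori the proportionality factor depends on the point. The points 1:0, 0:1 and 1:1 show that
    it is constant on the matrix, and a point with Y nonzero determines the last entry. *)
Lemma induces_inj m n (phi : curve g f -> curve g f) :
  mdet m != 0 -> induces m phi -> induces n phi -> msim g m n.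
Proof.
move=> d0 hm hn.
have pt X Z : (X != 0) || (Z != 0) -> exists2 l, l != 0 &
    [/\ mX n X Z = l * mX m X Z, mZ n X Z = l * mZ m X Z &
     forall Y, Y ^+ 2 = hform g f X Z -> me n * Y = l ^+ g.+1 * (me m * Y)].
  move=> h; have [P [Y [rP eY]]] := sqr_hform h.
  have [l l0 [e1 e2 e3]] := rep_prop (hm _ _ _ _ rP) (hn _ _ _ _ rP).
  exists l; rewrite // e1 e2; split=> // Y' eY'; move/eqP: (eY'); rewrite -eY eqf_sqr.
  by case/orP=> /eqP-> //; rewrite !mulrN e3.
have [|l1 l10 [a1 c1 _]] := pt 1 0; first by rewrite oner_neq0.
have [|l2 l20 [b2 d2 _]] := pt 0 1; first by rewrite oner_neq0 orbT.
have [|l3 l30 [e3 f3 _]] := pt 1 1; first by rewrite oner_neq0.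
rewrite /mX /mZ !mulr1 !mulr0 ?addr0 ?add0r in a1 c1 b2 d2 e3 f3.
rewrite a1 b2 in e3; rewrite c1 d2 in f3.
have e13 : (l1 - l3) * mdet m = 0.
  have -> : (l1 - l3) * mdet m = md m * (l1 * ma m + l2 * mb m - l3 * (ma m + mb m))
     - mb m * (l1 * mc m + l2 * md m - l3 * (mc m + md m)) by rewrite /mdet; ring.
  by rewrite e3 f3 !subrr !mulr0 subrr.
have e23 : (l2 - l3) * mdet m = 0.
  have -> : (l2 - l3) * mdet m = ma m * (l1 * mc m + l2 * md m - l3 * (mc m + md m))
     - mc m * (l1 * ma m + l2 * mb m - l3 * (ma m + mb m)) by rewrite /mdet; ring.
  by rewrite e3 f3 !subrr !mulr0 subrr.
move/eqP: e13; move/eqP: e23; rewrite !mulf_eq0 (negbTE d0) !orbF !subr_eq0.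
move=> /eqP el2 /eqP el1; subst l1 l2.
have [R hR] := roots_ex (hyper_neq0 hf); have [x xR] := notin_ex R.
have [Y eY] := sqrt_ex f.[x]; have Y0 : Y != 0.
  by apply: contraNneq xR => Y0; rewrite -hR /root -eY Y0 expr0n.
have [|l l0 [e1 e2 eZ]] := pt x 1; first by rewrite oner_neq0 orbT.
have el : l = l3.
  have := mX_eq0 d0 (X := x) (Z := 1); rewrite oner_neq0 orbT => /(_ isT).
  move: e1 e2; rewrite /mX /mZ !mulr1 a1 c1 b2 d2 -!mulrA -!mulrDr => e1 e2.
  by case/orP=> n0; apply: (mulIf n0).
exists l3 => //; split=> //; apply: (mulIf Y0); rewrite -mulrA -el; apply: eZ.
by rewrite hform1.
Qed.

Lemma induces_det m a : induces m a -> mdet m != 0.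
Proof.
move=> h; have [[d0 _ _] h'] := mob_ofP a; have [l l0 [ea eb ec ed _]] := induces_inj d0 h' h.
suff -> : mdet m = l ^+ 2 * mdet (mob_of a) by rewrite mulf_neq0 ?expf_neq0.
by rewrite /mdet ea eb ec ed; ring.
Qed.

(** The action of automorphisms on the projective line with coordinate x. *)
Definition red a t := mob_act (mob_of a) t.

Lemma redE m a t : induces m a -> red a t = mob_act m t.
Proof.
by move=> h; have [[d0 _ _] h'] := mob_ofP a; apply: mob_act_sim (induces_inj d0 h' h).
Qed.

Lemma redM a b t : red (a * b)%g t = red a (red b t).
Proof.
have [[_ _ _] ha] := mob_ofP a; have [[d0 _ _] hb] := mob_ofP b.
by rewrite (redE _ (induces_autM ha hb)) mob_actM.
Qed.

Lemma red1 t : red 1%g t = t.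
Proof. by rewrite (redE _ induces_aut1) mob_act_id. Qed.

Lemma red_hinv t : red (hinv g f) t = t.
Proof. by rewrite (redE _ induces_iota) mob_act_id. Qed.

Lemma redK a : cancel (red a) (red a^-1%g).
Proof. by move=> t; rewrite -redM mulVg red1. Qed.

Lemma red_zero a t : form_zero g f (red a t) = form_zero g f t.
Proof. by have [c _] := mob_ofP a; apply: compat_zero c. Qed.

(** For a scalar matrix with entry a, invariance of the form reads e^2 = a^(2g+2), so e = a^(g+1) or
    -a^(g+1). *)
Lemma scalar_aut m a : induces m a -> mb m = 0 -> mc m = 0 -> ma m = md m ->
  a = 1%g \/ a = hinv g f.
Proof.
move=> hm hb hc had; have [[_ e0 h] ha] := mob_ofP a.
have d0 := induces_det hm; have e2 : me m ^+ 2 = ma m ^+ g.*2.+2.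
  have [l l0 [ea eb ec ed ee]] := induces_inj d0 hm ha.
  have [R hR] := roots_ex (hyper_neq0 hf); have [x] := notin_ex R; rewrite -hR => fx.
  have := h x 1; rewrite /mX /mZ ea eb ec ed ee hb hc -had !(mulr0, mul0r, addr0, add0r, mulr1).
  have -> : hform g f (l * ma m * x) (l * ma m) = (l * ma m) ^+ g.*2.+2 * f.[x].
    by rewrite -(@hform1 _ g) // -hformM mulr1.
  rewrite hform1 // => /(mulIf fx); rewrite !exprMn sqr_exp_half.
  by move/(mulfI (expf_neq0 _ l0)) ->.
have a0 : ma m != 0.
  by apply: contraNneq d0 => a0; rewrite /mdet -had a0 hb hc !mulr0 subrr.
move/eqP: e2; rewrite -sqr_exp_half eqf_sqr => /orP[] /eqP ee; [left|right].
  apply: aut_sim hm induces_aut1; exists (ma m)^-1; rewrite ?invr_eq0 //=.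
  by rewrite hb hc -had ee mulVf // mulr0 exprVn mulVf // expf_neq0.
apply: aut_sim hm induces_iota; exists (ma m)^-1; rewrite ?invr_eq0 //=.
by rewrite hb hc -had ee mulVf // mulr0 mulrN exprVn mulVf // expf_neq0.
Qed.

(** Fixed points are zeros of c x^2 + (d - a) x - b, with infinity counted when c = 0. Three of them
    make the matrix scalar, and [scalar_aut] concludes. *)
Lemma red_three a t1 t2 t3 : t1 != t2 -> t1 != t3 -> t2 != t3 -> red a t1 = t1 ->
  red a t2 = t2 -> red a t3 = t3 -> a = 1%g \/ a = hinv g f.
Proof.
have [[d0 e0 _] hm] := mob_ofP a; rewrite /red; set m := mob_of a in hm d0 e0 *.
have inf : mob_act m None = None -> mc m = 0.
  rewrite /mob_act /pnorm /mZ /= mulr1 mulr0 addr0; by case: eqP.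
have fin x : mob_act m (Some x) = Some x -> ma m * x + mb m = x * (mc m * x + md m).
  rewrite /mob_act /pnorm /mX /mZ /= !mulr1; case: eqP => // /eqP n [e].
  by rewrite -{2}e divfK.
have sub x y : Some x != Some y -> x - y != 0.
  by rewrite subr_eq0; apply: contraNneq => ->.
wlog : t1 t2 t3 / t2 && t3.
  move=> W n12 n13 n23 h1 h2 h3;
    case: t1 t2 t3 n12 n13 n23 h1 h2 h3 => [x|] [y|] [z|] // n12 n13 n23 h1 h2 h3.
  - exact: (W (Some x) (Some y) (Some z)).
  - exact: (W None (Some x) (Some y)).
  - exact: (W None (Some x) (Some z)).
  exact: (W None (Some y) (Some z)).
case: t2 t3 => [y|] // [z|] // _ n12 n13 /sub yz0 h1 /fin hy /fin hz.
have E1 : (y - z) * (ma m - md m - (y + z) * mc m) = 0.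
  transitivity (ma m * y + mb m - y * (mc m * y + md m) - (ma m * z + mb m - z * (mc m * z + md m))).
    by ring.
  by rewrite hy hz !subrr.
move/eqP: E1; rewrite mulf_eq0 (negbTE yz0) subr_eq0 /= => /eqP E1.
have c0 : mc m = 0.
  case: t1 h1 n12 n13 => [x|/inf //] /fin hx /sub xy /sub xz.
  have E2 : (x - y) * (ma m - md m - (x + y) * mc m) = 0.
    transitivity (ma m * x + mb m - x * (mc m * x + md m) - (ma m * y + mb m - y * (mc m * y + md m))).
      by ring.
    by rewrite hx hy !subrr.
  move/eqP: E2; rewrite mulf_eq0 (negbTE xy) E1 /= -mulrBl mulf_eq0.
  by rewrite (_ : _ - _ = - (x - z)) ?oppr_eq0 ?(negbTE xz) /=; [move/eqP|ring].
have ad : ma m = md m by apply/eqP; rewrite -subr_eq0 E1 c0 mulr0.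
have b0 : mb m = 0.
  by apply: (addrI (md m * y)); rewrite -{1}ad hy c0 mul0r add0r addr0 mulrC.
exact: scalar_aut hm b0 c0 ad.
Qed.

Lemma hinv_neq1 : hinv g f <> 1%g.
Proof.
move=> e; have := induces_iota; rewrite e => h.
have [|l l0 /= [e1 _ _ _ e2]] := induces_inj _ induces_aut1 h.
  by rewrite /mdet /= mulr1 mulr0 subr0 oner_neq0.
rewrite mulr1 in e1; subst l; rewrite expr1n mulr1 in e2.
by case/eqP: two0; rewrite mulr2n -{1}e2 addNr.
Qed.

Lemma hinvV : (hinv g f * hinv g f)%g = 1%g.
Proof. by apply: aut_eq => P; apply: hinv_funK. Qed.

Lemma hinvC a : (hinv g f * a = a * hinv g f)%g.
Proof.
have [_ h] := mob_ofP a; have hi := induces_iota.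
apply: aut_sim (induces_autM hi h) (induces_autM h hi).
exists 1; rewrite ?oner_neq0 //=; split; rewrite ?expr1n; ring.
Qed.

(** By [red_three] an automorphism is determined, up to the hyperelliptic involution, by its
    permutation of the branch points, of which there are at least three. *)
Lemma finite_aut : exists s : seq A, forall a, a \in s.
Proof.
have [s us [ss hs]] := hyper_zeros hf.
pose T := seq_sub s.
have redS a (t : T) : red a (val t) \in s by rewrite hs red_zero -hs (valP t).
pose c a : {ffun T -> T} := [ffun t => SeqSub (redS a t)].
pose pre (u : {ffun T -> T}) : seq A := if pselect (exists a, c a = u) is left h
  then [:: projT1 (cid h); (projT1 (cid h) * hinv g f)%g] else [::].
exists (flatten [seq pre u | u <- enum {ffun T -> T}]) => a.
apply/flattenP; exists (pre (c a)); first by apply: map_f; rewrite mem_enum.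
rewrite /pre; case: pselect => [h|]; last by case; exists a.
case: (cid h) => b /= cb; rewrite !inE.
have fixs t : t \in s -> red (b^-1 * a)%g t = t.
  move=> ts; rewrite redM; have := congr1 (fun u : {ffun T -> T} => val (u (SeqSub ts))) cb.
  by rewrite !ffunE /= => <-; rewrite redK.
have [t1 [t2 [t3 [s' es]]]] : exists t1 t2 t3 s', s = [:: t1, t2, t3 & s'].
  by move: ss g2; case: (s) => [|t1 [|t2 [|t3 s']]]; case: (g) => //; exists t1, t2, t3, s'.
have [n12 n13 n23] : [/\ t1 != t2, t1 != t3 & t2 != t3].
  by move: us; rewrite es /= !inE !negb_or => /andP[/and3P[-> -> _] /andP[/andP[-> _] _]].
have := red_three (a := (b^-1 * a)%g) n12 n13 n23.
case; try by apply: fixs; rewrite es !inE eqxx ?orbT.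
  by move=> e; rewrite -[a](mulVKg b) e mulg1 eqxx.
by move=> e; rewrite -[a](mulVKg b) e eqxx orbT.
Qed.

End AutGroup.

(** * Finite models of the group, and changes of coordinate *)

Section FiniteGroupType.
Variables (A : groupType) (s : seq A).

(** A copy of [seq_sub s] indexed by the proof [hs], on which the closure of the group operations
    rests. *)
Definition fin_group (hs : forall a, a \in s) : Type := seq_sub s.

Variable hs : forall a, a \in s.
HB.instance Definition _ := Finite.on (fin_group hs).

Local Notation F := (fin_group hs).
Definition fg_in (a : A) : F := SeqSub (hs a).
Definition fg_one : F := fg_in 1%g.
Definition fg_mul (x y : F) : F := fg_in (val x * val y)%g.
Definition fg_inv (x : F) : F := fg_in (val x)^-1%g.

Fact fg_mulA : associative fg_mul.
Proof. by move=> x y z; apply: val_inj; rewrite /= mulgA. Qed.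
Fact fg_mul1 : left_id fg_one fg_mul.
Proof. by move=> x; apply: val_inj; rewrite /= mul1g. Qed.
Fact fg_mul1r : right_id fg_one fg_mul.
Proof. by move=> x; apply: val_inj; rewrite /= mulg1. Qed.
Fact fg_mulV : left_inverse fg_one fg_inv fg_mul.
Proof. by move=> x; apply: val_inj; rewrite /= mulVg. Qed.
Fact fg_mulVr : right_inverse fg_one fg_inv fg_mul.
Proof. by move=> x; apply: val_inj; rewrite /= mulgV. Qed.

HB.instance Definition _ := isGroup.Build F fg_mulA fg_mul1 fg_mul1r fg_mulV fg_mulVr.

End FiniteGroupType.

Lemma finite_groupType (A : groupType) (s : seq A) : (forall a, a \in s) ->
  exists (gT : finGroupType) (h : A -> gT) (h' : gT -> A),
  [/\ {morph h : a b / (a * b)%g}, cancel h h' & cancel h' h].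
Proof.
move=> hs; exists (fin_group hs : finGroupType), (fg_in hs), val.
by split=> // x; apply: val_inj.
Qed.

Section Transport.
Variables (k : closedFieldType) (g : nat) (f F : {poly k}).
Hypotheses (two0 : 2 != 0 :> k) (g2 : (2 <= g)%N).
Hypotheses (hf : hyperelliptic_poly g f) (hF : hyperelliptic_poly g F).

(** [T] is conjugation by the isomorphism that [n] induces. Every hypothesis about the action on the
    line moves along it to a better coordinate. *)
Lemma transport n : compat g n f F ->
  exists (T : curve_aut g f -> curve_aut g F) (T' : curve_aut g F -> curve_aut g f),
  [/\ {morph T : a b / (a * b)%g}, cancel T T', cancel T' T, T (hinv g f) = hinv g F &
      forall a t, red two0 g2 hF (T a) (mob_act n t) = mob_act n (red two0 g2 hf a t)].
Proof.
move=> cn; have /andP[_ sf] := hyper_size hf; have /andP[_ sF] := hyper_size hF.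
have [phi [psi [h1 h2 h3 h4 [h5 h6]]]] := compat_iso sf sF cn.
have c1 (x y z w : {poly k}) (u : curve g z -> curve g w) v (w0 : curve g x -> curve g y) :
  curve_morphism u -> curve_morphism v -> curve_morphism w0 -> curve_morphism (u \o v \o w0).
  by move=> hu hv hw; apply: curve_morphism_comp => //; apply: curve_morphism_comp.
pose T (a : curve_aut g f) : curve_aut g F :=
  MkAut (c1 _ _ _ _ _ _ _ h1 (aut_funP a) h2) (c1 _ _ _ _ _ _ _ h1 (aut_invP a) h2)
   (can_comp (can_comp h3 (aut_funK a)) h4) (can_comp (can_comp h3 (aut_invK a)) h4).
pose T' (a : curve_aut g F) : curve_aut g f :=
  MkAut (c1 _ _ _ _ _ _ _ h2 (aut_funP a) h1) (c1 _ _ _ _ _ _ _ h2 (aut_invP a) h1)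
   (can_comp (can_comp h4 (aut_funK a)) h3) (can_comp (can_comp h4 (aut_invK a)) h3).
exists T, T'; split.
- by move=> a b; apply: aut_eq => P /=; rewrite h3.
- by move=> a; apply: aut_eq => P /=; rewrite !h3.
- by move=> a; apply: aut_eq => P /=; rewrite !h4.
- have [d0 e0 _] := cn.
  have I := induces_comp h5 (induces_comp (@induces_hinv _ g f) h6).
  apply: (fun s => aut_sim s (I : induces _ (T (hinv g f))) (@induces_iota _ g F)).
  exists (mdet n)^-1; rewrite ?invr_eq0 //= /mdet in d0 *.
  split; try by field.
  rewrite exprVn; have := expf_neq0 g.+1 d0; move: (_ ^+ g.+1) => w w0.
  by field; rewrite w0 e0.
move=> a t; have [d0 _ _] := cn; have [[da _ _] ha] := mob_ofP two0 g2 hf a.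
have I : induces (mmul n (mmul (mob_of two0 g2 hf a) (minv g n))) (T a).
  exact: induces_comp h5 (induces_comp ha h6).
have dV : mdet (minv g n) != 0 by move: d0; rewrite /mdet /=; congr (_ != 0); ring.
by rewrite (redE _ _ _ _ I) !mob_actM ?mdetM ?mulf_neq0 // mob_actK.
Qed.

End Transport.

Section FixedPoints.
Variables (k : closedFieldType) (g : nat).
Hypotheses (two0 : 2 != 0 :> k) (g2 : (2 <= g)%N).
Hypotheses (odd0 : (g.*2.+1)%:R != 0 :> k) (even0 : (g.*2.+2)%:R != 0 :> k).

(** A translation preserving the branch points preserves their sum. *)
Lemma no_translation (F : {poly k}) c : hyperelliptic_poly g F ->
  (forall x, root F x -> root F (x + c)) -> c = 0.
Proof.
move=> hF hc; have F0 := hyper_neq0 hF.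
have [r er] := closed_field_poly_normal F.
have l0 : lead_coef F != 0 by rewrite lead_coef_eq0.
have rE x : (x \in r) = root F x by rewrite er rootZ // root_prod_XsubC.
have sr : size F = (size r).+1 by rewrite er size_scale // size_prod_XsubC.
have ur : uniq r.
  by case: hF => sep _; move: sep; rewrite er (eqp_separable (eqp_scale _ l0)) separable_prod_XsubC.
pose r' := [seq x + c | x <- r].
have ur' : uniq r' by rewrite map_inj_uniq //; apply: addIr.
have sub : {subset r' <= r} by move=> x /mapP[y yr ->]; rewrite rE hc // -rE.
have [|_ eqr] := uniq_min_size ur' sub; first by rewrite size_map.
have := perm_big _ (uniq_perm ur' ur eqr) (op := +%R) (x := 0) (P := predT) (F := id).
rewrite /= big_map big_split /= -[RHS]addr0 => /addrI.
rewrite big_const_seq count_predT iter_addr addr0 => /eqP.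
rewrite -mulr_natl mulf_eq0 => /orP[|/eqP //].
by case: hF => _ []; rewrite sr => -[->]; rewrite ?(negbTE odd0) ?(negbTE even0).
Qed.

(** A fixed point, found as a root of the fixed-point quadratic, is moved to infinity. The map
    becomes x |-> (a x + b)/d; the case a = d is a translation, excluded by [no_translation], and
    otherwise b/(d - a) is the only other fixed point. *)
Lemma red_fix2 (f : {poly k}) (hf : hyperelliptic_poly g f) (a : curve_aut g f) :
  a <> 1%g -> a <> hinv g f -> exists t1 t2, t1 != t2 /\
    forall t, (red two0 g2 hf a t == t) = (t == t1) || (t == t2).
Proof.
move=> a1 ai; have [[d0 _ _] ha] := mob_ofP two0 g2 hf a.
have [t1 ht1] : exists t, red two0 g2 hf a t = t.
  rewrite /red; set m := mob_of _ _ _ _ in d0 ha *.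
  have [c0|c0] := eqVneq (mc m) 0.
    by exists None; rewrite /mob_act /pnorm /mZ /= c0 mul0r mulr0 addr0 eqxx.
  pose p : {poly k} := mc m *: 'X^2 + (md m - ma m) *: 'X - (mb m)%:P.
  have sp : size p != 1%N.
    have : p`_2 = mc m by rewrite !coefE /= !mulr0 mulr1 addr0 subr0.
    by move=> e; apply: contraNneq c0 => s1; rewrite -e nth_default ?s1.
  have /closed_rootP[x /rootP] := sp.
  rewrite !(hornerE, hornerXn) /= => px; exists (Some x).
  have e1 : x * (mc m * x + md m) = ma m * x + mb m.
    by apply/eqP; rewrite -subr_eq0 -px; apply/eqP; ring.
  rewrite /mob_act /pnorm /mX /mZ /= !mulr1; case: eqP => [z0|/eqP n0].
    rewrite z0 mulr0 in e1; case/eqP: d0.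
    have -> : mdet m = ma m * (mc m * x + md m) - mc m * (ma m * x + mb m).
      by rewrite /mdet; ring.
    by rewrite z0 -e1 !mulr0 subrr.
  by rewrite -e1 mulfK.
have [m0 dm0 hm0] : exists2 m, mdet m != 0 & mob_act m t1 = None.
  have [|m dm [_ h]] := @mob_act_move k (if t1 is None then Some 0 else None) t1.
    by case: (t1).
  by exists m.
have [F [n [hF cn en]]] := change_coord hf dm0.
have [T [T' [TM TK TK' Th Tr]]] := transport two0 g2 hf hF cn.
have [dn _ _] := cn; pose b := T a.
have b1 : b <> 1%g.
  by move=> e; apply: a1; rewrite -[a]TK -/b e; apply: (can_inj TK); rewrite TK' -[LHS]mulg1;
    apply: (mulgI (T 1%g)); rewrite mulgA -!TM !mulg1.
have bi : b <> hinv g F by move=> e; apply: ai; apply: (can_inj TK); rewrite Th.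
suff [t2 [n2 ht2]] : exists t2, None != t2 /\
    forall t, (red two0 g2 hF b t == t) = (t == None) || (t == t2).
  exists t1, (mob_act (minv g n) t2).
  have n1 : mob_act n t1 = None by rewrite en.
  split; first by apply: contraNneq n2 => e; rewrite -n1 e mob_actVK.
  move=> t; rewrite -(inj_eq (mob_act_inj dn)) -Tr ht2 -n1 (inj_eq (mob_act_inj dn)).
  by congr (_ || _); apply/eqP/eqP => [<-|->]; rewrite ?mob_actK ?mob_actVK.
have [[db eb _] hb] := mob_ofP two0 g2 hF b.
have bN : red two0 g2 hF b None = None by rewrite -(hm0) -en Tr ht1.
rewrite /red in bN *; set m := mob_of _ _ _ _ in db eb hb bN *.
have c0 : mc m = 0.
  by move: bN; rewrite /mob_act /pnorm /mZ /= mulr1 mulr0 addr0; case: eqP.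
have [ma0 md0] : ma m != 0 /\ md m != 0.
  by move: db; rewrite /mdet c0 mulr0 subr0 mulf_eq0 negb_or => /andP[].
have actE x : mob_act m (Some x) = Some ((ma m * x + mb m) / md m).
  by rewrite /mob_act /pnorm /mX /mZ /= c0 mul0r add0r !mulr1 (negbTE md0).
have [e|ne] := eqVneq (ma m) (md m).
  have b0 : mb m != 0.
    by apply/eqP => b0; case: (scalar_aut two0 g2 hF hb b0 c0 e).
  case/eqP: b0; suff /eqP : mb m / md m = 0 by rewrite mulf_eq0 invr_eq0 (negbTE md0) orbF => /eqP.
  have /andP[_ sF] := hyper_size hF.
  apply: (no_translation hF) => x; rewrite -!(@form_zero_aff _ g) //.
  rewrite -(red_zero two0 g2 hF b) /red -/m actE e.
  by rewrite mulrDl mulrAC divff // mul1r.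
exists (Some (mb m / (md m - ma m))); split=> // -[x|]; last by rewrite bN !eqxx.
have dm : md m - ma m != 0 by rewrite subr_eq0 eq_sym.
rewrite actE /=; apply/eqP/eqP => -[h]; congr Some.
  apply: (mulIf dm); rewrite divfK //; apply/eqP.
  have : ma m * x + mb m = x * md m by rewrite -{2}h divfK.
  by move=> h'; rewrite mulrBr -h' -subr_eq0; apply/eqP; ring.
by rewrite h; field; rewrite md0 dm.
Qed.

End FixedPoints.

(** Modulo [z] the element [a] is an involution, so [z] and [a] generate a cyclic or Klein group of
    order 4. This excludes such elements from stabilizers of order 6. *)
Lemma klein_card (gT : finGroupType) (z a : gT) (C : {group gT}) :
  z != 1%g -> (z * z = 1)%g -> (z * a = a * z)%g -> a != 1%g -> a != z ->
  (a * a)%g \in [set 1%g; z] -> z \in C -> a \in C -> (4 %| #|C|)%N.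
Proof.
move=> z1 zz za a1 az aa zC aC.
have oz : #[z]%g = 2%N.
  by apply/eqP; rewrite eqn_leq order_gt1 z1 andbT dvdn_leq // order_dvdn expgS expg1 zz.
case/set2P: aa => [a2|a2]; last first.
  suff <- : #[a]%g = 4%N by apply: order_dvdG.
  by rewrite (@orderXprime _ 2 2) // expgS expg1 a2.
have oa : #[a]%g = 2%N.
  by apply/eqP; rewrite eqn_leq order_gt1 a1 andbT dvdn_leq // order_dvdn expgS expg1 a2.
have tI : <[z]>%g :&: <[a]>%g = 1%g.
  apply: prime_TIg; first by rewrite -orderE oz.
  by rewrite cycle_subG /= cycle2g // !inE negb_or z1 eq_sym.
have ce : <[a]>%g \subset 'C(<[z]>)%g.
  by rewrite cent_cycle cycle_subG; apply/cent1P; rewrite /commute za.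
suff <- : #|<[z]> <*> <[a]>|%g = 4%N.
  by apply: cardSg; rewrite join_subG !cycle_subG zC.
by rewrite cent_joinEr // TI_cardMg // -!orderE oz oa.
Qed.

Lemma cards4 (gT : finGroupType) (z a : gT) : z != 1%g -> (z * z = 1)%g ->
  a != 1%g -> a != z -> #|[set 1%g; z; a; (a * z)%g]| = 4%N.
Proof.
move=> z1 zz a1 az.
have az1 : (a * z != 1)%g.
  by apply: contra az => /eqP e; rewrite -(inj_eq (mulIg z)) e zz.
have aza : (a * z != a)%g by rewrite -{2}[a]mulg1 (inj_eq (mulgI a)).
have azz : (a * z != z)%g by rewrite -{2}[z]mul1g (inj_eq (mulIg z)).
rewrite setUC cardsU1 !inE (negbTE az1) (negbTE aza) (negbTE azz) /=.
by rewrite setUC cardsU1 !inE (negbTE az) (negbTE a1) /= cards2 eq_sym z1.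
Qed.

Section Trichotomy.
Variable k : closedFieldType.
Hypotheses (two0 : 2 != 0 :> k) (odd0 : 9 != 0 :> k) (even0 : 10 != 0 :> k).
Variable f : {poly k}.
Hypothesis hf : hyperelliptic_poly 4 f.
Local Notation A := (curve_aut 4 f).
Local Notation iota := (hinv 4 f).
Local Notation red := (red two0 (isT : (2 <= 4)%N) hf).

Definition aut_size (F : {poly k}) N := exists2 s : seq (curve_aut 4 F), uniq s &
  size s = N /\ forall a, a \in s.

Definition preserves_pair t1 t2 := forall a : A,
  red a t1 \in [:: t1; t2] /\ red a t2 \in [:: t1; t2].

(** [O] is the orbit of length 6, the set of fixed points of the involutions of
    the reduced group. *)
Definition tetrahedral (O : seq (option k)) := [/\ size O = 6%N /\ uniq O,
  (forall t, t \in O -> form_zero 4 f t) /\ (forall (a : A) t, t \in O -> red a t \in O),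
  forall t u, t \in O -> u \in O -> exists a : A, red a t = u,
  forall t, t \in O -> exists a : A, [/\ a <> 1%g, a <> iota, red a t = t &
    forall b : A, red b t = t -> b \in [:: 1%g; iota; a; (a * iota)%g]] &
  forall a : A, a <> 1%g -> a <> iota -> (a * a)%g \in [:: 1%g; iota] ->
    forall t, red a t = t -> t \in O].

Lemma aut_trichotomy : (forall a : A, a = 1%g \/ a = iota) \/
  (exists t1 t2, t1 != t2 /\ preserves_pair t1 t2) \/
  aut_size f 24 /\ exists O, tetrahedral O.
Proof.
have [sA hsA] := finite_aut two0 (isT : (2 <= 4)%N) hf.
have [gT [h [h' [hM hK hK']]]] := finite_groupType hsA.
have h1 : h 1%g = 1%g by apply: (mulgI (h 1%g)); rewrite -hM !mulg1.
have h'M x y : h' (x * y)%g = (h' x * h' y)%g by apply: (can_inj hK); rewrite hM !hK'.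
have h'1 : h' 1%g = 1%g by apply: (can_inj hK); rewrite h1 hK'.
have h'V x : h' x^-1%g = (h' x)^-1%g.
  by apply: (mulgI (h' x)); rewrite -h'M !mulgV.
have hV a : h a^-1%g = (h a)^-1%g by apply: (mulgI (h a)); rewrite -hM !mulgV.
pose z := h iota.
have z1 : z != 1%g by apply/eqP; rewrite -h1 => /(can_inj hK); apply: (hinv_neq1 two0 hf).
have zz : (z * z = 1)%g by rewrite -hM hinvV h1.
have h'z : h' z = iota by rewrite hK.
have zC x : (z * x = x * z)%g.
  by rewrite -[x]hK' -!hM (hinvC two0 (isT : (2 <= 4)%N) hf).
have [zs uzs [szs hzs]] := hyper_zeros hf.
have [t0 [t0' [n0 _]]] : exists t t' : option k, t != t' /\ True by exists None, (Some 0).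
pose nontriv (a : A) := (a != 1%g) && (a != iota).
have /choice[l hl] : forall a : A, exists l : seq (option k), forall t,
    (t \in l) = nontriv a && (red a t == t).
  move=> a; rewrite /nontriv; have [->|a1] := eqVneq a 1%g; first by exists [::].
  have [->|ai] := eqVneq a iota; first by exists [::].
  have [t1 [t2 [_ ht]]] := @red_fix2 k 4 two0 isT odd0 even0 f hf a (elimN eqP a1) (elimN eqP ai).
  by exists [:: t1; t2] => t; rewrite !inE ht.
(* The finite set for the class equation: the branch points, which give the invariant set of ten,
   and all fixed points of nontrivial elements, so that each of these fixes exactly two points of
   it. Conjugation shows that it is stable. *)
pose S := undup (zs ++ flatten [seq l a | a <- sA]).
have memS t : t \in S <-> form_zero 4 f t \/ exists a, nontriv a /\ red a t = t.
  rewrite mem_undup mem_cat -hzs; split.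
    case/orP=> [->|/flattenP[_ /mapP[a _ ->]]]; first by left.
    by rewrite hl => /andP[na /eqP e]; right; exists a.
  case=> [->//|[a [na ta]]]; apply/orP; right; apply/flattenP.
  by exists (l a); [apply: map_f|rewrite hl na ta eqxx].
have conj_nt a b : nontriv b -> nontriv (a * b * a^-1)%g.
  rewrite /nontriv => /andP[b1 bi]; apply/andP; split.
    by apply: contra b1 => /eqP e; rewrite -(mulKg a b) -(mulgKV a (a * b)%g) e mul1g mulVg.
  apply: contra bi => /eqP e; rewrite -(mulKg a b) -(mulgKV a (a * b)%g) e.
  by rewrite (hinvC two0 (isT : (2 <= 4)%N) hf) mulKg.
have closS a t : t \in S -> red a t \in S.
  move=> /memS ht; apply/memS; rewrite red_zero; case: ht => [->|[b [nb tb]]]; first by left.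
  by right; exists (a * b * a^-1)%g; rewrite conj_nt // !redM redK tb.
pose T := seq_sub S.
(* [red] is a left action while library actions are right actions; hence the inverse. *)
pose to (x : T) (u : gT) : T := SeqSub (closS (h' u^-1%g) _ (valP x)).
have to1 : forall x, to x 1%g = x.
  by move=> x; apply: val_inj; rewrite /= invg1 h'1 red1.
have toM : forall x, act_morph to x.
  by move=> x u v; apply: val_inj; rewrite /= invMg h'M redM.
pose act : {action gT &-> T} := TotalAction to1 toM.
have actE (x : T) a : val (act x (h a^-1%g)) = red a (val x).
  by rewrite /= -hV invgK hK.
have actE' (x : T) u : val (act x u) = red (h' u)^-1%g (val x) by rewrite /= h'V.
have toz x : act x z = x.
  apply: val_inj; rewrite actE' h'z /=.
  by rewrite -[in LHS](red_hinv two0 (isT : (2 <= 4)%N) hf (ssval x)) redK.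
have oz : #[z]%g = 2%N.
  by apply/eqP; rewrite eqn_leq order_gt1 z1 andbT dvdn_leq // order_dvdn expgS expg1 zz.
have [N cN] : exists N, #|[set: gT]| = N.*2.
  have := order_dvdG (in_setT z); rewrite oz => /dvdnP[N ->]; exists N.
  by rewrite muln2.
have szT : aut_size f N.*2.
  exists (map h' (enum gT)); first by rewrite map_inj_uniq ?enum_uniq //; apply: can_inj hK'.
  split; first by rewrite size_map -cardT -cN cardsT.
  by move=> a; rewrite -(hK a) map_f // mem_enum.
have [N1|N2] := leqP N 1.
  left=> a; have : [set 1%g; z] = [set: gT].
    by apply/eqP; rewrite eqEcard subsetT cN cards2 eq_sym z1; case: (N) N1 => [|[|]].
  move/setP/(_ (h a)); rewrite !inE => /orP[]/eqP; [left|right]; apply: (can_inj hK);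
  by rewrite // h1.
right.
have fix2 u : u != 1%g -> u != z -> #|'Fix_act[u]%g| = 2%N.
  move=> u1 uz; have nt : nontriv (h' u)^-1%g.
    rewrite /nontriv; apply/andP; split.
      apply: contra u1 => /eqP; move/(congr1 (fun x => x^-1)%g).
      by rewrite invgK invg1 -h'1 => /(can_inj hK') ->.
    apply: contra uz => /eqP; move/(congr1 (fun x => x^-1)%g); rewrite invgK => e.
    apply/eqP; apply: (can_inj hK'); rewrite h'z e; apply: (mulgI iota).
    by rewrite mulgV.
  have /andP[/eqP v1 /eqP vi] := nt.
  have [t1 [t2 [n12 ht]]] := @red_fix2 k 4 two0 isT odd0 even0 f hf (h' u)^-1%g v1 vi.
  have s1 : t1 \in S by apply/memS; right; exists (h' u)^-1%g; split=> //; apply/eqP;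
    rewrite ht eqxx.
  have s2 : t2 \in S by apply/memS; right; exists (h' u)^-1%g; split=> //; apply/eqP;
    rewrite ht eqxx orbT.
  have -> : 'Fix_act[u]%g = [set SeqSub s1; SeqSub s2].
    apply/setP => x; rewrite !inE sub1set inE -!val_eqE actE' ht.
    by [].
  by rewrite cards2 -val_eqE /= n12.
pose B : {set T} := [set x | form_zero 4 f (val x)].
have actB : [acts [set: gT], on B | act]%g.
  by apply/actsP => u _ x; rewrite !inE actE' red_zero.
have zsS t : t \in zs -> t \in S by rewrite mem_undup mem_cat => ->.
have cB : #|B| = 10%N.
  rewrite cardE -(size_map val) -szs; apply: perm_size; apply: uniq_perm => //.
    by rewrite map_inj_uniq ?enum_uniq //; apply: val_inj.
  move=> t; apply/mapP/idP => [[x]|tz].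
    by rewrite mem_enum inE hzs => hx ->.
  by exists (SeqSub (zsS _ tz)); rewrite // mem_enum inE /= -hzs.
case: (pair_or_tetrahedral z1 zz toz cN N2 fix2 actB cB) =>
  [[x [y [xy hxy]]]|[N12 [O [cO OB tO sO nO]]]].
  left; exists (val x), (val y); split; first by rewrite val_eqE.
  move=> a; have [] := hxy (h a^-1%g); rewrite !inE -!val_eqE !actE.
  by [].
right; rewrite N12 in szT; split=> //; exists (map val (enum O)).
have memO (x : T) : (val x \in map val (enum O)) = (x \in O).
  by rewrite mem_map ?mem_enum //; apply: val_inj.
have inO t : t \in map val (enum O) -> exists2 x : T, x \in O & t = val x.
  by case/mapP => x; rewrite mem_enum; exists x.
have stabP (x : T) b : red b (val x) = val x <-> h b \in 'C_[set: gT][x | act]%g.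
  rewrite in_setI in_setT andTb; split=> [e|/astab1P e].
    apply/astab1P; apply: val_inj; rewrite actE' hK.
    by rewrite -{1}e redK.
  by rewrite -{1}e actE' hK -redM mulgV red1.
have fin_nt b : b <> 1%g -> b <> iota -> h b != 1%g /\ h b != z.
  by move=> b1 bi; split; apply/eqP; rewrite -?h1 => /(can_inj hK).
split.
- by split; [rewrite size_map -cardE|rewrite map_inj_uniq ?enum_uniq //; apply: val_inj].
- split=> [t /inO[x xO ->]|a t /inO[x xO ->]].
    by have := subsetP OB _ xO; rewrite inE.
  rewrite -actE memO; have <- := tO _ xO; apply: mem_orbit; exact: in_setT.
- move=> t u /inO[x xO ->] /inO[y yO ->]; have := yO; rewrite -(tO _ xO).
  by case/orbitP => w _ <-; exists (h' w)^-1%g; rewrite actE'.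
- move=> t /inO[x xO ->]; have c4 := sO _ xO; set C := ('C_[set: gT][x | act])%G.
  have {c4}c4 : #|C| = 4%N by exact: c4.
  have zin : z \in C by apply/stabP; rewrite red_hinv.
  have [u [uC u1 uz]] : exists u, [/\ u \in C, u != 1%g & u != z].
    have : (0 < #|C :\: [set 1%g; z]|)%N.
      rewrite cardsD c4 (leq_trans _ (leq_sub2l 4 (subset_leq_card (subsetIr _ _)))) //.
      by rewrite cards2; case: (_ != _).
    by case/card_gt0P => u; rewrite !inE negb_or => /andP[/andP[u1 uz] uC]; exists u; rewrite !inE.
  exists (h' u); split.
  - by move=> e; case/eqP: u1; rewrite -(hK' u) e h1.
  - by move=> e; case/eqP: uz; rewrite -(hK' u) e.
  - by apply/stabP; rewrite hK'.
  move=> b /stabP bC.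
  have e4 : [set 1%g; z; u; (u * z)%g] = C.
    apply/eqP; rewrite eqEcard c4 cards4 // andbT.
    apply/subsetP => v hv; have : [|| v == 1%g, v == z, v == u | v == (u * z)%g].
      by move: hv; rewrite !inE -!orbA.
    by case/or4P=> /eqP->; rewrite ?group1 ?groupM.
  have : h b \in (C : {set gT}) by exact: bC.
  have -> : (b \in [:: 1; iota; h' u; h' u * iota]%g) =
      [|| b == 1%g, b == iota, b == h' u | b == (h' u * iota)%g] by rewrite !in_cons orbF.
  rewrite -e4 => hb; have {hb} : [|| h b == 1%g, h b == z, h b == u | h b == (u * z)%g].
    by move: hb; rewrite !inE -!orbA.
  by case/or4P=> /eqP e; rewrite -[b]hK e ?h'M ?h'1 ?h'z eqxx ?orbT.
move=> a a1 ai aa t ta.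
have nt : nontriv a by rewrite /nontriv; apply/andP; split; apply/eqP.
have tS : t \in S by apply/memS; right; exists a.
rewrite -[t]/(val (SeqSub tS : T)) memO; apply/negPn/negP => xO.
have [u1 uz] := fin_nt _ a1 ai.
have aC : h a \in ('C_[set: gT][SeqSub tS : T | act])%G by apply/stabP.
have xs : (SeqSub tS : T) \in special act.
  by apply: (fix_special z1 toz u1 uz); move: aC; rewrite in_setI => /andP[_ /astab1P].
have zin : z \in ('C_[set: gT][SeqSub tS : T | act])%G by apply/stabP; rewrite red_hinv.
(* Special points outside [O] have stabilizers of order 6, and 4 does not divide 6. *)
have := klein_card z1 zz (zC _) u1 uz _ zin aC; rewrite -hM; rewrite [#|_|]nO //.
by move=> /(_ _)/negP; apply=> //; move: aa; rewrite !inE => /orP[] /eqP ->; rewrite ?h1 eqxx ?orbT.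
Qed.

End Trichotomy.

(** * From abstract groups to finite ones *)

Section Bridge.
Local Open Scope group_scope.

Section Model.
Variables (A : groupType) (gT : finGroupType) (h : A -> gT) (h' : gT -> A).
Hypotheses (hM : {morph h : a b / a * b}) (hK : cancel h h') (h'K : cancel h' h).
Variables (hT : finGroupType) (H : {group hT}).

Let h1 : h 1 = 1.
Proof. by apply: (mulgI (h 1)); rewrite -hM !mulg1. Qed.

Let hX a n : h (a ^+ n) = h a ^+ n.
Proof. by elim: n => [|n IH]; rewrite ?expg0 // !expgS hM IH. Qed.

Lemma isog_to_model : [set: gT] \isog H -> isog_to A H.
Proof.
move/isogP=> [e inj im]; exists (e \o h); split=> [a b|a b|x] /=.
- by rewrite hM morphM ?inE.
- by move/(injmP inj); rewrite !inE => /(_ isT isT)/(can_inj hK).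
rewrite -im; split.
  by case/morphimP => y _ _ ->; exists (h' y); rewrite /= h'K.
by case=> a <-; apply: mem_morphim; rewrite inE.
Qed.

Lemma semidirect_model (nT cT : finGroupType) (N : {set nT}) (C : {set cT})
    (N' C' : {group gT}) : N' ><| C' = [set: gT] -> N' \isog N -> C' \isog C ->
  semidirect_isog_to A N C.
Proof.
move=> sd nN cC; exists gT, [set: gT]%G, N', C'; split=> //.
exists h; split=> // [|x]; first exact: can_inj hK.
by split=> _; rewrite ?inE //; exists (h' x).
Qed.

Variable z : A.
Hypothesis zC : forall a, z * a = a * z.

Lemma normal_model : <[h z]> <| [set: gT].
Proof.
apply: sub_center_normal; rewrite cycle_subG inE /= inE /=.
by apply/centP => y _; rewrite /commute -[y]h'K -!hM zC.
Qed.

Lemma quotient_model : [set: gT] / <[h z]> \isog H -> quotient_isog_to z H.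
Proof.
have nz := normal_model; have nT x : x \in 'N(<[h z]>).
  by have /andP[_ /subsetP] := nz; apply; rewrite inE.
move/isogP=> [e inj im].
pose c a := coset <[h z]> (h a).
have cE a b : cycle_coset z a = cycle_coset z b <-> c a = c b.
  split.
    move=> E; have [n ->] : cycle_coset z b a by rewrite -E; exists 0%N; rewrite expg0 mulg1.
    by rewrite /c hM hX morphM ?nT // [X in _ * X]coset_id ?mem_cycle // mulg1.
  move=> E; have [n hn] : exists n, a = b * z ^+ n.
    have : (h b)^-1 * h a \in <[h z]>.
      have E2 : coset <[h z]> ((h b)^-1 * h a) = 1.
      by rewrite morphM ?nT // morphV ?nT //; apply: (canLR (mulKg _)); rewrite mulg1.
    exact: coset_idr (nT _) E2.
    case/cycleP => n e1; exists n; apply: (can_inj hK); rewrite hM hX -e1.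
    by rewrite mulgA mulgV mul1g.
  have zz m m' : (z ^+ m * z ^+ m') = z ^+ (m + m') by rewrite expgD.
  apply: funext => x; apply/propext; split=> -[m ->].
    by exists (n + m)%N; rewrite hn -mulgA zz.
  (* Cosets are described by nonnegative exponents, so the inverse of z^n is written as the power n
     (o - 1), with o the order. *)
  exists (m + n * #[h z].-1)%N; rewrite hn -!mulgA zz; congr (_ * _).
  apply: (can_inj hK); rewrite !hX addnCA -mulnS prednK ?order_gt0 //.
  by rewrite expgD mulnC expgM expg_order expg1n mulg1.
(* The map is defined on all sets through a chosen representative; its value 1 on sets that are not
   cosets is arbitrary. *)
pose w (S : set A) := if pselect (exists a, S = cycle_coset z a) is left p then
  e (c (projT1 (cid p))) else 1.
have wE a : w (cycle_coset z a) = e (c a).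
  rewrite /w; case: pselect => [p|[]]; last by exists a.
  by case: cid => b /= /cE ->.
have cQ a : c a \in [set: gT] / <[h z]> by rewrite mem_quotient ?inE.
exists w; split=> [a b|a b|x]; rewrite ?wE.
- by rewrite /c hM morphM ?nT // morphM // cQ.
- by move=> E; apply/cE; apply: (injmP inj); rewrite ?cQ.
rewrite -im; split.
  case/morphimP => y _ /morphimP[u _ _ ->] ->; exists (h' u).
  by rewrite wE /c h'K.
by case=> a <-; rewrite wE; apply: mem_morphim; apply: cQ.
Qed.

End Model.

Lemma quotient_isog_card (A : groupType) (z : A) (hT iT : finGroupType)
    (H : {set hT}) (I : {set iT}) :
  quotient_isog_to z H -> quotient_isog_to z I -> #|H| = #|I|.
Proof.
suff le (hT' iT' : finGroupType) (H' : {set hT'}) (I' : {set iT'}) :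
    quotient_isog_to z H' -> quotient_isog_to z I' -> (#|H'| <= #|I'|)%N.
  by move=> qH qI; apply/eqP; rewrite eqn_leq !le.
case=> h [_ hI hH] [i [_ iI iH]].
have ex x : exists a, x \in H' -> h (cycle_coset z a) = x.
  case: (boolP (x \in H')) => [/hH[a <-]|_]; first by exists a.
  by exists 1.
pose p x := i (cycle_coset z (projT1 (cid (ex x)))).
have -> : #|H'| = #|p @: H'|.
  rewrite card_in_imset // => x y xH yH; rewrite /p.
  case: cid => a /= /(_ xH) ha; case: cid => b /= /(_ yH) hb /iI E.
  by rewrite -ha E.
apply: subset_leq_card; apply/subsetP => _ /imsetP[x xH ->].
by apply/iH; exists (projT1 (cid (ex x))).
Qed.

Section Iso.
Variables (A B : groupType) (T : A -> B) (T' : B -> A).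
Hypotheses (TM : {morph T : a b / a * b}) (TK : cancel T T') (T'K : cancel T' T).

Lemma isog_to_iso (hT : finGroupType) (H : {set hT}) : isog_to B H -> isog_to A H.
Proof.
case=> h [hM hI hS]; exists (h \o T); split=> [a b|a b|x] /=; first by rewrite TM hM.
  by move/hI/(can_inj TK).
by rewrite hS; split=> -[b <-]; [exists (T' b); rewrite /= T'K | exists (T b)].
Qed.

Lemma semidirect_isog_to_iso (nT cT : finGroupType) (N : {set nT}) (C : {set cT}) :
  semidirect_isog_to B N C -> semidirect_isog_to A N C.
Proof.
by case=> gT [G [N' [C' [sd nN cC i]]]]; exists gT, G, N', C'; split=> //; apply: isog_to_iso.
Qed.

Lemma quotient_isog_to_iso (z : A) (hT : finGroupType) (H : {set hT}) :
  quotient_isog_to (T z) H -> quotient_isog_to z H.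
Proof.
have T1 : T 1 = 1 by apply: (mulgI (T 1)); rewrite -TM !mulg1.
have TX a n : T (a ^+ n) = T a ^+ n by elim: n => [|n IH]; rewrite ?expg0 // !expgS TM IH.
case=> h [hM hI hS]; pose w (S : set A) := h (fun b => S (T' b)).
have wE a : w (cycle_coset z a) = h (cycle_coset (T z) (T a)).
  congr h; apply: funext => b; apply/propext; split=> -[n e]; exists n.
    by rewrite -[b]T'K e TM TX.
  by rewrite e -TX -TM TK.
exists w; split=> [a b|a b|x]; rewrite ?wE ?TM ?hM //.
  move/hI => E; apply: funext => x; apply/propext.
  have tr y : cycle_coset z y x <-> cycle_coset (T z) (T y) (T x).
    by split=> -[n e]; exists n; [rewrite e TM TX | apply: (can_inj TK); rewrite TM TX].
  by rewrite !tr E.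
by rewrite hS; split=> -[b <-]; [exists (T' b); rewrite wE T'K | exists (T b); rewrite wE].
Qed.

End Iso.
End Bridge.

(** * The groups of the classification from generators and relations *)

Section Model.
Local Open Scope group_scope.
Variables (A : groupType) (z : A) (gT : finGroupType) (w : gT) (h : A -> gT) (h' : gT -> A).
Hypotheses (hM : {morph h : a b / a * b}) (hK : cancel h h') (h'K : cancel h' h).
Hypotheses (hz : h z = w) (zC : forall a, z * a = a * z) (ow : #[w] = 2%N).

(** Stated by divisibility, so that it makes sense in the abstract group and passes to the finite
    model. *)
Definition has_order (x : A) n := forall i, (x ^+ i = 1) <-> (n %| i)%N.

Lemma model1 : h 1 = 1.
Proof. by apply: (mulgI (h 1)); rewrite -hM !mulg1. Qed.

Lemma modelX a n : h (a ^+ n) = h a ^+ n.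
Proof. by elim: n => [|n IH]; rewrite ?expg0 ?model1 // !expgS hM IH. Qed.

Lemma modelV a : h a^-1 = (h a)^-1.
Proof. by apply: (mulgI (h a)); rewrite -hM !mulgV model1. Qed.

Lemma model_order x n : has_order x n -> #[h x] = n.
Proof.
move=> ox; apply/eqP; rewrite eqn_dvd; apply/andP; split.
  by rewrite order_dvdn -modelX (ox n).2 ?model1.
by apply/(ox _).1; apply: (can_inj hK); rewrite modelX expg_order model1.
Qed.

Lemma model_norm : <[w]> <| [set: gT].
Proof. by rewrite -hz; exact: (normal_model hM h'K zC). Qed.

Lemma model_nt x : x \in 'N(<[w]>).
Proof. by have /andP[_ /subsetP] := model_norm; apply; rewrite inE. Qed.

Lemma card_model_quotient : (#|[set: gT] / <[w]>|.*2 = #|gT|)%N.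
Proof.
rewrite card_quotient ?normal_norm ?model_norm // -cardsT -muln2 mulnC.
by rewrite -ow -/(#|<[w]>|) Lagrange ?normal_sub ?model_norm.
Qed.

Lemma model_cyclic x n : has_order x n.*2 -> (0 < n)%N ->
  (forall a, exists i, a = x ^+ i) -> isog_to A (Zp n.*2) /\ quotient_isog_to z (Zp n).
Proof.
move=> ox n0 cov.
have gx : [set: gT] = <[h x]>.
  apply/esym/eqP; rewrite eqEsubset subsetT; apply/subsetP => u _.
  by have [i e] := cov (h' u); rewrite -[u]h'K e modelX mem_cycle.
have cT : #|[set: gT]| = n.*2 by rewrite gx -(model_order ox).
have cyc : cyclic [set: gT] by rewrite gx cycle_cyclic.
split; first by apply: (isog_to_model hM hK h'K); apply: isog_Zp.
apply: (quotient_model hM hK h'K zC); rewrite hz.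
apply: isog_Zp; first exact: quotient_cyclic.
by apply: double_inj; rewrite card_model_quotient -cardsT.
Qed.

Lemma model_gen x y : (forall a, exists i, a = x ^+ i \/ a = x ^+ i * y) ->
  [set: gT] = <<[set h x; h y]>>.
Proof.
move=> cov; apply/esym/eqP; rewrite eqEsubset subsetT; apply/subsetP => u _.
have gX : h x \in <<[set h x; h y]>> by rewrite mem_gen // !inE eqxx.
have gY : h y \in <<[set h x; h y]>> by rewrite mem_gen // !inE eqxx orbT.
by have [i [] e] := cov (h' u); rewrite -[u]h'K e ?hM modelX ?groupM ?groupX.
Qed.

Lemma model_notin x y : (forall i, y <> x ^+ i) -> h y \notin <[h x]>.
Proof.
by move=> yx; apply/cycleP => -[i]; rewrite -modelX => /(can_inj hK)/yx.
Qed.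

Lemma model_conj (x y t : A) : x * y = y * t -> h x ^ h y = h t.
Proof. by move=> e; apply: (mulgI (h y)); rewrite -conjgC -!hM e. Qed.

(** The dihedral relations need to hold only modulo [w]; the third one says that [v] inverts [u]
    there. *)
Lemma quotient_gens (u v : gT) q : (1 < q)%N -> [set: gT] = <<[set u; v]>> ->
  u ^+ q \in <[w]> -> v ^+ 2 \in <[w]> -> u ^ v * u \in <[w]> ->
  (#|gT| = q.*2.*2)%N -> [set: gT] / <[w]> \isog 'D_(q.*2).
Proof.
move=> q1 gT_ uq v2 uv cT; have nt := model_nt.
pose c := coset <[w]>; have cM a b : c (a * b) = c a * c b by rewrite /c morphM ?nt.
have cX a n : c (a ^+ n) = c a ^+ n by rewrite /c morphX ?nt.
apply: (@isog_dihedral _ _ (c u) (c v)) => //.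
- by rewrite /= gT_ quotient_gen ?quotientU ?quotient_set1 ?nt //; apply/subsetP => a _; apply: nt.
- by rewrite -cX; apply: coset_id.
- by rewrite -cX; apply: coset_id.
- apply: (mulIg (c u)); rewrite mulVg /c -morphJ ?nt // -morphM ?nt //; exact: coset_id.
by rewrite -leq_double card_model_quotient cT.
Qed.

(** The relation x y x = y says that [y] inverts [x], in the product form that composing monomial
    substitutions delivers. *)
Lemma model_dihedral x y q : (1 < q)%N -> has_order x q.*2 -> x ^+ q = z -> y * y = 1 ->
  x * y * x = y -> (forall i, y <> x ^+ i) ->
  (forall a, exists i, a = x ^+ i \/ a = x ^+ i * y) ->
  isog_to A 'D_(q.*2.*2) /\ quotient_isog_to z 'D_(q.*2).
Proof.
move=> q1 ox xq yy xyx yx cov; have gT_ := model_gen cov.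
have ohx := model_order ox.
have xV : h x ^ h y = (h x)^-1.
  by rewrite -modelV; apply: model_conj; rewrite -[in RHS]xyx mulgK.
have hy2 : h y ^+ 2 = 1 by rewrite -modelX expgS expg1 yy model1.
have cT : (#|gT| = q.*2.*2)%N.
  by rewrite -cardsT gT_ card_gen2 ?ohx ?xV ?groupV ?cycle_id ?hy2 ?model_notin.
split.
  apply: (isog_to_model hM hK h'K); apply: (@isog_dihedral _ _ (h x) (h y)) => //.
  - by apply: leq_trans q1 _; rewrite -addnn leq_addr.
  - by rewrite -ohx expg_order.
  by rewrite cardsT cT.
apply: (quotient_model hM hK h'K zC); rewrite hz.
apply: (quotient_gens q1 gT_) => //; first by rewrite -modelX xq hz cycle_id.
- by rewrite hy2.
by rewrite xV mulVg.
Qed.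

(** The Klein group as the dihedral group of order 4, so that its occurrences as a reduced group
    come out of the dihedral and quaternion computations. *)
Lemma isog_dihedral4 : 'D_4 \isog [set: 'Z_2 * 'Z_2].
Proof.
rewrite isog_sym; pose a : 'Z_2 * 'Z_2 := (1%R, 0%R); pose b : 'Z_2 * 'Z_2 := (0%R, 1%R).
have cV : (#|[set: 'Z_2 * 'Z_2]| = 4)%N by rewrite cardsT card_prod !card_ord.
apply: (@isog_dihedral _ _ a b 2); rewrite ?cV //.
apply/esym/eqP; rewrite eqEsubset subsetT; apply/subsetP => u _.
have gX : a \in <<[set a; b]>> by rewrite mem_gen // !inE eqxx.
have gY : b \in <<[set a; b]>> by rewrite mem_gen // !inE eqxx orbT.
have : u \in [set 1; a; b; a * b].
  by case: u => [[[|[|u]] hu] [[|[|v]] hv]] //; rewrite !inE -!orbA; apply/or4P;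
    [constructor 1|constructor 3|constructor 2|constructor 4].
by rewrite !inE -!orbA => /or4P[] /eqP->; rewrite ?groupM ?group1.
all: by rewrite ?expgS; apply/eqP; rewrite eqE.
Qed.

Lemma model_Klein x : x * x = 1 -> x <> 1 -> x <> z ->
  (forall a, a = 1 \/ a = z \/ a = x \/ a = x * z) ->
  isog_to A [set: 'Z_2 * 'Z_2] /\ quotient_isog_to z (Zp 2).
Proof.
move=> xx x1 xz cov.
have hx2 : h x ^+ 2 = 1 by rewrite -modelX expgS expg1 xx model1.
have zz : z ^+ 2 = 1 by apply: (can_inj hK); rewrite modelX hz -ow expg_order model1.
have gT_ : [set: gT] = <<[set w; h x]>>.
  rewrite -hz; apply: model_gen => a; case: (cov a) => [->|[->|[->|->]]].
  - by exists 0%N; left.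
  - by exists 1%N; left; rewrite expg1.
  - by exists 0%N; right; rewrite expg0 mul1g.
  by exists 1%N; right; rewrite expg1 zC.
have cT : #|gT| = 4%N.
  rewrite -cardsT gT_ card_gen2 ?ow ?hx2 //.
    by rewrite -hz (@model_conj _ _ z) ?cycle_id.
  rewrite -hz; apply: model_notin => i; rewrite -(odd_double_half i) expgD -mul2n.
  by rewrite expgM zz expg1n mulg1; case: (odd i).
split.
  apply: (isog_to_model hM hK h'K); apply: isog_Klein; first by rewrite cardsT.
  move=> u _; rewrite -[u]h'K -modelX -[RHS]model1; congr h.
  have e2 a b : a ^+ 2 = 1 -> b ^+ 2 = 1 -> a * b = b * a -> (a * b : A) ^+ 2 = 1.
    by rewrite !expgS !expg0 !mulg1 => ea eb c; rewrite -mulgA [b * _]mulgA -c -mulgA eb mulg1.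
  have x2 : x ^+ 2 = 1 by rewrite expgS expg1.
  by case: (cov (h' u)) => [->|[->|[->|->]]]; rewrite ?expg1n ?e2 // zC.
apply: (quotient_model hM hK h'K zC); rewrite hz.
apply: isog_Zp; last by apply: double_inj; rewrite card_model_quotient.
by apply: prime_cyclic; rewrite (_ : #|_| = 2%N) //; apply: double_inj; rewrite card_model_quotient.
Qed.

Lemma quotient_isog_trans (hT iT : finGroupType) (H : {group hT}) (I : {group iT}) :
  H \isog I -> quotient_isog_to z H -> quotient_isog_to z I.
Proof.
move/isogP=> [e inj im] [p [pM pI pS]].
have pH a : p (cycle_coset z a) \in H by apply/pS; exists a.
exists (e \o p); split=> [a b|a b|u] /=; first by rewrite pM morphM.
  by move/(injmP inj); rewrite !pH => /(_ isT isT)/pI.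
rewrite -im; split; first by case/morphimP => v _ /pS[a <-] ->; exists a.
by case=> a <-; apply: mem_morphim; apply: pH.
Qed.

Lemma model_quaternion x y : has_order x 4 -> x * x = z -> y * y = z ->
  x * y * x = y -> (forall i, y <> x ^+ i) ->
  (forall a, exists i, a = x ^+ i \/ a = x ^+ i * y) ->
  isog_to A 'Q_8 /\ quotient_isog_to z [set: 'Z_2 * 'Z_2].
Proof.
move=> ox xx yy xyx yx cov; have gT_ := model_gen cov.
have ohx := model_order ox.
have xV : h x ^ h y = (h x)^-1.
  by rewrite -modelV; apply: model_conj; rewrite -[in RHS]xyx mulgK.
have hy2 : h y ^+ 2 = w by rewrite -modelX expgS expg1 yy.
have hx2 : h x ^+ 2 = w by rewrite -modelX expgS expg1 xx.
have cT : (#|gT| = 8)%N.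
  by rewrite -cardsT gT_ card_gen2 ?ohx ?xV ?groupV ?cycle_id ?hy2 -?hx2 ?mem_cycle ?model_notin.
split.
  apply: (isog_to_model hM hK h'K); apply: (@isog_quaternion _ _ (h x) (h y)) => //.
  - by rewrite -ohx expg_order.
  - by rewrite hx2 hy2.
  by rewrite cardsT cT.
apply: (quotient_isog_trans isog_dihedral4).
apply: (quotient_model hM hK h'K zC); rewrite hz.
apply: (quotient_gens (isT : 1 < 2)%N gT_) => //; rewrite ?hx2 ?hy2 ?cycle_id //.
by rewrite xV mulVg.
Qed.

(** The involution [y] acts on the cyclic group of order 16 by the seventh power, and 7^2 = 1 modulo
    16. Modulo z = x^8 this is inversion, because 7 = -1 modulo 8. *)
Lemma model_semidirect16 x y : has_order x 16 -> x ^+ 8 = z -> y * y = 1 ->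
  x * y = y * x ^+ 7 -> (forall i, y <> x ^+ i) ->
  (forall a, exists i, a = x ^+ i \/ a = x ^+ i * y) ->
  semidirect_isog_to A (Zp 16) (Zp 2) /\ quotient_isog_to z 'D_16.
Proof.
move=> ox xz yy xy yx cov; have gT_ := model_gen cov.
have ohx := model_order ox; have nyx := model_notin yx.
have x7 : h x ^ h y = h x ^+ 7 by rewrite -modelX; apply: model_conj.
have hy2 : h y ^+ 2 = 1 by rewrite -modelX expgS expg1 yy model1.
have cT : (#|gT| = 32)%N.
  by rewrite -cardsT gT_ card_gen2 ?ohx ?x7 ?mem_cycle ?hy2 ?group1.
have oy : #[h y] = 2%N.
  by apply: nt_prime_order => //; apply: contraNneq nyx => ->; apply: group1.
split.
  have N : <[h y]> \subset 'N(<[h x]>) by rewrite norms_cycle x7 mem_cycle.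
  apply: (@semidirect_model _ _ _ _ hM hK h'K _ _ _ _ <[h x]>%G <[h y]>%G).
  - rewrite sdprodE //; first by rewrite gT_ gen2E norm_joinEr.
    apply/trivgP/subsetP => u /setIP[ux]; rewrite /= cycle2g // => /set2P[->|uy].
      exact: group1.
    by move: nyx; rewrite -uy ux.
  - by apply: isog_Zp; rewrite ?cycle_cyclic // -orderE.
  by apply: isog_Zp; rewrite ?cycle_cyclic // -orderE.
apply: (quotient_model hM hK h'K zC); rewrite hz.
apply: (quotient_gens (isT : 1 < 8)%N gT_) => //; rewrite ?hy2 ?group1 //.
  by rewrite -modelX xz hz cycle_id.
by rewrite x7 -expgSr -modelX xz hz cycle_id.
Qed.

(** The normal subgroup of order 5 is generated by x^2. For its complement, r = x^5 y has square z,
    hence order 4, and is inverted by y, so r and y generate a dihedral group of order 8. This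
    complement contains x^5 and z, which gives back x as x^6 x^5. *)
Lemma model_semidirect40 x y : has_order x 10 -> y * y = 1 ->
  x * y * x = y * z -> (forall i, z <> x ^+ i) ->
  (forall i, y <> x ^+ i /\ y <> x ^+ i * z) ->
  (forall a, exists i j l, a = x ^+ i * z ^+ j * y ^+ l) ->
  semidirect_isog_to A (Zp 5) 'D_8 /\ quotient_isog_to z 'D_20.
Proof.
move=> ox yy xyx zx yxz cov; have ohx := model_order ox.
pose X := h x; pose Y := h y.
have hy2 : Y ^+ 2 = 1 by rewrite -modelX expgS expg1 yy model1.
have YV : Y^-1 = Y by apply: (mulgI Y); rewrite mulgV -hy2.
have XY : X * Y * X = Y * w by rewrite -hz -!hM xyx.
have wC u : w * u = u * w by rewrite -[u]h'K -hz -!hM zC.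
have w2 : w * w = 1 by rewrite -[RHS](expg_order w) ow.
have XJ : X ^ Y = w * X^-1.
  by apply: (mulIg X); rewrite mulgKV conjgE -!mulgA (mulgA X) XY mulKg.
have XJi i : (X ^+ i) ^ Y = w ^+ i * X ^- i.
  by rewrite conjXg XJ expgMn ?expgVn //; apply: wC.
have X10 : X ^+ 10 = 1 by rewrite -ohx expg_order.
have X2J : (X ^+ 2) ^ Y = (X ^+ 2)^-1 by rewrite XJi expgS expg1 w2 mul1g.
have X5V : X ^- 5 = X ^+ 5 by apply: (mulgI (X ^+ 5)); rewrite mulgV -expgD X10.
have X5J : (X ^+ 5) ^ Y = w * X ^+ 5.
  by rewrite XJi X5V -[5%N]/(1 + 2 * 2)%N expgD expg1 expgM [w ^+ 2]w2 expg1n mulg1.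
pose r := X ^+ 5 * Y.
have r2 : r * r = w.
  rewrite /r -mulgA (_ : Y * (_ * _) = (X ^+ 5) ^ Y); last by rewrite conjgE YV mulgA.
  by rewrite X5J mulgA -wC -mulgA -expgD X10 mulg1.
have rY : r ^ Y = r^-1.
  apply: (mulgI r); rewrite mulgV conjMg X5J conjgE mulKg -[w * _ * _]mulgA -/r.
  by rewrite (mulgA r) -wC -mulgA r2 w2.
have wi i : w ^+ i = 1 \/ w ^+ i = w.
  rewrite -(odd_double_half i) expgD -mul2n expgM [w ^+ 2]w2 expg1n mulg1.
  by case: (odd i); [right|left].
have Xw i : X ^+ i != w.
  by apply/eqP; rewrite -hz -modelX => /(can_inj hK) e; apply: (zx i).
have Y1 : Y != 1.
  by apply/eqP; rewrite -model1 => /(can_inj hK); apply: (yxz 0%N).1.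
have Yw : Y != w.
  apply/eqP; rewrite -hz => /(can_inj hK); have := (yxz 0%N).2.
  by rewrite expg0 mul1g.
have X51 : X ^+ 5 != 1.
  by apply/negP; rewrite -order_dvdn ohx.
have rX i : r ^+ i = X ^+ 5 * Y * w ^+ i./2 \/ r ^+ i = w ^+ i./2.
  rewrite -{1 3}(odd_double_half i) expgD -mul2n expgM [r ^+ 2]r2.
  by case: (odd i); rewrite ?expg1 ?expg0 ?mul1g; [left|right].
have nYr : Y \notin <[r]>.
  apply/cycleP => -[i e]; case: (rX i); rewrite -e; last first.
    by move=> E; case: (wi i./2) => Ew; move: Y1 Yw; rewrite E Ew eqxx.
  case: (wi i./2) => ->; rewrite ?mulg1 => E.
    by move: X51; rewrite -(mulgK Y (X ^+ 5)) -E mulgV eqxx.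
  have /eqP[] := Xw 5; apply: (mulIg w); rewrite w2; apply: (mulIg Y).
  by rewrite mul1g -mulgA wC mulgA -E.
pose N := <[X ^+ 2]>; pose C := <<[set r; Y]>>.
have r1 : #[r] = 4%N.
  rewrite (@orderXprime _ 2 2) //; apply: nt_prime_order => //.
    by rewrite -expgM (expgM r 2 2) [r ^+ 2]r2 [LHS]w2.
  by rewrite [r ^+ 2]r2 -order_eq1 ow.
have cC : #|C| = 8%N.
  by rewrite card_gen2 ?r1 // ?rY ?groupV ?cycle_id // hy2 group1.
have cN : #|N| = 5%N by rewrite -orderE orderXdiv ohx.
have rC : r \in C by rewrite mem_gen // !inE eqxx.
have YC : Y \in C by rewrite mem_gen // !inE eqxx orbT.
have NC : C \subset 'N(N).
  rewrite gen_subG; apply/subsetP => u; rewrite -cycle_subG norms_cycle.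
  have X25 : (X ^+ 2) ^ (X ^+ 5) = X ^+ 2 by apply: (mulgI (X ^+ 5)); rewrite -conjgC -!expgD.
  have X2r : (X ^+ 2) ^ r = (X ^+ 2)^-1 by rewrite /r conjgM X25 X2J.
  by case/set2P=> ->; rewrite ?X2r ?X2J groupV cycle_id.
have tNC : N :&: C = 1 by apply: coprime_TIg; rewrite cN cC.
have X5C : X ^+ 5 \in C by rewrite -(mulgK Y (X ^+ 5)) groupM ?groupV.
have wC' : w \in C by rewrite -r2 groupM.
have CM v : v \in C -> v \in N <*> C.
  by apply/subsetP/joing_subr.
have XM : X \in N <*> C.
  have -> : X = (X ^+ 2) ^+ 3 * X ^+ 5 by rewrite -expgM -expgD (expgD X 10 1) X10 mul1g.
  apply: groupM; last exact: CM.
  apply: groupX.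
  by have /subsetP := joing_subl N C; apply; apply: cycle_id.
have sd : N ><| C = [set: gT].
  rewrite sdprodE //; apply/eqP; rewrite eqEsubset subsetT; apply/subsetP => u _.
  have [i [m [l e]]] := cov (h' u); rewrite -[u]h'K e !hM !modelX hz -/X -/Y.
  rewrite -(@norm_joinEr _ <[X ^+ 2]> <<[set r; Y]>>) //.
  by apply: groupM; [apply: groupM|]; apply: groupX => //; apply: CM.
have cT : #|gT| = 40%N by rewrite -cardsT -(sdprod_card sd) cN cC.
have gT_ : [set: gT] = <<[set X; Y]>>.
  have gX : X \in <<[set X; Y]>> by rewrite mem_gen // !inE eqxx.
  have gY : Y \in <<[set X; Y]>> by rewrite mem_gen // !inE eqxx orbT.
  have gw : w \in <<[set X; Y]>> by rewrite -(mulKg Y w) -XY !groupM ?groupV.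
  apply/esym/eqP; rewrite eqEsubset subsetT; apply/subsetP => u _.
  have [i [m [l e]]] := cov (h' u); rewrite -[u]h'K e !hM !modelX hz -/X -/Y.
  by rewrite !groupM ?groupX.
split.
  apply: (@semidirect_model _ _ _ _ hM hK h'K _ _ _ _ <[X ^+ 2]>%G <<[set r; Y]>>%G) => //.
    by apply: isog_Zp; rewrite ?cycle_cyclic.
  apply: (@isog_dihedral _ _ r Y 4) => //; rewrite ?cC //.
  by rewrite -r1 expg_order.
apply: (quotient_model hM hK h'K zC); rewrite hz.
apply: (quotient_gens (isT : 1 < 10)%N gT_) => //; rewrite ?X10 ?hy2 ?group1 //.
by rewrite XJ mulgKV cycle_id.
Qed.

(** The order 24 shows that [x], [y], [t] generate, since by [card_tetra] they generate a subgroup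
    of that order. Modulo [w] the same relations hold with [x] of order 2, which gives the
    alternating group. *)
Lemma model_tetra x y t : has_order x 4 -> x * x = z -> y * y = z ->
  x * y * x = y -> (forall i, y <> x ^+ i) -> t ^+ 3 = 1 -> t <> 1 ->
  x * t = t * y -> y * t = t * (x * y) -> #|gT| = 24%N ->
  isog_to A (SL2_F 3) /\ quotient_isog_to z 'Alt_('I_4).
Proof.
move=> ox xx yy xyx yx t3 t1 xt yt cT; have ohx := model_order ox.
have xV : h x ^ h y = (h x)^-1.
  by rewrite -modelV; apply: model_conj; rewrite -[in RHS]xyx mulgK.
have hy2 : h y ^+ 2 = w by rewrite -modelX expgS expg1 yy.
have hx2 : h x ^+ 2 = w by rewrite -modelX expgS expg1 xx.
have ht1 : h t != 1 by apply/eqP; rewrite -model1 => /(can_inj hK).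
have rel : tetra_rel (h x) (h y) (h t).
  split=> //; first by rewrite hx2.
  - by rewrite -modelX t3 model1.
  - exact: model_conj.
  by rewrite -hM; apply: model_conj.
have gT_ : [set: gT] = <<[set h x; h y; h t]>>.
  apply/esym/eqP; rewrite eqEcard subsetT.
  by rewrite (@card_tetra _ _ _ _ 4) // ?model_notin // cardsT cT.
have [H HE iH] := isog_SL2_3 rel ohx (model_notin yx) ht1.
split.
  rewrite /SL2_F HE; apply: (isog_to_model hM hK h'K).
  by rewrite gT_.
apply: (quotient_model hM hK h'K zC); rewrite hz.
pose c := coset <[w]>; have nt := model_nt.
have wx : <[w]> \subset <[h x]> by rewrite cycle_subG -hx2 mem_cycle.
have cX u n : c (u ^+ n) = c u ^+ n by rewrite /c morphX ?nt.
have cM u v : c (u * v) = c u * c v by rewrite /c morphM ?nt.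
have cJ u v : c (u ^ v) = c u ^ c v by rewrite /c morphJ ?nt.
have cx2 : c (h x) ^+ 2 = 1 by rewrite -cX hx2; apply/coset_id/cycle_id.
have cw u : c u = 1 -> u \in <[w]> by apply: coset_idr; apply: nt.
have cx : #[c (h x)] = 2%N.
  apply: nt_prime_order => //; apply/eqP => /cw.
  rewrite -cycle_subG => /subset_leq_card; rewrite -!orderE ohx ow //.
have -> : [set: gT] / <[w]> = <<[set c (h x); c (h y); c (h t)]>>.
  rewrite gT_ quotient_gen ?quotientU ?quotient_set1 ?nt //.
  by apply/subsetP => u _; apply: nt.
case: rel => r1 r2 r3 r4 r5.
apply: isog_Alt4 => //.
- split.
  + by rewrite -!cX r1.
  + by rewrite -cJ r2 /c morphV ?nt.
  + by rewrite -cX r3 /c morph1.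
  + by rewrite -cJ r4.
  by rewrite -cJ r5 cM.
- apply: contra (model_notin yx) => yc.
  have /cycleP[i ci] := yc; rewrite -cX in ci.
  rewrite -(mulKVg (h x ^+ i) (h y)) groupM ?mem_cycle //; apply: (subsetP wx); apply: cw.
  by rewrite cM ci -cM mulVg /c morph1.
apply/eqP => /cw/cycleP[i e].
have ht2 : h t ^+ 2 = 1 by rewrite e -expgM mulnC expgM -ow expg_order expg1n.
by move/eqP: ht1; apply; rewrite -[h t]mul1g -ht2 -expgSr r3.
Qed.

End Model.

(** * An invariant pair of points *)

(** With the pair at 0 and infinity, automorphisms have the form
    (x, y) |-> (a x, b y), written [dg a b], or (a / x, b y / x^5), [an a b]. *)

Notation dg a b := (Mob a 0 0 1 b).
Notation an a b := (Mob 0 a 1 0 b).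

Lemma induces_msim (k : fieldType) g (f F : {poly k}) m n (phi : curve g f -> curve g F) :
  msim g m n -> induces m phi -> induces n phi.
Proof.
move=> [l l0 [ea eb ec ed ee]] hm P X Z Y hP.
have := repM l0 (hm _ _ _ _ hP); congr rep.
- by rewrite /mX ea eb; ring.
- by rewrite /mZ ec ed; ring.
by rewrite ee mulrA.
Qed.

Lemma compat_msim (k : fieldType) g (f F : {poly k}) m n :
  msim g m n -> compat g m f F -> compat g n f F.
Proof.
move=> [l l0 [ea eb ec ed ee]] [dm em h]; split.
- have -> : mdet n = l ^+ 2 * mdet m by rewrite /mdet ea eb ec ed; ring.
  by rewrite mulf_neq0 // expf_neq0.
- by rewrite ee mulf_neq0 // expf_neq0.
move=> X Z; have -> : mX n X Z = l * mX m X Z by rewrite /mX ea eb; ring.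
have -> : mZ n X Z = l * mZ m X Z by rewrite /mZ ec ed; ring.
by rewrite hformM h ee exprMn sqr_exp_half mulrA.
Qed.

Section Coefficients.
Variables (k : closedFieldType) (f F : {poly k}).
Hypotheses (sf : (size f <= 11)%N) (sF : (size F <= 11)%N).

Lemma poly_coefs (p q : {poly k}) : (forall x, p.[x] = q.[x]) -> p = q.
Proof. by move=> e; apply: (@poly_cofin_inj _ p q [::]) => x _. Qed.

Lemma compat_dg a b : compat 4 (dg a b) f F <->
  [/\ a != 0, b != 0 & forall i, F`_i * a ^+ i = b ^+ 2 * f`_i].
Proof.
rewrite /compat /mdet /mX /mZ /=; split.
  rewrite mulr1 mulr0 subr0 => -[a0 b0 h]; split=> // i.
  pose P := \poly_(i < 11) (F`_i * a ^+ i).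
  have e : P = b ^+ 2 *: f.
    apply: poly_coefs => x; rewrite hornerZ -(@hform1 _ 4 f x) // -h /hform horner_poly.
    apply: eq_bigr => j _; by rewrite !mul0r addr0 add0r mulr1 expr1n mulr1 exprMn mulrA.
  have [le|lt] := leqP 11 i; first by rewrite !nth_default ?mul0r ?mulr0 // (leq_trans _ le).
  by move/(congr1 (fun p : {poly k} => p`_i)): e; rewrite coef_poly lt coefZ.
case=> a0 b0 h; split=> //; first by rewrite mulr1 mulr0 subr0.
move=> X Z; rewrite !mul0r addr0 add0r mul1r /hform mulr_sumr; apply: eq_bigr => i _.
rewrite exprMn mulrA h; ring.
Qed.

Lemma compat_an a b : compat 4 (an a b) f F <->
  [/\ a != 0, b != 0 & forall i, (i <= 10)%N -> F`_(10 - i) * a ^+ (10 - i) = b ^+ 2 * f`_i].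
Proof.
have E x y : hform 4 F (a * y) x =
    \sum_(i < 11) F`_(10 - i) * a ^+ (10 - i) * x ^+ i * y ^+ (10 - i).
  rewrite /hform (reindex_inj rev_ord_inj) /=; apply: eq_bigr => i _.
  have le_i : (i <= 10)%N by rewrite -ltnS.
  by rewrite subSS exprMn subKn //; ring.
rewrite /compat /mdet /mX /mZ /=; split.
  rewrite mulr1 mulr0 sub0r oppr_eq0 => -[a0 b0 h]; split=> // i le.
  pose P := \poly_(i < 11) (F`_(10 - i) * a ^+ (10 - i)).
  have e : P = b ^+ 2 *: f.
    apply: poly_coefs => x; rewrite hornerZ -(@hform1 _ 4 f x) // -h.
    rewrite !mul0r add0r mul1r addr0 E horner_poly.
    by apply: eq_bigr => j _; rewrite expr1n mulr1.
  by move/(congr1 (fun p : {poly k} => p`_i)): e; rewrite coef_poly ltnS le coefZ.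
case=> a0 b0 h; split=> //; first by rewrite mulr1 mulr0 sub0r oppr_eq0.
move=> X Z; rewrite !mul0r addr0 add0r mul1r E /hform mulr_sumr; apply: eq_bigr => i _.
have le_i : (i <= 10)%N by rewrite -ltnS.
rewrite h //; ring.
Qed.

End Coefficients.

Section Monomial.
Variable k : closedFieldType.
Hypothesis two0 : 2 != 0 :> k.
Let g2 : (2 <= 4)%N := isT.
Variable F : {poly k}.
Hypothesis hF : hyperelliptic_poly 4 F.
Local Notation A := (curve_aut 4 F).
Local Notation iota := (hinv 4 F).
Local Notation red := (red two0 g2 hF).

Let sF : (size F <= 11)%N.
Proof. by case: hF => _ []->. Qed.

Lemma dg_ex a b : a != 0 -> b != 0 -> (forall i, F`_i * a ^+ i = b ^+ 2 * F`_i) ->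
  exists x : A, induces (dg a b) x.
Proof. by move=> a0 b0 e; apply: (aut_ex hF); apply/(compat_dg sF sF). Qed.

Lemma an_ex a b : a != 0 -> b != 0 ->
  (forall i, (i <= 10)%N -> F`_(10 - i) * a ^+ (10 - i) = b ^+ 2 * F`_i) ->
  exists x : A, induces (an a b) x.
Proof. by move=> a0 b0 e; apply: (aut_ex hF); apply/(compat_an F sF). Qed.

Lemma dg_of (x : A) : red x (Some 0) = Some 0 -> red x None = None ->
  exists a b, [/\ induces (dg a b) x, a != 0, b != 0 &
    forall i, F`_i * a ^+ i = b ^+ 2 * F`_i].
Proof.
have [m cm im] := aut_mob two0 g2 hF x; rewrite !(redE _ _ _ _ im).
have [dm em _] := cm.
rewrite /mob_act /mX /mZ /pnorm /= !mulr0 !mulr1 !add0r !addr0.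
case: eqP => // d0 [b0] ; case: eqP => // c0 _.
have hd : md m != 0 by apply/eqP.
have mb0 : mb m = 0 by move/eqP: b0; rewrite mulf_eq0 invr_eq0 (negbTE hd) orbF => /eqP.
have sim : msim 4 m (dg (ma m / md m) (me m / md m ^+ 5)).
  exists (md m)^-1; first by rewrite invr_eq0.
  by rewrite mb0 c0 /= !mulr0 mulVf // mulrC exprVn [me m / _]mulrC.
have [n1 n2 n3] := (compat_dg sF sF _ _).1 (compat_msim sim cm).
by exists (ma m / md m), (me m / md m ^+ 5); split=> //; apply: induces_msim sim im.
Qed.

Lemma an_of (x : A) : red x (Some 0) = None -> red x None = Some 0 ->
  exists a b, [/\ induces (an a b) x, a != 0, b != 0 &
    forall i, (i <= 10)%N -> F`_(10 - i) * a ^+ (10 - i) = b ^+ 2 * F`_i].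
Proof.
have [m cm im] := aut_mob two0 g2 hF x; rewrite !(redE _ _ _ _ im).
have [dm em _] := cm.
rewrite /mob_act /mX /mZ /pnorm /= !mulr0 !mulr1 !add0r !addr0.
case: eqP => // d0 _; case: eqP => // c0 [a0].
have hc : mc m != 0 by apply/eqP.
have ma0 : ma m = 0 by move/eqP: a0; rewrite mulf_eq0 invr_eq0 (negbTE hc) orbF => /eqP.
have sim : msim 4 m (an (mb m / mc m) (me m / mc m ^+ 5)).
  exists (mc m)^-1; first by rewrite invr_eq0.
  by rewrite ma0 d0 /= !mulr0 mulVf // mulrC exprVn [me m / _]mulrC.
have [n1 n2 n3] := (compat_an F sF _ _).1 (compat_msim sim cm).
by exists (mb m / mc m), (me m / mc m ^+ 5); split=> //; apply: induces_msim sim im.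
Qed.

Implicit Types x y : A.

(** The entry 1 in the lower right corner leaves no scaling freedom. *)
Lemma dg_inj a b c d x : a != 0 -> induces (dg a b) x -> induces (dg c d) x -> a = c /\ b = d.
Proof.
move=> a0 h1 h2; have := induces_inj hF _ h1 h2; rewrite /mdet /= mulr1 mulr0 subr0.
case=> // l l0 /= [e1 _ _ e4 e5]; have l1 : l = 1 by rewrite e4 mulr1.
by rewrite e1 e5 l1 expr1n !mul1r.
Qed.

Lemma dg_an a b c d x : a != 0 -> induces (dg a b) x -> induces (an c d) x -> False.
Proof.
move=> a0 h1 h2; have := induces_inj hF _ h1 h2; rewrite /mdet /= mulr1 mulr0 subr0.
by case=> // l l0 /= [/esym/eqP]; rewrite mulf_eq0 (negbTE l0) (negbTE a0).
Qed.

Lemma dg_eq a b x y : induces (dg a b) x -> induces (dg a b) y -> x = y.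
Proof.
apply: aut_sim; exists 1; first exact: oner_neq0.
by rewrite !mul1r expr1n mul1r.
Qed.

Lemma an_eq a b x y : induces (an a b) x -> induces (an a b) y -> x = y.
Proof.
apply: aut_sim; exists 1; first exact: oner_neq0.
by rewrite !mul1r expr1n mul1r.
Qed.

Lemma dgM a b c d x y : induces (dg a b) x -> induces (dg c d) y ->
  induces (dg (a * c) (b * d)) (x * y)%g.
Proof.
move=> h1 h2; have := induces_autM h1 h2.
by rewrite /mmul /= !(mulr0, mul0r, addr0, add0r, mulr1).
Qed.

Lemma dgX a b x i : induces (dg a b) x -> induces (dg (a ^+ i) (b ^+ i)) (x ^+ i)%g.
Proof.
move=> h; elim: i => [|i IH]; first exact: induces_aut1.
by rewrite expgS !exprS; apply: dgM.
Qed.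

Lemma dg_anM a b c d x y : induces (dg a b) x -> induces (an c d) y ->
  induces (an (a * c) (b * d)) (x * y)%g.
Proof.
move=> h1 h2; have := induces_autM h1 h2.
by rewrite /mmul /= !(mulr0, mul0r, addr0, add0r, mulr1, mul1r).
Qed.

(** The product has lower left entry c; dividing it out costs c^(g+1) = c^5 in the last entry. *)
Lemma an_dgM a b c d x y : c != 0 -> induces (an a b) x -> induces (dg c d) y ->
  induces (an (a / c) (b * d / c ^+ 5)) (x * y)%g.
Proof.
move=> c0 h1 h2; apply: induces_msim (induces_autM h1 h2); exists c^-1; first by rewrite invr_eq0.
rewrite /= !(mulr0, mul0r, addr0, add0r, mulr1, mul1r) mulVf // mulrC exprVn.
by split=> //; apply: mulrC.
Qed.

Lemma anM a b c d x y : c != 0 -> induces (an a b) x -> induces (an c d) y ->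
  induces (dg (a / c) (b * d / c ^+ 5)) (x * y)%g.
Proof.
move=> c0 h1 h2; apply: induces_msim (induces_autM h1 h2); exists c^-1; first by rewrite invr_eq0.
rewrite /= !(mulr0, mul0r, addr0, add0r, mulr1, mul1r) mulVf // mulrC exprVn.
by split=> //; apply: mulrC.
Qed.

End Monomial.

(** * Outcomes of the classification and their invariance *)

Section Outcome.
Variable k : closedFieldType.
Implicit Types f F G : {poly k}.
Implicit Types Q : groupType -> Prop.

(** [Q] is a predicate on groups, so that an isomorphism type and a semidirect decomposition are
    handled alike; [P] is the normal form. *)
Definition realize (f : {poly k}) (hT : finGroupType) (H : {set hT}) (Q : groupType -> Prop)
    (P : {poly k} -> Prop) :=
  [/\ reduced_aut_isog 4 f H, Q (curve_aut 4 f) &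
      exists2 F, P F & hyperelliptic_poly 4 F /\ curve_iso 4 f 4 F].

Definition iso_invariant (Q : groupType -> Prop) := forall (A B : groupType) (T : A -> B) (T' : B -> A),
  {morph T : a b / (a * b)%g} -> cancel T T' -> cancel T' T -> Q B -> Q A.

Lemma curve_isoxx f : curve_iso 4 f 4 f.
Proof. by exists id, id; split=> //; apply: curve_morphism_id. Qed.

Definition isog_from (hT : finGroupType) (H : {set hT}) (A : groupType) : Prop := isog_to A H.
Definition semidirect_from (hT iT : finGroupType) (H : {set hT}) (I : {set iT}) (A : groupType) : Prop :=
  semidirect_isog_to A H I.

Lemma isog_from_invariant (hT : finGroupType) (H : {set hT}) : iso_invariant (isog_from H).
Proof. by move=> A B T T' TM TK T'K; apply: isog_to_iso TM TK T'K _ _. Qed.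

Lemma semidirect_from_invariant (hT iT : finGroupType) (H : {set hT}) (I : {set iT}) :
  iso_invariant (semidirect_from H I).
Proof. by move=> A B T T' TM TK T'K; apply: semidirect_isog_to_iso TM TK T'K _ _ _ _. Qed.

Definition Klein4 : {set 'Z_2 * 'Z_2} := [set: 'Z_2 * 'Z_2].

(** One constructor for each case of the classification; in the tetrahedral case
    the sign of the square root of -12 is left open. *)
Inductive outcome (f : {poly k}) : Prop :=
| Out1 of realize f (Zp 1) (isog_from (Zp 2)) (fun _ => True)
| Out21 of realize f (Zp 2) (isog_from Klein4) (fun F => exists a b c d,
    F = 'X^10 + a *: 'X^8 + b *: 'X^6 + c *: 'X^4 + d *: 'X^2 + 1)
| Out22 of realize f (Zp 2) (isog_from (Zp 4)) (fun F => exists a b c,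
    F = 'X^9 + a *: 'X^7 + b *: 'X^5 + c *: 'X^3 + 'X)
| Out3 of realize f (Zp 3) (isog_from (Zp 6)) (fun F => exists a b,
    F = 'X^10 + a *: 'X^7 + b *: 'X^4 + 'X)
| Out41 of realize f Klein4 (isog_from ('D_8)%g) (fun F => exists a b,
    F = 'X^10 + a *: 'X^8 + b *: 'X^6 + b *: 'X^4 + a *: 'X^2 + 1)
| Out41' of realize f Klein4 (isog_from ('D_8)%g) (fun F => exists a b,
    F = 'X^9 + a *: 'X^7 + b *: 'X^5 + a *: 'X^3 + 'X)
| Out42 of realize f Klein4 (isog_from ('Q_8)%g) (fun F => exists a,
    F = 'X * ('X^4 - 1) * ('X^4 + a *: 'X^2 + 1))
| Out5 of realize f ('D_8)%g (isog_from ('D_16)%g) (fun F => exists a, F = 'X^9 + a *: 'X^5 + 'X)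
| Out6 of realize f ('D_10)%g (isog_from ('D_20)%g) (fun F => exists a, F = 'X^10 + a *: 'X^5 + 1)
| Out7 of realize f ('Alt_('I_4))%g (isog_from (SL2_F 3)) (fun F => exists2 a, a ^+ 2 = - 12 &
    F = 'X * ('X^4 - 1) * ('X^4 + a *: 'X^2 + 1))
| Out8 of realize f ('D_16)%g (semidirect_from (Zp 16) (Zp 2)) (fun F => F = 'X^9 + 'X)
| Out9 of realize f (Zp 9) (isog_from (Zp 18)) (fun F => F = 'X^10 + 'X)
| Out10 of realize f ('D_20)%g (semidirect_from (Zp 5) ('D_8)%g) (fun F => F = 'X^10 + 1).

Hypothesis two0 : 2 != 0 :> k.
Let g2 : (2 <= 4)%N := isT.

Lemma hyper11 f : hyperelliptic_poly 4 f -> (size f <= 11)%N.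
Proof. by case=> _ []->. Qed.

Lemma realize_compat n f F (hT : finGroupType) (H : {set hT}) Q P :
  hyperelliptic_poly 4 f -> hyperelliptic_poly 4 F -> compat 4 n f F ->
  iso_invariant Q -> realize F H Q P -> realize f H Q P.
Proof.
move=> hf hF cn iQ [hR hQ [G PG [hG [al [be [m1 m2 c1 c2]]]]]].
have [T [T' [TM TK T'K Ti _]]] := transport two0 g2 hf hF cn.
have [phi [psi [h1 h2 h3 h4 _]]] := @compat_iso _ 4 _ _ _ (hyper11 hf) (hyper11 hF) cn.
split.
- by apply: (quotient_isog_to_iso TM TK T'K); rewrite Ti.
- exact: iQ TM TK T'K hQ.
exists G => //; split=> //; exists (al \o phi), (psi \o be); split.
- exact: curve_morphism_comp.
- exact: curve_morphism_comp.
- exact: can_comp.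
exact: can_comp.
Qed.

Lemma outcome_compat n f F : hyperelliptic_poly 4 f -> hyperelliptic_poly 4 F ->
  compat 4 n f F -> outcome F -> outcome f.
Proof.
move=> hf hF cn; have tr hT H Q P := @realize_compat n f F hT H Q P hf hF cn.
case=> /tr h; [constructor 1|constructor 2|constructor 3|constructor 4|constructor 5|
  constructor 6|constructor 7|constructor 8|constructor 9|constructor 10|constructor 11|
  constructor 12|constructor 13]; apply: h;
    (exact: isog_from_invariant) || exact: semidirect_from_invariant.
Qed.

Lemma realize_self F (hT : finGroupType) (H : {set hT}) Q P : hyperelliptic_poly 4 F ->
  P F -> Q (curve_aut 4 F) /\ quotient_isog_to (hinv 4 F) H -> realize F H Q P.
Proof.
by move=> hF PF [hQ hR]; split=> //; exists F => //; split=> //; apply: curve_isoxx.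
Qed.

Lemma aut_model f : hyperelliptic_poly 4 f -> exists (gT : finGroupType) (w : gT)
  (h : curve_aut 4 f -> gT) (h' : gT -> curve_aut 4 f),
  [/\ {morph h : a b / (a * b)%g}, cancel h h', cancel h' h, h (hinv 4 f) = w & #[w]%g = 2%N].
Proof.
move=> hf; have [s hs] := finite_aut two0 g2 hf.
have [gT [h [h' [hM hK h'K]]]] := finite_groupType hs.
exists gT, (h (hinv 4 f)), h, h'; split=> //.
have h1 : h 1%g = 1%g by apply: (mulgI (h 1%g)); rewrite -hM !mulg1.
apply: nt_prime_order => //; first by rewrite expgS expg1 -hM hinvV h1.
by apply/eqP; rewrite -h1 => /(can_inj hK); apply: hinv_neq1.
Qed.

Lemma prim_root_ex N : (0 < N)%N -> N%:R != 0 :> k -> exists z : k, N.-primitive_root z.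
Proof.
move=> N0 Nk; have sN : size ('X^N - 1 : {poly k}) = N.+1 by rewrite size_Xn_sub_1.
have [r er] := closed_field_poly_normal ('X^N - 1 : {poly k}).
move: er; rewrite (monicP (monic_Xn_sub_1 _ N0)) scale1r => er.
have sr : size r = N by move/(congr1 (fun p : {poly k} => size p)): er;
  rewrite sN size_prod_XsubC => -[].
have ur : uniq r by rewrite -separable_prod_XsubC -er separable_Xn_sub_1.
have ar : all N.-unity_root r.
  by apply/allP => x xr; rewrite /root_of_unity er root_prod_XsubC.
have := has_prim_root N0 ar ur; rewrite sr leqnn => /(_ isT)/hasP[z _ hz]; by exists z.
Qed.

Lemma root_ex N (c : k) : (0 < N)%N -> c != 0 -> exists2 y, y != 0 & y ^+ N = c.
Proof.
move=> N0 c0; have /closed_rootP[y /rootP] : size ('X^N - c%:P : {poly k}) != 1%N.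
  by rewrite size_XnsubC //; case: N N0.
rewrite hornerD hornerN hornerC hornerXn => /eqP; rewrite subr_eq0 => /eqP e; exists y => //.
by apply: contra c0 => /eqP y0; rewrite -e y0 expr0n; case: N N0 {e}.
Qed.

Section Pair.
Variables (f F : {poly k}).
Hypotheses (hf : hyperelliptic_poly 4 f) (hF : hyperelliptic_poly 4 F).

Definition fixes t1 t2 := forall x : curve_aut 4 f,
  red two0 g2 hf x t1 = t1 /\ red two0 g2 hf x t2 = t2.

Definition mixes t1 t2 := forall x : curve_aut 4 f,
  (red two0 g2 hf x t1 = t1 /\ red two0 g2 hf x t2 = t2) \/
  (red two0 g2 hf x t1 = t2 /\ red two0 g2 hf x t2 = t1).
End Pair.

Lemma fixes_compat n f F (hf : hyperelliptic_poly 4 f) (hF : hyperelliptic_poly 4 F) t1 t2 :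
  compat 4 n f F -> fixes hf t1 t2 -> fixes hF (mob_act n t1) (mob_act n t2).
Proof.
move=> cn; have [T [T' [_ _ T'K _ e]]] := transport two0 g2 hf hF cn.
by move=> h x; rewrite -[x]T'K !e; have [-> ->] := h (T' x).
Qed.

Lemma mixes_compat n f F (hf : hyperelliptic_poly 4 f) (hF : hyperelliptic_poly 4 F) t1 t2 :
  compat 4 n f F -> mixes hf t1 t2 -> mixes hF (mob_act n t1) (mob_act n t2).
Proof.
move=> cn; have [T [T' [_ _ T'K _ e]]] := transport two0 g2 hf hF cn.
by move=> h x; rewrite -[x]T'K !e; have [] := h (T' x) => -[-> ->]; [left|right].
Qed.

End Outcome.

Section HyperCoef.
Variables (k : closedFieldType) (F : {poly k}).
Hypothesis hF : hyperelliptic_poly 4 F.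

Lemma hyper_low : F`_0 = 0 -> F`_1 != 0.
Proof.
case: hF => sep _ F0; have := @nonsingular_aff k F 0 sep.
by rewrite !horner_coef0 coef_deriv mulr1n; apply.
Qed.

Lemma hyper_high : F`_10 = 0 -> F`_9 != 0.
Proof.
case: hF => sep sz F10; have F0 : F != 0 by rewrite -size_poly_gt0; case: sz => ->.
case: sz => sz; last by move: F0; rewrite -lead_coef_eq0 lead_coefE sz /= F10 eqxx.
by rewrite -[9%N]/(10.-1) -sz -lead_coefE lead_coef_eq0.
Qed.

Lemma hyper_coef i : (10 < i)%N -> F`_i = 0.
Proof. by move=> i10; rewrite nth_default // (leq_trans (hyper11 hF)). Qed.

Lemma hyper_bound i : F`_i != 0 -> (i <= 10)%N.
Proof. by apply: contraNT; rewrite -ltnNge => /hyper_coef ->. Qed.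
End HyperCoef.

Section Rescale.
Variables (k : closedFieldType) (F : {poly k}).
Hypothesis hF : hyperelliptic_poly 4 F.

Definition rescaled (l c : k) : {poly k} := \poly_(i < 11) (c ^+ 2 * F`_i / l ^+ i).

Lemma rescaledE l c i : (rescaled l c)`_i = c ^+ 2 * F`_i / l ^+ i.
Proof. by rewrite coef_poly; case: ltnP => // /(hyper_coef hF)->; rewrite mulr0 mul0r. Qed.

Lemma rescaled_compat l c : l != 0 -> c != 0 ->
  compat 4 (dg l c) F (rescaled l c) /\ hyperelliptic_poly 4 (rescaled l c).
Proof.
move=> l0 c0; have s : (size (rescaled l c) <= 4.*2.+3)%N by apply: size_poly.
have cn : compat 4 (dg l c) F (rescaled l c).
  apply/(compat_dg (hyper11 hF) s); split=> // i.
  by rewrite rescaledE mulfVK // expf_neq0.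
by split=> //; apply: compat_hyper hF s cn.
Qed.

Lemma rescaled_eq0 l c i : l != 0 -> c != 0 -> ((rescaled l c)`_i == 0) = (F`_i == 0).
Proof.
by move=> l0 c0; rewrite rescaledE !mulf_eq0 invr_eq0 !expf_eq0 (negbTE l0) (negbTE c0) !andbF orbF.
Qed.

(** The scales of x and of y are two free parameters, which normalize two coefficients to 1 by
    extracting roots. The set of exponents that occur is unchanged, and the case distinctions read
    it. *)
Lemma rescale i j : (i < j)%N -> F`_i != 0 -> F`_j != 0 -> exists G l c,
  [/\ compat 4 (dg l c) F G, hyperelliptic_poly 4 G, G`_i = 1 /\ G`_j = 1 &
      forall m, (G`_m == 0) = (F`_m == 0)].
Proof.
move=> ij Fi Fj; have [l l0 el] : exists2 l, l != 0 & l ^+ (j - i) = F`_j / F`_i.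
  by apply: root_ex; rewrite ?subn_gt0 // mulf_neq0 // invr_eq0.
have [c c0 ec] : exists2 c, c != 0 & c ^+ 2 = l ^+ i / F`_i.
  by apply: root_ex => //; rewrite mulf_neq0 ?invr_eq0 // expf_neq0.
have [cn hG] := rescaled_compat l0 c0; exists (rescaled l c), l, c; split=> //; last first.
  by move=> m; apply: rescaled_eq0.
rewrite !rescaledE ec mulfVK // divff ?expf_neq0 //; split=> //.
have -> : l ^+ j = l ^+ i * (F`_j / F`_i) by rewrite -el -exprD subnKC // ltnW.
by field; rewrite Fi Fj expf_neq0.
Qed.

End Rescale.

Section Diagonal.
Variable k : closedFieldType.
Hypotheses (two0 : 2 != 0 :> k) (three0 : 3 != 0 :> k) (five0 : 5 != 0 :> k).
Let g2 : (2 <= 4)%N := isT.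

Lemma prim_neq0 N (z : k) : N.-primitive_root z -> z != 0.
Proof.
move=> hz; have N0 := prim_order_gt0 hz; apply/eqP => z0.
by move/eqP: (prim_expr_order hz); rewrite z0 expr0n gtn_eqF // eq_sym oner_eq0.
Qed.

Lemma prim_root_opp1 : 2.-primitive_root (-1 : k).
Proof.
have [z hz] := prim_root_ex (isT : (0 < 2)%N) two0.
have := prim_expr_order hz; move/eqP; rewrite sqrf_eq1 => /orP[] /eqP ez; last by rewrite -ez.
by have := prim_order_dvd hz 1; rewrite ez expr1n eqxx.
Qed.

Section Fixed.
Variable F : {poly k}.
Hypothesis hF : hyperelliptic_poly 4 F.
Local Notation A := (curve_aut 4 F).
Local Notation iota := (hinv 4 F).
Implicit Types x y : A.

Lemma dg_order a b x N : a != 0 -> induces (dg a b) x -> N.-primitive_root b ->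
  (forall i, b ^+ i = 1 -> a ^+ i = 1) -> has_order x N.
Proof.
move=> a0 hx hb ab i; rewrite (prim_order_dvd hb); split.
  move=> xi; have := dgX i hx; rewrite xi => h1.
  by have [_ <-] := dg_inj hF (oner_neq0 k) (@induces_aut1 _ 4 F) h1.
by move=> /eqP bi; have := dgX i hx; rewrite bi ab // => h; apply: dg_eq h (@induces_aut1 _ 4 F).
Qed.

Lemma iota_dg x : induces (dg 1 (-1)) x -> x = iota.
Proof. by move=> h; apply: dg_eq h (@induces_iota _ _ F). Qed.

Lemma one_dg x : induces (dg 1 1) x -> x = 1%g.
Proof. by move=> h; apply: dg_eq h (@induces_aut1 _ 4 F). Qed.

Lemma trivial_outcome : (forall x, x = 1%g \/ x = iota) -> outcome F.
Proof.
move=> tr; apply: Out1; apply: (realize_self hF) => //.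
have [gT [w [h [h' [hM hK h'K hz ow]]]]] := aut_model two0 hF.
apply: (@model_cyclic _ _ _ _ _ _ hM hK h'K hz (hinvC two0 g2 hF) ow (hinv 4 F) 1) => //.
  apply: (dg_order (oner_neq0 k) (@induces_iota _ _ F)) => [|i _]; last exact: expr1n.
  exact: prim_root_opp1.
by move=> a; case: (tr a) => ->; [exists 0%N; rewrite expg0|exists 1%N; rewrite expg1].
Qed.

Hypothesis fx : fixes two0 hF (Some 0) None.

Lemma fixes_dg x : exists a b, [/\ induces (dg a b) x, a != 0, b != 0 &
    forall i, F`_i * a ^+ i = b ^+ 2 * F`_i].
Proof. by have [h1 h2] := fx x; apply: (dg_of h1 h2). Qed.

Lemma coef_exp (a b : k) i : F`_i * a ^+ i = b ^+ 2 * F`_i -> F`_i != 0 -> a ^+ i = b ^+ 2.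
Proof. by move=> e n; apply: (mulfI n); rewrite e mulrC. Qed.

(** Exponent 1 forces a = b^2, and exponent i + 1 then says b^(2i) = 1. So automorphisms correspond
    to certain roots of unity b, and the two conditions on [m] identify them as the 2m-th ones. *)
Lemma cyclic_case m : (0 < m)%N -> (m.*2)%:R != 0 :> k -> F`_0 = 0 -> F`_1 != 0 ->
  (forall i, F`_i.+1 != 0 -> (m %| i)%N) ->
  (forall b : k, b != 0 -> (forall i, F`_i.+1 != 0 -> b ^+ i.*2 = 1) -> b ^+ m.*2 = 1) ->
  isog_to A (Zp m.*2) /\ quotient_isog_to iota (Zp m).
Proof.
move=> m0 mk F0 F1 div bnd; have [z hz] := prim_root_ex (etrans (double_gt0 m) m0) mk.
have z0 : z != 0 by apply: prim_neq0 hz.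
have zm := prim_expr_order hz.
have [s hs] : exists s : A, induces (dg (z ^+ 2) z) s.
  apply: dg_ex => // [|[|i]]; rewrite ?expf_neq0 ?F0 ?mul0r ?mulr0 //.
  have [->|n] := eqVneq F`_i.+1 0; first by rewrite mulr0 mul0r.
  rewrite mulrC; congr (_ * _); case/dvdnP: (div _ n) => q ->.
  by rewrite -exprM mulnS exprD [(q * m)%N]mulnC mulnA mul2n exprM zm expr1n mulr1.
have [gT [w [h [h' [hM hK h'K hz' ow]]]]] := aut_model two0 hF.
apply: (@model_cyclic _ _ _ _ _ _ hM hK h'K hz' (hinvC two0 g2 hF) ow s m) => //.
  apply: (dg_order _ hs hz); rewrite ?expf_neq0 // => i zi.
  by rewrite -exprM mulnC exprM zi expr1n.
move=> x; have [a [b [hx a0 b0 e]]] := fixes_dg x.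
have ab : a = b ^+ 2 by rewrite -(coef_exp (e 1%N) F1).
have /(prim_rootP hz)[j bj] : b ^+ m.*2 = 1.
  apply: bnd => // i n; have := coef_exp (e i.+1) n.
  rewrite exprS ab -[_ ^+ i]exprM mul2n => E.
  by apply: (mulfI (expf_neq0 2 b0)); rewrite E mulr1.
exists j; apply: dg_eq hx _; have := dgX j hs; rewrite ab bj.
by rewrite -!exprM ![(2 * _)%N]mulnC.
Qed.

Lemma expr_gcd (x : k) m n : x ^+ m = 1 -> x ^+ n = 1 -> x ^+ gcdn m n = 1.
Proof.
case: (posnP n) => [->|n0]; first by rewrite gcdn0.
move=> xm /(prim_order_exists n0)[d hd dn]; apply/eqP.
by rewrite -(prim_order_dvd hd) dvdn_gcd dn andbT (prim_order_dvd hd) xm.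
Qed.

Lemma coef_in (s : seq nat) : all (fun i => F`_i == 0) s -> forall i, F`_i != 0 -> i \notin s.
Proof. by move/allP=> h i; apply: contra => /h. Qed.

Lemma coef_ex (s : seq nat) : ~~ all (fun i => F`_i == 0) s -> exists2 i, i \in s & F`_i != 0.
Proof. by case/allPn => i; exists i. Qed.

Lemma no_swap a b x : a != 0 -> induces (an a b) x -> False.
Proof. by move=> a0 hx; have [c [d [hx' c0 _ _]]] := fixes_dg x; apply: dg_an c0 hx' hx. Qed.

End Fixed.
End Diagonal.

(** * The pair is fixed pointwise *)

Section Fixed.
Variable k : closedFieldType.
Hypotheses (two0 : 2 != 0 :> k) (three0 : 3 != 0 :> k) (five0 : 5 != 0 :> k).
Let g2 : (2 <= 4)%N := isT.
Variable F : {poly k}.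
Hypothesis hF : hyperelliptic_poly 4 F.
Local Notation A := (curve_aut 4 F).
Local Notation iota := (hinv 4 F).
Implicit Types x y : A.
Hypothesis fx : fixes two0 hF (Some 0) None.

Lemma natr_neq0 a b c : (2 ^ a * 3 ^ b * 5 ^ c)%:R != 0 :> k.
Proof. by rewrite !natrM !natrX !mulf_neq0 // expf_neq0. Qed.

(** In [cyclic_case], m is the gcd of the i - 1 for the exponents i that occur. The exponent 10
    contributes 9, so m is 9, 3 or 1. *)
Lemma fixed_10_1 : F`_0 = 0 -> F`_1 = 1 -> F`_10 = 1 -> outcome F.
Proof.
move=> F0 F1 F10; have F1n : F`_1 != 0 by rewrite F1 oner_neq0.
have F10n : F`_10 != 0 by rewrite F10 oner_neq0.
have [a9|/coef_ex[i9 i9s Fi9]] := boolP (all (fun i => F`_i == 0) [:: 2; 3; 4; 5; 6; 7; 8; 9]%N).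
  apply: Out9; apply: (realize_self hF).
    move: a9 => /and5P[/eqP F2 /eqP F3 /eqP F4 /eqP F5 /and5P[/eqP F6 /eqP F7 /eqP F8 /eqP F9 _]].
    apply/polyP => i; rewrite !coefE; do 11 (case: i => [|i] //=; rewrite ?addr0 ?add0r //).
    by rewrite (hyper_coef hF).
  apply: (@cyclic_case _ two0 _ hF fx 9) => //; first exact: (natr_neq0 1 2 0).
    move=> i hi; have := hyper_bound hF hi; have := coef_in a9 hi; clear.
    by do 11 (case: i => [|i] //).
  by move=> b b0 /(_ 9%N F10n).
have [a3|/coef_ex[i3 i3s Fi3]] := boolP (all (fun i => F`_i == 0) [:: 2; 3; 5; 6; 8; 9]%N).
  apply: Out3; apply: (realize_self hF).
    move: a3 => /and5P[/eqP F2 /eqP F3 /eqP F5 /eqP F6 /and3P[/eqP F8 /eqP F9 _]].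
    exists F`_7, F`_4; apply/polyP => i; rewrite !coefE.
    do 11 (case: i => [|i] //=; rewrite ?(mulr0, mulr1, addr0, add0r) //).
    by rewrite (hyper_coef hF).
  apply: (@cyclic_case _ two0 _ hF fx 3) => //; first exact: (natr_neq0 1 1 0).
    move=> i hi; have := hyper_bound hF hi; have := coef_in a3 hi; clear.
    by do 11 (case: i => [|i] //).
  move=> b b0 h; have h9 := h 9%N F10n.
  have : i9 = 4%N \/ i9 = 7%N.
    have [->|/eqP/negbTE n4] := i9 =P 4%N; first by left.
    have [->|/eqP/negbTE n7] := i9 =P 7%N; first by right.
    by move: i9s (coef_in a3 Fi9); rewrite !inE n4 n7 /= => ->.
  case=> e; rewrite e in Fi9; first exact: (h 3%N Fi9).
  exact: (expr_gcd (h 6%N Fi9) h9).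
apply: Out1; apply: (realize_self hF) => //.
apply: (@cyclic_case _ two0 _ hF fx 1) => // b b0 h; have h9 := h 9%N F10n.
move: i3s; rewrite !inE => /or4P[|||/or3P[]] /eqP e; rewrite e in Fi3;
  first [exact: (expr_gcd (h 1%N Fi3) h9) | exact: (expr_gcd (h 2%N Fi3) h9) |
  exact: (expr_gcd (h 4%N Fi3) h9) | exact: (expr_gcd (h 5%N Fi3) h9) |
  exact: (expr_gcd (h 7%N Fi3) h9) | exact: (expr_gcd (h 8%N Fi3) h9)].
Qed.

(** The exponent 9 contributes 8, so the gcd of the i - 1 divides 8. If it is 8 or 4, only the
    exponents 1, 5, 9 occur and x |-> 1/x is an automorphism, contrary to [fx]; there remain 2 and
    1. *)
Lemma fixed_9_1 : F`_0 = 0 -> F`_10 = 0 -> F`_1 = 1 -> F`_9 = 1 -> outcome F.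
Proof.
move=> F0 F10 F1 F9; have F1n : F`_1 != 0 by rewrite F1 oner_neq0.
have F9n : F`_9 != 0 by rewrite F9 oner_neq0.
have [a4|/coef_ex[i4 i4s Fi4]] := boolP (all (fun i => F`_i == 0) [:: 2; 3; 4; 6; 7; 8]%N).
  move: a4 => /and5P[/eqP F2 /eqP F3 /eqP F4 /eqP F6 /and3P[/eqP F7 /eqP F8 _]].
  have [t ht] : exists t : A, induces (an 1 1) t.
    apply: an_ex; rewrite ?oner_neq0 // => i; rewrite !expr1n mulr1 mul1r.
    by do 11 (case: i => [|i]; rewrite ?F0 ?F1 ?F2 ?F3 ?F4 ?F6 ?F7 ?F8 ?F9 ?F10 //).
  by case: (no_swap fx (oner_neq0 k) ht).
have [a2|/coef_ex[i2 i2s Fi2]] := boolP (all (fun i => F`_i == 0) [:: 2; 4; 6; 8]%N).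
  apply: Out22; apply: (realize_self hF).
    move: a2 => /and5P[/eqP F2 /eqP F4 /eqP F6 /eqP F8 _].
    exists F`_7, F`_5, F`_3; apply/polyP => i; rewrite !coefE.
    do 11 (case: i => [|i] //=; rewrite ?(mulr0, mulr1, addr0, add0r) //).
    by rewrite (hyper_coef hF).
  apply: (@cyclic_case _ two0 _ hF fx 2) => //; first exact: (natr_neq0 2 0 0).
    move=> i hi; have := hyper_bound hF hi; have := coef_in a2 hi.
    have : i.+1 != 10%N by apply: contraNneq hi => ->; rewrite F10.
    by clear; do 11 (case: i => [|i] //).
  move=> b b0 h; have h8 := h 8%N F9n.
  have : i4 = 3%N \/ i4 = 7%N.
    have [->|/eqP/negbTE n4] := i4 =P 3%N; first by left.
    have [->|/eqP/negbTE n7] := i4 =P 7%N; first by right.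
    by move: i4s (coef_in a2 Fi4); rewrite !inE n4 n7 /= => ->.
  case=> e; rewrite e in Fi4; first exact: (h 2%N Fi4).
  exact: (expr_gcd (h 6%N Fi4) h8).
apply: Out1; apply: (realize_self hF) => //.
apply: (@cyclic_case _ two0 _ hF fx 1) => // b b0 h; have h8 := h 8%N F9n.
move: i2s; rewrite !inE => /or4P[] /eqP e; rewrite e in Fi2;
  first [exact: (expr_gcd (h 1%N Fi2) h8) | exact: (expr_gcd (h 3%N Fi2) h8) |
  exact: (expr_gcd (h 5%N Fi2) h8) | exact: (expr_gcd (h 7%N Fi2) h8)].
Qed.

(** Exponent 0 gives b^2 = 1, so a^i = 1 for every exponent i that occurs. If these are among 0, 5,
    10, then x |-> 1/x is an automorphism, contrary to [fx]. Otherwise their gcd is 2 or 1, and a is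
    1 or -1 in the first case. *)
Lemma fixed_10_0 : F`_0 = 1 -> F`_10 = 1 -> outcome F.
Proof.
move=> F0 F10; have F0n : F`_0 != 0 by rewrite F0 oner_neq0.
have F10n : F`_10 != 0 by rewrite F10 oner_neq0.
have [a4|/coef_ex[j js Fj]] := boolP (all (fun i => F`_i == 0) [:: 1; 2; 3; 4; 6; 7; 8; 9]%N).
  move: a4 => /and5P[/eqP F1 /eqP F2 /eqP F3 /eqP F4 /and5P[/eqP F6 /eqP F7 /eqP F8 /eqP F9 _]].
  have [t ht] : exists t : A, induces (an 1 1) t.
    apply: an_ex; rewrite ?oner_neq0 // => i; rewrite !expr1n mulr1 mul1r.
    by do 11 (case: i => [|i]; rewrite ?F0 ?F1 ?F2 ?F3 ?F4 ?F6 ?F7 ?F8 ?F9 ?F10 //).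
  by case: (no_swap fx (oner_neq0 k) ht).
have dgE x : exists a b, [/\ induces (dg a b) x, a != 0, b == 1 \/ b == -1 &
    forall i, F`_i != 0 -> a ^+ i = 1].
  have [a [b [hx a0 b0 e]]] := fixes_dg fx x; have b2 := coef_exp (e 0%N) F0n.
  exists a, b; split=> // [|i n]; last by rewrite (coef_exp (e i) n) -b2 expr0.
  by apply/orP; rewrite -sqrf_eq1 -b2 expr0.
have pm x a b : induces (dg a b) x -> a = 1 -> b == 1 \/ b == -1 -> x = 1%g \/ x = iota.
  move=> hx a1 [] /eqP eb; rewrite a1 eb in hx; first by left; apply: one_dg hx.
  by right; apply: iota_dg hx.
have [a2|/coef_ex[i is_ Fi]] := boolP (all (fun i => F`_i == 0) [:: 1; 3; 5; 7; 9]%N); last first.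
  apply: trivial_outcome => // x; have [a [b [hx a0 b1 h]]] := dgE x.
  apply: (pm x a b) => //; rewrite -(expr1 a).
  have hi := expr_gcd (h 10%N F10n) (h i Fi); have hj := expr_gcd (h 10%N F10n) (h j Fj).
  move: is_ hi; rewrite !inE => /or4P[/eqP->|/eqP->|/eqP-> h5|/orP[] /eqP->] //.
  have := expr_gcd h5 hj; move: js; rewrite !inE.
  by move=> /or4P[/eqP->|/eqP->|/eqP->|/or4P[/eqP->|/eqP->|/eqP->|/orP[] /eqP->]].
move: (a2) => /and5P[/eqP F1 /eqP F3 /eqP F5 /eqP F7 /andP[/eqP F9 _]].
apply: Out21; apply: (realize_self hF).
  exists F`_8, F`_6, F`_4, F`_2; apply/polyP => i; rewrite !coefE.
  do 11 (case: i => [|i] //=; rewrite ?(mulr0, mulr1, addr0, add0r) //).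
  by rewrite (hyper_coef hF).
have [s hs] : exists s : A, induces (dg (-1) 1) s.
  apply: dg_ex; rewrite ?oppr_eq0 ?oner_neq0 // => i; rewrite expr1n mul1r.
  have [->|n] := eqVneq F`_i 0; first by rewrite mul0r.
  suff : ~~ odd i by rewrite -signr_odd => /negbTE->; rewrite mulr1.
  have := hyper_bound hF n; have := coef_in a2 n.
  by clear; do 11 (case: i => [|i] //).
have ss : (s * s = 1)%g.
  by apply: one_dg; have := dgM hs hs; rewrite mulrNN !mulr1.
have m1 : (-1 : k) <> 1.
  by move/eqP; rewrite -subr_eq0 -opprD oppr_eq0 -[1 + 1]/(2%:R) (negbTE two0).
have [gT [w [h [h' [hM hK h'K hz ow]]]]] := aut_model two0 hF.
apply: (@model_Klein _ _ _ _ _ _ hM hK h'K hz (hinvC two0 g2 hF) ow s ss).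
- move=> s1; rewrite s1 in hs.
  by have [/esym/m1] := dg_inj hF (oner_neq0 k) (@induces_aut1 _ 4 F) hs.
- move=> s1; rewrite s1 in hs.
  by have [/esym/m1] := dg_inj hF (oner_neq0 k) (@induces_iota _ 4 F) hs.
move=> x; have [a [b [hx a0 b1 hc]]] := dgE x.
have : a ^+ 2 == 1.
  have hj := hc j Fj; have h10 := hc 10%N F10n; have := expr_gcd h10 hj.
  move: js (coef_in a2 Fj); rewrite !inE =>
    /or4P[/eqP->|/eqP->|/eqP->|/or4P[/eqP->|/eqP->|/eqP->|/orP[] /eqP->]] //= _ ->;
  by rewrite eqxx.
rewrite sqrf_eq1 => /orP[] /eqP ea.
  by case: (pm x a b hx ea b1) => ->; [left|right; left].
right; right; have xs : (x * s)%g = 1%g \/ (x * s)%g = iota.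
  apply: (pm _ (a * -1) (b * 1)); first exact: dgM hx hs.
    by rewrite ea mulrNN mulr1.
  by rewrite mulr1.
have xE : x = (x * s * s)%g by rewrite -mulgA ss mulg1.
by case: xs => e; [left|right]; rewrite xE e ?mul1g // hinvC.
Qed.

End Fixed.

Section FixedPair.
Variable k : closedFieldType.
Hypotheses (two0 : 2 != 0 :> k) (three0 : 3 != 0 :> k) (five0 : 5 != 0 :> k).
Let g2 : (2 <= 4)%N := isT.
Implicit Types f F G : {poly k}.

Lemma zero_at_0 F : hyperelliptic_poly 4 F -> form_zero 4 F (Some 0) = (F`_0 == 0).
Proof. by move=> hF; rewrite form_zero_aff ?(hyper11 hF) // /root horner_coef0. Qed.

Lemma mob_act_dg (a b : k) : a != 0 ->
  mob_act (dg a b) (Some 0) = Some 0 /\ mob_act (dg a b) None = None.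
Proof.
move=> a0; rewrite /mob_act /mX /mZ /pnorm /= !mulr0 !mulr1 !add0r addr0.
by rewrite oner_eq0 eqxx mul0r.
Qed.

Lemma fixed_normal F (hF : hyperelliptic_poly 4 F) : fixes two0 hF (Some 0) None ->
  (F`_0 = 0 \/ F`_10 != 0) -> outcome F.
Proof.
move=> fx h; have sub i j (ij : (i < j)%N) : F`_i != 0 -> F`_j != 0 ->
    (forall G (hG : hyperelliptic_poly 4 G), fixes two0 hG (Some 0) None -> G`_i = 1 ->
      G`_j = 1 -> (forall m, (G`_m == 0) = (F`_m == 0)) -> outcome G) -> outcome F.
  move=> Fi Fj W; have [G [l [c [cn hG [Gi Gj] e]]]] := rescale hF ij Fi Fj.
  have l0 : l != 0 by have [+ _ _] := cn; rewrite /mdet /= mulr1 mulr0 subr0.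
  apply: (outcome_compat two0 hF hG cn); apply: (W G hG) => //.
  by have := @fixes_compat _ two0 _ _ _ hF hG _ _ cn fx; have [-> ->] := mob_act_dg c l0.
have [F0|F0] := eqVneq F`_0 0; last first.
  have F10 : F`_10 != 0 by case: h => // e; rewrite e eqxx in F0.
  by apply: (sub 0%N 10%N) => // G hG fG G0 G10 _; apply: fixed_10_0 fG _ _.
have F1 := hyper_low hF F0.
have [F10|F10] := eqVneq F`_10 0; last first.
  apply: (sub 1%N 10%N) => // G hG fG G1 G10 e; apply: fixed_10_1 fG _ _ _ => //.
  by apply/eqP; rewrite e F0.
have F9 := hyper_high hF F10.
apply: (sub 1%N 9%N) => // G hG fG G1 G10 e; apply: fixed_9_1 fG _ _ _ _ => //;
  by apply/eqP; rewrite e ?F0 ?F10.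
Qed.

Lemma fixed_outcome f (hf : hyperelliptic_poly 4 f) t1 t2 : t1 != t2 ->
  fixes two0 hf t1 t2 -> outcome f.
Proof.
move=> t12 fx; have fx' : fixes two0 hf t2 t1 by move=> x; have [] := fx x.
(* If just one point of the pair is a branch point, it is sent to 0. This excludes F_0 nonzero with
   F_10 = 0. *)
wlog h : t1 t2 t12 fx fx' / form_zero 4 f t1 || ~~ form_zero 4 f t2.
  move=> W; case: (boolP (form_zero 4 f t1)) => z1; first by apply: (W t1 t2) => //; rewrite z1.
  by apply: (W t2 t1) => //; [rewrite eq_sym | rewrite z1 orbT].
have [m dm [m1 m2]] := mob_act_move t12.
have [F [n [hF cn nE]]] := change_coord hf dm.
apply: (outcome_compat two0 hf hF cn); apply: (@fixed_normal F hF).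
  by have := @fixes_compat _ two0 _ _ _ hf hF _ _ cn fx; rewrite !nE m1 m2.
move: h; rewrite -!(compat_zero _ cn) !nE m1 m2 (zero_at_0 hF) form_zero_inf.
by case/orP => [/eqP|]; [left|right].
Qed.

End FixedPair.

Lemma sqr_opp1_neq0 (k : fieldType) (i : k) : i ^+ 2 = -1 -> i != 0.
Proof.
by apply: contra_eqN => /eqP->; rewrite expr0n eq_sym oppr_eq0 oner_eq0.
Qed.

(** * The pair is interchanged by some automorphism *)

Section Swap.
Variable k : closedFieldType.
Hypotheses (two0 : 2 != 0 :> k) (three0 : 3 != 0 :> k) (five0 : 5 != 0 :> k).
Let g2 : (2 <= 4)%N := isT.

Lemma neq_opp1 : (1 : k) <> -1.
Proof. by move/eqP; rewrite -subr_eq0 opprK -[1 + 1]/(2%:R) (negbTE two0). Qed.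

Section Curve.
Variable F : {poly k}.
Hypothesis hF : hyperelliptic_poly 4 F.
Local Notation A := (curve_aut 4 F).
Local Notation iota := (hinv 4 F).
Implicit Types x y s t : A.

Lemma hinv_order : has_order (hinv 4 F) 2.
Proof. exact: (dg_order hF (oner_neq0 k) (@induces_iota _ _ F) (prim_root_opp1 two0) (fun i _ => expr1n _ i)). Qed.

Lemma order4 x : (x * x)%g = iota -> has_order x 4.
Proof.
move=> xx i; have ii : (iota * iota)%g = 1%g by apply: hinvV.
have x2 : (x ^+ 2 = iota)%g by rewrite expgS expg1.
have x4 : (x ^+ 4 = 1)%g by rewrite (expgM x 2 2) x2 expgS expg1.
split=> [e|/dvdnP[q ->]]; last by rewrite mulnC expgM x4 expg1n.
have : (2 %| i)%N by apply/hinv_order; rewrite -x2 -expgM mulnC expgM e expg1n.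
case/dvdnP=> q iq; move: e; rewrite iq mulnC expgM x2 => /hinv_order.
by rewrite -[4%N]/(2 * 2)%N dvdn_pmul2l.
Qed.

Hypothesis mx : mixes two0 hF (Some 0) None.

Lemma mixes_cases x :
  (exists a b, [/\ induces (dg a b) x, a != 0, b != 0 &
    forall i, F`_i * a ^+ i = b ^+ 2 * F`_i]) \/
  (exists a b, [/\ induces (an a b) x, a != 0, b != 0 &
    forall i, (i <= 10)%N -> F`_(10 - i) * a ^+ (10 - i) = b ^+ 2 * F`_i]).
Proof. by case: (mx x) => -[h1 h2]; [left; apply: (dg_of h1 h2) | right; apply: (an_of h1 h2)]. Qed.

(** Multiplying a swap by [t] gives a diagonal automorphism, so the swaps form one coset of the
    diagonal subgroup. *)
Lemma cover_swap d (t s : A) : d != 0 -> induces (an 1 d) t ->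
  (forall x a b, induces (dg a b) x -> a != 0 -> b != 0 ->
    (forall i, F`_i != 0 -> a ^+ i = b ^+ 2) -> exists i, x = (s ^+ i)%g) ->
  forall x, exists i, x = (s ^+ i)%g \/ x = (s ^+ i * t^-1)%g.
Proof.
move=> d0 ht cov x.
have dgc y a b : induces (dg a b) y -> a != 0 -> exists i, y = (s ^+ i)%g.
  move=> hy a0; case: (mixes_cases y) => -[a' [b' [hy' a0' b0' e]]];
    last by case: (dg_an hF a0 hy hy').
  by apply: (cov y a' b' hy') => // i; apply: coef_exp.
case: (mixes_cases x) => -[a [b [hx a0 b0 _]]].
  by have [i ->] := dgc x a b hx a0; exists i; left.
have [i e] := dgc _ _ _ (anM (oner_neq0 k) hx ht) (mulf_neq0 a0 (invr_neq0 (oner_neq0 k))).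
by exists i; right; rewrite -e mulgK.
Qed.

Lemma pal_swap d : d != 0 -> (forall i, (i <= 10)%N -> F`_(10 - i) = d ^+ 2 * F`_i) ->
  exists t : A, induces (an 1 d) t.
Proof. by move=> d0 e; apply: an_ex; rewrite ?oner_neq0 // => i le; rewrite expr1n mulr1 e. Qed.

Lemma an_sqr d t : induces (an 1 d) t -> induces (dg 1 (d ^+ 2)) (t * t)%g.
Proof.
by move=> h; have := anM (oner_neq0 k) h h; rewrite expr1n !divr1.
Qed.

Lemma an_notin d t s a b i : a != 0 -> induces (an 1 d) t -> induces (dg a b) s ->
  t <> (s ^+ i)%g.
Proof.
move=> a0 ht hs e; rewrite e in ht.
exact: (dg_an hF (expf_neq0 i a0) (dgX i hs) ht).
Qed.

Lemma swap_x9 : F`_0 = 0 -> F`_1 = 1 -> F`_9 = 1 -> F`_10 = 0 ->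
  all (fun i => F`_i == 0) [:: 2; 3; 4; 5; 6; 7; 8]%N -> outcome F.
Proof.
move=> F0 F1 F9 F10 /and5P[/eqP F2 /eqP F3 /eqP F4 /eqP F5 /and4P[/eqP F6 /eqP F7 /eqP F8 _]].
have F1n : F`_1 != 0 by rewrite F1 oner_neq0.
have F9n : F`_9 != 0 by rewrite F9 oner_neq0.
have [z hz] := prim_root_ex (isT : (0 < 16)%N) (natr_neq0 two0 three0 five0 4 0 0).
have z0 := prim_neq0 hz; have z16 := prim_expr_order hz.
have [s hs] : exists s : A, induces (dg (z ^+ 2) z) s.
  apply: dg_ex => // [|i]; first exact: expf_neq0.
  do 10 (case: i => [|i]; rewrite ?F0 ?F1 ?F2 ?F3 ?F4 ?F5 ?F6 ?F7 ?F8 ?F9 ?mul0r ?mulr0 ?mulr1 ?mul1r //).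
    by rewrite -exprM (_ : (2 * 9 = 16 + 2)%N) // exprD z16 mul1r.
  by case: i => [|i]; rewrite ?F10 ?(hyper_coef hF) ?mul0r ?mulr0.
have [t ht] : exists t : A, induces (an 1 1) t.
  apply: pal_swap; rewrite ?oner_neq0 // => i; rewrite expr1n mul1r.
  by do 11 (case: i => [|i]; rewrite ?F0 ?F1 ?F2 ?F3 ?F4 ?F5 ?F6 ?F7 ?F8 ?F9 ?F10 //).
have tt : (t * t = 1)%g by apply: one_dg; have := an_sqr ht; rewrite expr1n.
have tV : (t^-1 = t)%g by apply: (mulgI t); rewrite mulgV tt.
have z8 : z ^+ 8 = -1.
  have : (z ^+ 8) ^+ 2 == 1 by rewrite -exprM z16.
  by rewrite sqrf_eq1 -(prim_order_dvd hz) /= => /eqP.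
apply: Out8; apply: (realize_self hF).
  apply/polyP => i; rewrite !coefE; do 11 (case: i => [|i] //=; rewrite ?addr0 ?add0r //).
  by rewrite (hyper_coef hF).
have [gT [w [h [h' [hM hK h'K hz' ow]]]]] := aut_model two0 hF.
apply: (@model_semidirect16 _ _ _ _ _ _ hM hK h'K hz' (hinvC two0 g2 hF) ow s t) => //.
- apply: (dg_order hF _ hs hz); first exact: expf_neq0.
  by move=> i zi; rewrite -exprM mulnC exprM zi expr1n.
- by apply: iota_dg; have := dgX 8 hs; rewrite z8 -exprM z16.
(* The parameters are (z^2, z) for s t and (z^-14, z^7/z^70) for t s^7; they agree because z^16 =
   1. *)
- have h1 := dg_anM hs ht.
  have h2 := an_dgM (expf_neq0 7 (expf_neq0 2 z0)) ht (dgX 7 hs).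
  apply: an_eq h1 _; have := h2; congr (induces (an _ _) _).
    by rewrite mul1r mulr1 -exprM; apply: (mulIf (expf_neq0 14 z0));
      rewrite mulVf ?expf_neq0 // -exprD z16.
  rewrite mul1r mulr1 -!exprM; apply: (mulIf (expf_neq0 70 z0)); rewrite divfK ?expf_neq0 //.
  by rewrite -exprS -[71%N]/(7 + 16 * 4)%N exprD exprM z16 expr1n mulr1.
- by move=> i; apply: an_notin ht hs; apply: expf_neq0.
move=> x; rewrite -tV; apply: (cover_swap (oner_neq0 k) ht) => y a b hy a0 b0 e.
have ab : a = b ^+ 2 by rewrite -(e 1%N).
have b16 : b ^+ 16 = 1.
  apply: (mulIf (expf_neq0 2 b0)); rewrite -exprD mul1r -(e 9%N F9n) ab -exprM //.
have [j bj] := prim_rootP hz b16; exists j; apply: dg_eq hy _; have := dgX j hs.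
by rewrite ab bj -!exprM [(2 * j)%N]mulnC.
Qed.

Lemma swap_x9_x5 : F`_0 = 0 -> F`_1 = 1 -> F`_5 != 0 -> F`_9 = 1 -> F`_10 = 0 ->
  all (fun i => F`_i == 0) [:: 2; 3; 4; 6; 7; 8]%N -> outcome F.
Proof.
move=> F0 F1 F5 F9 F10 /and5P[/eqP F2 /eqP F3 /eqP F4 /eqP F6 /and3P[/eqP F7 /eqP F8 _]].
have F1n : F`_1 != 0 by rewrite F1 oner_neq0.
have F9n : F`_9 != 0 by rewrite F9 oner_neq0.
have [z hz] := prim_root_ex (isT : (0 < 8)%N) (natr_neq0 two0 three0 five0 3 0 0).
have z0 := prim_neq0 hz; have z8 := prim_expr_order hz.
have [s hs] : exists s : A, induces (dg (z ^+ 2) z) s.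
  apply: dg_ex => // [|i]; first exact: expf_neq0.
  rewrite -exprM; do 5 (case: i => [|i];
    rewrite ?F0 ?F1 ?F2 ?F3 ?F4 ?mul0r ?mulr0 ?mulr1 ?mul1r //).
  case: i => [|i]; first by rewrite (_ : (2 * 5 = 8 + 2)%N) // exprD z8 mul1r mulrC.
  do 4 (case: i => [|i]; rewrite ?F6 ?F7 ?F8 ?F9 ?mul0r ?mulr0 ?mulr1 ?mul1r //).
    by rewrite (_ : (2 * 9 = 8 * 2 + 2)%N) // exprD exprM z8 expr1n mul1r.
  by case: i => [|i]; rewrite ?F10 ?(hyper_coef hF) ?mul0r ?mulr0.
have [t ht] : exists t : A, induces (an 1 1) t.
  apply: pal_swap; rewrite ?oner_neq0 // => i; rewrite expr1n mul1r.
  by do 11 (case: i => [|i]; rewrite ?F0 ?F1 ?F2 ?F3 ?F4 ?F6 ?F7 ?F8 ?F9 ?F10 //).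
have tt : (t * t = 1)%g by apply: one_dg; have := an_sqr ht; rewrite expr1n.
have tV : (t^-1 = t)%g by apply: (mulgI t); rewrite mulgV tt.
have z4 : z ^+ 4 = -1.
  have : (z ^+ 4) ^+ 2 == 1 by rewrite -exprM z8.
  by rewrite sqrf_eq1 -(prim_order_dvd hz) /= => /eqP.
apply: Out5; apply: (realize_self hF).
  exists F`_5; apply/polyP => i; rewrite !coefE.
  do 11 (case: i => [|i] //=; rewrite ?(mulr0, mulr1, addr0, add0r) //).
  by rewrite (hyper_coef hF).
have [gT [w [h [h' [hM hK h'K hz' ow]]]]] := aut_model two0 hF.
apply: (@model_dihedral _ _ _ _ _ _ hM hK h'K hz' (hinvC two0 g2 hF) ow s t 4) => //.
- apply: (dg_order hF _ hs hz); first exact: expf_neq0.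
  by move=> i zi; rewrite -exprM mulnC exprM zi expr1n.
- by apply: iota_dg; have := dgX 4 hs; rewrite z4 -exprM z8.
- have z2 := expf_neq0 2 z0; apply: an_eq (an_dgM z2 (dg_anM hs ht) hs) _.
  rewrite !mulr1 divff // -expr2 -exprM (_ : z ^+ (2 * 5) = z ^+ 2) ?divff //.
  by rewrite (_ : (2 * 5 = 8 + 2)%N) // exprD z8 mul1r.
- by move=> i; apply: an_notin ht hs; apply: expf_neq0.
move=> x; rewrite -tV; apply: (cover_swap (oner_neq0 k) ht) => y a b hy a0 b0 e.
have ab : a = b ^+ 2 by rewrite -(e 1%N).
have b8 : b ^+ 8 = 1.
  by apply: (mulIf (expf_neq0 2 b0)); rewrite -exprD mul1r -(e 5%N F5) ab -exprM.
have [j bj] := prim_rootP hz b8; exists j; apply: dg_eq hy _; have := dgX j hs.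
by rewrite ab bj -!exprM [(2 * j)%N]mulnC.
Qed.

Lemma sqrt_opp1 : exists i : k, i ^+ 2 = -1.
Proof. exact: sqrt_ex. Qed.

Lemma odd_diag (i : k) x (a b : k) : i ^+ 2 = -1 -> induces (dg (-1) i) x ->
  b ^+ 4 = 1 -> a = b ^+ 2 -> exists j, induces (dg a b) (x ^+ j)%g.
Proof.
move=> ii hx b4 ->; have i4 : 4.-primitive_root i.
  have [z hz] := prim_root_ex (isT : (0 < 4)%N) (natr_neq0 two0 three0 five0 2 0 0).
  have i41 : i ^+ 4 = 1 by rewrite (exprM i 2 2) ii sqrrN expr1n.
  have [d hd d4] := prim_order_exists (isT : (0 < 4)%N) i41.
  have : ~~ (d %| 2)%N by rewrite (prim_order_dvd hd) ii; apply/eqP => /esym/neq_opp1.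
  by case: d hd d4 => [|[|[|[|[|d]]]]] // hd; move/dvdn_leq => /(_ isT).
have [j bj] := prim_rootP i4 b4; exists j; have := dgX j hx.
by rewrite -ii bj -!exprM [(2 * j)%N]mulnC.
Qed.

Section Odd.
Hypotheses (F0 : F`_0 = 0) (F2 : F`_2 = 0) (F4 : F`_4 = 0) (F6 : F`_6 = 0).
Hypotheses (F8 : F`_8 = 0) (F10 : F`_10 = 0) (F9 : F`_9 = 1).

Lemma odd_ex : exists2 i : k, i ^+ 2 = -1 & exists s : A, induces (dg (-1) i) s.
Proof.
have [i ii] := sqrt_opp1; exists i => //.
have i0 := sqr_opp1_neq0 ii.
apply: dg_ex => // [|j]; first by rewrite oppr_eq0 oner_neq0.
rewrite ii; do 10 (case: j => [|j];
  first by rewrite ?F0 ?F2 ?F4 ?F6 ?F8 -signr_odd /= ?mul0r ?mulr0 // expr1 mulrC).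
by case: j => [|j]; rewrite ?F10 ?(hyper_coef hF) ?mul0r ?mulr0.
Qed.

(** The exponent 9 gives b^16 = 1; exponent 3 or 7 gives b^4 = 1 or b^12 = 1, and the gcd with 16 is
    4 either way. *)
Lemma odd_bound (a b : k) : F`_1 != 0 -> F`_3 != 0 \/ F`_7 != 0 -> b != 0 ->
  (forall i, F`_i != 0 -> a ^+ i = b ^+ 2) -> b ^+ 4 = 1 /\ a = b ^+ 2.
Proof.
move=> F1 F37 b0 e; have ab : a = b ^+ 2 by rewrite -(e 1%N F1).
split=> //; have div i : F`_i.+1 != 0 -> b ^+ (2 * i) = 1.
  move=> n; apply: (mulIf (expf_neq0 2 b0)).
  by rewrite -exprD mul1r -(e i.+1 n) ab -exprM mulnSr.
have F9n : F`_9 != 0 by rewrite F9 oner_neq0.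
have b16 := div 8%N F9n; case: F37 => n; first exact: (div 2%N n).
exact: (expr_gcd (div 6%N n) b16).
Qed.

Lemma swap_odd : F`_1 = 1 -> F`_3 = F`_7 -> F`_7 != 0 -> outcome F.
Proof.
move=> F1 F3 F7; have F1n : F`_1 != 0 by rewrite F1 oner_neq0.
have [i ii [s hs]] := odd_ex.
have [t ht] : exists t : A, induces (an 1 1) t.
  apply: pal_swap; rewrite ?oner_neq0 // => j; rewrite expr1n mul1r.
  by do 11 (case: j => [|j]; rewrite ?F0 ?F1 ?F2 ?F3 ?F4 ?F6 ?F8 ?F9 ?F10 //).
have tt : (t * t = 1)%g by apply: one_dg; have := an_sqr ht; rewrite expr1n.
have tV : (t^-1 = t)%g by apply: (mulgI t); rewrite mulgV tt.
have ss : (s * s = iota)%g by apply: iota_dg; have := dgM hs hs; rewrite mulrNN mulr1 -expr2 ii.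
have m0 : (-1 : k) != 0 by rewrite oppr_eq0 oner_neq0.
apply: Out41'; apply: (realize_self hF).
  exists F`_7, F`_5; apply/polyP => j; rewrite !coefE.
  do 11 (case: j => [|j] //=; rewrite ?(mulr0, mulr1, addr0, add0r) //).
  by rewrite (hyper_coef hF).
have [gT [w [h [h' [hM hK h'K hz' ow]]]]] := aut_model two0 hF.
suff [q1 q2] : isog_from ('D_8)%g A /\ quotient_isog_to iota ('D_4)%g.
  by split=> //; apply: quotient_isog_trans isog_dihedral4 q2.
apply: (@model_dihedral _ _ _ _ _ _ hM hK h'K hz' (hinvC two0 g2 hF) ow s t 2) => //.
- exact: order4.
- apply: an_eq (an_dgM m0 (dg_anM hs ht) hs) _.
  by rewrite !mulr1 divff // -expr2 ii -signr_odd expr1 divff.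
- by move=> j; apply: an_notin ht hs.
move=> x; rewrite -tV; apply: (cover_swap (oner_neq0 k) ht) => y a b hy a0 b0 e.
have [b4 ab] := odd_bound F1n (or_intror F7) b0 e.
by have [j hj] := odd_diag ii hs b4 ab; exists j; apply: dg_eq hy hj.
Qed.

(** Antisymmetry forces the factor of y in the swap to be a square root of -1. The swap then squares
    to the hyperelliptic involution rather than to 1, which makes the group quaternion instead of
    dihedral. *)
Lemma swap_odd_anti : F`_1 = -1 -> F`_3 = - F`_7 -> F`_5 = 0 -> F`_7 != 0 -> outcome F.
Proof.
move=> F1 F3 F5 F7; have F1n : F`_1 != 0 by rewrite F1 oppr_eq0 oner_neq0.
have [i ii [s hs]] := odd_ex.
have i0 := sqr_opp1_neq0 ii.
have [t ht] : exists t : A, induces (an 1 i) t.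
  apply: pal_swap => // j; rewrite ii mulN1r.
  by do 11 (case: j => [|j]; rewrite ?F0 ?F1 ?F2 ?F3 ?F4 ?F5 ?F6 ?F8 ?F9 ?F10 ?oppr0 ?opprK //).
have tt : (t * t = iota)%g by apply: iota_dg; have := an_sqr ht; rewrite ii.
have ss : (s * s = iota)%g by apply: iota_dg; have := dgM hs hs; rewrite mulrNN mulr1 -expr2 ii.
have m0 : (-1 : k) != 0 by rewrite oppr_eq0 oner_neq0.
apply: Out42; apply: (realize_self hF).
  exists F`_7; rewrite mulrDr mulr1.
  have -> : 'X * ('X^4 - 1) * ('X^4 + F`_7 *: 'X^2) + 'X * ('X^4 - 1) =
    'X^9 + F`_7 *: 'X^7 - F`_7 *: 'X^3 - 'X :> {poly k}.
    by rewrite -!mul_polyC; ring.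
  apply/polyP => j; rewrite !coefE.
  do 11 (case: j => [|j] //=; rewrite ?(mulr0, mulr1, subr0, sub0r, addr0, add0r, oppr0) //).
  by rewrite (hyper_coef hF).
have [gT [w [h [h' [hM hK h'K hz' ow]]]]] := aut_model two0 hF.
apply: (@model_quaternion _ _ _ _ _ _ hM hK h'K hz' (hinvC two0 g2 hF) ow s t) => //.
- exact: order4.
- apply: an_eq (an_dgM m0 (dg_anM hs ht) hs) _.
  rewrite !mulr1 divff // -expr2 ii -signr_odd expr1 mulN1r.
  by rewrite invrN1 mulrN1 opprK.
- by move=> j; apply: an_notin ht hs.
move=> x; have tV : (t^-1 = s ^+ 2 * t)%g.
  by apply: (mulIg t); rewrite mulVg -mulgA tt [(s ^+ 2)%g]ss hinvV.
have [j [] e] : exists j, x = (s ^+ j)%g \/ x = (s ^+ j * t^-1)%g.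
- apply: (cover_swap i0 ht) => y a b hy a0 b0 e.
  have [b4 ab] := odd_bound F1n (or_intror F7) b0 e.
  by have [j hj] := odd_diag ii hs b4 ab; exists j; apply: dg_eq hy hj.
- by exists j; left.
by exists (j + 2)%N; right; rewrite e tV mulgA expgD.
Qed.

End Odd.

Section Degree10.
Hypotheses (F0 : F`_0 = 1) (F10 : F`_10 = 1).
Let F0n : F`_0 != 0. Proof. by rewrite F0 oner_neq0. Qed.
Let F10n : F`_10 != 0. Proof. by rewrite F10 oner_neq0. Qed.

Lemma deg10_bound (a b : k) : (forall i, F`_i != 0 -> a ^+ i = b ^+ 2) ->
  (b = 1 \/ b = -1) /\ forall i, F`_i != 0 -> a ^+ i = 1.
Proof.
move=> e; have b2 : b ^+ 2 = 1 by rewrite -(e 0%N F0n) expr0.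
split=> [|i n]; last by rewrite e.
by move/eqP: b2; rewrite sqrf_eq1 => /orP[] /eqP; [left|right].
Qed.

(** No power of s = (z x, y) is the hyperelliptic involution, and z^5 = -1 gives s t s = t iota: [t]
    inverts [s] only up to [iota], which is the situation of [model_semidirect40]. *)
Lemma swap_x10 : all (fun i => F`_i == 0) [:: 1; 2; 3; 4; 5; 6; 7; 8; 9]%N -> outcome F.
Proof.
move=> /and5P[/eqP F1 /eqP F2 /eqP F3 /eqP F4 /and5P[/eqP F5 /eqP F6 /eqP F7 /eqP F8 /andP[/eqP F9 _]]].
have [z hz] := prim_root_ex (isT : (0 < 10)%N) (natr_neq0 two0 three0 five0 1 0 1).
have z0 := prim_neq0 hz; have z10 := prim_expr_order hz.
have [s hs] : exists s : A, induces (dg z 1) s.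
  apply: dg_ex => // [|i]; first exact: oner_neq0.
  rewrite expr1n mul1r.
  do 11 (case: i => [|i]; rewrite ?F0 ?F1 ?F2 ?F3 ?F4 ?F5 ?F6 ?F7 ?F8 ?F9 ?F10 ?z10 ?expr0 ?mul0r ?mul1r //).
  by rewrite (hyper_coef hF) ?mul0r.
have [t ht] : exists t : A, induces (an 1 1) t.
  apply: pal_swap; rewrite ?oner_neq0 // => i; rewrite expr1n mul1r.
  by do 11 (case: i => [|i]; rewrite ?F0 ?F1 ?F2 ?F3 ?F4 ?F5 ?F6 ?F7 ?F8 ?F9 ?F10 //).
have tt : (t * t = 1)%g by apply: one_dg; have := an_sqr ht; rewrite expr1n.
have z5 : z ^+ 5 = -1.
  have : (z ^+ 5) ^+ 2 == 1 by rewrite -exprM z10.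
  by rewrite sqrf_eq1 -(prim_order_dvd hz) /= => /eqP.
apply: Out10; apply: (realize_self hF).
  apply/polyP => i; rewrite !coefE; do 11 (case: i => [|i] //=; rewrite ?addr0 ?add0r //).
  by rewrite (hyper_coef hF).
have iotaN i : iota <> (s ^+ i)%g.
  move=> e; have := dgX i hs; rewrite -e expr1n => h.
  by have [_ /esym/neq_opp1] := dg_inj hF (oner_neq0 k) (@induces_iota _ 4 F) h.
have [gT [w [h [h' [hM hK h'K hz' ow]]]]] := aut_model two0 hF.
apply: (@model_semidirect40 _ _ _ _ _ _ hM hK h'K hz' (hinvC two0 g2 hF) ow s t) => //.
- move=> i; rewrite (prim_order_dvd hz); split.
    move=> si; have := dgX i hs; rewrite si => h1.
    by have [<- _] := dg_inj hF (oner_neq0 k) (@induces_aut1 _ 4 F) h1.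
  by move=> /eqP zi; have := dgX i hs; rewrite zi expr1n; apply: one_dg.
- apply: an_eq (an_dgM z0 (dg_anM hs ht) hs) _.
  rewrite !mulr1 divff // z5 mul1r invrN1.
  by have := an_dgM (oner_neq0 k) ht (@induces_iota _ 4 F); rewrite expr1n !divr1 mul1r.
- move=> i; split; first exact: an_notin ht hs.
  move=> e; rewrite e in ht.
  exact: (dg_an hF (mulf_neq0 (expf_neq0 i z0) (oner_neq0 k)) (dgM (dgX i hs) (@induces_iota _ 4 F)) ht).
have dgc y a b : induces (dg a b) y -> a != 0 ->
    (forall i, F`_i != 0 -> a ^+ i = b ^+ 2) -> exists i j, y = (s ^+ i * iota ^+ j)%g.
  move=> hy a0 e; have [b1 h1] := deg10_bound e.
  have [j aj] := prim_rootP hz (h1 10%N F10n); exists j; case: b1 => b1; [exists 0%N|exists 1%N].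
    by rewrite expg0 mulg1; apply: dg_eq hy _; have := dgX j hs; rewrite expr1n -aj b1.
  rewrite expg1; apply: dg_eq hy _; have := dgM (dgX j hs) (@induces_iota _ 4 F).
  by rewrite expr1n mulr1 mul1r -aj b1.
move=> x; case: (mixes_cases x) => -[a [b [hx a0 b0 e]]].
  have [i [j ->]] := dgc _ _ _ hx a0 (fun i => coef_exp (e i)).
  by exists i, j, 0%N; rewrite expg0 mulg1.
have hxt := anM (oner_neq0 k) hx ht; have a1 : a / 1 != 0 by rewrite divr1.
case: (mixes_cases (x * t)%g) => -[a' [b' [hy' a0' b0' e']]]; last by case: (dg_an hF a1 hxt hy').
have [i [j E]] := dgc _ _ _ hy' a0' (fun i => coef_exp (e' i)).
by exists i, j, 1%N; rewrite expg1 -E -mulgA tt mulg1.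
Qed.

Lemma swap_x10_x5 : F`_5 != 0 ->
  all (fun i => F`_i == 0) [:: 1; 2; 3; 4; 6; 7; 8; 9]%N -> outcome F.
Proof.
move=> F5 /and5P[/eqP F1 /eqP F2 /eqP F3 /eqP F4 /and5P[/eqP F6 /eqP F7 /eqP F8 /eqP F9 _]].
have [z hz] := prim_root_ex (isT : (0 < 5)%N) (natr_neq0 two0 three0 five0 0 0 1).
have z0 := prim_neq0 hz; have z5 := prim_expr_order hz.
have m0 : (-1 : k) != 0 by rewrite oppr_eq0 oner_neq0.
have [s hs] : exists s : A, induces (dg z (-1)) s.
  apply: dg_ex => // i; rewrite sqrrN expr1n mul1r.
  do 11 (case: i => [|i]; rewrite ?F1 ?F2 ?F3 ?F4 ?F6 ?F7 ?F8 ?F9 ?z5 ?expr0 ?mul0r ?mulr1 //).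
    by rewrite (exprM z 5 2) z5 expr1n mulr1.
  by rewrite (hyper_coef hF) ?mul0r.
have [t ht] : exists t : A, induces (an 1 1) t.
  apply: pal_swap; rewrite ?oner_neq0 // => i; rewrite expr1n mul1r.
  by do 11 (case: i => [|i]; rewrite ?F0 ?F1 ?F2 ?F3 ?F4 ?F6 ?F7 ?F8 ?F9 ?F10 //).
have tt : (t * t = 1)%g by apply: one_dg; have := an_sqr ht; rewrite expr1n.
have tV : (t^-1 = t)%g by apply: (mulgI t); rewrite mulgV tt.
apply: Out6; apply: (realize_self hF).
  exists F`_5; apply/polyP => i; rewrite !coefE.
  do 11 (case: i => [|i] //=; rewrite ?(mulr0, mulr1, addr0, add0r) //).
  by rewrite (hyper_coef hF).
have sgn i : ((-1 : k) ^+ i == 1) = (2 %| i)%N by rewrite -(prim_order_dvd (prim_root_opp1 two0)).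
have [gT [w [h [h' [hM hK h'K hz' ow]]]]] := aut_model two0 hF.
apply: (@model_dihedral _ _ _ _ _ _ hM hK h'K hz' (hinvC two0 g2 hF) ow s t 5) => //.
- move=> i; rewrite -[5.*2]/(5 * 2)%N Gauss_dvd // (prim_order_dvd hz) -sgn; split.
    move=> si; have := dgX i hs; rewrite si => h1.
    by have [<- <-] := dg_inj hF (oner_neq0 k) (@induces_aut1 _ 4 F) h1; rewrite eqxx.
  by move=> /andP[/eqP zi /eqP si]; have := dgX i hs; rewrite zi si; apply: one_dg.
- by apply: iota_dg; have := dgX 5 hs; rewrite z5 -signr_odd expr1.
- apply: an_eq (an_dgM z0 (dg_anM hs ht) hs) _.
  by rewrite !mulr1 divff // z5 divr1 mulrNN mulr1.
- by move=> i; apply: an_notin ht hs.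
move=> x; rewrite -tV; apply: (cover_swap (oner_neq0 k) ht) => y a b hy a0 b0 e.
have [b1 h1] := deg10_bound e.
have [j aj] := prim_rootP hz (h1 5%N F5).
(* Adding multiples of 5 to the exponent keeps [a] and changes the sign of the second parameter at
   will; [m] is chosen below by parity to match [b]. *)
have zE m : z ^+ (5 * m + j) = a by rewrite exprD exprM z5 expr1n mul1r -aj.
have sE m : induces (dg a ((-1) ^+ (5 * m + j))) (s ^+ (5 * m + j))%g.
  by have := dgX (5 * m + j) hs; rewrite zE.
have sO m : odd (5 * m + j) = odd m (+) odd j by rewrite oddD oddM.
case: b1 => b1; rewrite b1 in hy.
  exists (5 * j + j)%N; apply: dg_eq hy _; have := sE j.
  by rewrite -signr_odd sO addbb.
exists (5 * j.+1 + j)%N; apply: dg_eq hy _; have := sE j.+1.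
by rewrite -signr_odd sO /= addNb addbb expr1.
Qed.

(** The element of order 4 is the lift [r] of x |-> -1/x, whose square is the hyperelliptic
    involution since (-1)^5 = -1; the lifts of x |-> -x and x |-> 1/x are involutions. *)
Lemma swap_even : F`_2 = F`_8 -> F`_4 = F`_6 -> F`_6 != 0 \/ F`_8 != 0 ->
  all (fun i => F`_i == 0) [:: 1; 3; 5; 7; 9]%N -> outcome F.
Proof.
move=> F2 F4 F68 /and5P[/eqP F1 /eqP F3 /eqP F5 /eqP F7 /andP[/eqP F9 _]].
have m0 : (-1 : k) != 0 by rewrite oppr_eq0 oner_neq0.
have [r hr] : exists r : A, induces (an (-1) 1) r.
  apply: an_ex; rewrite ?oner_neq0 // => i le; rewrite expr1n mul1r -signr_odd oddB //.
  by move: le; do 11 (case: i => [|i];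
    rewrite ?F0 ?F1 ?F2 ?F3 ?F4 ?F5 ?F7 ?F9 ?F10 ?mul0r ?mulr1 //).
have [t ht] : exists t : A, induces (an 1 1) t.
  apply: pal_swap; rewrite ?oner_neq0 // => i; rewrite expr1n mul1r.
  by do 11 (case: i => [|i]; rewrite ?F0 ?F1 ?F2 ?F3 ?F4 ?F5 ?F7 ?F9 ?F10 //).
have tt : (t * t = 1)%g by apply: one_dg; have := an_sqr ht; rewrite expr1n.
have m5 : (-1 : k) ^+ 5 = -1 by rewrite -signr_odd expr1.
have rr : (r * r = iota)%g.
  by apply: iota_dg; have := anM m0 hr hr; rewrite divff // m5 invrN1 mulr1 mul1r.
have rt : induces (dg (-1) 1) (r * t)%g.
  by have := anM (oner_neq0 k) hr ht; rewrite expr1n !divr1 mulr1.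
have rtr : (r * t * r = t)%g.
  apply: an_eq ht; have := dg_anM rt hr.
  by rewrite mulrNN !mulr1.
have r2 : (r ^+ 2 = iota)%g by rewrite expgS expg1.
apply: Out41; apply: (realize_self hF).
  exists F`_8, F`_6; apply/polyP => i; rewrite !coefE.
  do 11 (case: i => [|i] //=; rewrite ?(mulr0, mulr1, addr0, add0r) //).
  by rewrite (hyper_coef hF).
have [gT [w [h [h' [hM hK h'K hz' ow]]]]] := aut_model two0 hF.
suff [q1 q2] : isog_from ('D_8)%g A /\ quotient_isog_to iota ('D_4)%g.
  by split=> //; apply: quotient_isog_trans isog_dihedral4 q2.
apply: (@model_dihedral _ _ _ _ _ _ hM hK h'K hz' (hinvC two0 g2 hF) ow r t 2) => //.
- exact: order4.
- move=> i e; have rtC : (r * t = t * r)%g by rewrite e -expgS -expgSr.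
  have := rt; rewrite rtC; have := anM m0 ht hr; rewrite m5 invrN1 mulr1 mul1r => h1 h2.
  by have [_ /esym/neq_opp1] := dg_inj hF m0 h1 h2.
have dgc y a b : induces (dg a b) y -> a != 0 ->
    (forall i, F`_i != 0 -> a ^+ i = b ^+ 2) -> exists i, y = (r ^+ i)%g \/ y = (r ^+ i * t)%g.
  move=> hy a0 e; have [b1 h1] := deg10_bound e.
  have : a ^+ 2 == 1.
    by case: F68 => n; apply/eqP; have := expr_gcd (h1 10%N F10n) (h1 _ n).
  rewrite sqrf_eq1 => /orP[] /eqP ea; rewrite ea in hy.
    case: b1 => b1; rewrite b1 in hy; first by exists 0%N; left; rewrite expg0; apply: one_dg.
    by exists 2%N; left; rewrite r2; apply: iota_dg.
  case: b1 => b1; rewrite b1 in hy; [exists 1%N; right|exists 3%N; right].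
    by rewrite expg1; apply: dg_eq hy rt.
  rewrite (expgD r 2 1) r2 expg1 -mulgA; apply: dg_eq hy _.
  by have := dgM (@induces_iota _ 4 F) rt; rewrite mul1r mulr1.
move=> x; case: (mixes_cases x) => -[a [b [hx a0 b0 e]]].
  exact: dgc hx a0 (fun i => coef_exp (e i)).
have hxt := anM (oner_neq0 k) hx ht; have a1 : a / 1 != 0 by rewrite divr1.
case: (mixes_cases (x * t)%g) => -[a' [b' [hy' a0' b0' e']]]; last by case: (dg_an hF a1 hxt hy').
have xE : x = (x * t * t)%g by rewrite -mulgA tt mulg1.
have [i [] E] := dgc _ _ _ hy' a0' (fun i => coef_exp (e' i)); exists i; rewrite xE E.
  by right.
by left; rewrite -mulgA tt mulg1.
Qed.

End Degree10.

End Curve.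
End Swap.

Section SwapNormal.
Variable k : closedFieldType.
Hypotheses (two0 : 2 != 0 :> k) (three0 : 3 != 0 :> k) (five0 : 5 != 0 :> k).
Let g2 : (2 <= 4)%N := isT.
Implicit Types F G : {poly k}.

Lemma eq_opp_eq0 (x : k) : x = - x -> x = 0.
Proof.
by move/eqP; rewrite -addr_eq0 -mulr2n -mulr_natr mulf_eq0 (negbTE two0) orbF => /eqP.
Qed.

(** Rescaling x so that the swap becomes x |-> 1 / x makes the coefficients
    symmetric or antisymmetric. *)
Lemma sym_form F (hF : hyperelliptic_poly 4 F) (a b : k) : a != 0 -> b != 0 ->
  (forall i, (i <= 10)%N -> F`_(10 - i) * a ^+ (10 - i) = b ^+ 2 * F`_i) ->
  exists G l c (e : k), [/\ compat 4 (dg l c) F G, hyperelliptic_poly 4 G, e = 1 \/ e = -1,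
    (forall i, (i <= 10)%N -> G`_(10 - i) = e * G`_i) /\
    (forall m, (G`_m == 0) = (F`_m == 0)) &
    G`_10 = 1 \/ G`_10 = 0 /\ G`_9 = 1].
Proof.
(* [j] is the degree of [F]. The choice of [l] turns x |-> a/x into x |-> 1/x, and [c] makes the
   leading coefficient 1. Applying the symmetry twice to that coefficient gives e^2 = 1. *)
move=> a0 b0 h; pose j := if F`_10 == 0 then 9%N else 10%N.
have Fj : F`_j != 0.
  by rewrite /j; have [e10|//] := eqVneq F`_10 0; apply: (hyper_high hF).
have [l l0 el] : exists2 l, l != 0 & l ^+ 2 = a^-1 by apply: root_ex; rewrite ?invr_eq0.
have [c c0 ec] : exists2 c, c != 0 & c ^+ 2 = l ^+ j / F`_j.
  by apply: root_ex => //; rewrite mulf_neq0 ?invr_eq0 // expf_neq0.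
have [cn hG] := rescaled_compat hF l0 c0.
have Gj : (rescaled F l c)`_j = 1.
  by rewrite rescaledE // ec mulfVK // divff // expf_neq0.
have sym i : (i <= 10)%N -> (rescaled F l c)`_(10 - i) = b ^+ 2 * l ^+ 10 * (rescaled F l c)`_i.
  move=> le; rewrite !rescaledE //.
  have -> : l ^+ 10 = l ^+ (10 - i) * l ^+ i by rewrite -exprD subnK.
  have -> : F`_(10 - i) = b ^+ 2 * F`_i * (l ^+ (10 - i)) ^+ 2.
    by rewrite -exprM mulnC exprM el exprVn -h // mulfK // expf_neq0.
  by field; rewrite !expf_neq0.
exists (rescaled F l c), l, c, (b ^+ 2 * l ^+ 10); split=> //.
- suff : (b ^+ 2 * l ^+ 10) ^+ 2 == 1 by rewrite sqrf_eq1 => /orP[] /eqP; [left|right].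
  have le : (j <= 10)%N by rewrite /j; case: eqP.
  have := sym _ (leq_subr j 10); rewrite subKn // sym // Gj mulr1.
  by set u := _ * l ^+ 10; rewrite expr2 => <-.
- by split=> // m; apply: rescaled_eq0.
move: Gj; rewrite /j; have := rescaled_eq0 hF 10 l0 c0.
by have [_ /eqP|_ _] := eqVneq F`_10 0; [right|left].
Qed.

Section Symmetric.
Variables (G : {poly k}) (hG : hyperelliptic_poly 4 G) (e : k).
Hypotheses (mx : mixes two0 hG (Some 0) None) (e1 : e = 1 \/ e = -1).
Hypothesis sym : forall i, (i <= 10)%N -> G`_(10 - i) = e * G`_i.
Variables (a b : k).
Hypotheses (b0 : b != 0) (a1 : a <> 1).
Hypothesis ab : forall i, G`_i != 0 -> a ^+ i = b ^+ 2.

Let rescaled_mixes l c (hH : hyperelliptic_poly 4 (rescaled G l c)) : l != 0 -> c != 0 ->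
  mixes two0 hH (Some 0) None.
Proof.
move=> l0 c0; have [cn _] := rescaled_compat hG l0 c0.
by have := @mixes_compat _ two0 _ _ _ hG hH _ _ cn mx; have [-> ->] := mob_act_dg c l0.
Qed.

Let rescale_mixes i j : (i < j)%N -> G`_i != 0 -> G`_j != 0 ->
  (forall H (hH : hyperelliptic_poly 4 H), mixes two0 hH (Some 0) None -> H`_i = 1 ->
      H`_j = 1 -> (forall m, (H`_m == 0) = (G`_m == 0)) -> outcome H) -> outcome G.
Proof.
move=> ij Gi Gj W; have [H [l [c [cn hH [Hi Hj] E]]]] := rescale hG ij Gi Gj.
have l0 : l != 0 by have [+ _ _] := cn; rewrite /mdet /= mulr1 mulr0 subr0.
apply: (outcome_compat two0 hG hH cn); apply: (W H hH) => //.
by have := @mixes_compat _ two0 _ _ _ hG hH _ _ cn mx; have [-> ->] := mob_act_dg c l0.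
Qed.

Let eN i : G`_i != 0 -> G`_i = e * G`_i -> e = 1.
Proof. by move=> n E; apply: (mulIf n); rewrite -E mul1r. Qed.

(** All exponents i that occur satisfy a^i = 1. If one of them lies outside 0, 5, 10, its gcd with
    10 is 1 or 2; as a is not 1, a = -1 and [G] is even. *)
Lemma sym_10 : G`_10 = 1 -> outcome G.
Proof.
move=> G10; have G10n : G`_10 != 0 by rewrite G10 oner_neq0.
have G0 : G`_0 = e by rewrite (sym (leqnn 10)) G10 mulr1.
have G0n : G`_0 != 0 by rewrite G0; case: e1 => ->; rewrite ?oppr_eq0 oner_neq0.
have a_1 i : G`_i != 0 -> a ^+ i = 1 by move=> n; rewrite (ab n) -(ab G0n) expr0.
have [a4|/coef_ex[j js Gj]] := boolP (all (fun i => G`_i == 0) [:: 1; 2; 3; 4; 6; 7; 8; 9]%N).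
  have [G5|G5] := eqVneq G`_5 0.
    (* Here [e] may be -1; with only the two extreme terms left, both can be rescaled to 1. *)
    apply: (@rescale_mixes 0 10) => // H hH mH H0 H10 E.
    apply: (@swap_x10 _ two0 three0 five0 H hH mH H0 H10).
    move: a4 => /and5P[F1 F2 F3 F4 /and5P[F6 F7 F8 F9 _]].
    by rewrite /= !E F1 F2 F3 F4 F6 F7 F8 F9 G5 eqxx.
  have E1 := eN G5 (sym (isT : (5 <= 10)%N)); rewrite E1 in G0.
  exact: (@swap_x10_x5 _ two0 three0 five0 G hG mx G0 G10 G5 a4).
have a2 : a ^+ 2 = 1.
  have h := expr_gcd (a_1 10%N G10n) (a_1 j Gj).
  move: js h; rewrite !inE => /or4P[/eqP->|/eqP->|/eqP->|/or4P[/eqP->|/eqP->|/eqP->|/orP[] /eqP->]] //=;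
  by rewrite expr1 => /a1.
have aN : a = -1 by move/eqP: a2; rewrite sqrf_eq1 => /orP[] /eqP.
have odd0 : all (fun i => G`_i == 0) [:: 1; 3; 5; 7; 9]%N.
  have o i : odd i -> G`_i == 0.
    move=> oi; apply: contraT => /a_1; rewrite aN -signr_odd oi expr1 => /esym.
    by move/(neq_opp1 two0).
  by rewrite /= !o.
have G68 : G`_6 != 0 \/ G`_8 != 0.
  have E i : (i <= 10)%N -> G`_i != 0 -> G`_(10 - i) != 0.
    by move=> le n; rewrite sym // mulf_neq0 //; case: e1 => ->; rewrite ?oppr_eq0 oner_neq0.
  have nj := coef_in odd0 Gj; move: js nj (E j) Gj; rewrite !inE.
  by move=> /or4P[/eqP->|/eqP->|/eqP->|/or4P[/eqP->|/eqP->|/eqP->|/orP[] /eqP->]] //= _ h n;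
    do ?[by left | by right | by right; apply: h | by left; apply: h].
case: e1 => ee.
  apply: (@swap_even _ two0 _ hG mx) => //; first by rewrite G0 ee.
    by rewrite -[2%N]/(10 - 8)%N sym // ee mul1r.
  by rewrite -[4%N]/(10 - 6)%N sym // ee mul1r.
(* An antisymmetric even [G] becomes symmetric when x is rescaled by a square root of -1, since I^10
   = -1. *)
have [I II] := sqrt_opp1 k.
have I0 := sqr_opp1_neq0 II.
have [cn hH] := rescaled_compat hG I0 I0; apply: (outcome_compat two0 hG hH cn).
have I4 : I ^+ 4 = 1 by rewrite (exprM I 2 2) II sqrrN expr1n.
have I6 : I ^+ 6 = -1 by rewrite (exprD I 4 2) I4 II mul1r.
have I8 : I ^+ 8 = 1 by rewrite (exprM I 4 2) I4 expr1n.
have I10 : I ^+ 10 = -1 by rewrite (exprD I 8 2) I8 II mul1r.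
have HE i : (rescaled G I I)`_i = - G`_i / I ^+ i by rewrite (rescaledE hG) II mulN1r.
apply: (@swap_even _ two0 _ hH (rescaled_mixes hH I0 I0)).
- by rewrite HE G0 ee expr0 opprK divr1.
- by rewrite HE G10 I10 divff // oppr_eq0 oner_neq0.
- rewrite !HE II I8 -[2%N]/(10 - 8)%N sym // ee; by rewrite invrN1 mulrN1 divr1 mulN1r opprK.
- rewrite !HE I4 I6 -[4%N]/(10 - 6)%N sym // ee; by rewrite invrN1 mulrN1 divr1 mulN1r opprK.
- by case: G68 => n; [left|right]; rewrite (rescaled_eq0 hG).
by move: odd0; rewrite /= !(rescaled_eq0 hG).
Qed.

(** Exponent 1 gives a = b^2, hence a^(i-1) = 1 for each exponent i. If one lies outside 1, 5, 9,
    then a = -1 and [G] is odd with G_7 nonzero; the sign [e] separates the dihedral case from the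
    quaternion one. *)
Lemma sym_9 : G`_10 = 0 -> G`_9 = 1 -> outcome G.
Proof.
move=> G10 G9; have G9n : G`_9 != 0 by rewrite G9 oner_neq0.
have G0 : G`_0 = 0 by rewrite (sym (leqnn 10)) G10 mulr0.
have G1 : G`_1 = e by rewrite (sym (isT : (9 <= 10)%N)) G9 mulr1.
have G1n : G`_1 != 0 by rewrite G1; case: e1 => ->; rewrite ?oppr_eq0 oner_neq0.
have ab2 : a = b ^+ 2 := ab G1n.
have a0 : a != 0 by rewrite ab2 expf_neq0.
have a_1 i : G`_i.+1 != 0 -> a ^+ i = 1.
  by move/ab; rewrite -ab2 exprS => E; apply: (mulfI a0); rewrite E mulr1.
have [a4|/coef_ex[j js Gj]] := boolP (all (fun i => G`_i == 0) [:: 2; 3; 4; 6; 7; 8]%N).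
  have [G5|G5] := eqVneq G`_5 0.
    apply: (@rescale_mixes 1 9) => // H hH mH H1 H9 E.
    apply: (@swap_x9 _ two0 three0 five0 H hH mH) => //; try by apply/eqP; rewrite E ?G0 ?G10.
    move: a4 => /and5P[F2 F3 F4 F6 /and3P[F7 F8 _]].
    by rewrite /= !E F2 F3 F4 F6 F7 F8 G5 eqxx.
  have E1 := eN G5 (sym (isT : (5 <= 10)%N)); rewrite E1 in G1.
  exact: (@swap_x9_x5 _ two0 three0 five0 G hG mx G0 G1 G5 G9 G10 a4).
have a2 : a ^+ 2 = 1.
  have h8 := a_1 8%N G9n.
  move: js Gj; rewrite !inE => /or4P[/eqP->|/eqP->|/eqP->|/or3P[/eqP->|/eqP->|/eqP->]] /a_1 h;
  have := expr_gcd h8 h => //; by rewrite /= expr1 => /a1.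
have aN : a = -1 by move/eqP: a2; rewrite sqrf_eq1 => /orP[] /eqP.
have ev i : odd i -> G`_i.+1 = 0.
  move=> oi; apply/eqP; apply: contraT => /a_1; rewrite aN -signr_odd oi expr1 => /esym.
  by move/(neq_opp1 two0).
have G7 : G`_7 != 0.
  move: js Gj; rewrite !inE => /or4P[/eqP->|/eqP->|/eqP->|/or3P[/eqP->|/eqP->|/eqP->]] //;
    try by rewrite ev ?eqxx.
  rewrite -[3%N]/(10 - 7)%N sym //; by apply: contraNneq => ->; rewrite mulr0.
case: e1 => ee.
  apply: (@swap_odd _ two0 three0 five0 _ hG mx) => //; try exact: ev; first by rewrite G1.
  by rewrite -[3%N]/(10 - 7)%N sym // ee mul1r.
apply: (@swap_odd_anti _ two0 three0 five0 _ hG mx) => //; try exact: ev; first by rewrite G1.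
  by rewrite -[3%N]/(10 - 7)%N sym // ee mulN1r.
by have := sym (isT : (5 <= 10)%N); rewrite ee mulN1r => /eq_opp_eq0.
Qed.

End Symmetric.

Lemma swap_outcome F (hF : hyperelliptic_poly 4 F) (x y : curve_aut 4 F) (a b c d : k) :
  mixes two0 hF (Some 0) None -> a != 0 -> induces (an a b) x ->
  induces (dg c d) y -> c != 0 -> c <> 1 -> outcome F.
Proof.
move=> mx a0 hx hy c0 c1.
case: (mixes_cases mx x) => -[a' [b' [hx' a0' b0' E]]]; first by case: (dg_an hF a0' hx' hx).
case: (mixes_cases mx y) => -[c' [d' [hy' c0' d0' E']]]; last by case: (dg_an hF c0 hy hy').
have [cc dd] := dg_inj hF c0 hy hy'; rewrite -cc -dd in E' d0'.
have [G [l [m [e [cn hG e1 [sym zer] top]]]]] := sym_form hF a0' b0' E.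
have l0 : l != 0 by have [+ _ _] := cn; rewrite /mdet /= mulr1 mulr0 subr0.
have mG : mixes two0 hG (Some 0) None.
  by have := @mixes_compat _ two0 _ _ _ hF hG _ _ cn mx; have [-> ->] := mob_act_dg m l0.
apply: (outcome_compat two0 hF hG cn).
have cd i : G`_i != 0 -> c ^+ i = d ^+ 2 by rewrite zer; apply: coef_exp.
case: top => [G10|[G10 G9]]; first exact: (sym_10 mG e1 sym c1 cd G10).
exact: (sym_9 mG e1 sym d0' c1 cd G10 G9).
Qed.

End SwapNormal.

Section PairOutcome.
Variable k : closedFieldType.
Hypotheses (two0 : 2 != 0 :> k) (three0 : 3 != 0 :> k) (five0 : 5 != 0 :> k).
Let g2 : (2 <= 4)%N := isT.
Variables (f : {poly k}) (hf : hyperelliptic_poly 4 f).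
Local Notation A := (curve_aut 4 f).
Local Notation iota := (hinv 4 f).
Local Notation red := (red two0 g2 hf).

Lemma nine0 : 9 != 0 :> k. Proof. by rewrite -[9]/((3 * 3)%:R) natrM mulf_neq0. Qed.
Lemma ten0 : 10 != 0 :> k. Proof. by rewrite -[10]/((2 * 5)%:R) natrM mulf_neq0. Qed.

(** If some element swaps the pair and no nontrivial one fixes it pointwise, the reduced group has
    order 2. The two fixed points of the swap are then fixed by every automorphism, and
    [fixed_outcome] applies to them instead. *)
Lemma mixes_outcome t1 t2 : t1 != t2 -> mixes two0 hf t1 t2 -> outcome f.
Proof.
move=> t12 mx.
have [fx|] := pselect (forall x, red x t1 = t1).
  apply: (@fixed_outcome _ two0 three0 five0 f hf t1 t2 t12) => x; split=> //.
  by case: (mx x) => -[] // e; move: t12; rewrite -e fx eqxx.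
move/existsNP => [x0 hx0].
have [x01 x02] : red x0 t1 = t2 /\ red x0 t2 = t1 by case: (mx x0) => -[] // /hx0.
have [[y [y1 [y2 [y3 y4]]]]|ny] := pselect (exists y : A,
    y <> 1%g /\ y <> iota /\ red y t1 = t1 /\ red y t2 = t2).
  have [m dm [m1 m2]] := mob_act_move t12.
  have [F [n [hF cn nE]]] := change_coord hf dm.
  have [T [T' [TM TK T'K Ti Te]]] := transport two0 g2 hf hF cn.
  apply: (outcome_compat two0 hf hF cn).
  have mxF : mixes two0 hF (Some 0) None.
    by have := @mixes_compat _ two0 _ _ _ hf hF _ _ cn mx; rewrite !nE m1 m2.
  have T1 : T 1%g = 1%g by apply: (mulgI (T 1%g)); rewrite -TM !mulg1.
  have N1 : mob_act n t1 = Some 0 by rewrite nE.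
  have N2 : mob_act n t2 = None by rewrite nE.
  have [a [b [hx a0 _ _]]] : exists a b, [/\ induces (an a b) (T x0), a != 0, b != 0 &
      forall i, (i <= 10)%N -> F`_(10 - i) * a ^+ (10 - i) = b ^+ 2 * F`_i].
    by apply: (@an_of _ two0 F hF); rewrite -1?N1 -?N2 Te ?x01 ?x02.
  have [c [d [hy c0 _ _]]] : exists a b, [/\ induces (dg a b) (T y), a != 0, b != 0 &
      forall i, F`_i * a ^+ i = b ^+ 2 * F`_i].
    by apply: (@dg_of _ two0 F hF); rewrite -1?N1 -?N2 Te ?y3 ?y4.
  apply: (swap_outcome three0 five0 mxF a0 hx hy c0) => c1.
  have := @scalar_aut _ _ _ two0 g2 hF _ _ hy (erefl _) (erefl _) c1.
  by rewrite -T1 -Ti => -[] /(can_inj TK).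
have [x0n1 x0ni] : x0 <> 1%g /\ x0 <> iota.
  by split=> e; apply: hx0; rewrite e ?red1 ?red_hinv.
have [s1 [s2 [s12 hs]]] := red_fix2 two0 g2 nine0 ten0 hf x0n1 x0ni.
apply: (@fixed_outcome _ two0 three0 five0 f hf s1 s2 s12) => x.
have triv y : red y t1 = t1 -> red y t2 = t2 -> y = 1%g \/ y = iota.
  move=> h1 h2; apply: contrapT => /not_orP[n1 n2]; apply: ny; by exists y.
have id y t : y = 1%g \/ y = iota -> red y t = t by case=> ->; rewrite ?red1 ?red_hinv.
case: (mx x) => -[h1 h2]; first by split; apply/id/triv.
have hxx : (x * x0)%g = 1%g \/ (x * x0)%g = iota by apply: triv; rewrite redM ?x01 ?x02.
have [f1 f2] : red x0 s1 = s1 /\ red x0 s2 = s2 by split; apply/eqP; rewrite hs eqxx ?orbT.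
by split; [rewrite -{1}f1|rewrite -{1}f2]; rewrite -redM id.
Qed.

Lemma pair_outcome t1 t2 : t1 != t2 -> preserves_pair two0 hf t1 t2 -> outcome f.
Proof.
move=> t12 pp; apply: (mixes_outcome t12) => x; have [] := pp x.
have ne : red x t1 <> red x t2 by move/(can_inj (redK two0 g2 hf x))/eqP; rewrite (negbTE t12).
rewrite !inE => /orP[] /eqP e1 /orP[] /eqP e2; rewrite e1 e2 in ne *; by [left|right|case: ne].
Qed.

End PairOutcome.

(** * The tetrahedral case *)

Section Tetra.
Variable k : closedFieldType.
Hypotheses (two0 : 2 != 0 :> k) (three0 : 3 != 0 :> k) (five0 : 5 != 0 :> k).
Let g2 : (2 <= 4)%N := isT.

Section Abstract.
Variables (f : {poly k}) (hf : hyperelliptic_poly 4 f) (O : seq (option k)).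
Local Notation A := (curve_aut 4 f).
Local Notation iota := (hinv 4 f).
Local Notation red := (red two0 g2 hf).
Hypothesis hO : tetrahedral two0 hf O.
Implicit Types u v : A.

(** The stabilizer of a point of [O] consists of 1, [iota], a and a [iota], so its elements other
    than 1 and [iota] agree up to [iota]. *)
Lemma tetra_stab t u v : t \in O -> red u t = t -> red v t = t -> u <> 1%g -> u <> iota ->
  v <> 1%g -> v <> iota -> v = u \/ v = (u * iota)%g.
Proof.
case: hO => _ _ _ st _ tO ut vt u1 ui v1 vi; have [a [a1 ai at_ h]] := st _ tO.
have c w : w <> 1%g -> w <> iota -> red w t = t -> w = a \/ w = (a * iota)%g.
  move=> w1 wi /h; rewrite !in_cons orbF => /orP[/eqP/w1|/orP[/eqP/wi|/orP[] /eqP]] //.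
  - by left.
  by right.
have aii : (a * iota * iota = a)%g by rewrite -mulgA hinvV mulg1.
case: (c u u1 ui ut) => ->; case: (c v v1 vi vt) => ->; rewrite ?aii; by [left|right].
Qed.

Lemma tetra_sqr t u : t \in O -> red u t = t -> u <> 1%g -> u <> iota ->
  (u * u)%g \in [:: 1%g; iota].
Proof.
move=> tO ut u1 ui; have uut : red (u * u)%g t = t by rewrite redM ut.
rewrite !in_cons; have [->|n1] := eqVneq (u * u)%g 1%g; first by [].
have [->|ni] := eqVneq (u * u)%g iota; first by rewrite orbT.
case: (tetra_stab tO ut uut u1 ui); try by apply/eqP.
  by rewrite -{3}[u]mulg1 => /mulgI.
by move/mulgI.
Qed.

Lemma tetra_fix u : u <> 1%g -> u <> iota -> (u * u)%g \in [:: 1%g; iota] ->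
  forall t, red u t = t -> t \in O.
Proof. by case: hO => _ _ _ _ h; apply: h. Qed.

(** Conjugation by [x] carries [u] to an element fixing [s], equal to [v] up to [iota] by
    [tetra_stab]. Hence [x] sends the second fixed point of [u] to the second fixed point of [v]. *)
Lemma tetra_swap t1 t2 u x : t1 \in O -> u <> 1%g -> u <> iota -> red u t1 = t1 ->
  red u t2 = t2 -> t1 != t2 -> forall v s, v <> 1%g -> v <> iota -> red v s = s ->
  red x t1 = s -> red v (red x t2) = red x t2 /\ red x t2 != s.
Proof.
move=> t1O u1 ui ut1 ut2 t12 v s v1 vi vs xs.
have sO : s \in O by rewrite -xs; case: hO => _ [_ h] _ _ _; apply: h.
pose w := (x * u * x^-1)%g.
have xK t : red x^-1%g (red x t) = t by apply: redK.
have ws : red w s = s by rewrite /w !redM -xs xK ut1.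
have wt : red w (red x t2) = red x t2 by rewrite /w !redM xK ut2.
have w1 : w <> 1%g.
  by move=> e; apply: u1; apply: (mulgI x); apply: (mulIg x^-1%g); rewrite -/w e mulg1 mulgV.
have wi : w <> iota.
  move=> e; apply: ui; apply: (mulgI x); apply: (mulIg x^-1%g); rewrite -/w e.
  by rewrite -(hinvC two0 g2 hf) mulgK.
split; last by rewrite -xs; apply: contra t12 => /eqP/(can_inj (redK two0 g2 hf x)) ->.
case: (tetra_stab sO ws vs w1 wi v1 vi) => -> //.
by rewrite (redM _ _ _ w) red_hinv.
Qed.

End Abstract.

Lemma tetra_compat n f F (hf : hyperelliptic_poly 4 f) (hF : hyperelliptic_poly 4 F) O :
  compat 4 n f F -> tetrahedral two0 hf O -> tetrahedral two0 hF (map (mob_act n) O).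
Proof.
move=> cn [[sO uO] [zO stO] trO stab fixO].
have [dn _ _] := cn; have ninj := mob_act_inj dn.
have [T [T' [TM TK T'K Ti Te]]] := transport two0 g2 hf hF cn.
have T1 : T 1%g = 1%g by apply: (mulgI (T 1%g)); rewrite -TM !mulg1.
have ne (a : curve_aut 4 F) : a <> 1%g -> a <> hinv 4 F -> T' a <> 1%g /\ T' a <> hinv 4 f.
  by rewrite -{1 2}[a]T'K -T1 -Ti => h1 h2; split=> e; [apply: h1|apply: h2]; rewrite e.
split.
- by rewrite size_map map_inj_uniq.
- split=> [_ /mapP[t tO ->]|a _ /mapP[t tO ->]]; first by rewrite (compat_zero t cn); apply: zO.
  by rewrite -[a]T'K Te; apply: map_f; apply: stO.
- move=> _ _ /mapP[t tO ->] /mapP[u uO' ->]; have [a e] := trO _ _ tO uO'.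
  by exists (T a); rewrite Te e.
- move=> _ /mapP[t tO ->]; have [a [a1 ai at_ h]] := stab _ tO; exists (T a); split.
  + by rewrite -T1 => /(can_inj TK).
  + by rewrite -Ti => /(can_inj TK).
  + by rewrite Te at_.
  move=> b; rewrite -{1}[b]T'K Te => /ninj/h bh.
  have <- : map T [:: 1%g; hinv 4 f; a; (a * hinv 4 f)%g] =
    [:: 1%g; hinv 4 F; T a; (T a * hinv 4 F)%g] by rewrite /= T1 TM Ti.
  by rewrite -[b]T'K; apply: map_f.
move=> a a1 ai aa t at_; have [h1 h2] := ne a a1 ai.
have [u eu] : exists u, t = mob_act n u.
  by exists (mob_act (minv 4 n) t); rewrite (mob_actVK 4 dn).
rewrite eu; apply: map_f; apply: (fixO (T' a)) => //.
  have := map_f T' aa; rewrite /= -{1 2}[a]T'K -TM TK.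
  by rewrite -{1}T1 -Ti !TK.
by apply: ninj; rewrite -Te T'K -eu.
Qed.

Lemma size_compat n (f F : {poly k}) N : hyperelliptic_poly 4 f -> hyperelliptic_poly 4 F ->
  compat 4 n f F -> aut_size f N -> aut_size F N.
Proof.
move=> hf hF cn [s us [ss hs]].
have [T [T' [TM TK T'K Ti Te]]] := transport two0 g2 hf hF cn.
exists (map T s); first by rewrite map_inj_uniq //; apply: can_inj TK.
by split=> [|a]; [rewrite size_map|rewrite -[a]T'K map_f].
Qed.

End Tetra.

Section TetraCoords.
Variable k : closedFieldType.
Hypotheses (two0 : 2 != 0 :> k) (three0 : 3 != 0 :> k) (five0 : 5 != 0 :> k).
Let g2 : (2 <= 4)%N := isT.

Lemma induces_compat (F : {poly k}) (hF : hyperelliptic_poly 4 F) m (x : curve_aut 4 F) :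
  induces m x -> compat 4 m F F.
Proof.
move=> hm; have [n cn hn] := aut_mob two0 g2 hF x; have [dn _ _] := cn.
exact: compat_msim (induces_inj hF dn hn hm) cn.
Qed.

Lemma mob_actS (m : mob k) x y : mc m * x + md m != 0 ->
  ma m * x + mb m = y * (mc m * x + md m) -> mob_act m (Some x) = Some y.
Proof.
move=> n e; rewrite /mob_act /mX /mZ /pnorm /= !mulr1 (negbTE n) e.
by rewrite mulfK.
Qed.

(** A point of [O] and the other fixed point of its involution go to 0 and infinity. The involution
    becomes x |-> -x, and F_1 nonzero makes the factor of y square to -1, so only odd exponents
    survive. By transitivity some element carries one of the two points to the other, and
    [tetra_swap] shows that it swaps them. *)
Lemma tetra_coords f (hf : hyperelliptic_poly 4 f) O : tetrahedral two0 hf O ->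
  exists F n (hF : hyperelliptic_poly 4 F) (O' : seq (option k)),
  [/\ compat 4 n f F, tetrahedral two0 hF O', Some 0 \in O' /\ None \in O',
   (forall i, odd i = false -> F`_i = 0) &
   exists a b, [/\ a != 0, b != 0 &
     forall i, (i <= 10)%N -> F`_(10 - i) * a ^+ (10 - i) = b ^+ 2 * F`_i]].
Proof.
move=> hO; have [[sO uO] [zO stO] trO stab fixO] := hO.
have [t1 t1O] : exists t, t \in O by case: (O) sO => // t s _; exists t; rewrite in_cons eqxx.
have [a [a1 ai at1 _]] := stab _ t1O; have aa := tetra_sqr hO t1O at1 a1 ai.
have [s1 [s2 [s12 fs]]] := red_fix2 two0 g2 (nine0 three0) (ten0 two0 five0) hf a1 ai.
have [t2 [t12 ft]] : exists t2, t1 != t2 /\ forall t, (red two0 g2 hf a t == t) = (t == t1) || (t == t2).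
  have := fs t1; rewrite at1 eqxx => /esym/orP[] /eqP e; rewrite e.
    by exists s2; split.
  by exists s1; split=> [|t]; [rewrite eq_sym|rewrite fs orbC].
have at2 : red two0 g2 hf a t2 = t2 by apply/eqP; rewrite ft eqxx orbT.
have t2O : t2 \in O := tetra_fix hO a1 ai aa at2.
have [x xt1] := trO _ _ t1O t2O.
have [] := tetra_swap hO t1O a1 ai at1 at2 t12 a1 ai at2 xt1.
move/eqP; rewrite ft => /orP[/eqP xt2 _|->] //.
have [m dm [m1 m2]] := mob_act_move t12.
have [F [n [hF cn nE]]] := change_coord hf dm.
have [T [T' [TM TK T'K Ti Te]]] := transport two0 g2 hf hF cn.
have T1 : T 1%g = 1%g by apply: (mulgI (T 1%g)); rewrite -TM !mulg1.
have N1 : mob_act n t1 = Some 0 by rewrite nE.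
have N2 : mob_act n t2 = None by rewrite nE.
have O1 : Some 0 \in map (mob_act n) O by rewrite -N1 map_f.
have O2 : None \in map (mob_act n) O by rewrite -N2 map_f.
have hO' := tetra_compat hF cn hO.
exists F, n, hF, (map (mob_act n) O); split=> //.
  have F0 : F`_0 = 0.
    by apply/eqP; rewrite -(zero_at_0 hF); case: hO' => _ [h _] _ _ _; apply: h.
  have F1 := hyper_low hF F0.
  have [c [d [hy c0 d0 cd]]] : exists b c, [/\ induces (dg b c) (T a), b != 0, c != 0 &
      forall i, F`_i * b ^+ i = c ^+ 2 * F`_i].
    by apply: (dg_of (two0 := two0) (hF := hF)); rewrite -1?N1 -?N2 Te ?at1 ?at2.
  have c1 : c <> 1.
    move=> c1; have := @scalar_aut _ _ _ two0 g2 hF _ _ hy (erefl _) (erefl _) c1.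
    by rewrite -T1 -Ti => -[] /(can_inj TK).
  have c2 : c ^+ 2 = 1.
    have h2 := dgM hy hy; move: aa; rewrite -expr2 !in_cons orbF in h2 *.
    case/orP=> /eqP e; rewrite -TM e ?T1 ?Ti in h2.
      by have [] := dg_inj hF (oner_neq0 k) (@induces_aut1 _ 4 F) h2.
    by have [] := dg_inj hF (oner_neq0 k) (@induces_iota _ 4 F) h2.
  have cN : c = -1 by move/eqP: c2; rewrite sqrf_eq1 => /orP[] /eqP.
  have d2 : d ^+ 2 = -1 by rewrite -(coef_exp (cd 1%N) F1) cN.
  move=> i oi; apply/eqP; apply: contraT => n0; have := coef_exp (cd i) n0.
  by rewrite cN d2 -signr_odd oi expr0 => /(neq_opp1 two0).
have [c [d [hy c0 d0 cd]]] : exists a b, [/\ induces (an a b) (T x), a != 0, b != 0 &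
      forall i, (i <= 10)%N -> F`_(10 - i) * a ^+ (10 - i) = b ^+ 2 * F`_i].
  by apply: (an_of (two0 := two0) (hF := hF)); rewrite -1?N1 -?N2 Te ?xt1 ?xt2.
by exists c, d.
Qed.

End TetraCoords.

Section TetraNormal.
Variable k : closedFieldType.
Hypotheses (two0 : 2 != 0 :> k) (three0 : 3 != 0 :> k) (five0 : 5 != 0 :> k).
Let g2 : (2 <= 4)%N := isT.
Variables (G : {poly k}) (hG : hyperelliptic_poly 4 G) (O : seq (option k)).
Local Notation A := (curve_aut 4 G).
Local Notation iota := (hinv 4 G).
Local Notation red := (red two0 g2 hG).
Hypotheses (hO : tetrahedral two0 hG O) (O0 : Some 0 \in O) (Oi : None \in O).
Variable e : k.
Hypotheses (ev : forall i, odd i = false -> G`_i = 0) (G9 : G`_9 = 1) (e1 : e = 1 \/ e = -1).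
Hypothesis sym : forall i, (i <= 10)%N -> G`_(10 - i) = e * G`_i.
Variable I : k.
Hypothesis II : I ^+ 2 = -1.

Let I0 : I != 0.
Proof. exact: sqr_opp1_neq0. Qed.

Let I1 : I <> 1.
Proof. by move=> E; move: II; rewrite E expr1n => /(neq_opp1 two0). Qed.

Let IN1 : I <> -1.
Proof. by move=> E; move: II; rewrite E sqrrN expr1n => /(neq_opp1 two0). Qed.

Lemma tetra_poly : G = 'X^9 + G`_7 *: 'X^7 + G`_5 *: 'X^5 + (e * G`_7) *: 'X^3 + e *: 'X.
Proof.
have G1 : G`_1 = e by rewrite (sym (isT : (9 <= 10)%N)) G9 mulr1.
have G3 : G`_3 = e * G`_7 := sym (isT : (7 <= 10)%N).
have [E0 E2 E4 E6 [E8 E10]] : [/\ G`_0 = 0, G`_2 = 0, G`_4 = 0, G`_6 = 0 & G`_8 = 0 /\ G`_10 = 0].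
  by rewrite !ev.
apply/polyP => j; rewrite !coefE.
do 11 (case: j => [|j] //=; rewrite ?(mulr0, mulr1, addr0, add0r) //).
by rewrite (hyper_coef hG).
Qed.

Let sigma_ex : exists s : A, induces (dg (-1) I) s.
Proof.
apply: dg_ex => // [|i]; first by rewrite oppr_eq0 oner_neq0.
case oi: (odd i); last by rewrite ev // mul0r mulr0.
by rewrite -signr_odd oi II expr1 mulrC.
Qed.

Lemma tau_ex : exists2 d, d ^+ 2 = e & exists t : A, induces (an 1 d) t.
Proof.
have [d d0 de] : exists2 d, d != 0 & d ^+ 2 = e.
  by apply: root_ex => //; case: e1 => ->; rewrite ?oppr_eq0 oner_neq0.
by exists d => //; apply: pal_swap => // i le; rewrite sym // de.
Qed.

Let neqA (x : A) c d : induces (an c d) x -> x <> 1%g /\ x <> iota.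
Proof.
move=> h; split=> E; rewrite E in h; first exact: (dg_an hG (oner_neq0 k) (@induces_aut1 _ 4 G) h).
exact: (dg_an hG (oner_neq0 k) (@induces_iota _ 4 G) h).
Qed.

Let sqrA (x : A) : induces (dg 1 e) (x * x)%g -> (x * x)%g \in [:: 1%g; iota].
Proof.
by case: e1 => -> h; rewrite !in_cons; [rewrite (one_dg h)|rewrite (iota_dg h)]; rewrite eqxx ?orbT.
Qed.

(** The two points are the fixed points of x |-> 1/x, an involution of the reduced group. *)
Lemma tetra_pm1 : Some 1 \in O /\ Some (-1) \in O.
Proof.
have [d de [t ht]] := tau_ex; have [t1 ti] := neqA ht.
have tt : (t * t)%g \in [:: 1%g; iota] by apply: sqrA; rewrite -de; apply: an_sqr.
split; apply: (tetra_fix hO t1 ti tt); rewrite (redE _ _ _ _ ht); apply: mob_actS => /=;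
  rewrite ?mul0r ?mulr1 ?mul1r ?addr0 ?add0r ?mulrNN ?mulr1 ?oppr_eq0 ?oner_neq0 //.
Qed.

(** The two points are the fixed points of x |-> -1/x, obtained by composing x |-> 1/x with x |->
    -x. *)
Lemma tetra_pmI : Some I \in O /\ Some (- I) \in O.
Proof.
have [d de [t ht]] := tau_ex; have [s hs] := sigma_ex.
have hx := dg_anM hs ht; have [t1 ti] := neqA hx.
have m0 : (-1 : k) != 0 by rewrite oppr_eq0 oner_neq0.
have tt : (s * t * (s * t))%g \in [:: 1%g; iota].
  apply: sqrA; have := anM _ hx hx; rewrite mulr1 => /(_ m0).
  rewrite divff // -signr_odd expr1 -expr2 exprMn II de => h.
  by have -> : e = -1 * e / -1 by rewrite invrN1 mulrN1 mulN1r opprK.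
split; apply: (tetra_fix hO t1 ti tt); rewrite (redE _ _ _ _ hx); apply: mob_actS => /=;
  rewrite ?mul0r ?mulr1 ?mul1r ?addr0 ?add0r ?mulrNN -?expr2 ?II ?oppr_eq0 ?I0 //.
Qed.

(** If e = 1 then 1 would be a double root of G. *)
Lemma tetra_sign : e = -1 /\ G`_5 = 0.
Proof.
have zO t : t \in O -> form_zero 4 G t by case: hO => _ [h _] _ _ _; apply: h.
have z x : Some x \in O -> G.[x] = 0.
  by move/zO; rewrite form_zero_aff ?(hyper11 hG) // => /rootP.
have GE x : G.[x] = x ^+ 9 + G`_7 * x ^+ 7 + G`_5 * x ^+ 5 + (e * G`_7) * x ^+ 3 + e * x.
  by rewrite {1}tetra_poly !hornerE.
have E1 : 1 + G`_7 + G`_5 + e * G`_7 + e = 0.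
  by have := z _ tetra_pm1.1; rewrite GE !expr1n !mulr1.
have E2 : 1 - G`_7 + G`_5 - e * G`_7 + e = 0.
  have := z _ tetra_pmI.1; rewrite GE.
  have i3 : I ^+ 3 = - I by rewrite exprS II mulrN1.
  have i5 : I ^+ 5 = I by rewrite (exprD I 2 3) II i3 mulrNN mul1r.
  have i7 : I ^+ 7 = - I by rewrite (exprD I 2 5) II i5 mulN1r.
  have i9 : I ^+ 9 = I by rewrite (exprD I 2 7) II i7 mulrNN mul1r.
  rewrite i3 i5 i7 i9 => E; apply: (mulfI I0); rewrite mulr0 -[RHS]E; ring.
case: e1 => ee; last first.
  split=> //; move: E1; rewrite ee; move: G`_7 G`_5 => u v h; rewrite -[RHS]h; ring.
have n4 : 4 != 0 :> k by rewrite -[4]/((2 * 2)%:R) natrM mulf_neq0.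
have lin (u v : k) : 1 + u + v + 1 * u + 1 = 0 -> 1 - u + v - 1 * u + 1 = 0 -> v = - 2 /\ u = 0.
  move=> h1 h2; split.
    apply/eqP; rewrite -addr_eq0; apply/eqP; apply: (mulfI two0); rewrite mulr0.
    rewrite -[RHS](addr0 0) -{1}h1 -h2; ring.
  by apply: (mulfI n4); rewrite mulr0 -[RHS](subr0 0) -{1}h1 -h2; ring.
rewrite ee in E1 E2; have [B A0] := lin _ _ E1 E2.
(* This is x (x^4 - 1)^2; its derivative at 1 is 9 - 10 + 1 = 0. *)
have GP : G = 'X^9 + (- 2) *: 'X^5 + 'X.
  by rewrite tetra_poly A0 B ee mulr0 !scale0r !addr0 scale1r.
have [sep _] := hG; have := @nonsingular_aff k G 1 sep (z _ tetra_pm1.1).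
have -> : G^`() = 9%:R *: 'X^8 + (- 2) *: (5%:R *: 'X^4) + 1.
  by rewrite GP !derivD derivZ !derivXn derivX -!scaler_nat.
rewrite !hornerD !hornerZ !hornerXn hornerC !expr1n => /eqP[]; ring.
Qed.

End TetraNormal.

Section TetraGroup.
Variable k : closedFieldType.
Hypotheses (two0 : 2 != 0 :> k) (three0 : 3 != 0 :> k) (five0 : 5 != 0 :> k).
Let g2 : (2 <= 4)%N := isT.
Variables (G : {poly k}) (hG : hyperelliptic_poly 4 G) (O : seq (option k)).
Local Notation A := (curve_aut 4 G).
Local Notation iota := (hinv 4 G).
Local Notation red := (red two0 g2 hG).
Hypotheses (hO : tetrahedral two0 hG O) (O0 : Some 0 \in O) (Oi : None \in O).
Hypotheses (O1 : Some 1 \in O) (ON1 : Some (-1) \in O).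
Hypotheses (G9 : G`_9 = 1) (G1 : G`_1 = -1) (G3 : G`_3 = - G`_7) (G5 : G`_5 = 0).
Hypothesis (ev : forall i, odd i = false -> G`_i = 0).
Variable I : k.
Hypotheses (II : I ^+ 2 = -1) (OI : Some I \in O) (ONI : Some (- I) \in O).
Variables s t : A.
Hypotheses (hs : induces (dg (-1) I) s) (ht : induces (an 1 I) t).

Let I0 : I != 0.
Proof. exact: sqr_opp1_neq0. Qed.

Let I1 : 1 - I != 0.
Proof.
rewrite subr_eq0; apply/eqP => E; move: II; rewrite -E expr1n => /(neq_opp1 two0).
by [].
Qed.

Let IN1 : 1 + I != 0.
Proof.
rewrite addr_eq0; apply/eqP => E; move: II; rewrite -[I]opprK -E sqrrN expr1n.
by move/(neq_opp1 two0).
Qed.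

Let m0 : (-1 : k) != 0. Proof. by rewrite oppr_eq0 oner_neq0. Qed.

Let opp0 (x : k) : x != 0 -> x != - x.
Proof. by move=> n; apply: contra n => /eqP/(eq_opp_eq0 two0)->. Qed.

Let sixO z : z \in O -> z \in [:: Some 0; None; Some 1; Some (-1); Some I; Some (- I)].
Proof.
have [[sO uO] _ _ _ _] := hO.
set L := [:: _; _; _; _; _; _]; suff [uL LO] : uniq L /\ {subset L <= O}.
  by have [_ ->] := uniq_min_size uL LO (eq_leq sO).
have i1 : I != 1 by move: I1; rewrite subr_eq0 eq_sym.
have i2 : I != -1 by move: IN1; rewrite addrC addr_eq0.
have j1 : - I != 1 by rewrite eqr_oppLR.
have j2 : - I != -1 by rewrite eqr_opp.
have n0 : 0 != I by rewrite eq_sym.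
have oo : (0 : k) != 1 by rewrite eq_sym oner_eq0.
split; last by move=> x; rewrite !in_cons orbF => /or4P[|||/or3P[]] /eqP->.
rewrite /= !in_cons !in_nil !orbF !(inj_eq (@Some_inj _)) /= !negb_or.
have sy (x y : k) : x != y -> y != x by rewrite eq_sym.
have n2 : 0 != - I by rewrite eq_sym oppr_eq0.
by rewrite oo (sy _ _ m0) n0 n2 (opp0 (oner_neq0 k)) (sy _ _ i1) (sy _ _ j1) (sy _ _ i2) (sy _ _ j2) opp0.
Qed.

(** x |-> (r - x) / (r + x), which sends 0 to 1 and infinity to -1; for r^2 = -1
    it permutes 0, 1 and r cyclically. *)
Definition order3 (r e : k) := Mob (-1) r 1 r e.

(** Replacing x by -x in (r - x)/(r + x) gives (r + x)/(r - x), the same map for -r. *)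
Lemma order3_neg (r e : k) (g : A) : r != 0 -> induces (order3 r e) g ->
  induces (order3 (- r) (- (e * I))) (g * s)%g.
Proof.
move=> r0 hg; apply: induces_msim (induces_autM hg hs); exists (-1) => //=.
rewrite -signr_odd expr1; split; ring.
Qed.

(** By transitivity some g sends 0 to 1, and [tetra_swap] then sends infinity to -1, so g is (r -
    x)/(r + x). The image (r - 1)/(r + 1) of 1 lies in [O], which leaves r among 1, -1, I, -I; the
    first two are excluded, and [order3_neg] turns -I into I. *)
Lemma order3_exists : exists e (g : A), induces (order3 I e) g.
Proof.
have [_ [_ stO] trO _ _] := hO; have [g g0] := trO _ _ O0 O1.
have neqd (x : A) c d : c != 1 -> induces (dg c d) x -> x <> 1%g /\ x <> iota.
  move=> c1 h; split=> E; rewrite E in h.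
    by have [e _] := dg_inj hG (oner_neq0 k) (@induces_aut1 _ 4 G) h; rewrite -e eqxx in c1.
  by have [e _] := dg_inj hG (oner_neq0 k) (@induces_iota _ 4 G) h; rewrite -e eqxx in c1.
have [s1 si] := neqd _ _ _ (negbT (introF eqP (fun e => neq_opp1 two0 (esym e)))) hs.
have [t1 ti] : t <> 1%g /\ t <> iota.
  split=> E; move: ht; rewrite E => h;
    first exact: (dg_an hG (oner_neq0 k) (@induces_aut1 _ 4 G) h).
  exact: (dg_an hG (oner_neq0 k) (@induces_iota _ 4 G) h).
have [ms0 msi] := mob_act_dg I m0.
have r0 : red s (Some 0) = Some 0 by rewrite (redE _ _ _ _ hs).
have ri : red s None = None by rewrite (redE _ _ _ _ hs).
have tm (x : k) : x != 0 -> red t (Some x) = Some x^-1.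
  move=> x0; rewrite (redE _ _ _ _ ht); apply: mob_actS => /=; first by rewrite mul1r addr0.
  by rewrite mul0r add0r mul1r addr0 mulVf.
have t0 : red t (Some 0) = None.
  by rewrite (redE _ _ _ _ ht) /mob_act /mX /mZ /pnorm /= !mulr0 !mul0r addr0 eqxx.
have ti0 : red t None = Some 0.
  by rewrite (redE _ _ _ _ ht) /mob_act /mX /mZ /pnorm /= !mulr0 !mulr1 !addr0 oner_eq0 mul0r.
have tt1 : red t (Some 1) = Some 1 by rewrite tm ?oner_neq0 // invr1.
have [gi gi1] := tetra_swap hO O0 s1 si r0 ri isT t1 ti tt1 g0.
have {gi gi1} gN : red g None = Some (-1).
  case: (red g None) gi gi1 => [y|]; last by rewrite ti0.
  have [->|y0] := eqVneq y 0; first by rewrite t0.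
  rewrite tm // => -[yy] y1; have : y ^+ 2 == 1 by rewrite expr2 -{1}yy mulVf.
  by rewrite sqrf_eq1 => /orP[] /eqP e; [rewrite e eqxx in y1|rewrite e].
have [m cm hm] := aut_mob two0 g2 hG g; have [dm em _] := cm.
have mc0 : mc m != 0.
  apply/eqP => c0; move: gN; rewrite (redE _ _ _ _ hm) /mob_act /mZ /pnorm /= c0.
  by rewrite mulr0 mul0r addr0 eqxx.
have ea : ma m = - mc m.
  move: gN; rewrite (redE _ _ _ _ hm) /mob_act /mX /mZ /pnorm /= !mulr0 !addr0 !mulr1.
  by rewrite (negbTE mc0) => -[E]; rewrite -[ma m](divfK mc0) E mulN1r.
have md0 : md m != 0.
  apply/eqP => c0; move: g0; rewrite (redE _ _ _ _ hm) /mob_act /mZ /pnorm /= c0.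
  by rewrite mulr0 mul0r addr0 eqxx.
have eb : mb m = md m.
  move: g0; rewrite (redE _ _ _ _ hm) /mob_act /mX /mZ /pnorm /= !mulr0 !add0r !mulr1.
  by rewrite (negbTE md0) => -[E]; rewrite -[mb m](divfK md0) E mul1r.
pose r := md m / mc m; have rn : r != 0 by rewrite mulf_neq0 // invr_eq0.
have hg : induces (order3 r (me m / mc m ^+ 5)) g.
  apply: induces_msim hm; exists (mc m)^-1; first by rewrite invr_eq0.
  by rewrite ea eb /= mulrN mulVf // exprVn; split=> //; apply: mulrC.
move: hg; move: (me m / _) => e hg; clear ea eb md0 mc0 cm hm dm em.
(* For r = 1 the map is an involution, whose fixed points would lie in [O]; but it permutes the six
   points of [O] without fixing any. *)
have noone (e' : k) (g' : A) : induces (order3 1 e') g' -> False.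
  move=> h; have r3 x y : 1 * x + 1 != 0 -> -1 * x + 1 = y * (1 * x + 1) -> red g' (Some x) = Some y.
    by move=> n E; rewrite (redE _ _ _ _ h); apply: mob_actS.
  have z0 : red g' (Some 0) = Some 1 by apply: r3; rewrite ?mulr0 ?add0r ?mulr1 ?oner_neq0.
  have g'1 : g' <> 1%g by move=> E; move: z0; rewrite E red1 => -[/esym/eqP]; rewrite oner_eq0.
  have g'i : g' <> iota.
    by move=> E; move: z0; rewrite E red_hinv => -[/esym/eqP]; rewrite oner_eq0.
  have gg : (g' * g')%g \in [:: 1%g; iota].
    have := scalar_aut two0 g2 hG (induces_autM h h); rewrite /= !in_cons => W.
    by case: W; try ring; move=> ->; rewrite eqxx ?orbT.
  have [u [v [_ fu]]] := red_fix2 two0 g2 (nine0 three0) (ten0 two0 five0) hG g'1 g'i.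
  have gu : red g' u = u by apply/eqP; rewrite fu eqxx.
  have := sixO (tetra_fix hO g'1 g'i gg gu); rewrite !in_cons orbF.
  case/or4P=> [|||/or3P[]] /eqP eu; move: gu; rewrite eu.
  - by rewrite z0 => -[/eqP]; rewrite oner_eq0.
  - rewrite (redE _ _ _ _ h) /mob_act /mZ /pnorm /= mulr0 mulr1 addr0.
    by rewrite oner_eq0.
  - rewrite (r3 1 0) => [[/esym/eqP]||]; rewrite ?oner_eq0 // ?mulr1 ?mul0r ?addNr //.
  - by rewrite (redE _ _ _ _ h) /mob_act /mZ /pnorm /= !mulr1 mul1r addNr eqxx.
  - rewrite (r3 I (- I)) => [[/esym/eqP]||]; first by rewrite (negbTE (opp0 I0)).
      by rewrite mul1r addrC.
    by rewrite mulN1r mul1r mulrDr mulNr -expr2 II opprK mulr1 addrC.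
  rewrite (r3 (- I) I) => [[/eqP]||]; first by rewrite (negbTE (opp0 I0)).
    by rewrite mul1r addrC.
  by rewrite mulN1r mul1r mulrDr mulrN -expr2 II !opprK mulr1 addrC.
have g1 : red g (Some 1) \in [:: Some 0; None; Some I; Some (- I)].
  have := sixO (stO g _ O1); rewrite !in_cons => /or4P[-> //|->|/eqP E|]; rewrite ?orbT //.
    by have := can_inj (redK two0 g2 hG g) (etrans E (esym g0)) => -[/eqP]; rewrite oner_eq0.
  case/or3P=> [/eqP E| ->|->]; rewrite ?orbT //.
  by have := can_inj (redK two0 g2 hG g) (etrans E (esym gN)).
have dE : red g (Some 1) = pnorm (r - 1) (1 + r).
  by rewrite (redE _ _ _ _ hg) /mob_act /mX /mZ /= !mulr1 addrC.
move: g1; rewrite dE /pnorm addr_eq0; case: eqVneq => [r1|rn1].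
  move=> _; have h := order3_neg rn hg; rewrite -r1 in h.
  by case: (noone _ _ h).
rewrite !in_cons orbF /= !(inj_eq (@Some_inj _)) => /or3P[|/eqP E|/eqP E].
- rewrite mulf_eq0 invr_eq0 [1 + r == 0]addr_eq0 (negbTE rn1) orbF subr_eq0 => /eqP r1.
  by rewrite r1 in hg; case: (noone _ _ hg).
- have E' : r - 1 = I * (1 + r) by rewrite -E divfK // addr_eq0.
  exists e, g; suff -> : I = r by [].
  apply: (mulIf I1); rewrite mulrBr mulr1 -expr2 II opprK; apply: esym.
  transitivity ((r - 1) + 1 - r * I); first by ring.
  by rewrite E'; ring.
have E' : r - 1 = - I * (1 + r) by rewrite -E divfK // addr_eq0.
suff rE : r = - I.
  by rewrite rE in hg; have := order3_neg _ hg; rewrite opprK oppr_eq0 => /(_ I0) h; eexists;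
    eexists; apply: h.
apply: (mulIf IN1); rewrite [RHS]mulrDr mulr1 mulNr -expr2 II opprK.
transitivity ((r - 1) + 1 + r * I); first by ring.
by rewrite E'; ring.
Qed.

Lemma tetra_hform U V : hform 4 G U V =
  U * V * (U ^+ 4 - V ^+ 4) * (U ^+ 4 + G`_7 * (U ^+ 2 * V ^+ 2) + V ^+ 4).
Proof.
have [E0 E2 E4 E6 [E8 E10]] : [/\ G`_0 = 0, G`_2 = 0, G`_4 = 0, G`_6 = 0 & G`_8 = 0 /\ G`_10 = 0].
  by rewrite !ev.
rewrite /hform !big_ord_recl big_ord0 /= /bump /=.
rewrite E0 G1 E2 G3 E4 G5 E6 E8 G9 E10; move: G`_7 => u; ring.
Qed.

(** Comparison of the coefficients of x and x^3 in G o g = e^2 G. *)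
Lemma tetra_coef e (g : A) : induces (order3 I e) g -> G`_7 ^+ 2 = - 12.
Proof.
move=> hg; have [_ _ h] := induces_compat two0 hG hg.
pose u := G`_7; have c8 : 8 * I != 0.
  by rewrite mulf_neq0 // -[8]/((2 * 2 * 2)%:R) !natrM !mulf_neq0.
(* [T] and [W] come from expanding the transformed form with U V = -(1 + x^2), U^2 + V^2 = 2(x^2 -
   1) and U^2 - V^2 = -4 I x. Proportionality to G gives W = T u, that is 2u - 12 = u^2 + 2u. *)
pose T := u + 2; pose W := 2 * u - 12.
have E : (8 * I) *: (T *: 'X^9 + W *: 'X^7 - W *: 'X^3 - T *: 'X) =
    e ^+ 2 *: ('X^9 + u *: 'X^7 - u *: 'X^3 - 'X).
  apply: poly_coefs => x; rewrite !(hornerZ, hornerD, hornerN, hornerXn, hornerX).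
  have := h x 1; rewrite /mX /mZ /= !tetra_hform !mulr1 mul1r mulN1r -/u.
  set U := - x + I; set V := x + I.
  have e2 : U * V = - (1 + x ^+ 2).
    by transitivity (I ^+ 2 - x ^+ 2); [rewrite /U /V|rewrite II]; ring.
  have e3 : U ^+ 2 + V ^+ 2 = 2 * (x ^+ 2 - 1).
    by transitivity (2 * (x ^+ 2 + I ^+ 2)); [rewrite /U /V|rewrite II]; ring.
  have e4 : U ^+ 2 - V ^+ 2 = - (4 * I * x) by rewrite /U /V; ring.
  have -> : U * V * (U ^+ 4 - V ^+ 4) * (U ^+ 4 + u * (U ^+ 2 * V ^+ 2) + V ^+ 4) =
    U * V * ((U ^+ 2 - V ^+ 2) * (U ^+ 2 + V ^+ 2)) *
      ((U ^+ 2 + V ^+ 2) ^+ 2 + (u - 2) * (U * V) ^+ 2) by ring.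
  rewrite e2 e3 e4 !expr1n mulr1 => E.
  transitivity (e ^+ 2 * (x * (x ^+ 4 - 1) * (x ^+ 4 + u * x ^+ 2 + 1))); last by ring.
  by rewrite -E /T /W; ring.
have E1 := congr1 (fun p : {poly k} => p`_1) E.
have E3 := congr1 (fun p : {poly k} => p`_3) E.
move: E1 E3; rewrite !coefE /= !(mulr0, addr0, add0r, mulr1, oppr0) => E1 E3.
have {}E1 : 8 * I * T = e ^+ 2 by apply: oppr_inj; rewrite -mulrN E1 mulrN1.
have {}E3 : 8 * I * W = e ^+ 2 * u by apply: oppr_inj; rewrite -!mulrN E3.
have : W = T * u by apply: (mulfI c8); rewrite mulrA E1.
rewrite /W /T => E4; transitivity ((u + 2) * u - 2 * u); first by rewrite -/u; ring.
by rewrite -E4; ring.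
Qed.

(** Conjugation by an element c of order 3 moves s to y and y to w, lifts of the three involutions.
    Stabilizers determine y as s t and w as s y, each up to [iota], and the signs are adjusted until
    the relations of [model_tetra] hold. *)
Lemma tetra_group : aut_size G 24 -> outcome G.
Proof.
move=> [l ul [sl hl]]; have [e [g hg]] := order3_exists.
have A12 := tetra_coef hg.
have ii : (iota * iota)%g = 1%g by apply: hinvV.
have iC (x : A) : (iota * x)%g = (x * iota)%g by apply: (hinvC two0 g2 hG).
have r3 x y : 1 * x + I != 0 -> -1 * x + I = y * (1 * x + I) -> red g (Some x) = Some y.
  by move=> n E; rewrite (redE _ _ _ _ hg); apply: mob_actS.
have g0 : red g (Some 0) = Some 1.
  by apply: r3; rewrite ?mulr0 ?add0r ?mul1r.
have g1 : red g (Some 1) = Some I.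
  apply: r3; rewrite !mulr1 //; by rewrite mulrDr mulr1 -expr2 II addrC.
have gI : red g (Some I) = Some 0.
  apply: r3; rewrite mul1r ?mulN1r ?addNr ?mul0r //.
  by rewrite -mulr2n -mulr_natr mulf_neq0.
(* The cube fixes 0, 1 and I. If it is [iota], then g [iota] has cube 1 and the same action on the
   line. *)
have ggg : (g * g * g)%g = 1%g \/ (g * g * g)%g = iota.
  have n01 : Some (0 : k) != Some 1 by rewrite (inj_eq (@Some_inj _)) eq_sym oner_neq0.
  have n0I : Some 0 != Some I by rewrite (inj_eq (@Some_inj _)) eq_sym.
  have n1I : Some 1 != Some I by rewrite (inj_eq (@Some_inj _)) -subr_eq0.
  by apply: (red_three n01 n0I n1I); rewrite 2!redM ?(g0, g1, gI).
have [c [c3 [c0 [c1 cI]]]] : exists c, (c ^+ 3 = 1)%g /\ red c (Some 0) = Some 1 /\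
    red c (Some 1) = Some I /\ red c (Some I) = Some 0.
  case: ggg => E.
    by exists g; split=> //; rewrite !expgS expg0 mulg1 mulgA.
  exists (g * iota)%g; rewrite !redM !red_hinv; split=> //.
  rewrite !expgS expg0 mulg1 !mulgA -!(mulgA _ iota g) !iC !mulgA.
  rewrite -!(mulgA _ iota g) !iC !mulgA E.
  by rewrite ii mul1g.
have c_neq1 : c <> 1%g.
  by move=> E; move: c0; rewrite E red1 => -[/esym/eqP]; rewrite oner_eq0.
have cV x y : red c x = y -> red c^-1%g y = x by move<-; apply: redK.
have ss : (s * s)%g = iota by apply: iota_dg; have := dgM hs hs; rewrite mulrNN mulr1 -expr2 II.
have sts : (s * t * s)%g = t.
  apply: an_eq (an_dgM m0 (dg_anM hs ht) hs) _.
  rewrite !mulr1 divff // -expr2 II -signr_odd expr1 mulN1r.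
  by rewrite invrN1 mulrN1 opprK.
have neqA (x : A) a b : induces (an a b) x -> x <> 1%g /\ x <> iota.
  move=> h; split=> E; rewrite E in h;
    first exact: (dg_an hG (oner_neq0 k) (@induces_aut1 _ 4 G) h).
  exact: (dg_an hG (oner_neq0 k) (@induces_iota _ 4 G) h).
have iotaA (x : A) a b : induces (an a b) x -> induces (an a (b * -1)) (x * iota)%g.
  by move=> h; have := an_dgM (oner_neq0 k) h (@induces_iota _ 4 G); rewrite expr1n !divr1.
have hst := dg_anM hs ht; have [st1 sti] := neqA _ _ _ hst.
have tI (x : k) : x != 0 -> red t (Some x) = Some x^-1.
  move=> x0; rewrite (redE _ _ _ _ ht); apply: mob_actS => /=; first by rewrite mul1r addr0.
  by rewrite mul0r add0r mul1r addr0 mulVf.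
have sN (x : k) : red s (Some x) = Some (- x).
  rewrite (redE _ _ _ _ hs); apply: mob_actS => /=; first by rewrite mul0r add0r oner_neq0.
  by rewrite mul0r add0r mulr1 mulN1r addr0.
have stI : red (s * t)%g (Some I) = Some I.
  have IV : I^-1 = - I by apply: (mulfI I0); rewrite divff // mulrN -expr2 II opprK.
  by rewrite redM tI // sN IV opprK.
pose y := (c^-1 * s * c)%g.
have yI : red y (Some I) = Some I by rewrite 2!redM cI sN oppr0; apply: cV.
have cj (x : A) : (c^-1 * x * c)%g = 1%g -> x = 1%g.
  by move=> E; apply: (mulgI c^-1%g); apply: (mulIg c); rewrite E mulg1 mulVg.
have cji (x : A) : (c^-1 * x * c)%g = iota -> x = iota.
  by move=> E; apply: (mulgI c^-1%g); apply: (mulIg c); rewrite E -iC -mulgA mulVg mulg1.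
have [s1 si] : s <> 1%g /\ s <> iota.
  split=> E; move: hs; rewrite E => h.
    by have [/neq_opp1] := dg_inj hG (oner_neq0 k) (@induces_aut1 _ 4 G) h.
  by have [/neq_opp1] := dg_inj hG (oner_neq0 k) (@induces_iota _ 4 G) h.
have y1 : y <> 1%g by move=> /cj.
have yi : y <> iota by move=> /cji.
have yy : (y * y)%g = iota.
  by rewrite /y !mulgA mulgK -(mulgA _ s s) ss -iC -mulgA mulVg mulg1.
have yst : y = (s * t)%g \/ y = (s * t * iota)%g by apply: (tetra_stab hO OI stI yI).
have sys : (s * y * s)%g = y.
  case: yst => ->; first by rewrite -!mulgA (mulgA s t s) sts.
  by rewrite -!mulgA iC !mulgA -(mulgA s s t) -(mulgA s _ s) sts.
have [a [b hy]] : exists a b, induces (an a b) y.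
  by case: yst => ->; [do 2!eexists; apply: hst | do 2!eexists; apply: iotaA hst].
have ys i : y <> (s ^+ i)%g.
  by move=> E; rewrite E in hy; apply: (dg_an hG (expf_neq0 i m0) (dgX i hs) hy).
have tt1 : red t (Some 1) = Some 1 by rewrite tI ?oner_neq0 // invr1.
have syt : (s * y)%g = (iota * t)%g \/ (s * y)%g = (iota * t * iota)%g.
  by case: yst => ->; rewrite !mulgA ss; [left|right].
have sy1 : red (s * y)%g (Some 1) = Some 1.
  by case: syt => ->; rewrite !redM ?red_hinv tt1.
have [n1 n2] : (s * y)%g <> 1%g /\ (s * y)%g <> iota.
  case: syt => ->; rewrite iC; first exact: neqA (iotaA _ _ _ ht).
  exact: neqA (iotaA _ _ _ (iotaA _ _ _ ht)).
pose w := (c^-1 * y * c)%g.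
have w1 : red w (Some 1) = Some 1 by rewrite 2!redM c1 yI; apply: cV.
have wn1 : w <> 1%g by move=> /cj.
have wni : w <> iota by move=> /cji.
have E1 : (s * c = c * y)%g by rewrite /y !mulgA mulgV mul1g.
have E2 : (y * c = c * w)%g by rewrite /w !mulgA mulgV mul1g.
have [gT [wz [h [h' [hM hK h'K hz ow]]]]] := aut_model two0 hG.
have cT : #|gT| = 24%N.
  have ul' : uniq (map h l) by rewrite map_inj_uniq //; apply: can_inj hK.
  rewrite -sl -(size_map h) -(card_uniqP ul'); apply: eq_card => v.
  by rewrite inE -[v]h'K map_f.
have done x z : (x * x)%g = iota -> (z * z)%g = iota -> (x * z * x)%g = z ->
    (forall i, z <> (x ^+ i)%g) -> (x * c = c * z)%g -> (z * c = c * (x * z))%g -> outcome G.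
  move=> xx zz xzx zx xc zc; apply: Out7; apply: (realize_self hG).
    exists G`_7 => //; rewrite mulrDr mulr1.
    have -> : 'X * ('X^4 - 1) * ('X^4 + G`_7 *: 'X^2) + 'X * ('X^4 - 1) =
      'X^9 + G`_7 *: 'X^7 - G`_7 *: 'X^3 - 'X :> {poly k}.
      by rewrite -!mul_polyC; ring.
    have [e0 e2 e4 e6 [e8 e10]] :
      [/\ G`_0 = 0, G`_2 = 0, G`_4 = 0, G`_6 = 0 & G`_8 = 0 /\ G`_10 = 0] by rewrite !ev.
    apply/polyP => j; rewrite !coefE.
    do 11 (case: j => [|j] //=; rewrite ?(mulr0, mulr1, subr0, sub0r, addr0, add0r, oppr0) //).
    by rewrite (hyper_coef hG).
  apply: (@model_tetra _ _ _ _ _ _ hM hK h'K hz (hinvC two0 g2 hG) ow x z c) => //.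
  exact: order4.
case: (tetra_stab hO O1 sy1 w1 n1 n2 wn1 wni) => wE.
  by apply: (done s y) => //; rewrite E2 wE.
(* When w = s y [iota], multiplying both s and y by [iota] keeps their product and absorbs the extra
   sign. *)
have twist x z : (x * x)%g = iota -> (z * z)%g = iota -> (x * z * x)%g = z ->
    (forall i, (z * iota)%g <> ((x * iota) ^+ i)%g) -> (x * c)%g = (c * z)%g ->
    (z * c)%g = (c * (x * z * iota))%g -> outcome G.
  move=> xx zz xzx zx xc zc; have mi u v : (u * iota * (v * iota))%g = (u * v)%g.
    by rewrite -mulgA iC -mulgA ii mulg1.
  apply: (done (x * iota)%g (z * iota)%g) => //; rewrite ?mi //.
  - by rewrite mulgA xzx.
  - by rewrite -mulgA iC mulgA xc mulgA.
  by rewrite -mulgA iC mulgA zc -!mulgA ii mulg1.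
apply: (twist s y ss yy sys) => // [i E|].
  have hz' := iotaA _ _ _ hy; rewrite E in hz'.
  exact: (dg_an hG (expf_neq0 i (mulf_neq0 m0 (oner_neq0 k))) (dgX i (dgM hs (@induces_iota _ 4 G))) hz').
by rewrite E2 wE.
Qed.

End TetraGroup.

(** * Assembly of the cases *)

Section Final.
Variable k : closedFieldType.
Hypotheses (two0 : 2 != 0 :> k) (three0 : 3 != 0 :> k) (five0 : 5 != 0 :> k).
Let g2 : (2 <= 4)%N := isT.
Variables (f : {poly k}) (hf : hyperelliptic_poly 4 f).

Lemma tetra_outcome O : tetrahedral two0 hf O -> aut_size f 24 -> outcome f.
Proof.
move=> hO s24.
have [F [n [hF [O' [cn hO' [O0 Oi] ev [a [b [a0 b0 e]]]]]]]] := tetra_coords three0 five0 hO.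
have [G [l [c [d [cl hG d1 [sym zer] top]]]]] := sym_form hF a0 b0 e.
have l0 : l != 0 by have [+ _ _] := cl; rewrite /mdet /= mulr1 mulr0 subr0.
apply: (outcome_compat two0 hf hF cn); apply: (outcome_compat two0 hF hG cl).
have hO2 := tetra_compat hG cl hO'; have [m1 m2] := mob_act_dg c l0.
set O2 := map _ _ in hO2.
have O20 : Some 0 \in O2 by rewrite -m1 map_f.
have O2i : None \in O2 by rewrite -m2 map_f.
have evG i : odd i = false -> G`_i = 0 by move=> oi; apply/eqP; rewrite zer ev.
have G9 : G`_9 = 1.
  by case: top => [G10|[] //]; move/eqP: (evG 10%N erefl); rewrite G10 oner_eq0.
have [I II] := sqrt_opp1 k.
have I0 := sqr_opp1_neq0 II.
have [dE G5] := tetra_sign hO2 evG G9 d1 sym II.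
have [p1 p2] := tetra_pm1 hO2 d1 sym; have [p3 p4] := tetra_pmI hO2 evG d1 sym II.
have [s hs] : exists s : curve_aut 4 G, induces (dg (-1) I) s.
  apply: dg_ex => // [|i]; first by rewrite oppr_eq0 oner_neq0.
  case oi: (odd i); last by rewrite evG // mul0r mulr0.
  by rewrite -signr_odd oi II expr1 mulrC.
have [t ht] : exists t : curve_aut 4 G, induces (an 1 I) t.
  by apply: pal_swap => // i le; rewrite sym // II dE.
rewrite dE in sym.
apply: (@tetra_group _ two0 three0 five0 G hG O2 hO2 O20 O2i p1 p2 G9 _ _ G5 evG I II p3 p4 s t hs ht).
- by rewrite (sym 9%N isT) G9 mulr1.
- by rewrite (sym 7%N isT) mulN1r.
by apply: (size_compat two0 hF hG cl); apply: (size_compat two0 hf hF cn).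
Qed.

Lemma all_outcomes : outcome f.
Proof.
case: (aut_trichotomy two0 (nine0 three0) (ten0 two0 five0) hf) =>
  [tr|[[t1 [t2 [t12 pp]]]|[s24 [O hO]]]].
- exact: trivial_outcome.
- exact: (pair_outcome three0 five0 t12 pp).
exact: tetra_outcome hO s24.
Qed.

End Final.

(** Rescaling x by a square root of -1 replaces a by -a, so the two square roots of -12 give
    isomorphic curves. *)
Lemma tetra_flip (k : closedFieldType) (a : k) (F G : {poly k}) :
  2 != 0 :> k -> hyperelliptic_poly 4 F ->
  F = 'X * ('X^4 - 1) * ('X^4 + a *: 'X^2 + 1) ->
  G = 'X * ('X^4 - 1) * ('X^4 - a *: 'X^2 + 1) ->
  hyperelliptic_poly 4 G /\ curve_iso 4 F 4 G.
Proof.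
move=> two0 hF FE GE; have [i ii] := sqrt_opp1 k.
have i0 := sqr_opp1_neq0 ii.
have [c c0 ci] : exists2 c, c != 0 & c ^+ 2 = i by apply: root_ex.
have ex b : 'X * ('X^4 - 1) * ('X^4 + b *: 'X^2 + 1) =
    'X^9 + b *: 'X^7 - b *: 'X^3 - 'X :> {poly k} by rewrite -!mul_polyC; ring.
have [cn hG] := rescaled_compat hF i0 c0.
suff -> : G = rescaled F i c.
  split=> //; have [phi [psi [h1 h2 h3 h4 _]]] := @compat_iso _ 4 _ _ _ (hyper11 hF) (hyper11 hG) cn.
  by exists phi, psi.
have i3 : i ^+ 3 = - i by rewrite exprS ii mulrN1.
have i7 : i ^+ 7 = - i by rewrite (exprD i 4 3) (exprM i 2 2) ii sqrrN expr1n mul1r i3.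
have i9 : i ^+ 9 = i by rewrite (exprD i 2 7) ii i7 mulrNN mul1r.
apply/polyP => j; rewrite (rescaledE hF) ci FE GE -scaleNr !ex !coefE.
have [->|_] := eqVneq j 9%N; first by rewrite /= ?(mulr0n, mulr1n) i9; field.
have [->|_] := eqVneq j 7%N; first by rewrite /= ?(mulr0n, mulr1n) i7; field; rewrite ?oppr_eq0.
have [->|_] := eqVneq j 3%N; first by rewrite /= ?(mulr0n, mulr1n) i3; field; rewrite ?oppr_eq0.
have [->|_] := eqVneq j 1%N; first by rewrite /= ?(mulr0n, mulr1n) expr1; field.
by rewrite /= !mulr0n !(mulr0, subr0, addr0, mul0r).
Qed.


Lemma pchar_small (k : closedFieldType) p : p \in [pchar k] -> (7 <= p)%N ->
  [/\ 2 != 0 :> k, 3 != 0 :> k & 5 != 0 :> k].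
Proof.
move=> pk p7; have n0 n : (0 < n < 7)%N -> n%:R != 0 :> k.
  case/andP=> n0 n7; rewrite -(dvdn_pcharf pk); apply/negP => /(dvdn_leq n0).
  by rewrite leqNgt (leq_trans n7 p7).
by split; apply: n0.
Qed.

Lemma card_reduced_groups :
  (#|Zp 1| = 1%N) * (#|Zp 2| = 2%N) * (#|Zp 3| = 3%N) * (#|Klein4| = 4%N) *
  (#|('D_8)%g| = 8%N) * (#|('D_10)%g| = 10%N) * (#|('Alt_('I_4))%g| = 12%N) *
  (#|('D_16)%g| = 16%N) * (#|Zp 9| = 9%N) * (#|('D_20)%g| = 20%N).
Proof.
rewrite !card_Zp // (@card_dihedral 4) // (@card_dihedral 5) // (@card_dihedral 8) //.
rewrite (@card_dihedral 10) // /Klein4 cardsT card_prod !card_ord.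
have -> : #|('Alt_('I_4))%g| = 12%N; last by [].
by have := @card_Alt 'I_4; rewrite card_ord => /(_ isT); rewrite !factS fact0; lia.
Qed.

Theorem theorem3 (k : closedFieldType) (p : nat)
    (hchar : p \in [pchar k]) (hp : (7 <= p)%N)
    (i s3 : k) (hi : i ^+ 2 = -1) (hs3 : s3 ^+ 2 = 3)
    (f : {poly k}) (hf : hyperelliptic_poly 4 f) :
  let Red (gT : finGroupType) (G : {set gT}) := reduced_aut_isog 4 f G in
  let Aut (gT : finGroupType) (G : {set gT}) := aut_isog 4 f G in
  let model (F : {poly k}) := hyperelliptic_poly 4 F /\ curve_iso 4 f 4 F in
  let V4 : {set 'Z_2 * 'Z_2} := [set: 'Z_2 * 'Z_2] in
  (Red _ (Zp 1) \/ Red _ (Zp 2) \/ Red _ (Zp 3) \/ Red _ V4 \/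
   Red _ ('D_8)%g \/ Red _ ('D_10)%g \/ Red _ ('Alt_('I_4))%g \/ Red _ ('D_16)%g \/
   Red _ (Zp 9) \/ Red _ ('D_20)%g)
  /\ (Red _ (Zp 1) -> (exists F, model F) /\ Aut _ (Zp 2))
  /\ (Red _ (Zp 2) ->
        (exists a b c d, model ('X^10 + a *: 'X^8 + b *: 'X^6 + c *: 'X^4
                                + d *: 'X^2 + 1))
          /\ Aut _ V4
        \/ (exists a b c, model ('X^9 + a *: 'X^7 + b *: 'X^5 + c *: 'X^3
                                 + 'X))
          /\ Aut _ (Zp 4))
  /\ (Red _ (Zp 3) ->
        (exists a b, model ('X^10 + a *: 'X^7 + b *: 'X^4 + 'X))
          /\ Aut _ (Zp 6))
  /\ (Red _ V4 ->
        ((exists a b, model ('X^10 + a *: 'X^8 + b *: 'X^6 + b *: 'X^4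
                             + a *: 'X^2 + 1))
         \/ (exists a b, model ('X^9 + a *: 'X^7 + b *: 'X^5 + a *: 'X^3
                                + 'X)))
          /\ Aut _ ('D_8)%g
        \/ (exists a, model ('X * ('X^4 - 1) * ('X^4 + a *: 'X^2 + 1)))
          /\ Aut _ ('Q_8)%g)
  /\ (Red _ ('D_8)%g ->
        (exists a, model ('X^9 + a *: 'X^5 + 'X)) /\ Aut _ ('D_16)%g)
  /\ (Red _ ('D_10)%g ->
        (exists a, model ('X^10 + a *: 'X^5 + 1)) /\ Aut _ ('D_20)%g)
  /\ (Red _ ('Alt_('I_4))%g ->
        model ('X * ('X^4 - 1) * ('X^4 + (2 * i * s3) *: 'X^2 + 1))
          /\ Aut _ (SL2_F 3))
  /\ (Red _ ('D_16)%g ->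
        model ('X^9 + 'X) /\ semidirect_isog_to (curve_aut 4 f) (Zp 16) (Zp 2))
  /\ (Red _ (Zp 9) -> model ('X^10 + 'X) /\ Aut _ (Zp 18))
  /\ (Red _ ('D_20)%g ->
        model ('X^10 + 1) /\ semidirect_isog_to (curve_aut 4 f) (Zp 5) ('D_8)%g).
Proof.
have [two0 three0 five0] := pchar_small hchar hp.
have out := all_outcomes two0 three0 five0 hf.
move=> Red Aut model V4'; split.
  case: out => -[hR _ _]; rewrite /Red; tauto.
have cV : #|V4'| = 4%N by rewrite -[V4']/Klein4 card_reduced_groups.
have cmp (gT hT : finGroupType) (H : {set gT}) (K : {set hT}) Q P :
    Red hT K -> realize f H Q P -> #|H| = #|K| /\ Q (curve_aut 4 f) /\ exists2 F, P F & model F.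
  by move=> hR [hR' hQ hF]; split=> //; apply: quotient_isog_card hR' hR.
split.
  move=> hR; case: out => /(cmp _ _ _ _ _ _ hR)[];
    rewrite !card_reduced_groups // => _ [hQ [F PF mF]].
  by split=> //; exists F.
split.
  move=> hR; case: out => /(cmp _ _ _ _ _ _ hR)[];
    rewrite !card_reduced_groups // => _ [hQ [F PF mF]].
    by case: PF => a [b [c [d E]]]; left; split=> //; exists a, b, c, d; rewrite -E.
  by case: PF => a [b [c E]]; right; split=> //; exists a, b, c; rewrite -E.
split.
  move=> hR; case: out => /(cmp _ _ _ _ _ _ hR)[];
    rewrite !card_reduced_groups // => _ [hQ [F PF mF]].
  by case: PF => a [b E]; split=> //; exists a, b; rewrite -E.
split.
  move=> hR; case: out => /(cmp _ _ _ _ _ _ hR)[];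
    rewrite cV ?card_reduced_groups // => _ [hQ [F PF mF]].
  - by case: PF => a [b E]; left; split=> //; left; exists a, b; rewrite -E.
  - by case: PF => a [b E]; left; split=> //; right; exists a, b; rewrite -E.
  by case: PF => a E; right; split=> //; exists a; rewrite -E.
split.
  move=> hR; case: out => /(cmp _ _ _ _ _ _ hR)[];
    rewrite !card_reduced_groups // => _ [hQ [F PF mF]].
  by case: PF => a E; split=> //; exists a; rewrite -E.
split.
  move=> hR; case: out => /(cmp _ _ _ _ _ _ hR)[];
    rewrite !card_reduced_groups // => _ [hQ [F PF mF]].
  by case: PF => a E; split=> //; exists a; rewrite -E.
split.
  move=> hR; case: out => /(cmp _ _ _ _ _ _ hR)[];
    rewrite !card_reduced_groups // => _ [hQ [F PF mF]].
  case: PF => a a2 E; split=> //.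
  (* Both squares are 4 (-1) 3 = -12, so [a] is the required coefficient up to sign, and
     [tetra_flip] supplies the other sign. *)
  have : a ^+ 2 == (2 * i * s3) ^+ 2.
    by rewrite a2 !exprMn hi hs3; apply/eqP; ring.
  rewrite eqf_sqr => /orP[] /eqP ea; first by rewrite -ea -E.
  have [hF cF] := mF; have := tetra_flip two0 hF E (erefl _).
  rewrite ea scaleNr opprK => -[hG [al [be [m1 m2 c1 c2]]]]; split=> //.
  have [phi [psi [m3 m4 c3 c4]]] := cF; exists (al \o phi), (psi \o be); split.
  - exact: curve_morphism_comp.
  - exact: curve_morphism_comp.
  - exact: can_comp.
  exact: can_comp.
split.
  move=> hR; case: out => /(cmp _ _ _ _ _ _ hR)[];
    rewrite !card_reduced_groups // => _ [hQ [F PF mF]].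
  by split=> //; rewrite -PF.
split.
  move=> hR; case: out => /(cmp _ _ _ _ _ _ hR)[];
    rewrite !card_reduced_groups // => _ [hQ [F PF mF]].
  by split=> //; rewrite -PF.
move=> hR; case: out => /(cmp _ _ _ _ _ _ hR)[];
  rewrite !card_reduced_groups // => _ [hQ [F PF mF]].
by split=> //; rewrite -PF.
Qed.
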